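(* Let $F$ be an imaginary quadratic field of discriminant $\Delta$, with ring of integers $\mathcal{O}_F$. Then the number $N_{\mathrm{perf}}(F)$ of $\mathrm{GL}_2(\mathcal{O}_F)$-equivalence classes of perfect binary Hermitian forms over $F$ satisfies \[ N_{\mathrm{perf}}(F) \geq \left\lceil \frac{|\Delta|^{3/2}}{360\pi^2 \Lambda(\pi/3)}\, \zeta_F(2) \right\rceil . \]
   Context: Fix a complex embedding $F \hookrightarrow \mathbb{C}$, so that $\mathcal{O}_F^2 \subset \mathbb{C}^2$. Let $V$ be the real vector space of $2\times 2$ complex Hermitian matrices and $C \subset V$ the cone of positive definite ones. For $A \in V$ and $x\in\mathbb{C}^2$ write $A[x] = \bar{x}^t A x$. For $A \in C$, $\min(A) = \inf_{v \in \mathcal{O}_F^2\setminus\{0\}} A[v]$, and $\operatorname{Min}(A)$ is the (finite) set of $v \in \mathcal{O}_F^2\setminus\{0\}$ with $A[v]=\min(A)$. A form $A \in C$ is a perfect binary Hermitian form over $F$ if the real span of $\{v\bar{v}^t : v \in \operatorname{Min}(A)\}$ is all of $V$; equivalently $\operatorname{Min}(A)$ determines $A$ up to positive scaling. The group $\mathrm{GL}_2(\mathcal{O}_F)$ acts on $V$ by $g\cdot A = g A \bar{g}^t$, and $N_{\mathrm{perf}}(F)$ counts perfect forms up to this action together with positive homothety (i.e. it is the number of orbits of top-dimensional cones of the Voronoi–Koecher fan, each spanned by $\{v\bar v^t: v\in \operatorname{Min}(A)\}$ for a perfect $A$). Here $\zeta_F(s) = \sum_{\mathfrak{n}\subseteq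 \mathcal{O}_F} \mathrm{N}_{F/\mathbb{Q}}(\mathfrak{n})^{-s}$ is the Dedekind zeta function of $F$ (sum over nonzero ideals), and $\Lambda(\theta) = -\int_0^\theta \log|2\sin t|\,dt$ is the Lobachevsky function. *)

(* Defs.v *)
From HB Require Import structures.
From mathcomp Require Import all_boot all_order all_algebra.
From mathcomp Require Import all_classical all_reals all_analysis.
From mathcomp.real_closed Require Import complex.
Set Implicit Arguments. Unset Strict Implicit. Unset Printing Implicit Defensive.
Import Order.TTheory GRing.Theory Num.Theory.
Local Open Scope ring_scope.
Local Open Scope classical_set_scope.

Definition rC {R : realType} (x : R) : R[i] := Complex x 0.

(* The imaginary quadratic field F = Q(sqrt d), d < 0 squarefree, with the *)
(* fixed complex embedding sending sqrt d to i * sqrt(-d).                 *)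

Definition squarefree_int (d : int) : Prop :=
  forall p : nat, prime p -> ~~ (p ^ 2 %| `|d|)%N.

Definition sqrtd {R : realType} (d : int) : R[i] :=
  Complex 0 (Num.sqrt (- (d%:~R : R))).

Definition inF {R : realType} (d : int) (z : R[i]) : Prop :=
  exists p q : rat, z = rC (ratr p) + rC (ratr q) * sqrtd d.

Definition integral_over_Z {R : realType} (z : R[i]) : Prop :=
  exists p : {poly int}, p \is monic /\ root (map_poly (fun n : int => n%:~R) p) z.

Definition OF {R : realType} (d : int) : set R[i] :=
  [set z | inF d z /\ integral_over_Z z].

Definition disc (d : int) : int := if (d %% 4)%Z == 1 then d else 4 * d.

Definition conjT {R : realType} {m n : nat} (A : 'M[R[i]]_(m, n)) : 'M[R[i]]_(n, m) :=
  (map_mx Num.conj A)^T.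

Definition hermitian {R : realType} (A : 'M[R[i]]_2) : Prop := conjT A = A.

Definition herm_eval {R : realType} (A : 'M[R[i]]_2) (x : 'cV[R[i]]_2) : R[i] :=
  (conjT x *m A *m x) 0 0.

Definition posdef {R : realType} (A : 'M[R[i]]_2) : Prop :=
  hermitian A /\ forall x : 'cV[R[i]]_2, x != 0 -> 0 < herm_eval A x.

Definition lat_nz {R : realType} (d : int) : set 'cV[R[i]]_2 :=
  [set v | (forall i, OF d (v i 0)) /\ v != 0].

Definition minval {R : realType} (d : int) (A : 'M[R[i]]_2) : R :=
  inf [set complex.Re (herm_eval A v) | v in lat_nz d].

Definition Min {R : realType} (d : int) (A : 'M[R[i]]_2) : set 'cV[R[i]]_2 :=
  [set v | lat_nz d v /\ herm_eval A v = rC (minval d A)].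

Definition perfect {R : realType} (d : int) (A : 'M[R[i]]_2) : Prop :=
  posdef A /\
  forall H : 'M[R[i]]_2, hermitian H ->
    exists s : seq (R * 'cV[R[i]]_2),
      (forall p, p \in s -> Min d A p.2) /\
      H = \sum_(p <- s) (rC p.1 *: (p.2 *m conjT p.2)).

Definition inGL2 {R : realType} (d : int) (g : 'M[R[i]]_2) : Prop :=
  g \in unitmx /\ (forall i j, OF d (g i j)) /\ (forall i j, OF d (invmx g i j)).

Definition form_equiv {R : realType} (d : int) (A B : 'M[R[i]]_2) : Prop :=
  exists g, inGL2 d g /\ exists l : R, 0 < l /\ B = rC l *: (g *m A *m conjT g).

Definition perf_classes {R : realType} (d : int) : set (set 'M[R[i]]_2) :=
  [set [set B | perfect d B /\ form_equiv d A B] | A in perfect d].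

Definition nz_ideal {R : realType} (d : int) (I : set R[i]) : Prop :=
  I `<=` OF d /\ I 0 /\ (forall x y, I x -> I y -> I (x - y)) /\
  (forall a x, OF d a -> I x -> I (a * x)) /\ (exists x, I x /\ x != 0).

Definition ideal_norm_is {R : realType} (d : int) (I : set R[i]) (n : nat) : Prop :=
  ([set [set y | OF d y /\ I (x - y)] | x in OF d] #= `I_n)%card.

(* zeta_F(2) = sum over nonzero ideals I of N(I)^-2, written as a sum over *)
(* the pairs (I, N(I)).                                                    *)
Definition zetaF2 {R : realType} (d : int) : \bar R :=
  esum [set p : (set R[i] * nat)%type | nz_ideal d p.1 /\ ideal_norm_is d p.1 p.2]
       (fun p => (((p.2%:R : R) ^+ 2)^-1)%:E).

Definition Lobachevsky {R : realType} (theta : R) : R :=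
  - Rintegral (@lebesgue_measure R) `[0, theta]%classic (fun t => ln `|2 * sin t|).

(* Main.v *)
Require Import Defs.
From HB Require Import structures.
From mathcomp Require Import all_boot all_order all_algebra.
From mathcomp Require Import all_classical all_reals all_analysis.
From mathcomp Require Import measurable_realfun.
From mathcomp.real_closed Require Import complex.
From mathcomp Require Import ring lra zify.
Set Implicit Arguments. Unset Strict Implicit. Unset Printing Implicit Defensive.
Import Order.TTheory GRing.Theory Num.Theory numFieldNormedType.Exports.
Local Open Scope ring_scope.
Local Open Scope classical_set_scope.

(** On the set P1 of positive definite forms B with det B <= 1, Lebesgue measure is invariant
    under SL_2(C). Voronoi reduction moves every B in P1 into the cone spanned by the minimal
    vectors of one of m perfect forms. Parity of coordinates leaves at most twelve minimal
    vectors up to sign, so the cone is covered by fifteen simplicial cones; the part of such a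
    simplicial cone in P1 has measure at most 3/2 Lambda(pi/3), the bound for the volume of an
    ideal hyperbolic tetrahedron. So m sets of measure at most 15 * 3/2 * Lambda(pi/3) meet all
    GL_2(O)-orbits on P1.

    For an ideal I = (x, y) put v = (x, y) and integrate det B exp(- e B[v]) over a fundamental
    domain of P1 for the stabilizer of v in SL_2(O), a strip of cusp coordinates. The value is at
    least sqrt|Delta| / (4 e^2 N(I)^2). Folding the strips of finitely many ideals back to the m
    sets bounds the sum of these integrals by that of det B Theta_e(B) over the m sets, where the
    theta series satisfies det B Theta_e(B) <= (4 pi^2 / |Delta| + o(1)) / e^2 with an integrable
    error. Letting e tend to 0 gives zeta_F(2) <= 360 m pi^2 Lambda(pi/3) / |Delta|^(3/2). *)

(** * Measure-preserving maps and products of sigma-finite measures *)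

Section PreservingMaps.
Local Open Scope ereal_scope.

(** The forms of determinant 1 make up hyperbolic 3-space, and Lebesgue measure on the cone of forms
    with [fdet B <= 1] is half the hyperbolic volume; so the maximal volume 3 Lambda(pi/3) of an
    ideal tetrahedron shows up as 3/2 Lambda(pi/3). In the linear four-space group elements act
    linearly, and invariance reduces to shears. No fundamental domain for GL_2(O) is built. All
    estimates are one-sided: it suffices that finitely many pieces meet every orbit and that their
    outer measure is bounded. Distinct ideals I = (x, y) give vectors in distinct orbits, and the
    stabilizer of such a vector in SL_2(O) is a translation group isomorphic to I^-2, of covolume
    sqrt|Delta| / (2 N(I)^2). The 15 comes from coning the boundary of a cone with n <= 12
    generators from one of them: there are at most 2n - 4 triangular facets, and on average over the
    apex (2n - 4)(n - 3) / n of them avoid it. Finally 360 = 4 * 4 * 15 * 3/2, with one 4 from the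
    theta constant 4 pi^2 / |Delta| and the other from the strip integral. *)

Definition preserving d1 d2 (S : measurableType d1) (T : measurableType d2) (R : realType)
    (m : set S -> \bar R) (m' : set T -> \bar R) (f : S -> T) : Prop :=
  measurable_fun [set: S] f /\ forall A, measurable A -> m (f @^-1` A) = m' A.

Lemma preserving_comp d1 d2 d3 (S : measurableType d1) (T : measurableType d2)
    (U : measurableType d3) (R : realType) (m1 : set S -> \bar R) (m2 : set T -> \bar R)
    (m3 : set U -> \bar R) (f : S -> T) (g : T -> U) :
  preserving m1 m2 f -> preserving m2 m3 g -> preserving m1 m3 (g \o f).
Proof.
move=> [mf hf] [mg hg]; split; first exact: measurableT_comp.
move=> A mA; rewrite comp_preimage hf; last by rewrite -[X in measurable X]setTI; exact: mg.
exact: hg.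
Qed.

Lemma preserving_ext d1 d2 (S : measurableType d1) (T : measurableType d2) (R : realType)
    (m : set S -> \bar R) (m' : set T -> \bar R) (f g : S -> T) :
  f =1 g -> preserving m m' f -> preserving m m' g.
Proof. by move=> /funext ->. Qed.

Lemma preserving_integral d1 d2 (S : measurableType d1) (T : measurableType d2) (R : realType)
    (m : {measure set S -> \bar R}) (m' : {measure set T -> \bar R}) (f : S -> T)
    (D : set T) (F : T -> \bar R) :
  preserving m m' f -> measurable D -> measurable_fun D F ->
  (forall y, D y -> 0 <= F y) ->
  \int[m']_(y in D) F y = \int[m]_(x in f @^-1` D) F (f x).
Proof.
move=> [mf hf] mD mF F0.
rewrite -(@ge0_integral_pushforward _ _ _ _ _ f mf m D F) //; last first.
  by move=> y /set_mem; exact: F0.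
by apply: eq_measure_integral => A mA _; rewrite -hf.
Qed.

Section Product.
Context d1 d2 (S : measurableType d1) (T : measurableType d2) (R : realType).
Variables (m1 : {sigma_finite_measure set S -> \bar R})
          (m2 : {sigma_finite_measure set T -> \bar R}).

(** A product measure is determined by its values on rectangles, and the swap permutes
    rectangles. *)
Lemma preserving_swap : preserving (m1 \x m2) (m2 \x m1) (fun p => (p.2, p.1)).
Proof.
have ms : measurable_fun [set: (S * T)%type] (fun p : S * T => (p.2, p.1)).
  exact: measurable_fun_pair.
split=> // A mA.
have -> : (m1 \x m2) ((fun p : S * T => (p.2, p.1)) @^-1` A) =
  pushforward (m1 \x m2) (fun p : S * T => (p.2, p.1)) A by [].
apply/esym/product_measure_unique => // B C mB mC.
rewrite /= /pushforward.
have -> : (fun p : S * T => (p.2, p.1)) @^-1` (B `*` C) = C `*` B.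
  by apply/seteqP; split=> -[x y] /= [? ?].
by rewrite product_measure1E// muleC.
Qed.

(** Skew products: the fibre map [g x] may depend on the base point. Integrating the measures of
    sections reduces the claim to invariance of each fibre under [g x] and of the base under [f].
    The shears below are instances. *)
Lemma preserving_prod (f : S -> S) (g : S -> T -> T) :
  preserving m1 m1 f -> (forall x, preserving m2 m2 (g x)) ->
  measurable_fun [set: (S * T)%type] (fun p => g p.1 p.2) ->
  preserving (m1 \x m2) (m1 \x m2) (fun p => (f p.1, g p.1 p.2)).
Proof.
move=> [mf hf] hg mg.
have mF : measurable_fun [set: (S * T)%type] (fun p => (f p.1, g p.1 p.2)).
  by apply: measurable_fun_pair => //; exact: measurableT_comp.
split=> // A mA; rewrite /product_measure1 /=.
rewrite (@preserving_integral _ _ _ _ _ m1 m1 f setT (m2 \o xsection A))//.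
- rewrite preimage_setT; apply: eq_integral => x _ /=.
  rewrite -((hg x).2 (xsection A (f x))); last exact: measurable_xsection.
  by congr (m2 _); apply/seteqP; split=> y; rewrite /xsection /= ?inE.
- exact: measurable_fun_xsection.
Qed.

(* The library's sigma-finite structure on products is shadowed by a later *)
(* instance for subprobabilities, hence this alias. *)
Definition sfprod := m1 \x m2.

HB.instance Definition _ := Measure.on sfprod.

Lemma sfprod_sigma_finite : sigma_finite setT sfprod.
Proof.
have /sigma_finiteP[F [TF ndF fF]] := sigma_finiteT m1.
have /sigma_finiteP[G [TG ndG fG]] := sigma_finiteT m2.
exists (fun n => F n `*` G n).
  apply/seteqP; split=> // -[x y] _.
  have [i _ Fx] : (\bigcup_i F i) x by rewrite -TF.
  have [j _ Gy] : (\bigcup_j G j) y by rewrite -TG.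
  exists (maxn i j) => //; split=> /=.
    by move: x Fx; apply/subsetPset/ndF/leq_maxl.
  by move: y Gy; apply/subsetPset/ndG/leq_maxr.
move=> n; have [mF Fn] := fF n; have [mG Gn] := fG n.
split; first exact: measurableX.
by rewrite /sfprod product_measure1E // lte_mul_pinfty // ge0_fin_numE.
Qed.

HB.instance Definition _ := Measure_isSigmaFinite.Build _ _ _ sfprod sfprod_sigma_finite.

End Product.
End PreservingMaps.

(** * Translation, reflection and scaling of Lebesgue measure on the line *)

Section RealLine.
Context {R : realType}.
Local Notation RR := (measurableTypeR R).

Lemma preserving_idR : preserving (@lebesgue_measure R) (@lebesgue_measure R) (@idfun RR).
Proof. by split; [exact: measurable_id|]. Qed.

Lemma preserving_shift (t : R) :
  preserving (@lebesgue_measure R) (@lebesgue_measure R) (fun x : RR => (x : R) + t : RR).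
Proof.
have mf : measurable_fun [set: RR] (fun x : RR => (x : R) + t : RR).
  by apply: measurable_funD.
split=> // A mA; apply/esym.
apply: (@lebesgue_measure_unique R (pushforward (@lebesgue_measure R) (fun x : RR => (x : R) + t : RR))) => //.
move=> _ [[a b]] _ <-; rewrite /= /pushforward.
have -> : (fun x : RR => (x : R) + t : RR) @^-1` `]a, b]%classic = `]a - t, b - t]%classic.
  by apply/seteqP; split=> x /=; rewrite !in_itv /= ltrBlDr lerBrDr.
rewrite !lebesgue_measure_itv /= !lte_fin ltrD2r; case: ifP => // _.
by rewrite -!EFinB; congr (_%:E); ring.
Qed.

Lemma preserving_opp :
  preserving (@lebesgue_measure R) (@lebesgue_measure R) (fun x : RR => - (x : R) : RR).
Proof.
split; first by apply: oppr_measurable.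
by move=> A mA; exact: lebesgue_measureN.
Qed.

Lemma lebesgue_measure_scale (k : R) (A : set RR) : 0 < k -> measurable A ->
  lebesgue_measure A = (k%:E * @lebesgue_measure R ((fun x : RR => (k * (x : R))%R : RR) @^-1` A))%E.
Proof.
move=> k0 mA.
have mf : measurable_fun [set: RR] (fun x : RR => k * (x : R) : RR).
  by apply: measurable_funM.
pose m := pushforward (@lebesgue_measure R) (fun x : RR => k * (x : R) : RR).
have k0' : 0 <= k by exact: ltW.
pose K : {nonneg R} := NngNum k0'.
apply: (@lebesgue_measure_unique R (mscale K m)) => //.
move=> _ [[a b]] _ <-; rewrite /= /mscale /= /m /pushforward.
have -> : (fun x : RR => k * (x : R) : RR) @^-1` `]a, b]%classic = `]a / k, b / k]%classic.
  by apply/seteqP; split=> x /=; rewrite !in_itv /= ltr_pdivrMr // ler_pdivlMr // mulrC.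
rewrite !lebesgue_measure_itv /= !lte_fin ltr_pM2r ?invr_gt0 //.
case: ifP => _; last by rewrite mule0.
by rewrite -!EFinB -EFinM; congr (_%:E); field; rewrite gt_eqF.
Qed.

End RealLine.

(** * Complex numbers by real and imaginary parts; two-by-two matrices *)

Section ComplexParts.
Context {R : realType}.
Local Notation C := R[i].

Lemma Re_add (z w : C) : complex.Re (z + w) = complex.Re z + complex.Re w.
Proof. by case: z; case: w. Qed.
Lemma Im_add (z w : C) : complex.Im (z + w) = complex.Im z + complex.Im w.
Proof. by case: z; case: w. Qed.
Lemma Re_opp (z : C) : complex.Re (- z) = - complex.Re z.
Proof. by case: z. Qed.
Lemma Im_opp (z : C) : complex.Im (- z) = - complex.Im z.
Proof. by case: z. Qed.
Lemma Re_mul (z w : C) :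
  complex.Re (z * w) = complex.Re z * complex.Re w - complex.Im z * complex.Im w.
Proof. by case: z; case: w. Qed.
Lemma Im_mul (z w : C) :
  complex.Im (z * w) = complex.Re z * complex.Im w + complex.Im z * complex.Re w.
Proof. by case: z; case: w. Qed.
Lemma Re_conj (z : C) : complex.Re (Num.conj z) = complex.Re z.
Proof. by case: z. Qed.
Lemma Im_conj (z : C) : complex.Im (Num.conj z) = - complex.Im z.
Proof. by case: z. Qed.

Definition reim := (Re_add, Im_add, Re_opp, Im_opp, Re_mul, Im_mul, Re_conj, Im_conj).

Lemma complex_ext (z w : C) :
  complex.Re z = complex.Re w -> complex.Im z = complex.Im w -> z = w.
Proof. by case: z; case: w => a b c d /= -> ->. Qed.

Definition normC2 (z : C) : R := complex.Re z ^+ 2 + complex.Im z ^+ 2.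

Lemma normC2M z w : normC2 (z * w) = normC2 z * normC2 w.
Proof. by rewrite /normC2 !reim; ring. Qed.
Lemma normC2_ge0 z : 0 <= normC2 z.
Proof. by rewrite addr_ge0 // sqr_ge0. Qed.
Lemma normC2_eq0 z : (normC2 z == 0) = (z == 0).
Proof. by rewrite paddr_eq0 ?sqr_ge0 // !sqrf_eq0 eq_complex. Qed.
Lemma normC2_gt0 z : (0 < normC2 z) = (z != 0).
Proof. by rewrite lt_def normC2_ge0 andbT normC2_eq0. Qed.
Lemma normC2_conj z : normC2 (Num.conj z) = normC2 z.
Proof. by rewrite /normC2 !reim sqrrN. Qed.
Lemma normC2N z : normC2 (- z) = normC2 z.
Proof. by rewrite /normC2 !reim !sqrrN. Qed.
Lemma normC2_1 : normC2 1 = 1.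
Proof. by rewrite /normC2 /= expr1n expr0n addr0. Qed.
Lemma normC2_0 : normC2 0 = 0.
Proof. by rewrite /normC2 /= expr0n addr0. Qed.
Lemma conjM_normC2 z : Num.conj z * z = rC (normC2 z).
Proof. by apply: complex_ext; rewrite /= !reim /normC2; ring. Qed.
Lemma rCM (x y : R) : rC (x * y) = rC x * rC y.
Proof. by apply: complex_ext; rewrite /= ?mulr0 ?mul0r ?subr0 ?addr0. Qed.
Lemma rCD (x y : R) : rC (x + y) = rC x + rC y.
Proof. by apply: complex_ext; rewrite /= ?addr0. Qed.
Lemma rC1 : rC 1 = 1 :> C. Proof. by []. Qed.
Lemma rC0 : rC 0 = 0 :> C. Proof. by []. Qed.
Lemma rC_inj : injective (@rC R).
Proof. by move=> x y []. Qed.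

Definition mx2 (p q r s : C) : 'M[C]_2 :=
  \matrix_(i, j) if i == 0 then (if j == 0 then p else q) else (if j == 0 then r else s).

Lemma mx2E (g : 'M[C]_2) : g = mx2 (g 0 0) (g 0 1) (g 1 0) (g 1 1).
Proof.
apply/matrixP => i j; rewrite mxE.
by case: i => [[|[|?]] ?] //; case: j => [[|[|?]] ?] //=;
  congr (g _ _); apply: val_inj.
Qed.

Lemma mx2_00 p q r s : mx2 p q r s 0 0 = p. Proof. by rewrite mxE. Qed.
Lemma mx2_01 p q r s : mx2 p q r s 0 1 = q. Proof. by rewrite mxE. Qed.
Lemma mx2_10 p q r s : mx2 p q r s 1 0 = r. Proof. by rewrite mxE. Qed.
Lemma mx2_11 p q r s : mx2 p q r s 1 1 = s. Proof. by rewrite mxE. Qed.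
Definition mx2_ij := (mx2_00, mx2_01, mx2_10, mx2_11).

Lemma sum_ord2 (V : nmodType) (f : 'I_2 -> V) : \sum_i f i = f 0 + f 1.
Proof. by rewrite big_ord_recr big_ord1 /=; congr (f _ + f _); apply: val_inj. Qed.

Lemma mx2M p q r s p' q' r' s' : mx2 p q r s *m mx2 p' q' r' s' =
  mx2 (p * p' + q * r') (p * q' + q * s') (r * p' + s * r') (r * q' + s * s').
Proof. by rewrite [LHS]mx2E !mxE !sum_ord2 !mx2_ij. Qed.

Lemma mx2_conjT p q r s :
  conjT (mx2 p q r s) = mx2 (Num.conj p) (Num.conj r) (Num.conj q) (Num.conj s).
Proof. by rewrite [LHS]mx2E !mxE. Qed.

Lemma mx2_det p q r s : \det (mx2 p q r s) = p * s - q * r.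
Proof.
rewrite (expand_det_row _ ord0) sum_ord2 /cofactor !det_mx11 !mxE /=.
by rewrite /bump /= expr0 expr1 /=; ring.
Qed.

Lemma mx2_1 : 1%:M = mx2 1 0 0 1.
Proof. by rewrite [LHS]mx2E !mxE. Qed.

Lemma conjTM m n p (A : 'M[C]_(m, n)) (B : 'M[C]_(n, p)) :
  conjT (A *m B) = conjT B *m conjT A.
Proof. by rewrite /conjT map_mxM trmx_mul. Qed.

Lemma conjTK m n (A : 'M[C]_(m, n)) : conjT (conjT A) = A.
Proof. by apply/matrixP => i j; rewrite !mxE conjCK. Qed.

Lemma det_conjT (g : 'M[C]_2) : \det (conjT g) = Num.conj (\det g).
Proof. by rewrite [g]mx2E mx2_conjT !mx2_det rmorphB !rmorphM /=; ring. Qed.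

End ComplexParts.

(** * Binary Hermitian forms as points of a real four-space *)

Section HermitianForms.
Context {R : realType}.
Local Notation C := R[i].
Local Notation RR := (measurableTypeR R).

(* The Hermitian matrix with diagonal entries a, c and upper right entry *)
(* x + iy is encoded as ((a, c), (x, y)). *)
Definition form : Type := ((RR * RR) * (RR * RR))%type.
Definition Form (a c x y : R) : form := (((a : RR), (c : RR)), ((x : RR), (y : RR))).
Definition fa (B : form) : R := B.1.1.
Definition fc (B : form) : R := B.1.2.
Definition fx (B : form) : R := B.2.1.
Definition fy (B : form) : R := B.2.2.
Definition fdet (B : form) : R := fa B * fc B - fx B ^+ 2 - fy B ^+ 2.

Lemma FormE B : B = Form (fa B) (fc B) (fx B) (fy B).
Proof. by case: B => -[a c] [x y]. Qed.

Definition herm (B : form) : 'M[C]_2 :=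
  mx2 (rC (fa B)) (Complex (fx B) (fy B)) (Complex (fx B) (- fy B)) (rC (fc B)).
Definition coord (M : 'M[C]_2) : form :=
  Form (complex.Re (M 0 0)) (complex.Re (M 1 1)) (complex.Re (M 0 1)) (complex.Im (M 0 1)).

Lemma hermK : cancel herm coord.
Proof. by move=> -[[a c] [x y]]; rewrite /coord /herm !mx2_ij. Qed.

Lemma hermitian_herm B : Defs.hermitian (herm B).
Proof.
rewrite /Defs.hermitian /herm mx2_conjT; congr mx2; apply: complex_ext;
  by rewrite /= ?reim ?oppr0 ?opprK.
Qed.

Lemma coordK M : Defs.hermitian M -> herm (coord M) = M.
Proof.
move=> hM; rewrite [RHS]mx2E /herm /coord /fa /fc /fx /fy /=.
have h i j : M i j = Num.conj (M j i) by rewrite -{1}hM !mxE.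
have im0 i : complex.Im (M i i) = 0.
  by have := congr1 (@complex.Im R) (h i i); rewrite Im_conj; lra.
congr mx2; apply: complex_ext => //=; rewrite ?im0 //.
- by rewrite [RHS](congr1 (@complex.Re R) (h 1 0)) Re_conj.
- by rewrite [RHS](congr1 (@complex.Im R) (h 1 0)) Im_conj.
Qed.

Lemma det_herm B : \det (herm B) = rC (fdet B).
Proof. by rewrite mx2_det; apply: complex_ext; rewrite !reim /= /fdet; ring. Qed.

Definition act (g : 'M[C]_2) (B : form) : form := coord (g *m herm B *m conjT g).

Lemma herm_act g B : herm (act g B) = g *m herm B *m conjT g.
Proof.
apply: coordK; rewrite /Defs.hermitian !conjTM conjTK mulmxA.
by rewrite (hermitian_herm B).
Qed.

Lemma actM g h B : act (g *m h) B = act g (act h B).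
Proof. by rewrite /act -/(act h B) herm_act conjTM !mulmxA. Qed.

Lemma act1 B : act 1%:M B = B.
Proof.
have -> : act 1%:M B = coord (herm B).
  by rewrite /act mx2_1 mx2_conjT -/(herm B) !mx2M; congr coord; rewrite /herm; congr mx2;
    rewrite ?rmorph1 ?rmorph0; ring.
by rewrite hermK.
Qed.

Lemma actK g h B : g *m h = 1%:M -> act g (act h B) = B.
Proof. by move=> gh; rewrite -actM gh act1. Qed.

Lemma fdet_act g B : fdet (act g B) = normC2 (\det g) * fdet B.
Proof.
apply: rC_inj; rewrite -det_herm herm_act !det_mulmx det_herm det_conjT rCM -conjM_normC2.
by ring.
Qed.

Lemma herm_evalE B (v : 'cV[C]_2) : herm_eval (herm B) v =
  rC (fa B * normC2 (v 0 0) + fc B * normC2 (v 1 0) +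
    2 * complex.Re (Complex (fx B) (fy B) * (Num.conj (v 0 0) * v 1 0))).
Proof.
rewrite /herm_eval !mxE sum_ord2 !mxE !sum_ord2 !mxE /=.
by apply: complex_ext; rewrite /= !reim /normC2 /=; ring.
Qed.

Definition hval (B : form) (v : 'cV[C]_2) : R := complex.Re (herm_eval (herm B) v).

Lemma hvalE B v : hval B v =
  fa B * normC2 (v 0 0) + fc B * normC2 (v 1 0) +
    2 * complex.Re (Complex (fx B) (fy B) * (Num.conj (v 0 0) * v 1 0)).
Proof. by rewrite /hval herm_evalE. Qed.

Lemma herm_eval_hval B v : herm_eval (herm B) v = rC (hval B v).
Proof. by rewrite /hval herm_evalE. Qed.

(** The action on forms is dual to the one on vectors; this is why vectors are transformed by
    [conjT g] in all that follows. *)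
Lemma hval_act g B v : hval (act g B) v = hval B (conjT g *m v).
Proof. by rewrite /hval /herm_eval herm_act conjTM conjTK !mulmxA. Qed.

(** Completing the square in the first variable, multiplied by [fa B] to avoid a division. *)
Lemma hval_complete_square B v :
  fa B * hval B v = normC2 (rC (fa B) * v 0 0 + Complex (fx B) (fy B) * v 1 0)
                    + fdet B * normC2 (v 1 0).
Proof. by rewrite hvalE /normC2 /fdet !reim /=; ring. Qed.

Definition posform (B : form) := 0 < fa B /\ 0 < fdet B.

Lemma posform_hval B v : posform B -> v != 0 -> 0 < hval B v.
Proof.
move=> [a0 d0] v0; rewrite -(pmulr_rgt0 _ a0) hval_complete_square.
have [w0|w0] := eqVneq (v 1 0) 0.
  rewrite w0 normC2_0 !mulr0 !addr0 normC2M mulr_gt0 // normC2_gt0.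
    by apply/eqP => /rC_inj a00; rewrite a00 ltxx in a0.
  apply: contra v0 => /eqP v00; apply/eqP/colP => i; rewrite mxE.
  by case: i => [[|[|?]] ?] //; [rewrite -v00|rewrite -w0]; congr (v _ _); apply: val_inj.
by rewrite ltr_wpDl ?normC2_ge0 // mulr_gt0 // normC2_gt0.
Qed.

Lemma fdet_le_mul B : fdet B <= fa B * fc B.
Proof. by rewrite /fdet -addrA -opprD gerBl addr_ge0 // sqr_ge0. Qed.

Lemma posform_fc B : posform B -> 0 < fc B.
Proof.
move=> [a0 d0]; rewrite -(pmulr_rgt0 _ a0).
exact: lt_le_trans d0 (fdet_le_mul B).
Qed.

Definition vec2 (x y : C) : 'cV[C]_2 := \col_i (if i == 0 then x else y).
Lemma vec2_0 x y : vec2 x y 0 0 = x. Proof. by rewrite mxE. Qed.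
Lemma vec2_1 x y : vec2 x y 1 0 = y. Proof. by rewrite mxE. Qed.
Lemma vec2E (v : 'cV[C]_2) : v = vec2 (v 0 0) (v 1 0).
Proof.
apply/colP => i; rewrite mxE.
by case: i => [[|[|?]] ?] //=; congr (v _ _); apply: val_inj.
Qed.
Lemma mx2_vec2 p q r s x y : mx2 p q r s *m vec2 x y = vec2 (p * x + q * y) (r * x + s * y).
Proof. by rewrite [LHS]vec2E !mxE !sum_ord2 !mxE. Qed.
Lemma vec2_eq0 x y : (vec2 x y == 0) = (x == 0) && (y == 0).
Proof.
apply/eqP/andP => [/colP h|[/eqP -> /eqP ->]].
  by have := h 0; have := h 1; rewrite !mxE /= => -> ->.
by apply/colP => i; rewrite !mxE; case: ifP.
Qed.

Definition rankone (v : 'cV[C]_2) : form := coord (v *m conjT v).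

Lemma herm_rankone v : herm (rankone v) = v *m conjT v.
Proof. by apply: coordK; rewrite /Defs.hermitian conjTM conjTK. Qed.

Lemma rankoneE v : rankone v = Form (normC2 (v 0 0)) (normC2 (v 1 0))
  (complex.Re (v 0 0 * Num.conj (v 1 0))) (complex.Im (v 0 0 * Num.conj (v 1 0))).
Proof.
by rewrite /rankone /coord !mxE !big_ord1 !mxE; congr Form; rewrite /normC2 !reim; ring.
Qed.

(** The new upper left entry is the value of B at the first column of [conjT g], which is nonzero
    because g is invertible. *)
Lemma act_posform g B : \det g != 0 -> posform B -> posform (act g B).
Proof.
move=> g0 pB; have d0 : 0 < fdet (act g B).
  by rewrite fdet_act mulr_gt0 ?normC2_gt0 //; case: pB.
split=> //.
have gT : conjT g *m vec2 1 0 != 0.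
  apply/eqP => h.
  have /eqP : \det (conjT g) = 0.
    rewrite [g]mx2E mx2_conjT mx2_det.
    move: h; rewrite {1}[g]mx2E mx2_conjT mx2_vec2 => /eqP.
    by rewrite vec2_eq0 !mulr1 !mulr0 !addr0 => /andP[/eqP -> /eqP ->]; ring.
  by rewrite det_conjT conjC_eq0 (negbTE g0).
have := posform_hval pB gT; rewrite -hval_act hvalE vec2_0 vec2_1 normC2_0 normC2_1.
by rewrite !reim /= => h; lra.
Qed.

End HermitianForms.

(** * Lebesgue measure on forms and its invariance under matrices with |det| = 1 *)

Section FormMeasure.
Context {R : realType}.
Local Notation C := R[i].
Local Notation RR := (measurableTypeR R).
Local Notation leb := (@lebesgue_measure R).
Local Open Scope ereal_scope.

Definition leb2 : {sigma_finite_measure set (RR * RR)%type -> \bar R} := sfprod leb leb.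
Definition mu4 : {sigma_finite_measure set (@form R) -> \bar R} := sfprod leb2 leb2.

Lemma measurable_fa : measurable_fun [set: @form R] (@fa R).
Proof. by apply: measurableT_comp => //; apply: measurableT_comp. Qed.
Lemma measurable_fc : measurable_fun [set: @form R] (@fc R).
Proof. by apply: measurableT_comp => //; apply: measurableT_comp. Qed.
Lemma measurable_fx : measurable_fun [set: @form R] (@fx R).
Proof. by apply: measurableT_comp => //; apply: measurableT_comp. Qed.
Lemma measurable_fy : measurable_fun [set: @form R] (@fy R).
Proof. by apply: measurableT_comp => //; apply: measurableT_comp. Qed.

Lemma measurable_Form d (T : measurableType d) (f g h k : T -> R) :
  measurable_fun [set: T] f -> measurable_fun [set: T] g ->
  measurable_fun [set: T] h -> measurable_fun [set: T] k ->
  measurable_fun [set: T] (fun t => Form (f t) (g t) (h t) (k t)).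
Proof. by move=> mf mg mh mk; apply: measurable_fun_pair; apply: measurable_fun_pair. Qed.

Lemma measurable_fdet : measurable_fun [set: @form R] (@fdet R).
Proof.
apply: measurable_funB; [apply: measurable_funB|].
- by apply: measurable_funM; [exact: measurable_fa|exact: measurable_fc].
- by apply: measurable_funX; exact: measurable_fx.
- by apply: measurable_funX; exact: measurable_fy.
Qed.

Lemma preserving_leb2 (s t : R) :
  preserving leb2 leb2 (fun p : (RR * RR)%type => ((p.1 : R) + s : RR, (p.2 : R) + t : RR)%R).
Proof.
apply: (@preserving_prod _ _ _ _ _ _ _ (fun x : RR => (x : R) + s : RR)%R
  (fun _ (y : RR) => (y : R) + t : RR)%R).
- exact: preserving_shift.
- by move=> _; exact: preserving_shift.
- by apply: measurable_funD.
Qed.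

Lemma preserving_shear_xy (f g : R -> R -> R) :
  measurable_fun [set: (RR * RR)%type] (fun p : (RR * RR)%type => f p.1 p.2) ->
  measurable_fun [set: (RR * RR)%type] (fun p : (RR * RR)%type => g p.1 p.2) ->
  preserving mu4 mu4 (fun B : @form R =>
    Form (fa B) (fc B) (fx B + f (fa B) (fc B)) (fy B + g (fa B) (fc B))).
Proof.
move=> mf mg.
have : preserving (leb2 \x leb2) (leb2 \x leb2) (fun p : ((RR * RR) * (RR * RR))%type =>
    (idfun p.1, ((p.2.1 : R) + f p.1.1 p.1.2 : RR, (p.2.2 : R) + g p.1.1 p.1.2 : RR)%R)).
apply: (@preserving_prod _ _ _ _ _ leb2 leb2 idfun
   (fun p q => ((q.1 : R) + f p.1 p.2 : RR, (q.2 : R) + g p.1 p.2 : RR)%R)).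
- by split; [exact: measurable_id|].
- by move=> p; exact: preserving_leb2.
- apply: measurable_fun_pair; apply: measurable_funD.
  + exact: measurable_fx.
  + by apply: (measurableT_comp mf).
  + exact: measurable_fy.
  + by apply: (measurableT_comp mg).
by apply: preserving_ext => -[[a c] [x y]].
Qed.

Lemma preserving_shear_a (f : R -> R -> R -> R) :
  measurable_fun [set: @form R] (fun B => f (fc B) (fx B) (fy B)) ->
  preserving mu4 mu4 (fun B : @form R =>
    Form (fa B + f (fc B) (fx B) (fy B)) (fc B) (fx B) (fy B)).
Proof.
move=> mf.
have ms := preserving_swap leb2 leb2.
have mfs (c x y : R) : measurable_fun [set: R] (fun a : R => f c x y) by [].
pose T := (fun p : ((RR * RR) * (RR * RR))%type => (p.1,
   ((p.2.1 : R) + f p.2.2 p.1.1 p.1.2 : RR, p.2.2)%R)).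
have hT : preserving (leb2 \x leb2) (leb2 \x leb2) T.
  apply: (@preserving_prod _ _ _ _ _ leb2 leb2 idfun
     (fun p q => ((q.1 : R) + f q.2 p.1 p.2 : RR, q.2)%R)).
  - by split; [exact: measurable_id|].
  - move=> p.
    have mfp : measurable_fun [set: RR] (fun c : RR => f c p.1 p.2).
      have mF : measurable_fun [set: RR] (fun c : RR => Form 0 c p.1 p.2).
        by apply: measurable_Form.
      exact: (measurableT_comp mf mF).
    have h : preserving leb2 leb2 (fun q : (RR * RR)%type => (q.1, (q.2 : R) + f q.1 p.1 p.2 : RR)%R).
      apply: (@preserving_prod _ _ _ _ _ leb leb idfun (fun c a : RR => (a : R) + f c p.1 p.2 : RR)%R).
      + exact: preserving_idR.
      + by move=> x; exact: preserving_shift.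
      + by apply: measurable_funD => //; exact: (measurableT_comp mfp).
    have h2 := preserving_swap leb leb.
    exact: (preserving_comp (preserving_comp h2 h) h2).
  - apply: measurable_fun_pair; first apply: measurable_funD.
    + by apply: measurableT_comp => //; apply: measurableT_comp.
    + have mF : measurable_fun [set: ((RR * RR) * (RR * RR))%type]
         (fun p : ((RR * RR) * (RR * RR))%type => Form 0 p.2.2 p.1.1 p.1.2).
        by apply: measurable_Form => //; apply: measurableT_comp => //; apply: measurableT_comp.
      exact: (measurableT_comp mf mF).
    + by apply: measurableT_comp => //; apply: measurableT_comp.
apply: preserving_ext (preserving_comp (preserving_comp ms hT) ms).
by move=> -[[a c] [x y]].
Qed.

Lemma preserving_flip : preserving mu4 mu4 (fun B : @form R =>
  Form (fc B) (fa B) (fx B) (- fy B)%R).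
Proof.
have : preserving (leb2 \x leb2) (leb2 \x leb2) (fun p : ((RR * RR) * (RR * RR))%type =>
    ((p.1.2, p.1.1), (p.2.1, - (p.2.2 : R) : RR)%R)).
apply: (@preserving_prod _ _ _ _ _ leb2 leb2 (fun p => (p.2, p.1))
   (fun p q => (q.1, - (q.2 : R) : RR)%R)).
- exact: preserving_swap.
- move=> p; apply: (@preserving_prod _ _ _ _ _ leb leb idfun (fun _ y => - (y : R) : RR)%R).
  + exact: preserving_idR.
  + by move=> x; exact: preserving_opp.
  + by apply: measurableT_comp => //; exact: oppr_measurable.
- apply: measurable_fun_pair; first exact: measurable_fx.
  have m : measurable_fun [set: @form R] ((-%R : R -> R) \o (@fy R)).
    by apply: measurableT_comp; [exact: oppr_measurable|exact: measurable_fy].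
  exact: m.
by apply: preserving_ext => -[[a c] [x y]].
Qed.

(** The unipotent substitution is a shear of (x, y) along c followed by a shear of a. *)
Lemma preserving_upper (t : C) : preserving mu4 mu4 (act (mx2 1 t 0 1)%R).
Proof.
have h1 := @preserving_shear_xy (fun _ c => complex.Re t * c)%R (fun _ c => complex.Im t * c)%R.
(* Here x and y are the off-diagonal coordinates already shifted by the first shear, whence the
   minus sign of the quadratic term. *)
have h2 := @preserving_shear_a (fun c x y =>
  2 * (complex.Re t * x + complex.Im t * y) - normC2 t * c)%R.
have e : act (mx2 1 t 0 1)%R = (fun B : @form R =>
    Form (fa B + (2 * (complex.Re t * fx B + complex.Im t * fy B) - normC2 t * fc B)) (fc B) (fx B) (fy B))%R
    \o (fun B : @form R =>
    Form (fa B) (fc B) (fx B + complex.Re t * fc B) (fy B + complex.Im t * fc B))%R.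
  apply/funext => B; rewrite /act /herm mx2_conjT !mx2M /coord !mx2_ij /=.
  by congr Form; rewrite /= ?reim /normC2 /fa /fc /fx /fy /=; ring.
rewrite e; apply: (preserving_comp (h1 _ _) (h2 _)).
- by apply: measurable_funM.
- by apply: measurable_funM.
- apply: measurable_funB; apply: measurable_funM => //; last exact: measurable_fc.
  by apply: measurable_funD; apply: measurable_funM => //;
    [exact: measurable_fx|exact: measurable_fy].
Qed.

Lemma preserving_weyl : preserving mu4 mu4 (act (mx2 0 1 1 0)%R).
Proof.
have e : act (mx2 0 1 1 0)%R = (fun B : @form R => Form (fc B) (fa B) (fx B) (- fy B)%R).
  apply/funext => B; rewrite /act /herm mx2_conjT !mx2M /coord !mx2_ij /=.
  by congr Form; rewrite /= ?reim /=; ring.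
by rewrite e; exact: preserving_flip.
Qed.

Lemma preserving_act_mul g h : preserving mu4 mu4 (act g) -> preserving mu4 mu4 (act h) ->
  preserving mu4 mu4 (act (g *m h)).
Proof.
move=> hg hh; have -> : act (g *m h) = act g \o act h by apply/funext => B; exact: actM.
exact: preserving_comp hh hg.
Qed.

(* If r <> 0, a matrix (p q; r s) of determinant 1 is a product of elementary *)
(* matrices: upper ((p-1)/r), lower r, upper ((s-1)/r). *)
Lemma preserving_act_det1 (g : 'M[C]_2) : \det g = 1%R -> preserving mu4 mu4 (act g).
Proof.
have low r : preserving mu4 mu4 (act (mx2 1 0 r 1 : 'M[C]_2)%R).
  have -> : (mx2 1 0 r 1 = mx2 0 1 1 0 *m mx2 1 r 0 1 *m mx2 0 1 1 0 :> 'M[C]_2)%R.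
    by rewrite !mx2M; congr mx2; ring.
  apply: preserving_act_mul; last exact: preserving_weyl.
  by apply: preserving_act_mul; [exact: preserving_weyl|exact: preserving_upper].
have main p q r s : r != 0%R -> (p * s - q * r = 1)%R -> preserving mu4 mu4 (act (mx2 p q r s : 'M[C]_2)).
  move=> r0 d.
  have -> : (mx2 p q r s = mx2 1 ((p - 1) / r) 0 1 *m mx2 1 0 r 1 *m mx2 1 ((s - 1) / r) 0 1)%R.
    rewrite !mx2M; congr mx2; try by field.
    have -> : (q = (p * s - 1) / r)%R by rewrite -d; field.
    by field.
  apply: preserving_act_mul; last exact: preserving_upper.
  by apply: preserving_act_mul; [exact: preserving_upper|exact: low].
rewrite [g]mx2E mx2_det; move: (g 0 0)%R (g 0 1)%R (g 1 0)%R (g 1 1)%R => p q r s d.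
have [r0|] := eqVneq r 0%R; last by move=> r0; exact: main.
have s0 : s != 0%R by apply: contra_eqN d => /eqP ->; rewrite r0 mulr0 mulr0 subr0 eq_sym oner_eq0.
(* For r = 0 the entry s is nonzero, and a quarter turn moves it into the lower left corner. *)
have -> : (mx2 p q r s = mx2 q (- p) s (- r) *m mx2 0 1 (-1) 0)%R.
  by rewrite mx2M; congr mx2; ring.
apply: preserving_act_mul; apply: main => //; last by ring.
  by rewrite -d; ring.
Qed.

Lemma act_scale (l : C) (g : 'M[C]_2) B : normC2 l = 1%R -> act (l *: g) B = act g B.
Proof.
move=> l1; rewrite /act; congr coord.
have -> : conjT (l *: g) = Num.conj l *: conjT g.
  by apply/matrixP => i j; rewrite !mxE rmorphM.
by rewrite -scalemxAl -scalemxAl -scalemxAr scalerA mulrC conjM_normC2 l1 rC1 scale1r.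
Qed.

(** Dividing g by a square root of its determinant gives determinant 1, and a scalar of modulus 1
    acts trivially on forms. *)
Lemma preserving_act (g : 'M[C]_2) : normC2 (\det g) = 1%R -> preserving mu4 mu4 (act g).
Proof.
move=> d1; pose l := sqrtc (\det g).
have l2 : (l ^+ 2 = \det g)%R by exact: sqr_sqrtc.
have nl : normC2 l = 1%R.
  have : (normC2 l ^+ 2 = 1)%R by rewrite expr2 -normC2M -expr2 l2.
  by move=> /eqP; rewrite sqrf_eq1 => /orP[/eqP //|/eqP h]; have := normC2_ge0 l; rewrite h; lra.
have l0 : l != 0%R by rewrite -normC2_gt0 nl.
have -> : act g = act (l^-1 *: g).
  apply/funext => B; rewrite act_scale //.
  by have := congr1 (fun x => x) (normC2M l l^-1%R); rewrite mulfV // normC2_1 nl mul1r.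
apply: preserving_act_det1; rewrite detZ -l2; by field.
Qed.

Lemma measurable_act (g : 'M[C]_2) : measurable_fun [set: @form R] (act g).
Proof.
have e : act g = (fun B => Form
   (fa B * normC2 (g 0 0) + fc B * normC2 (g 0 1) +
     2 * (fx B * complex.Re (g 0 0 * Num.conj (g 0 1)) - fy B * complex.Im (g 0 0 * Num.conj (g 0 1))))
   (fa B * normC2 (g 1 0) + fc B * normC2 (g 1 1) +
     2 * (fx B * complex.Re (g 1 0 * Num.conj (g 1 1)) - fy B * complex.Im (g 1 0 * Num.conj (g 1 1))))
   (fa B * complex.Re (g 0 0 * Num.conj (g 1 0)) + fc B * complex.Re (g 0 1 * Num.conj (g 1 1))
    + fx B * complex.Re (g 0 0 * Num.conj (g 1 1) + g 0 1 * Num.conj (g 1 0))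
    - fy B * complex.Im (g 0 0 * Num.conj (g 1 1) - g 0 1 * Num.conj (g 1 0)))
   (fa B * complex.Im (g 0 0 * Num.conj (g 1 0)) + fc B * complex.Im (g 0 1 * Num.conj (g 1 1))
    + fx B * complex.Im (g 0 0 * Num.conj (g 1 1) + g 0 1 * Num.conj (g 1 0))
    + fy B * complex.Re (g 0 0 * Num.conj (g 1 1) - g 0 1 * Num.conj (g 1 0))))%R.
  apply/funext => B; rewrite {1}[g]mx2E /act /herm mx2_conjT !mx2M /coord !mx2_ij /=.
  by congr Form; rewrite /= ?reim /normC2 /=; ring.
have M (f : @form R -> R) k : measurable_fun [set: @form R] f ->
    measurable_fun [set: @form R] (fun B => f B * k)%R.
  by move=> mf; apply: measurable_funM.
rewrite e; apply: measurable_Form.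
- apply: measurable_funD; first by apply: measurable_funD; apply: M; [exact: measurable_fa|exact: measurable_fc].
  by apply: measurable_funM => //; apply: measurable_funB; apply: M; [exact: measurable_fx|exact: measurable_fy].
- apply: measurable_funD; first by apply: measurable_funD; apply: M; [exact: measurable_fa|exact: measurable_fc].
  by apply: measurable_funM => //; apply: measurable_funB; apply: M; [exact: measurable_fx|exact: measurable_fy].
- apply: measurable_funB; last by apply: M; exact: measurable_fy.
  apply: measurable_funD; last by apply: M; exact: measurable_fx.
  by apply: measurable_funD; apply: M; [exact: measurable_fa|exact: measurable_fc].
- apply: measurable_funD; last by apply: M; exact: measurable_fy.
  apply: measurable_funD; last by apply: M; exact: measurable_fx.
  by apply: measurable_funD; apply: M; [exact: measurable_fa|exact: measurable_fc].
Qed.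

End FormMeasure.

(** * Changes of variables in signed and nonnegative integrals *)

Section SignedIntegrals.
Local Open Scope ereal_scope.

Lemma preserving_integral_signed d1 d2 (S : measurableType d1) (T : measurableType d2)
    (R : realType) (m : {measure set S -> \bar R}) (m' : {measure set T -> \bar R}) (f : S -> T)
    (D : set T) (F : T -> \bar R) :
  preserving m m' f -> measurable D -> measurable_fun D F ->
  \int[m']_(y in D) F y = \int[m]_(x in f @^-1` D) F (f x).
Proof.
move=> hf mD mF; rewrite integralE [RHS]integralE; congr (_ - _).
- rewrite (preserving_integral hf mD (measurable_funepos mF) (fun y _ => funepos_ge0 F y)).
  by apply: eq_integral => x _; rewrite !funeposE.
- rewrite (preserving_integral hf mD (measurable_funeneg mF) (fun y _ => funeneg_ge0 F y)).
  by apply: eq_integral => x _; rewrite !funenegE.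
Qed.

Lemma preserving_integrable d1 d2 (S : measurableType d1) (T : measurableType d2)
    (R : realType) (m : {measure set S -> \bar R}) (m' : {measure set T -> \bar R}) (f : S -> T)
    (D : set T) (F : T -> \bar R) :
  preserving m m' f -> measurable D -> m'.-integrable D F -> m.-integrable (f @^-1` D) (F \o f).
Proof.
move=> hf mD /integrableP[mF iF]; apply/integrableP; split.
  apply: (measurable_comp (F := D)) => //; first by move=> _ [x Dx <-].
  exact: measurable_funS hf.1.
rewrite -(@preserving_integral _ _ _ _ _ m m' f D (fun y => `|F y|)) //.
exact: measurableT_comp.
Qed.

Lemma ge0_integral_scale (R : realType) (k : R) (D : set R) (F : R -> \bar R) :
  let leb := [the measure _ _ of @lebesgue_measure R] in
  (0 < k)%R -> measurable D -> measurable_fun D F -> (forall x, D x -> 0 <= F x) ->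
  \int[@lebesgue_measure R]_(x in D) F x =
  k%:E * \int[@lebesgue_measure R]_(x in (fun x => k * x)%R @^-1` D) F (k * x)%R.
Proof.
move=> leb k0 mD mF F0.
have mf : measurable_fun [set: R] (fun x : R => k * x)%R by apply: measurable_funM.
have K0 : (0 <= k^-1)%R by rewrite invr_ge0 ltW.
have hf : preserving (@lebesgue_measure R) (mscale (NngNum K0) (@lebesgue_measure R))
    (fun x : measurableTypeR R => (k * (x : R))%R : measurableTypeR R).
  split=> // A mA; rewrite /mscale /= (lebesgue_measure_scale k0 mA) muleA -EFinM mulVf ?mul1e //.
  by rewrite gt_eqF.
rewrite -(@preserving_integral _ _ _ _ _ leb (mscale (NngNum K0) leb) _ D F hf) //.
by rewrite ge0_integral_mscale //= muleA -EFinM mulfV ?mul1e // gt_eqF.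
Qed.

End SignedIntegrals.

(** * The function ln |2 sin t| and elementary trigonometric values *)

Section Lobachevsky.
Context {R : realType}.
Local Notation leb := (@lebesgue_measure R).
Implicit Types (a b c t x y : R).

Definition lsin t : R := ln `|2 * sin t|.
Definition lint a b : R := Rintegral leb `[a, b] lsin.

Lemma LobachevskyE a : Lobachevsky a = - lint 0 a.
Proof. by []. Qed.

Lemma measurable_lsin : measurable_fun [set: R] lsin.
Proof.
have ms : measurable_fun [set: R] (fun t : R => `|2 * sin t|).
  apply: measurableT_comp => //; apply: measurable_funM => //.
  by apply: continuous_measurable_fun; exact: continuous_sin.
exact: (measurableT_comp (@measurable_ln R) ms).
Qed.

Lemma lsin_refl t : lsin (pi - t) = lsin t.
Proof. by rewrite /lsin sinB sinpi cospi mul0r sub0r mulN1r opprK. Qed.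

(** 2 sin 2t = (2 sin t)(2 cos t), with the cosine written as a sine so that only [lsin] occurs. *)
Lemma lsin_dup t : sin t != 0 -> cos t != 0 -> lsin (2 * t) = lsin t + lsin (pi / 2 - t).
Proof.
move=> s0 c0; rewrite /lsin sinB sin_pihalf cos_pihalf mul1r mul0r subr0.
rewrite -lnM ?posrE ?normr_gt0 ?mulf_neq0 ?pnatr_eq0 //.
rewrite -normrM [2 * t]mulrC mulr_natr mulr2n sinD; congr (ln `|_|); ring.
Qed.

(** With s = sin(pi/6), the identity cos(pi/6 + pi/6) = sin(pi/6) and the addition formula give (2s
    - 1)(s + 1) = 0. *)
Lemma sin_pi6 : sin (pi / 6) = 1 / 2 :> R.
Proof.
have p0 := @pi_gt0 R.
have s0 : 0 < sin (pi / 6 : R) by apply: sin_gt0_pi; apply/andP; split; lra.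
have e1 : cos (pi / 6 + pi / 6) = sin (pi / 6 : R).
  have -> : pi / 6 + pi / 6 = pi / 2 - pi / 6 :> R by field.
  by rewrite cosB cos_pihalf sin_pihalf mul0r mul1r add0r.
have := cos2Dsin2 (pi / 6 : R); rewrite cosD in e1; move=> e2.
have : (2 * sin (pi / 6 : R) - 1) * (sin (pi / 6 : R) + 1) = 0 by nra.
by move=> /eqP; rewrite mulf_eq0 => /orP[/eqP|/eqP]; lra.
Qed.

Lemma cos_pi3 : cos (pi / 3) = 1 / 2 :> R.
Proof.
rewrite -sin_pi6; have -> : pi / 3 = pi / 2 - pi / 6 :> R by field.
by rewrite cosB cos_pihalf sin_pihalf mul0r mul1r add0r.
Qed.

(** Mean value theorem, the cosine being at least 1/2 on [0, pi/3]. *)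
Lemma sin_ge_half t : 0 <= t <= pi / 3 -> t / 2 <= sin t.
Proof.
have p0 := @pi_gt0 R.
move=> /andP[t0 t3].
have [c ct e] := MVT_segment t0 (fun x _ => is_derive_sin x)
  (continuous_subspaceT (@continuous_sin R)).
move: e ct; rewrite sin0 !subr0 in_itv /= => -> /andP[c0 ct].
suff : 1 / 2 <= cos c by move=> h; nra.
rewrite -cos_pi3 leNgt ltr_cos ?in_itv /=; try by apply/andP; split; lra.
by rewrite -leNgt (le_trans ct).
Qed.

(** Derivative and continuity are assumed at the endpoints too, in place of one-sided limits; a = b
    is allowed. *)
Lemma FTC2_closed (F f : R -> R) a b : a <= b ->
  (forall x, a <= x <= b -> is_derive x 1 F (f x)) ->
  (forall x, a <= x <= b -> {for x, continuous f}) ->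
  (\int[leb]_(x in `[a, b]) (f x)%:E = (F b - F a)%:E)%E.
Proof.
rewrite le_eqVlt => /orP[/eqP -> _ _|ab dF cf].
  by rewrite set_itv1 integral_set1 subrr.
have cF x : a <= x <= b -> {for x, continuous F}.
  move=> xab; apply: differentiable_continuous; apply/derivable1_diffP.
  by have := dF x xab; move=> [].
rewrite (@continuous_FTC2 R f F a b) // ?EFinB //.
- apply/continuous_within_itvP => //; split.
  + by move=> x; rewrite in_itv /= => /andP[ax xb]; apply: cf; rewrite !ltW.
  + by apply: cvg_at_right_filter; apply: cf; rewrite lexx ltW.
  + by apply: cvg_at_left_filter; apply: cf; rewrite lexx ltW.
- split.
  + move=> x; rewrite in_itv /= => /andP[ax xb].
    have xab : a <= x <= b by rewrite !ltW.
    by have [] := dF x xab.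
  + by apply: cvg_at_right_filter; apply: cF; rewrite lexx ltW.
  + by apply: cvg_at_left_filter; apply: cF; rewrite lexx ltW.
- move=> x; rewrite in_itv /= => /andP[ax xb].
  rewrite derive1E.
  have xab : a <= x <= b by rewrite !ltW.
  by have := dF x xab; move=> ?; rewrite derive_val.
Qed.

End Lobachevsky.

(** * Integrability of ln |2 sin t| on [0, pi] *)

Section Lobachevsky1.
Context {R : realType}.
Local Notation leb := (@lebesgue_measure R).
Implicit Types (a b c t : R).

(** Monotone convergence, in the form that serves for upper bounds of improper integrals. *)
Lemma ge0_integral_le_exhaust d (T : measurableType d) (m : {measure set T -> \bar R})
    (F : (set T)^nat) (f : T -> \bar R) (M : \bar R) :
  {homo F : n m / (n <= m)%N >-> (n <= m)%O} ->
  (forall i, measurable (F i)) -> (forall i, measurable_fun (F i) f) ->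
  (forall i x, F i x -> (0 <= f x)%E) ->
  (forall i, (\int[m]_(x in F i) f x <= M)%E) ->
  (\int[m]_(x in \bigcup_i F i) f x <= M)%E.
Proof.
move=> ndF mF mf f0 hM.
have h := ge0_nondecreasing_set_cvg_integral ndF mF mf f0 (mu := m).
rewrite -(cvg_lim _ h) //; apply: lime_le; first by apply/cvg_ex; eexists; exact: h.
by apply: nearW.
Qed.

Lemma bigcup_itv_right a b : a < b ->
  `]a, b] = \bigcup_n `[a + (b - a) / n.+1%:R, b] :> set R.
Proof.
move=> ab; apply/seteqP; split=> x.
  rewrite /= in_itv /= => /andP[ax xb].
  have xa : 0 < x - a by rewrite subr_gt0.
  exists (Num.trunc ((b - a) / (x - a))) => //=.
  rewrite in_itv /= xb andbT -lerBrDl ler_pdivrMr ?ltr0n // -ler_pdivrMl //.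
  by rewrite mulrC ltW // truncnS_gt.
move=> [n _] /=; rewrite !in_itv /= => /andP[h ->]; rewrite andbT.
by apply: lt_le_trans h; rewrite ltrDl divr_gt0 // ?subr_gt0 // ltr0n.
Qed.

Lemma nd_itv_right a b : a < b ->
  {homo (fun n => `[a + (b - a) / n.+1%:R, b] : set R) : n m / (n <= m)%N >-> (n <= m)%O}.
Proof.
move=> ab n m nm; apply/subsetPset => x /=; rewrite !in_itv /= => /andP[h ->]; rewrite andbT.
apply: le_trans h; rewrite lerD2l ler_pM2l ?subr_gt0 // lef_pV2 ?posrE ?ltr0n //.
by rewrite ler_nat ltnS.
Qed.

(** x - x ln x is an antiderivative, and e ln e <= 0. *)
Lemma integral_Nln_le1 (e : R) : 0 < e <= 1 -> (\int[leb]_(x in `[e, 1%R]) (- ln x)%:E <= 1%:E)%E.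
Proof.
move=> /andP[e0 e1].
have hd x : e <= x <= 1 -> is_derive x 1 (fun x => x - x * ln x) (- ln x).
  move=> /andP[ex _]; have x0 : 0 < x by exact: lt_le_trans e0 ex.
  have h := is_deriveB (is_derive_id x 1) (is_deriveM (is_derive_id x 1) (is_derive1_ln x0)).
  by apply: (is_derive_eq h); rewrite /GRing.scale /=; field; rewrite gt_eqF.
have hc x : e <= x <= 1 -> {for x, continuous (fun x : R => - ln x)}.
  move=> /andP[ex _]; have x0 : 0 < x by exact: lt_le_trans e0 ex.
  by apply: cvgN; exact: continuous_ln.
rewrite (FTC2_closed e1 hd hc) lee_fin ln1 mulr0 subr0.
have : e * ln e <= 0 by apply: mulr_ge0_le0; [exact: ltW|exact: ln_le0].
by lra.
Qed.

Lemma integrable_ln01 : leb.-integrable `[0, 1] (EFin \o @ln R).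
Proof.
have m1 : measurable_fun [set: R] (EFin \o (fun x : R => - ln x)).
  apply/measurable_EFinP; apply: measurableT_comp; first exact: oppr_measurable.
  exact: measurable_ln.
apply/integrableP; split.
  by apply/measurable_EFinP; apply: measurable_funTS; exact: measurable_ln.
have -> : (\int[leb]_(x in `[0%R, 1%R]) `|(EFin \o @ln R) x| = \int[leb]_(x in `]0%R, 1%R]) (- ln x)%:E)%E.
  have mm : measurable_fun `](0:R), 1[ (fun x : R => `|(EFin \o @ln R) x|%E).
    apply: measurableT_comp => //; apply/measurable_EFinP; apply: measurable_funTS; exact: measurable_ln.
  have mm2 : measurable_fun `](0:R), 1[ (fun x : R => (- ln x)%:E) by exact: measurable_funTS.
  rewrite (@integral_itv_bndoo R 0 1 _ true false mm) (@integral_itv_bndoo R 0 1 _ false false mm2).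
  apply: eq_integral => x; rewrite inE /= in_itv /= => /andP[x0 x1].
  by rewrite ler0_norm // ln_le0 // ltW.
apply: (@le_lt_trans _ _ 1%:E); last exact: ltry.
rewrite (bigcup_itv_right ltr01); apply: ge0_integral_le_exhaust.
- exact: nd_itv_right.
- by move=> i; exact: measurable_itv.
- by move=> i; exact: measurable_funTS.
- move=> i x /=; rewrite in_itv /= => /andP[_ x1].
  by rewrite lee_fin oppr_ge0 ln_le0.
- move=> i; apply: integral_Nln_le1; rewrite add0r subr0 div1r.
  by rewrite invr_gt0 ltr0n /= invf_le1 ?ltr0n // ler1n.
Qed.

(** On this range x <= 2 sin x <= 2. *)
Lemma ln_lsin_bound (x : R) : 0 < x <= 1 / 2 -> `|lsin x| <= `|ln x| + ln 2.
Proof.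
move=> /andP[x0 x1].
have hs : x / 2 <= sin x by apply: sin_ge_half; have := @pi_ge2 R; lra.
have s0 : 0 < 2 * sin x by lra.
have s1 := sin_le1 x.
rewrite /lsin (gtr0_norm s0).
have u : ln (2 * sin x) <= ln 2 by rewrite ler_ln ?posrE //; lra.
have l : ln x <= ln (2 * sin x) by rewrite ler_ln ?posrE //; lra.
have n : ln x <= 0 by apply: ln_le0; lra.
have t : 0 <= ln 2 :> R by apply: ln_ge0; lra.
rewrite [`|ln x|]ler0_norm // ler_norml; apply/andP; split; lra.
Qed.

Lemma integrable_lsin01 : leb.-integrable `[(0:R), 1 / 2] (EFin \o @lsin R).
Proof.
have ml : measurable_fun `[(0:R), 1 / 2] (EFin \o @lsin R).
  by apply/measurable_EFinP; apply: measurable_funTS; exact: measurable_lsin.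
(* The constant term with [lsin 0] covers the endpoint 0, which [ln_lsin_bound] excludes. *)
apply: (@le_integrable _ _ _ leb `[(0:R), 1 / 2] _ _ (fun x => ((`|ln x| + ln 2) + `|lsin 0|)%:E)) => //.
  move=> x /=; rewrite in_itv /= => /andP[x0 x1]; rewrite lee_fin.
  have l2 : 0 <= ln 2 :> R by apply: ln_ge0; lra.
  rewrite [`|_ + _|]ger0_norm ?addr_ge0 //.
  have [->|x00] := eqVneq x 0; first by rewrite lerDr addr_ge0.
  apply: (le_trans (ln_lsin_bound _)); last by rewrite lerDl.
  by rewrite lt_def x00 x0 x1.
have i1 : leb.-integrable `[(0:R), 1 / 2] (EFin \o (fun x : R => `|ln x|)).
  apply: (@integrableS _ _ _ leb `[(0:R), 1]) => //.
    by move=> x /=; rewrite !in_itv /=; lra.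
  by have := integrable_abse integrable_ln01.
have ic (k : R) : leb.-integrable `[(0:R), 1 / 2] (EFin \o (fun=> k)).
  by apply: continuous_compact_integrable; [exact: segment_compact|exact: cst_continuous].
have h := @integrableD _ _ _ leb `[(0:R), 1 / 2] _ _ _ (@integrableD _ _ _ leb `[(0:R), 1 / 2] _ _ _ i1 (ic (ln 2))) (ic `|lsin 0|).
by apply: h.
Qed.

Lemma continuous_lsin t : 0 < t < pi -> {for t, continuous (@lsin R)}.
Proof.
move=> tp; have s0 := sin_gt0_pi tp.
have c2 : {for t, continuous (fun t : R => 2 * sin t)}.
  by apply: continuousM; [exact: cst_continuous|exact: continuous_sin].
apply: (@continuous_comp _ _ _ (fun t : R => `|2 * sin t|) (@ln R)).
  by apply: (continuous_comp c2); exact: norm_continuous.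
by apply: continuous_ln; rewrite normr_gt0 mulf_neq0 // ?pnatr_eq0 // gt_eqF.
Qed.

Lemma preserving_refl c :
  preserving leb leb (fun x : measurableTypeR R => c - (x : R) : measurableTypeR R).
Proof.
apply: preserving_ext (preserving_comp preserving_opp (preserving_shift c)).
by move=> x /=; rewrite addrC.
Qed.

Lemma preimage_refl c a b : (fun x => c - x) @^-1` `[a, b] = `[c - b, c - a] :> set R.
Proof. by apply/seteqP; split=> x /=; rewrite !in_itv /=; lra. Qed.

Lemma integrable_setU d (T : measurableType d) (m : {measure set T -> \bar R})
    (A B : set T) (f : T -> \bar R) : measurable A -> measurable B ->
  m.-integrable A f -> m.-integrable B f -> m.-integrable (A `|` B) f.
Proof.
move=> mA mB /integrableP[mfA iA] iB.
have mBA : measurable (B `\` A) by exact: measurableD.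
have /integrableP[mfB iB'] := integrableS mB mBA (@subDsetl _ _ _) iB.
have e : A `|` B = A `|` (B `\` A).
  apply/seteqP; split=> x; last by move=> [|[]]; [left|right].
  by move=> []; [left|move=> Bx; have [Ax|Ax] := pselect (A x); [left|right]].
have mf : measurable_fun (A `|` (B `\` A)) f by apply/measurable_funU.
rewrite e; apply/integrableP; split=> //.
rewrite ge0_integral_setU //; first exact: lte_add_pinfty.
- exact: measurableT_comp.
- by apply/disj_setPS => x [Ax [_ /(_ Ax)]].
Qed.

(** A logarithmic singularity at 0 and, by the reflection t -> pi - t, at pi; the function is
    continuous in between. *)
Lemma integrable_lsin : leb.-integrable `[0, pi] (EFin \o @lsin R).
Proof.
have p2 := @pi_ge2 R.
have i1 := integrable_lsin01.
have i2 : leb.-integrable `[1 / 2, pi - 1 / 2] (EFin \o @lsin R).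
  apply: continuous_compact_integrable; first exact: segment_compact.
  apply: continuous_in_subspaceT => x; rewrite inE /= in_itv /= => /andP[x1 x2].
  by apply: continuous_lsin; lra.
have i3 : leb.-integrable `[pi - 1 / 2, pi] (EFin \o @lsin R).
  have := preserving_integrable (preserving_refl pi) (measurable_itv _) i1.
  rewrite preimage_refl subr0; apply: eq_integrable => //.
  by move=> x _ /=; rewrite lsin_refl.
have -> : `[0, pi] = (`[0, 1 / 2] `|` `[1 / 2, pi - 1 / 2]) `|` `[pi - 1 / 2, pi] :> set R.
  apply/seteqP; split=> x /=; rewrite !in_itv /=.
    by case: (leP x (1 / 2)) => h1; [left; left|case: (leP x (pi - 1 / 2)) => h2; [left; right|right]]; lra.
  by move=> [[]|]; lra.
apply: integrable_setU => //; first by apply: measurableU; exact: measurable_itv.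
by apply: integrable_setU => //; exact: measurable_itv.
Qed.

Lemma integrable_lsinS a b : 0 <= a -> b <= pi -> leb.-integrable `[a, b] (EFin \o @lsin R).
Proof.
move=> a0 bp; apply: (integrableS _ _ _ integrable_lsin) => // x /=.
by rewrite !in_itv /=; lra.
Qed.

End Lobachevsky1.

(** * Duplication, concavity and maximum of the Lobachevsky function *)

Section Lobachevsky2.
Context {R : realType}.
Local Notation leb := (@lebesgue_measure R).
Local Notation lint := (@lint R).
Implicit Types (a b c t : R).

Lemma Rintegral_cc_oo a b (f : R -> R) : leb.-integrable `[a, b] (EFin \o f) ->
  Rintegral leb `[a, b] f = Rintegral leb `]a, b[ f.
Proof.
move=> i; rewrite -Rintegral_itv_obnd_cbnd; last first.
  by apply: (integrableS _ _ _ i) => // x /=; rewrite !in_itv /=; lra.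
apply/esym/Rintegral_itv_bndo_bndc.
by apply: (integrableS _ _ _ i) => // x /=; rewrite !in_itv /=; lra.
Qed.

Lemma lint_cat a b c : 0 <= a -> a <= b -> b <= c -> c <= pi ->
  lint a c = lint a b + lint b c.
Proof.
move=> a0 ab bc cp.
have i1 := @integrable_lsinS R a c a0 cp.
have h := @Rintegral_itvB R (@lsin R) (BLeft a) (BRight c) b i1.
have -> : lint b c = Rintegral leb `]b, c] (@lsin R).
  apply/esym/Rintegral_itv_obnd_cbnd; apply: (integrableS _ _ _ i1) => //.
  by move=> x /=; rewrite !in_itv /=; lra.
by rewrite /lint -h ?bnd_simp //; ring.
Qed.

Lemma lint_refl a b c (f : R -> R) : 0 <= c - b -> c - a <= pi ->
  (forall t, a <= t <= b -> f t = lsin (c - t)) ->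
  Rintegral leb `[a, b] f = lint (c - b) (c - a) /\ leb.-integrable `[a, b] (EFin \o f).
Proof.
move=> h0 h1 hf.
have i := integrable_lsinS h0 h1.
have p := @preserving_refl R c.
have e : `[a, b] = (fun x => c - x) @^-1` `[c - b, c - a] :> set R.
  by apply/seteqP; split=> x /=; rewrite !in_itv /=; lra.
have E : {in (`[a, b] : set R), (EFin \o lsin) \o (fun x => c - x) =1 EFin \o f}.
  by move=> x; rewrite inE /= in_itv /= => /hf ->.
split.
  rewrite /lint /Rintegral; congr fine.
  have [m _] := @integrableP _ _ _ _ _ _ i.
  rewrite (preserving_integral_signed p (measurable_itv _) m) -e.
  by apply: eq_integral => x /E /= ->.
have j := preserving_integrable p (measurable_itv _) i; rewrite -e in j.
by move: j; apply: eq_integrable.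
Qed.

Lemma lint_shift a b c (f : R -> R) : 0 <= a + c -> b + c <= pi ->
  (forall t, a <= t <= b -> f t = lsin (t + c)) ->
  Rintegral leb `[a, b] f = lint (a + c) (b + c) /\ leb.-integrable `[a, b] (EFin \o f).
Proof.
move=> h0 h1 hf.
have i := integrable_lsinS h0 h1.
have p := @preserving_shift R c.
have e : `[a, b] = (fun x => x + c) @^-1` `[a + c, b + c] :> set R.
  by apply/seteqP; split=> x /=; rewrite !in_itv /=; lra.
have E : {in (`[a, b] : set R), (EFin \o lsin) \o (fun x => x + c) =1 EFin \o f}.
  by move=> x; rewrite inE /= in_itv /= => /hf ->.
split.
  rewrite /lint /Rintegral; congr fine.
  have [m _] := @integrableP _ _ _ _ _ _ i.
  rewrite (preserving_integral_signed p (measurable_itv _) m) -e.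
  by apply: eq_integral => x /E /= ->.
have j := preserving_integrable p (measurable_itv _) i; rewrite -e in j.
by move: j; apply: eq_integrable.
Qed.

(** The substitution t -> 2t, applied to the positive and negative parts separately because
    [ge0_integral_scale] concerns nonnegative functions. *)
Lemma lint_half a : 0 <= a <= pi / 2 ->
  lint 0 (2 * a) = 2 * Rintegral leb `[0, a] (fun t => lsin (2 * t)) /\
  leb.-integrable `[0, a] (EFin \o (fun t => lsin (2 * t))).
Proof.
move=> /andP[a0 ap].
have i : leb.-integrable `[0, 2 * a] (EFin \o @lsin R) by apply: integrable_lsinS => //; lra.
have /integrableP[mf _] := i.
have e : (fun x => 2 * x) @^-1` `[0, 2 * a] = `[0, a] :> set R.
  by apply/seteqP; split=> x /=; rewrite !in_itv /=; lra.
have S F : measurable_fun (`[0, 2 * a] : set R) F -> (forall x, (0 <= F x)%E) ->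
  (\int[leb]_(x in `[0%R, (2 * a)%R]) F x = 2%:E * \int[leb]_(x in `[0%R, a]) F (2 * x)%R)%E.
  move=> mF F0; rewrite (@ge0_integral_scale R 2 _ F) ?e //.
have m2 : measurable_fun (`[0, a] : set R) (EFin \o (fun t => lsin (2 * t))).
  apply/measurable_EFinP; apply: (measurableT_comp (@measurable_lsin R)) => //.
have i2 : leb.-integrable `[0, a] (EFin \o (fun t => lsin (2 * t))).
  apply/integrableP; split=> //.
  have /integrableP[_] := i; rewrite S //; last exact: measurableT_comp.
  have := @integral_ge0 _ _ _ leb (`[0, a]) (fun x => `|(EFin \o lsin) (2 * x)%R|%E) (fun x _ => abse_ge0 _).
  set z := (\int[leb]_(x in `[0%R, a]) `|(EFin \o lsin) (2 * x)%R|)%E => z0 h.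
  change (z < +oo)%E; move: z z0 h.
  by case=> //= [r|] _; rewrite ?ltry // mulry gtr0_sg // mul1e ltxx.
split=> //.
have P := integrable_pos_fin_num _ i2; have N := integrable_neg_fin_num _ i2.
rewrite /lint /Rintegral integralE S; last by move=> x; exact: funepos_ge0.
  rewrite S; last by move=> x; exact: funeneg_ge0.
    rewrite [in RHS]integralE.
    have -> : (\int[leb]_(x in `[0%R, a]) (EFin \o lsin)^\+ (2 * x)%R =
      \int[leb]_(x in `[0%R, a]) (EFin \o (fun t => lsin (2 * t)%R))^\+ x)%E.
      by apply: eq_integral => x _; rewrite !funeposE.
    have -> : (\int[leb]_(x in `[0%R, a]) (EFin \o lsin)^\- (2 * x)%R =
      \int[leb]_(x in `[0%R, a]) (EFin \o (fun t => lsin (2 * t)%R))^\- x)%E.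
      by apply: eq_integral => x _; rewrite !funenegE.
    rewrite -(fineK (P _)) // -(fineK (N _)) // -!EFinM -!EFinB /=; ring.
  exact: measurable_funeneg.
exact: measurable_funepos.
Qed.

(** The duplication formula: [lsin_dup] is integrated over the open interval, where sine and cosine
    do not vanish. *)
Lemma lint_dup a : 0 <= a <= pi / 2 -> lint 0 (2 * a) = 2 * lint 0 a + 2 * lint (pi / 2 - a) (pi / 2).
Proof.
move=> /[dup] /andP[a0 ap] aP; have p2 := @pi_ge2 R.
have [-> i] := lint_half aP.
have hr t : 0 <= t <= a -> (fun t => lsin (pi / 2 - t)) t = lsin (pi / 2 - t) by [].
have [e1 i1] := @lint_refl 0 a (pi / 2) (fun t => lsin (pi / 2 - t)) (ltac:(lra)) (ltac:(lra)) hr.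
have i0 : leb.-integrable `[0, a] (EFin \o @lsin R) by apply: integrable_lsinS; lra.
have isum : leb.-integrable `[0, a] (EFin \o (fun t : R => lsin t + lsin (pi / 2 - t))).
  by have := @integrableD _ _ _ leb `[0, a] _ _ _ i0 i1; apply.
rewrite -mulrDr; congr (_ * _).
have -> : lint (pi / 2 - a) (pi / 2) = Rintegral leb `[0, a] (fun t => lsin (pi / 2 - t)).
  by rewrite e1; congr lint; ring.
transitivity (Rintegral leb `[0, a] (fun t : R => lsin t + lsin (pi / 2 - t))); last first.
  by rewrite (@RintegralD _ _ _ leb `[0, a] _ _ (measurable_itv _) i0 i1).
rewrite (Rintegral_cc_oo i) (Rintegral_cc_oo isum).
apply: eq_Rintegral => t; rewrite inE /= in_itv /= => /andP[t0 ta].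
by apply: lsin_dup; apply: lt0r_neq0; [apply: sin_gt0_pi|apply: cos_gt0_pihalf]; lra.
Qed.

Lemma lint_le a b (k : R) : 0 <= a -> a <= b -> b <= pi ->
  (forall t, a <= t <= b -> lsin t <= k) -> lint a b <= k * (b - a).
Proof.
move=> a0 ab bp h.
have ik : leb.-integrable `[a, b] (EFin \o (fun=> k)).
  by apply: continuous_compact_integrable; [exact: segment_compact|exact: cst_continuous].
have i := integrable_lsinS a0 bp.
have hh x : (`[a, b] : set R) x -> lsin x <= (fun=> k) x by rewrite /= in_itv /=; exact: h.
have := @le_Rintegral _ _ _ leb `[a, b] _ _ (measurable_itv _) i ik hh; rewrite -/(lint a b).
rewrite Rintegral_cst //= lebesgue_measure_itv /= lte_fin.
by move: ab; rewrite le_eqVlt => /orP[/eqP ->|ab]; rewrite ?ltxx ?subrr ?mulr0 //= ab.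
Qed.

Lemma lint_ge a b (k : R) : 0 <= a -> a <= b -> b <= pi ->
  (forall t, a <= t <= b -> k <= lsin t) -> k * (b - a) <= lint a b.
Proof.
move=> a0 ab bp h.
have ik : leb.-integrable `[a, b] (EFin \o (fun=> k)).
  by apply: continuous_compact_integrable; [exact: segment_compact|exact: cst_continuous].
have i := integrable_lsinS a0 bp.
have hh x : (`[a, b] : set R) x -> (fun=> k) x <= lsin x by rewrite /= in_itv /=; exact: h.
have := @le_Rintegral _ _ _ leb `[a, b] _ _ (measurable_itv _) ik i hh; rewrite -/(lint a b).
rewrite Rintegral_cst //= lebesgue_measure_itv /= lte_fin.
by move: ab; rewrite le_eqVlt => /orP[/eqP ->|ab]; rewrite ?ltxx ?subrr ?mulr0 //= ab.
Qed.

Lemma lsin_homo (x y : R) : 0 < x -> x <= y -> y <= pi / 2 -> lsin x <= lsin y.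
Proof.
move=> x0 xy yp.
have sx : 0 < sin x by apply: sin_gt0_pi; lra.
have sy : 0 < sin y by apply: sin_gt0_pi; lra.
have sxy : sin x <= sin y.
  move: xy; rewrite le_eqVlt => /orP[/eqP -> //|xy].
  by rewrite ltW // ltr_sin ?in_itv //=; lra.
by rewrite /lsin !gtr0_norm ?mulr_gt0 // ler_ln ?posrE ?mulr_gt0 // ler_pM2l.
Qed.

Lemma lsin_pi6 : @lsin R (pi / 6) = 0.
Proof. by rewrite /lsin sin_pi6 mulrC divfK ?pnatr_eq0 // normr1 ln1. Qed.

(** The derivative - ln |2 sin t| decreases on (0, pi/2), so the function is concave there and lies
    below its tangent at pi/3. Over three angles with sum pi the linear terms cancel, which is the
    extremality of the regular ideal tetrahedron. *)
Lemma Lobachevsky_tangent a : 0 < a < pi / 2 ->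
  Lobachevsky a <= Lobachevsky (pi / 3) - lsin (pi / 3) * (a - pi / 3).
Proof.
move=> /andP[a0 ap]; have p2 := @pi_ge2 R; rewrite !LobachevskyE.
have [h|h] := leP a (pi / 3).
  rewrite (@lint_cat 0 a (pi / 3)); try lra.
  have := @lint_le a (pi / 3) (lsin (pi / 3)) (ltW a0) h (ltac:(lra)).
  have H t : a <= t <= pi / 3 -> lsin t <= lsin (pi / 3).
    by move=> tt; apply: lsin_homo; lra.
  by move=> /(_ H); lra.
rewrite (@lint_cat 0 (pi / 3) a); try lra.
have := @lint_ge (pi / 3) a (lsin (pi / 3)) (ltac:(lra)) (ltW h) (ltac:(lra)).
have H t : pi / 3 <= t <= a -> lsin (pi / 3) <= lsin t.
  by move=> tt; apply: lsin_homo; lra.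
by move=> /(_ H); lra.
Qed.

(** Reflection and duplication at pi/2 make the integral over [0, pi/2] vanish; duplication at pi/6
    then relates the integrals up to pi/6 and up to pi/3. *)
Lemma Lobachevsky_pi6 : Lobachevsky (pi / 6) = 3 / 2 * Lobachevsky (pi / 3) :> R.
Proof.
have p2 := @pi_ge2 R; rewrite !LobachevskyE.
have e3 : lint (pi / 2) pi = lint 0 (pi / 2).
  have [] := @lint_refl (pi / 2) pi pi (@lsin R) (ltac:(lra)) (ltac:(lra)).
    by move=> t _; rewrite lsin_refl.
  have -> : pi - pi / 2 = pi / 2 :> R by field.
  by rewrite subrr => <-.
have e1 := @lint_dup (pi / 6) (ltac:(lra)).
have e2 := @lint_dup (pi / 2) (ltac:(lra)).
have [h3 [h4 [h5 h7]]] : (pi : R) / 3 <= pi / 2 /\ (0 <= (pi : R) / 3 /\ ((pi : R) / 2 <= pi /\ 0 <= (pi : R) / 2)).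
  by clear e1 e2; lra.
have e4 := lint_cat (lexx 0) h7 h5 (lexx pi).
have e5 := lint_cat (lexx 0) h4 h3 h5.
have s1 : 2 * (pi / 6) = pi / 3 :> R by field.
have s2 : pi / 2 - pi / 6 = pi / 3 :> R by field.
have s3 : 2 * (pi / 2) = pi :> R by field.
rewrite s1 s2 in e1; rewrite s3 subrr in e2; lra.
Qed.

(** The integrand [lsin] changes sign at pi/6, so the maximum is there. *)
Lemma Lobachevsky_max a : 0 < a < pi / 2 -> Lobachevsky a <= 3 / 2 * Lobachevsky (pi / 3).
Proof.
move=> /andP[a0 ap]; have p2 := @pi_ge2 R; rewrite -Lobachevsky_pi6 !LobachevskyE lerN2.
have [h|h] := leP a (pi / 6).
  rewrite (@lint_cat 0 a (pi / 6)); try lra.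
  have := @lint_le a (pi / 6) 0 (ltW a0) h (ltac:(lra)).
  have H t : a <= t <= pi / 6 -> lsin t <= 0.
    by move=> tt; rewrite -lsin_pi6; apply: lsin_homo; lra.
  by move=> /(_ H); lra.
rewrite (@lint_cat 0 (pi / 6) a); try lra.
have := @lint_ge (pi / 6) a 0 (ltac:(lra)) (ltW h) (ltac:(lra)).
have H t : pi / 6 <= t <= a -> 0 <= lsin t.
  by move=> tt; rewrite -lsin_pi6; apply: lsin_homo; lra.
by move=> /(_ H); lra.
Qed.

End Lobachevsky2.

(** * Elementary integrals for the volume over a right triangle *)

Section RightTriangleIntegrals.
Context {R : realType}.
Local Notation leb := (@lebesgue_measure R).
Implicit Types (a b c s t u k q m al : R).

Lemma measurable_set_le d (T : measurableType d) (f g : T -> R) :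
  measurable_fun [set: T] f -> measurable_fun [set: T] g ->
  measurable [set t | f t <= g t].
Proof.
move=> mf mg.
have -> : [set t | f t <= g t] = setT `&` (g \- f) @^-1` `[0, +oo[.
  by rewrite setTI; apply/seteqP; split=> x /=; rewrite in_itv /= andbT subr_ge0.
by apply: measurable_funB.
Qed.

Lemma measurable_set_lt d (T : measurableType d) (f g : T -> R) :
  measurable_fun [set: T] f -> measurable_fun [set: T] g ->
  measurable [set t | f t < g t].
Proof.
move=> mf mg.
have -> : [set t | f t < g t] = setT `&` (g \- f) @^-1` `]0, +oo[.
  by rewrite setTI; apply/seteqP; split=> x /=; rewrite in_itv /= andbT subr_gt0.
by apply: measurable_funB.
Qed.

Lemma integral_cubic u k b : 0 < k -> 0 <= b -> k * b ^+ 2 = 1 ->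
  (\int[leb]_(c in `[0%R, b]) (u * (c - k * c ^+ 3))%:E = (u / (4 * k))%:E)%E.
Proof.
move=> k0 b0 kb.
have hd c : 0 <= c <= b -> is_derive c 1 (fun c => u * (c ^+ 2 / 2 - k * (c ^+ 4 / 4))) (u * (c - k * c ^+ 3)).
  move=> _.
  have h2 : is_derive c 1 (fun c : R => c ^+ 2) (2 * c).
    by apply: is_derive_eq; rewrite /GRing.scale /=; ring.
  have h4 : is_derive c 1 (fun c : R => c ^+ 4) (4 * c ^+ 3).
    by apply: is_derive_eq; rewrite /GRing.scale /=; ring.
  have e : (fun c : R => u * (c ^+ 2 / 2 - k * (c ^+ 4 / 4))) =
    (u / 2) \*: (fun c : R => c ^+ 2) - (u * k / 4) \*: (fun c : R => c ^+ 4).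
    by apply/funext => x; rewrite !fctE /= /GRing.scale /=; field.
  rewrite e.
  have h := is_deriveB (is_deriveZ (u / 2) h2) (is_deriveZ (u * k / 4) h4).
  by apply: (is_derive_eq h); rewrite /GRing.scale /=; field.
have hc c : 0 <= c <= b -> {for c, continuous (fun c : R => u * (c - k * c ^+ 3))}.
  move=> _; apply: continuousM; first exact: cst_continuous.
  apply: continuousB; first exact: cvg_id.
  by apply: continuousM; [exact: cst_continuous|exact: exprn_continuous].
rewrite (FTC2_closed b0 hd hc); congr (_%:E).
have -> : b ^+ 4 = b ^+ 2 * b ^+ 2 by ring.
have -> : b ^+ 2 = k^-1 by rewrite -[RHS]mulr1 -kb mulKf // gt_eqF.
by field; rewrite gt_eqF.
Qed.

Lemma integral_u q m : 0 < q -> 0 <= m -> m ^+ 2 * q < 1 ->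
  (\int[leb]_(u in `[0%R, m]) (u / (4 * (1 - u ^+ 2 * q)))%:E =
   (- ln (1 - m ^+ 2 * q) / (8 * q))%:E)%E.
Proof.
move=> q0 m0 mq.
have pos u : 0 <= u <= m -> 0 < 1 - u ^+ 2 * q.
    move=> /andP[u0 um]; have : u ^+ 2 <= m ^+ 2 by rewrite ler_sqr ?nnegrE.
    by nra.
have hd u : 0 <= u <= m -> is_derive u 1 (fun u => - (8 * q)^-1 * ln (1 - u ^+ 2 * q))
    (u / (4 * (1 - u ^+ 2 * q))).
  move=> /pos p.
  have h2 : is_derive u 1 (fun u : R => 1 - u ^+ 2 * q) (- (2 * u * q)).
    have e : (fun u : R => 1 - u ^+ 2 * q) = cst 1 - q \*: (fun u : R => u ^+ 2).
      by apply/funext => x; rewrite !fctE /= /GRing.scale /=; ring.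
    have h3 : is_derive u 1 (fun c : R => c ^+ 2) (2 * u).
      by apply: is_derive_eq; rewrite /GRing.scale /=; ring.
    have h := is_deriveB (is_derive_cst (1 : R) u 1) (is_deriveZ q h3).
    rewrite e; apply: (is_derive_eq h).
    by rewrite /GRing.scale /=; ring.
  have h := is_deriveZ (- (8 * q)^-1) (is_derive1_comp (g := fun u => 1 - u ^+ 2 * q) (is_derive1_ln p) h2).
  apply: (is_derive_eq h); rewrite /GRing.scale /=; field.
  by rewrite !gt_eqF.
have hc u : 0 <= u <= m -> {for u, continuous (fun u : R => u / (4 * (1 - u ^+ 2 * q)))}.
  move=> /pos p; apply: continuousM; first exact: cvg_id.
  apply: continuousV; first by rewrite mulf_neq0 // gt_eqF.
  apply: continuousM; first exact: cst_continuous.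
  apply: continuousB; first exact: cst_continuous.
  by apply: continuousM; [exact: exprn_continuous|exact: cst_continuous].
rewrite (FTC2_closed m0 hd hc); congr (_%:E).
by rewrite expr0n /= mul0r subr0 ln1; field; rewrite gt_eqF.
Qed.

(** What remains of the measure of the cone over a right triangle after integrating out a, c and u =
    x / c; the last variable is s = y / x. *)
Definition tri_density (al s : R) : R := - ln (1 - cos al ^+ 2 * (1 + s ^+ 2)) / (8 * (1 + s ^+ 2)).

(** The same density in the angle t with s = tan t, Jacobian included. *)
Definition tri_angular (al t : R) : R :=
  (2 * lsin (pi / 2 - t) - lsin (al - t) - lsin (t + al)) / 8.

(** 1 - cos^2 al / cos^2 t = sin(al - t) sin(al + t) / cos^2 t. The logarithm of the right side is a
    combination of values of [lsin], in which the factors 2 cancel. *)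
Lemma tri_angularE al t : 0 <= t -> t < al -> al < pi / 2 ->
  tri_angular al t = tri_density al (tan t) * (cos t ^- 2).
Proof.
move=> t0 ta ap; have p2 := @pi_ge2 R.
have ct : 0 < cos t by apply: cos_gt0_pihalf; lra.
have ct0 : cos t != 0 by rewrite gt_eqF.
have sm : 0 < sin (al - t) by apply: sin_gt0_pi; lra.
have sp : 0 < sin (t + al) by apply: sin_gt0_pi; lra.
have key : 1 - cos al ^+ 2 * (1 + tan t ^+ 2) = sin (al - t) * sin (t + al) / cos t ^+ 2.
  rewrite -cos2_tan2 // sinB sinD.
  have e1 := cos2Dsin2 al; have e2 := cos2Dsin2 t.
  have e3 : (sin al * cos t - cos al * sin t) * (sin t * cos al + cos t * sin al) =
    cos t ^+ 2 - cos al ^+ 2.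
    have -> : (sin al * cos t - cos al * sin t) * (sin t * cos al + cos t * sin al) =
      sin al ^+ 2 * cos t ^+ 2 - cos al ^+ 2 * sin t ^+ 2 by ring.
    rewrite !sin2cos2; ring.
  by rewrite e3; field.
rewrite /tri_density key -cos2_tan2 // /tri_angular.
have sph : sin (pi / 2 - t) = cos t by rewrite sinB sin_pihalf cos_pihalf; ring.
rewrite /lsin sph !gtr0_norm ?mulr_gt0 //.
rewrite ln_div ?posrE ?mulr_gt0 ?exprn_gt0 // lnM ?posrE // lnXn // mulr2n.
rewrite !lnM ?posrE //.
by field; rewrite ct0.
Qed.

Lemma tri_density_ge0 al s : 0 < al < pi / 2 -> 0 <= s -> s < tan al -> 0 <= tri_density al s.
Proof.
move=> /andP[a0 ap] s0 st.
have ca : 0 < cos al by apply: cos_gt0_pihalf; lra.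
rewrite /tri_density divr_ge0 //; last by apply: mulr_ge0 => //; nra.
rewrite oppr_ge0 ln_le0 //.
have : 0 <= cos al ^+ 2 * (1 + s ^+ 2) by rewrite mulr_ge0 ?sqr_ge0 //; nra.
by lra.
Qed.

Lemma tri_density_arg al s : 0 < al < pi / 2 -> 0 <= s -> s < tan al ->
  cos al ^+ 2 * (1 + s ^+ 2) < 1.
Proof.
move=> /andP[a0 ap] s0 st.
have ca : 0 < cos al by apply: cos_gt0_pihalf; lra.
have e : cos al ^+ 2 * (1 + tan al ^+ 2) = 1.
  by rewrite -cos2_tan2 ?gt_eqF // mulfV // expf_neq0 // gt_eqF.
have c2 : 0 < cos al ^+ 2 by rewrite exprn_gt0.
by rewrite -[X in _ < X]e ltr_pM2l // ltrD2l ltr_sqr ?nnegrE //; lra.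
Qed.

Lemma continuous_tri_density al s : 0 < al < pi / 2 -> 0 <= s -> s < tan al ->
  {for s, continuous (tri_density al)}.
Proof.
move=> h s0 st; have p := tri_density_arg h s0 st.
have c1 : {for s, continuous (fun s : R => 1 + s ^+ 2)}.
  by apply: continuousD; [exact: cst_continuous|exact: exprn_continuous].
apply: continuousM; last first.
  apply: continuousV; first by rewrite mulf_neq0 // gt_eqF //; nra.
  by apply: continuousM => //; exact: cst_continuous.
apply: continuousN.
apply: (@continuous_comp _ _ _ (fun s : R => 1 - cos al ^+ 2 * (1 + s ^+ 2)) (@ln R)).
  apply: continuousB; first exact: cst_continuous.
  by apply: continuousM => //; exact: cst_continuous.
by apply: continuous_ln; rewrite subr_gt0.
Qed.

Lemma tan_gt0_lt a b : 0 <= a -> a < b -> b < pi / 2 -> 0 <= tan a < tan b.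
Proof.
move=> a0 ab bp; have p0 := @pi_ge2 R.
rewrite ltr_tan ?in_itv /= ?ab ?andbT; try by apply/andP; split; lra.
move: a0; rewrite le_eqVlt => /orP[/eqP <-|a0]; first by rewrite tan0.
by rewrite -(@tan0 R) ltW // ltr_tan ?in_itv //=; apply/andP; split; lra.
Qed.

End RightTriangleIntegrals.

(** * Measure of the cone over a right triangle *)

Section RightTriangleMeasure.
Context {R : realType}.
Local Notation leb := (@lebesgue_measure R).
Local Notation RR := (measurableTypeR R).
Implicit Types (a b c s t u al : R).

(** In the upper half-space the form is the point over z = (x + iy) / c at height sqrt(det) / c, and
    [fc B <= fa B] puts it on or above the unit hemisphere. The base is the right triangle with
    vertices 0, cos al and e^(i al), the standard piece in the subdivision of an ideal
    tetrahedron. *)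
Definition right_cone (al : R) : set (@form R) :=
  [set B | [/\ 0 < fc B, fc B <= fa B, fdet B <= 1,
     0 < fx B <= fc B * cos al & 0 <= fy B <= fx B * tan al]].

(* The image of right_cone under (a, c, x, y) |-> (a, c, x / c, y / x). *)
Definition right_cone' (al : R) : set (@form R) :=
  [set B | [/\ 0 < fc B, fc B <= fa B,
     fa B * fc B - fc B ^+ 2 * fx B ^+ 2 * (1 + fy B ^+ 2) <= 1,
     0 < fx B <= cos al & 0 <= fy B <= tan al]].

Lemma measurable_right_cone al : measurable (right_cone al).
Proof.
have -> : right_cone al = [set B | 0 < fc B] `&` [set B | fc B <= fa B] `&`
    [set B | fdet B <= 1] `&` [set B | 0 < fx B] `&` [set B | fx B <= fc B * cos al] `&`
    [set B | 0 <= fy B] `&` [set B | fy B <= fx B * tan al].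
  apply/seteqP; split=> B.
    by move=> [h1 h2 h3 /andP[h4 h5] /andP[h6 h7]].
  by move=> [[[[[[h1 h2] h3] h4] h5] h6] h7]; split=> //; apply/andP.
have ma := @measurable_fa R; have mc := @measurable_fc R.
have mx := @measurable_fx R; have my := @measurable_fy R; have md := @measurable_fdet R.
repeat apply: measurableI; first [apply: measurable_set_lt|apply: measurable_set_le] => //;
  by apply: measurable_funM.
Qed.

Lemma measurable_right_cone' al : measurable (right_cone' al).
Proof.
have -> : right_cone' al = [set B | 0 < fc B] `&` [set B | fc B <= fa B] `&`
    [set B | fa B * fc B - fc B ^+ 2 * fx B ^+ 2 * (1 + fy B ^+ 2) <= 1] `&`
    [set B | 0 < fx B] `&` [set B | fx B <= cos al] `&`
    [set B | 0 <= fy B] `&` [set B | fy B <= tan al].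
  apply/seteqP; split=> B.
    by move=> [h1 h2 h3 /andP[h4 h5] /andP[h6 h7]].
  by move=> [[[[[[h1 h2] h3] h4] h5] h6] h7]; split=> //; apply/andP.
have ma := @measurable_fa R; have mc := @measurable_fc R.
have mx := @measurable_fx R; have my := @measurable_fy R.
have mF : measurable_fun [set: @form R] (fun B : @form R => fa B * fc B - fc B ^+ 2 * fx B ^+ 2 * (1 + fy B ^+ 2)).
  apply: measurable_funB; first exact: measurable_funM.
  apply: measurable_funM; first by apply: measurable_funM; exact: measurable_funX.
  by apply: measurable_funD => //; exact: measurable_funX.
by repeat apply: measurableI; first [apply: measurable_set_lt|apply: measurable_set_le] => //.
Qed.

Lemma right_cone_subst al a c u s : 0 < c -> 0 < u ->
  right_cone al (Form a c (c * u) (c * u * s)) <-> right_cone' al (Form a c u s).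
Proof.
move=> c0 u0; rewrite /right_cone /right_cone' /= /fdet /fa /fc /fx /fy /=.
have e1 : a * c - (c * u) ^+ 2 - (c * u * s) ^+ 2 = a * c - c ^+ 2 * u ^+ 2 * (1 + s ^+ 2) by ring.
rewrite e1 (pmulr_rgt0 _ c0) (ler_pM2l c0) (pmulr_rge0 _ (mulr_gt0 c0 u0)).
by rewrite (ler_pM2l (mulr_gt0 c0 u0)).
Qed.

Local Open Scope ereal_scope.

(** The weight c^2 |u| is the Jacobian of x = c u, y = c u s; the absolute value keeps it
    nonnegative everywhere. *)
Definition right_density (al : R) (B : @form R) : \bar R :=
  ((fc B ^+ 2 * `|fx B|) * \1_(right_cone' al) B)%R%:E.

Lemma right_density_ge0 al B : 0 <= right_density al B.
Proof. by rewrite lee_fin mulr_ge0 // mulr_ge0 // sqr_ge0. Qed.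

Lemma measurable_right_density al : measurable_fun [set: @form R] (right_density al).
Proof.
apply/measurable_EFinP; apply: measurable_funM.
  apply: measurable_funM; first by apply: measurable_funX; exact: measurable_fc.
  by apply: measurableT_comp => //; exact: measurable_fx.
by apply: measurable_indic; exact: measurable_right_cone'.
Qed.

Lemma integral_indicator_scale d (T : measurableType d) (m : {measure set T -> \bar R})
    (A : set T) (k : R) : measurable A -> (0 <= k)%R ->
  \int[m]_x (k * \1_A x)%R%:E = k%:E * m A.
Proof.
move=> mA k0.
under eq_integral do rewrite EFinM.
rewrite ge0_integralZl_EFin //.
  by rewrite integral_indic // setIT.
by apply/measurable_EFinP; exact: measurable_indic.
Qed.

(** At fixed a and c, first x is rescaled by c, then y by x = c u. *)
Lemma leb2_section al (p : (RR * RR)%type) :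
  leb2 (xsection (right_cone al) p) = \int[leb2]_q right_density al (p, q).
Proof.
have mS := measurable_right_cone al; have mS' := measurable_right_cone' al.
case: p => a c.
have mX : measurable (xsection (right_cone al) (a, c)) by exact: measurable_xsection.
rewrite -[RHS]/(\int[leb \x leb]_q right_density al ((a, c), q)).
rewrite fubini_tonelli1; last 2 first.
- apply: (measurableT_comp (measurable_right_density al)).
  by apply: measurable_fun_pair.
- by move=> x; exact: right_density_ge0.
rewrite -[LHS]/(\int[leb]_x leb (xsection (xsection (right_cone al) (a, c)) x)).
have [c0|c0] := leP c 0%R.
  rewrite !integral0_eq //.
    move=> x _; rewrite /fubini_F; apply: integral0_eq => y _.
    rewrite /right_density indicE memNset ?mulr0 //.
    by move=> [] /=; rewrite /fc /= => h; rewrite ltNge c0 in h.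
  move=> x _; rewrite [X in leb X](_ : _ = set0) ?measure0 //.
  apply/seteqP; split=> // y /xsectionP/xsectionP [] /=.
  by rewrite /fc /= => h; rewrite ltNge c0 in h.
rewrite (@ge0_integral_scale R c setT) //; last first.
  exact: measurable_fun_xsection.
rewrite preimage_setT -ge0_integralZl_EFin //; last 2 first.
- have mcu : measurable_fun [set: RR] (fun u : RR => (c : R) * u : RR)%R by apply: measurable_funM.
  exact: (measurableT_comp (measurable_fun_xsection leb mX) mcu).
- exact: ltW.
apply: eq_integral => u _; rewrite /fubini_F /=.
have mXX x : measurable (xsection (xsection (right_cone al) (a, c)) x) by exact: measurable_xsection.
have [u0|u0] := leP u 0%R.
  rewrite [X in leb X](_ : _ = set0) ?measure0 ?mule0; last first.
    apply/seteqP; split=> // y /xsectionP/xsectionP [_ _ _ /=].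
    by rewrite /fx /= => /andP[h _]; rewrite ltNge mulr_ge0_le0 // ltW in h.
  apply/esym/integral0_eq => y _; rewrite /right_density indicE memNset ?mulr0 //.
  by move=> [_ _ _]; rewrite /fx /= => /andP[h _]; rewrite ltNge u0 in h.
have cu0 : (0 < c * u)%R by rewrite mulr_gt0.
rewrite (lebesgue_measure_scale cu0) //.
set A := (X in leb X).
have e : A = [set s | right_cone' al (Form a c u s)].
  apply/seteqP; split=> s; rewrite /A /=.
    by move=> /xsectionP/xsectionP h; apply/(right_cone_subst al a s c0 u0).
  by move=> h; apply/xsectionP/xsectionP; apply/(right_cone_subst al a s c0 u0).
have mA : measurable A.
  by rewrite /A -[X in measurable X]setTI; apply: measurable_funM => //; exact: mXX.
rewrite muleA -EFinM.
rewrite -(@integral_indicator_scale _ _ leb A _ mA); last by rewrite !mulr_ge0 // ltW.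
apply: eq_integral => s _; rewrite /right_density /= /fc /fx /=.
congr (_%:E); congr (_ * _)%R; first by rewrite gtr0_norm //; ring.
by rewrite !indicE e; congr (_%:R); rewrite !mem_setE.
Qed.

(** With w = u^2 (1 + s^2) and k = 1 - w, the conditions c <= a and det <= 1 leave for a an interval
    of length (1 - k c^2) / c, nonempty for c <= k^(-1/2). Weighted by c^2 u, this leaves the
    integral of u (c - k c^3). *)
Lemma integral_density_ac al u s : (0 < al < pi / 2)%R -> (0 < u <= cos al)%R ->
    (0 <= s)%R -> (s < tan al)%R ->
  \int[leb2]_p right_density al (p, (u : RR, s : RR)) =
  (u / (4 * (1 - u ^+ 2 * (1 + s ^+ 2))))%:E.
Proof.
move=> hal /andP[u0 uc] s0 st.
have kk := tri_density_arg hal s0 st.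
set k := (1 - u ^+ 2 * (1 + s ^+ 2))%R.
have k0 : (0 < k)%R.
  rewrite subr_gt0 (le_lt_trans _ kk) // ler_wpM2r //; first by rewrite addr_ge0 ?sqr_ge0.
  have ca0 := lt_le_trans u0 uc.
  by rewrite ler_sqr ?nnegrE ?(ltW u0) ?(ltW ca0).
pose b := (Num.sqrt k)^-1%R.
have b0 : (0 < b)%R by rewrite invr_gt0 sqrtr_gt0.
have kb : (k * b ^+ 2 = 1)%R by rewrite exprVn sqr_sqrtr ?ltW // mulfV // gt_eqF.
rewrite -(integral_cubic u k0 (ltW b0) kb).
rewrite -[LHS]/(\int[leb \x leb]_p right_density al (p, (u : RR, s : RR))).
rewrite fubini_tonelli2; last 2 first.
- apply: (measurableT_comp (measurable_right_density al)).
  by apply: measurable_fun_pair.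
- by move=> x; exact: right_density_ge0.
rewrite [RHS]integral_mkcond; apply: eq_integral => c _; rewrite /fubini_G patchE.
have z : (forall a, ~ right_cone' al (Form a c u s)) ->
    \int[leb]_a right_density al ((a, c), (u : RR, s : RR)) = 0.
  move=> h; apply: integral0_eq => a _; rewrite /right_density indicE memNset ?mulr0 //.
  exact: h.
case: ifPn => [|cb]; last first.
  apply: z => a [] /=; rewrite /fa /fc /fx /fy /= => c0 ca h _ _.
  move: cb; rewrite notin_setE /= in_itv /= => /negP; rewrite negb_and -!ltNge => /orP[|bc].
    by rewrite ltNge ltW.
  have : (1 < k * c ^+ 2)%R.
    rewrite -kb ltr_pM2l // ltr_sqr ?nnegrE // ltW //.
  have : (c * c <= a * c)%R by rewrite ler_pM2r.
  by rewrite /k; nra.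
rewrite inE /= in_itv /= => /andP[c0 cb].
move: c0; rewrite le_eqVlt => /orP[/eqP c0|c0].
  rewrite z; first by rewrite -c0 expr0n /= mulr0 subr0 mulr0.
  by move=> a [] /=; rewrite /fc /= -c0 ltxx.
set w := (u ^+ 2 * (1 + s ^+ 2))%R.
have e a : right_density al ((a, c), (u : RR, s : RR)) =
    ((c ^+ 2 * u) * \1_(`[c, ((1 + c ^+ 2 * w) / c)%R] : set R) a)%R%:E.
  rewrite /right_density /fc /fx /= (gtr0_norm u0); congr (_ * _)%R%:E.
  rewrite !indicE; congr (_%:R); congr nat_of_bool; apply/idP/idP; rewrite !inE /= in_itv /=.
    move=> [] /=; rewrite /fa /fc /fx /fy /= => _ -> h _ _ /=.
    by rewrite ler_pdivlMr //; move: h; rewrite -mulrA -/w; lra.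
  move=> /andP[h1]; rewrite ler_pdivlMr // => h2; split; rewrite /fa /fc /fx /fy //=.
  - by rewrite -mulrA -/w; lra.
  - by rewrite u0 uc.
  - by rewrite s0 ltW.
under eq_integral do rewrite e.
rewrite (@integral_indicator_scale _ _ leb _ (c ^+ 2 * u)%R) //; last by rewrite mulr_ge0 ?sqr_ge0 ?ltW.
have hc : (c <= (1 + c ^+ 2 * w) / c)%R.
  rewrite ler_pdivlMr //.
  have h2 : (c ^+ 2 <= b ^+ 2)%R by rewrite ler_sqr ?nnegrE ?(ltW b0) ?(ltW c0).
  have : (k * c ^+ 2 <= k * b ^+ 2)%R by rewrite ler_pM2l.
  rewrite kb.
  by rewrite /k -/w; nra.
rewrite [X in _ * X]lebesgue_measure_itv /= lte_fin.
have -> : (if (c < (1 + c ^+ 2 * w) / c)%R then ((1 + c ^+ 2 * w) / c)%:E - c%:E else 0)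
   = ((1 + c ^+ 2 * w) / c - c)%:E.
  by move: hc; rewrite le_eqVlt => /orP[/eqP <-|->] //; rewrite ltxx subrr.
by rewrite -EFinM; congr (_%:E); rewrite /k -/w; field; rewrite gt_eqF.
Qed.

Lemma right_density_out al a c u s :
  ~ ((0 < u <= cos al)%R /\ (0 <= s <= tan al)%R) ->
  right_density al ((a, c), (u : RR, s : RR)) = 0.
Proof.
move=> h; rewrite /right_density indicE memNset ?mulr0 //.
by move=> [_ _ _ h1 h2]; apply: h; split.
Qed.

Lemma mu4_right_cone al : (0 < al < pi / 2)%R ->
  mu4 (right_cone al) = \int[leb]_(s in `[0%R, tan al[) (tri_density al s)%:E.
Proof.
move=> hal; have /andP[a0 ap] := hal.
have ca : (0 < cos al)%R by apply: cos_gt0_pihalf; lra.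
rewrite -[LHS]/(\int[leb2]_p leb2 (xsection (right_cone al) p)).
under eq_integral do rewrite leb2_section.
rewrite (@fubini_tonelli _ _ _ _ _ leb2 leb2 (right_density al)); last 2 first.
- exact: measurable_right_density.
- exact: right_density_ge0.
rewrite -[LHS]/(\int[leb \x leb]_q (fubini_G leb2 (right_density al)) q).
have mG : measurable_fun [set: (RR * RR)%type] (fubini_G leb2 (right_density al)).
  by apply: measurable_fun_fubini_tonelli_G; [exact: measurable_right_density|exact: right_density_ge0].
have G0 q : 0 <= fubini_G leb2 (right_density al) q.
  by apply: integral_ge0 => p _; exact: right_density_ge0.
rewrite fubini_tonelli2 //.
set K := fubini_G leb _.
have mK : measurable_fun [set: RR] K by exact: measurable_fun_fubini_tonelli_G.
have K1 s : (0 <= s)%R -> (s < tan al)%R -> K s = (tri_density al s)%:E.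
  move=> s0 st; rewrite /K /fubini_G.
  have q0 : (0 < 1 + s ^+ 2)%R by have := sqr_ge0 s; lra.
  rewrite /tri_density -(integral_u q0 (ltW ca) (tri_density_arg hal s0 st)).
  rewrite [RHS]integral_mkcond; apply: eq_integral => u _; rewrite patchE.
  case: ifPn => [|uc]; last first.
    apply: integral0_eq => -[a c] _; apply: right_density_out => -[/andP[u0 uc'] _].
    by move: uc; rewrite notin_setE /= in_itv /= (ltW u0) uc'.
  rewrite inE /= in_itv /= => /andP[u0 uc].
  move: u0; rewrite le_eqVlt => /orP[/eqP u0|u0]; last by rewrite integral_density_ac // u0 uc.
  rewrite -u0 mul0r; apply: integral0_eq => -[a c] _; apply: right_density_out => -[].
  by rewrite ltxx.
have K2 s : ~ (0 <= s <= tan al)%R -> K s = 0.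
  move=> h; rewrite /K /fubini_G; apply: integral0_eq => u _; apply: integral0_eq => -[a c] _.
  by apply: right_density_out => -[].
have -> : \int[leb]_s K s = \int[leb]_(s in `[0%R, tan al]) K s.
  rewrite [RHS]integral_mkcond; apply: eq_integral => s _; rewrite patchE.
  by case: ifPn => //; rewrite notin_setE /= in_itv /= => /K2.
(* The endpoint s = tan al is dropped: there the logarithm in [tri_density] has argument 0. *)
have mK' : measurable_fun (`]0%R, tan al[ : set R) K by exact: measurable_funTS.
rewrite (@integral_itv_bndoo R 0%R (tan al) K true false mK').
rewrite -(@integral_itv_bndoo R 0%R (tan al) K true true mK').
by apply: eq_integral => s; rewrite inE /= in_itv /= => /andP[s0 st]; exact: K1.
Qed.

End RightTriangleMeasure.

(** * The measure over a right triangle as a value of the Lobachevsky function *)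

Section RightTriangleLobachevsky.
Context {R : realType}.
Local Notation leb := (@lebesgue_measure R).
Implicit Types (a b c s t u al be : R).
Local Open Scope ereal_scope.

(** The two shifted terms add up to the integral of [lsin] over [0, 2 al]; by duplication the total
    is - 2 times the integral over [0, al]. *)
Lemma integral_tri_angular al : (0 < al < pi / 2)%R ->
  \int[leb]_(t in `[0%R, al]) (tri_angular al t)%:E = (Lobachevsky al / 4)%:E.
Proof.
move=> /andP[a0 ap]; have p2 := @pi_ge2 R.
have c : lint 0 (2 * al) = (lint 0 al + lint al (al + al))%R.
  have -> : (2 * al = al + al)%R by ring.
  by apply: lint_cat; lra.
have [e1 i1] := @lint_refl R 0 al (pi / 2) (fun t => lsin (pi / 2 - t)) (ltac:(lra)) (ltac:(lra)) (fun t _ => erefl).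
have [e2 i2] := @lint_refl R 0 al al (fun t => lsin (al - t)) (ltac:(lra)) (ltac:(lra)) (fun t _ => erefl).
have [e3 i3] := @lint_shift R 0 al al (fun t => lsin (t + al)) (ltac:(lra)) (ltac:(lra)) (fun t _ => erefl).
have mi := @measurable_itv R (Interval (BLeft 0%R) (BRight al)).
have i1' : leb.-integrable `[0%R, al] (EFin \o (fun t => 2 * lsin (pi / 2 - t))%R).
  by have := @integrableZl _ _ _ leb _ mi 2 _ i1; apply: eq_integrable.
have i12 : leb.-integrable `[0%R, al] (EFin \o (fun t => 2 * lsin (pi / 2 - t) - lsin (al - t))%R).
  by have := @integrableB _ _ _ leb _ mi _ _ i1' i2; apply: eq_integrable.
have i123 : leb.-integrable `[0%R, al] (EFin \o (fun t => 2 * lsin (pi / 2 - t) - lsin (al - t) - lsin (t + al))%R).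
  by have := @integrableB _ _ _ leb _ mi _ _ i12 i3; apply: eq_integrable.
have iT : leb.-integrable `[0%R, al] (EFin \o (fun t => 8^-1 * (2 * lsin (pi / 2 - t) - lsin (al - t) - lsin (t + al)))%R).
  by have := @integrableZl _ _ _ leb _ mi 8^-1%R _ i123; apply: eq_integrable.
have -> : \int[leb]_(t in `[0%R, al]) (tri_angular al t)%:E =
   (Rintegral leb `[0%R, al] (fun t => 8^-1 * (2 * lsin (pi / 2 - t) - lsin (al - t) - lsin (t + al)))%R)%:E.
  rewrite /Rintegral fineK.
    by apply: eq_integral => t _; rewrite /tri_angular mulrC.
  by have := @integrable_fin_num _ _ _ leb _ mi _ iT; apply.
rewrite (@RintegralZl _ _ _ leb _ _ 8^-1%R mi i123).
rewrite (@RintegralB _ _ _ leb _ _ _ mi i12 i3) (@RintegralB _ _ _ leb _ _ _ mi i1' i2).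
rewrite (@RintegralZl _ _ _ leb _ _ 2%R mi i1) e1 e2 e3.
have d := @lint_dup R al (ltac:(lra)).
rewrite !subr0 subrr add0r.
rewrite LobachevskyE; congr (_%:E); rewrite c in d; lra.
Qed.

(** The substitution s = tan t. The upper end stays below [tan al], where the density is continuous;
    the rest of [0, al] only adds a nonnegative amount. *)
Lemma integral_tri_density_le al be : (0 <= be)%R -> (be < al)%R -> (al < pi / 2)%R ->
  \int[leb]_(s in `[0%R, tan be]) (tri_density al s)%:E <= (Lobachevsky al / 4)%:E.
Proof.
move=> b0 ba ap; have p2 := @pi_ge2 R.
have a0 : (0 < al)%R by lra.
have hal : (0 < al < pi / 2)%R by rewrite a0.
have cp t : (0 <= t)%R -> (t <= be)%R -> cos t != 0%R.
  by move=> t0 tb; rewrite gt_eqF // cos_gt0_pihalf //; lra.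
have tl t : (0 <= t)%R -> (t <= be)%R -> (0 <= tan t < tan al)%R.
  by move=> t0 tb; apply: tan_gt0_lt => //; lra.
have d1 t : (0 <= t)%R -> (t <= be)%R -> ((@tan R)^`()%classic t = cos t ^- 2)%R.
  by move=> t0 tb; rewrite derive1E; have := is_derive_tan (cp t t0 tb) => ?; rewrite derive_val.
have cc t : (0 <= t)%R -> (t <= be)%R -> {for t, continuous (fun t : R => cos t ^- 2)%R}.
  move=> t0 tb; apply: (@continuousV _ _ (fun t : R => cos t ^+ 2)%R); first by rewrite expf_neq0 // cp.
  apply: (@continuous_comp _ _ _ (@cos R) (fun x : R => x ^+ 2)%R); first exact: continuous_cos.
  exact: exprn_continuous.
have cd t : (0 <= t)%R -> (t <= be)%R -> {for t, continuous (@tan R)^`()%classic}.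
  move=> t0 tb; have ct : (0 < cos t)%R by rewrite lt_def cp //= cos_ge0_pihalf //; lra.
  suff : (@tan R)^`()%classic x @[x --> t] --> (cos t ^- 2)%R by rewrite -d1.
  apply: cvg_trans (cc t t0 tb); apply: near_eq_cvg.
  have nc : \forall x \near t, (0 < cos x)%R by apply: (cvgr_gt _ (@continuous_cos R t)).
  near=> x; have cx : (0 < cos x)%R by near: x.
  by rewrite derive1E; have := is_derive_tan (lt0r_neq0 cx) => ?; rewrite derive_val.
rewrite -(@tan0 R).
rewrite (@integration_by_substitution_increasing R tan (tri_density al) 0%R be b0).
- apply: (@le_trans _ _ (\int[leb]_(t in `[0%R, be]) (tri_angular al t)%:E)).
    rewrite le_eqVlt; apply/orP; left; apply/eqP; apply: eq_integral => t.
    rewrite inE /= in_itv /= => /andP[t0 tb].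
    by rewrite (tri_angularE t0 (le_lt_trans tb ba) ap) -(d1 t t0 tb).
  have ae t : (0 <= t)%R -> (t < al)%R -> (0 <= tri_angular al t)%R.
    move=> t0 ta; rewrite tri_angularE //; apply: mulr_ge0.
      by apply: tri_density_ge0 => //; have /andP[] := tan_gt0_lt t0 ta ap.
    by rewrite invr_ge0 sqr_ge0.
  have mT : measurable_fun [set: R] (fun t => (tri_angular al t)%:E).
    apply/measurable_EFinP; apply: measurable_funM => //.
    have ml (f : R -> R) : measurable_fun [set: R] f -> measurable_fun [set: R] (fun t => lsin (f t)).
      by move=> mf; exact: (measurableT_comp (@measurable_lsin R) mf).
    apply: measurable_funB; first apply: measurable_funB.
    + by apply: measurable_funM => //; apply: ml; apply: measurable_funB.
    + by apply: ml; apply: measurable_funB.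
    + by apply: ml; apply: measurable_funD.
  rewrite -(integral_tri_angular hal).
  have mT' : measurable_fun (`]0%R, al[ : set R) (fun t => (tri_angular al t)%:E) by exact: measurable_funTS.
  rewrite (@integral_itv_bndoo R 0%R al _ true false mT') -(@integral_itv_bndoo R 0%R al _ true true mT').
  apply: ge0_subset_integral => //.
  + exact: measurable_funTS.
  + by move=> t; rewrite /= in_itv /= => /andP[t0 ta]; rewrite lee_fin ae.
  + by move=> t; rewrite /= !in_itv /= => /andP[-> tb]; rewrite (le_lt_trans tb).
- move=> x y; rewrite !in_itv /= => /andP[x0 xb] /andP[y0 yb] xy.
  by rewrite ltr_tan ?in_itv //=; apply/andP; split; lra.
- by move=> x; rewrite in_itv /= => /andP[x0 xb]; apply: cd; rewrite ltW.
- apply/cvg_ex; eexists; apply: cvg_at_right_filter; exact: (cd 0%R).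
- apply/cvg_ex; eexists; apply: cvg_at_left_filter; exact: (cd be).
- split.
  + move=> x; rewrite in_itv /= => /andP[x0 xb].
    by have [] := is_derive_tan (cp x (ltW x0) (ltW xb)).
  + by apply: cvg_at_right_filter; apply: continuous_tan; apply: cp.
  + by apply: cvg_at_left_filter; apply: continuous_tan; apply: cp.
- apply: continuous_in_subspaceT => s; rewrite inE /= in_itv /= tan0 => /andP[s0 sb].
  by apply: continuous_tri_density => //; apply: le_lt_trans sb _; have /andP[] := tl be b0 (lexx _).
Unshelve. all: by end_near.
Qed.

Lemma tan_le (x y : R) : (- (pi / 2) < x)%R -> (x <= y)%R -> (y < pi / 2)%R -> (tan x <= tan y)%R.
Proof.
rewrite [(x <= y)%R]le_eqVlt => x1 /orP[/eqP -> //|xy] y2; apply: ltW.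
by rewrite ltr_tan ?in_itv //=; apply/andP; split; lra.
Qed.

(** The angles al - al / (n + 1) exhaust the half-open range. *)
Lemma mu4_right_cone_le al : (0 < al < pi / 2)%R ->
  mu4 (right_cone al) <= (Lobachevsky al / 4)%:E.
Proof.
move=> hal; have /andP[a0 ap] := hal; have p2 := @pi_ge2 R.
rewrite mu4_right_cone //.
pose F (n : nat) : set R := `[0%R, tan (al - al / n.+1%:R)].
have bn (n : nat) : (0 <= al - al / n.+1%:R < al)%R.
  have : (0 < al / n.+1%:R)%R by rewrite divr_gt0 ?ltr0n.
  have : (al / n.+1%:R <= al)%R by rewrite ler_pdivrMr ?ltr0n // ler_peMr ?ler1n // ltW.
  by move: (al / n.+1%:R)%R => x h1 h2; apply/andP; split; lra.
have -> : `[0%R, tan al[%classic = \bigcup_n F n.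
  apply/seteqP; split=> s; last first.
    move=> [n _]; rewrite /F /= !in_itv /= => /andP[-> h]; have /andP[b0 ba] := bn n.
    by have /andP[_ h2] := tan_gt0_lt b0 ba ap; rewrite (le_lt_trans h h2).
  rewrite /= in_itv /= => /andP[s0 st].
  have at1 : (0 <= atan s)%R by rewrite -(@atan0 R); apply: le_atan.
  have at2 := atan_ltpi2 s.
  have at3 : (atan s < al)%R.
    by rewrite -(tanK (x := al)) ?lt_atan // in_itv /=; apply/andP; split; lra.
  have d0 : (0 < al - atan s)%R by lra.
  exists (Num.trunc (al / (al - atan s))) => //.
  rewrite /F /= in_itv /= s0 /=.
  set n := Num.trunc _.
  have h : (atan s <= al - al / n.+1%:R)%R.
    by rewrite lerBrDr -lerBrDl ler_pdivrMr ?ltr0n // -ler_pdivrMl // mulrC ltW // truncnS_gt.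
  have /andP[b0 ba] := bn n.
  rewrite -[X in (X <= _)%R](atanK s).
  apply: tan_le => //; first by lra.
  exact: lt_trans ap.
apply: ge0_integral_le_exhaust.
- move=> n m nm; apply/subsetPset => s; rewrite /F /= !in_itv /= => /andP[-> h] /=.
  apply: le_trans h _; have /andP[b0 ba] := bn n; have /andP[b0' ba'] := bn m.
  have : (al - al / n.+1%:R <= al - al / m.+1%:R)%R.
    by rewrite lerD2l lerN2 ler_pM2l // lef_pV2 ?posrE ?ltr0n // ler_nat ltnS.
  move=> h; apply: tan_le => //; first by apply: lt_le_trans b0; lra.
  exact: lt_trans ap.
- by move=> n; exact: measurable_itv.
- move=> n; apply/measurable_EFinP; apply: measurable_funTS.
  have m1 : measurable_fun [set: R] (fun s : R => 1 + s ^+ 2)%R.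
    by apply: measurable_funD => //; exact: measurable_funX.
  apply: measurable_funM.
    apply: measurableT_comp; first exact: oppr_measurable.
    apply: (measurableT_comp (@measurable_ln R)).
    by apply: measurable_funB => //; apply: measurable_funM.
  apply: continuous_measurable_fun => s; apply: (@continuousV _ _ (fun s : R => 8 * (1 + s ^+ 2))%R).
    by rewrite mulf_neq0 // gt_eqF //; have := sqr_ge0 s; lra.
  apply: continuousM; first exact: cst_continuous.
  by apply: continuousD; [exact: cst_continuous|exact: exprn_continuous].
- move=> n s; rewrite /F /= in_itv /= => /andP[s0 st]; rewrite lee_fin.
  apply: tri_density_ge0 => //; apply: le_lt_trans st _.
  by have /andP[b0 ba] := bn n; have /andP[] := tan_gt0_lt b0 ba ap.
- by move=> n; have /andP[b0 ba] := bn n; exact: integral_tri_density_le.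
Qed.

End RightTriangleLobachevsky.

(** * Outer measure bounds; isosceles triangles and sectors *)

Section CoveredSets.
Context {R : realType}.
Local Notation C := R[i].
Local Open Scope ereal_scope.

(* Bounds the outer measure, as the sets at hand need not be measurable. *)
Definition covered (S : set (@form R)) (b : R) : Prop :=
  exists D, [/\ measurable D, S `<=` D & mu4 D <= b%:E].

Lemma covered_sub (S T : set (@form R)) b : S `<=` T -> covered T b -> covered S b.
Proof. by move=> ST [D [mD TD Db]]; exists D; split=> //; apply: subset_trans ST TD. Qed.

Lemma covered_le (S : set (@form R)) b b' : (b <= b')%R -> covered S b -> covered S b'.
Proof.
by move=> bb [D [mD TD Db]]; exists D; split=> //; apply: le_trans Db _; rewrite lee_fin.
Qed.

Lemma coveredU (S T : set (@form R)) b b' :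
  covered S b -> covered T b' -> covered (S `|` T) (b + b').
Proof.
move=> [D [mD SD Db]] [D' [mD' TD' Db']]; exists (D `|` D'); split.
- exact: measurableU.
- by move=> x [/SD|/TD']; [left|right].
- by apply: le_trans (measureU2 _ mD mD') _; rewrite EFinD leeD.
Qed.

Lemma covered_set0 : covered set0 0.
Proof. by exists set0; split=> //; rewrite measure0. Qed.

Lemma covered_preserving (f : @form R -> @form R) (S : set (@form R)) b :
  preserving mu4 mu4 f -> covered S b -> covered (f @^-1` S) b.
Proof.
move=> [mf hf] [D [mD SD Db]]; exists (f @^-1` D); split.
- by rewrite -[X in measurable X]setTI; exact: mf.
- by move=> x /SD.
- by rewrite hf.
Qed.

Lemma covered_fx0 : covered [set B | fx B = 0%R] 0.
Proof.
have -> : [set B : @form R | fx B = 0%R] = setT `*` ([set 0%R] `*` setT).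
  apply/seteqP; split=> -[[a c] [x y]] /=; rewrite /fx /=; last by move=> [_ [-> _]].
  by move=> ->.
have m0 : measurable ([set 0%R] : set (measurableTypeR R)) by exact: measurable_set1.
exists (setT `*` ([set 0%R] `*` setT)); split=> //.
  by apply: measurableX => //; apply: measurableX.
rewrite [X in X <= _](product_measure1E leb2 leb2) //; last exact: measurableX.
rewrite [X in _ * X](product_measure1E (@lebesgue_measure R) (@lebesgue_measure R)) //.
rewrite [X in _ * (X * _) <= _](_ : _ = 0); last exact: lebesgue_measure_set1.
by rewrite mul0e mule0.
Qed.

Lemma preserving_conj : preserving mu4 mu4 (fun B : @form R =>
  Form (fa B) (fc B) (fx B) (- fy B)%R).
Proof.
have : preserving (leb2 \x leb2) (leb2 \x leb2) (fun p : @form R =>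
    ((p.1.1, p.1.2), (p.2.1, - (p.2.2 : R) : measurableTypeR R)%R)).
apply: (@preserving_prod _ _ _ _ _ leb2 leb2 (fun p => (p.1, p.2))
   (fun p q => (q.1, - (q.2 : R) : measurableTypeR R)%R)).
- by apply: (@preserving_ext _ _ _ _ _ _ _ idfun) => [[]|] //; split; [exact: measurable_id|].
- move=> p; apply: (@preserving_prod _ _ _ _ _ (@lebesgue_measure R) (@lebesgue_measure R) idfun
     (fun _ y => - (y : R) : measurableTypeR R)%R).
  + exact: preserving_idR.
  + by move=> x; exact: preserving_opp.
  + by apply: measurableT_comp => //; exact: oppr_measurable.
- apply: measurable_fun_pair; first exact: measurable_fx.
  have m : measurable_fun [set: @form R] ((-%R : R -> R) \o (@fy R)).
    by apply: measurableT_comp; [exact: oppr_measurable|exact: measurable_fy].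
  exact: m.
by apply: preserving_ext => -[[a c] [x y]].
Qed.

(** Over the triangle with vertices 0, e^(i al), e^(- i al): two mirror images of the right triangle
    and the null set x = 0 that [right_cone] leaves out. *)
Lemma covered_isosceles (al : R) : (0 < al < pi / 2)%R ->
  covered [set B | [/\ 0 < fc B, fc B <= fa B, fdet B <= 1, 0 <= fx B <= fc B * cos al
    & `|fy B| <= fx B * tan al]%R] (Lobachevsky al / 2).
Proof.
move=> hal.
have c1 : covered (right_cone al) (Lobachevsky al / 4).
  by exists (right_cone al); split=> //; [exact: measurable_right_cone|exact: mu4_right_cone_le].
have c2 := covered_preserving preserving_conj c1.
have := coveredU covered_fx0 (coveredU c1 c2).
have -> : (0 + (Lobachevsky al / 4 + Lobachevsky al / 4) = Lobachevsky al / 2)%R by field.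
apply: covered_sub => B [h1 h2 h3 /andP[h4 h5] h6].
have [x0|x0] := eqVneq (fx B) 0%R; [by left|right].
have xp : (0 < fx B)%R by rewrite lt_def x0.
have [y0|y0] := leP 0%R (fy B); [left|right]; split=> //.
- by rewrite xp.
- by rewrite y0 -(ger0_norm y0).
- by move: h3; rewrite /fdet /fa /fc /fx /fy /= sqrrN.
- by rewrite /fx /= xp.
- by rewrite /fy /fx /= oppr_ge0 ltW //= -(ltr0_norm y0).
Qed.

Local Open Scope ring_scope.

(** Twice the signed area of the triangle 0, z, w. *)
Definition crossC (z w : C) : R := complex.Im (Num.conj z * w).

(** Half of the central angle of two unit vectors. In an inscribed triangle that contains the centre
    it is the angle opposite the side from z to w, a dihedral angle of the ideal tetrahedron
    above. *)
Definition half_angle (z w : C) : R := acos (complex.Re (Num.conj z * w)) / 2.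

Lemma unit_half_angle (z w : C) : normC2 z = 1%R -> normC2 w = 1%R -> (0 < crossC z w)%R ->
  [/\ (0 < half_angle z w < pi / 2)%R, cos (half_angle z w + half_angle z w) = complex.Re (Num.conj z * w)
    & sin (half_angle z w + half_angle z w) = crossC z w].
Proof.
move=> z1 w1 h.
have n1 : (complex.Re (Num.conj z * w) ^+ 2 + crossC z w ^+ 2 = 1)%R.
  by have := normC2M (Num.conj z) w; rewrite normC2_conj z1 w1 mulr1.
have r1 : (-1 < complex.Re (Num.conj z * w) < 1)%R by apply/andP; split; nra.
have /andP[r2 r3] := r1.
have ap : (0 < acos (complex.Re (Num.conj z * w)) < pi)%R.
  by rewrite acos_gt0 ?acos_ltpi ?r2 ?r3 ?(ltW r2) ?(ltW r3).
have /andP[a1 a2] := ap.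
have -> : (half_angle z w + half_angle z w = acos (complex.Re (Num.conj z * w)))%R.
  by rewrite /half_angle; field.
split.
- by rewrite /half_angle; apply/andP; split; lra.
- by rewrite acosK // in_itv /= !ltW.
- rewrite sin_acos ?ltW //.
  have -> : (1 - complex.Re (Num.conj z * w) ^+ 2 = crossC z w ^+ 2)%R by lra.
  by rewrite sqrtr_sqr gtr0_norm.
Qed.

(** The forms over the triangle 0, z, w; s and t are barycentric weights multiplied by c. *)
Definition sector (z w : C) : set (@form R) :=
  [set B | [/\ 0 < fc B, fc B <= fa B & fdet B <= 1]%R /\
    exists s t : R, [/\ 0 <= s, 0 <= t, s + t <= fc B
      & Complex (fx B) (fy B) = rC s * z + rC t * w]%R].

(** A diagonal matrix acts as a rotation about 0 and takes the bisector m of z and w to the positive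
    real axis, which is the isosceles position. *)
Lemma covered_sector (z w : C) : normC2 z = 1%R -> normC2 w = 1%R -> (0 < crossC z w)%R ->
  covered (sector z w) (Lobachevsky (half_angle z w) / 2).
Proof.
move=> z1 w1 h; have [hal c2 s2] := unit_half_angle z1 w1 h.
set al := half_angle z w in hal c2 s2 *.
have /andP[a0 ap] := hal.
have ca : (0 < cos al)%R by apply: cos_gt0_pihalf; have := @pi_ge2 R; lra.
have sa : (0 < sin al)%R by apply: sin_gt0_pi; have := @pi_ge2 R; lra.
pose e : C := Complex (cos al) (sin al).
have e1 : normC2 e = 1%R by rewrite /normC2 /= cos2Dsin2.
have zw : (Num.conj z * w = e * e)%R.
  by apply: complex_ext; rewrite /= -?c2 -?s2 ?cosD ?sinD //; rewrite /crossC in s2; rewrite -s2 sinD; ring.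
pose m := (z * e)%R.
have m1 : normC2 m = 1%R by rewrite normC2M z1 e1 mulr1.
have mz : (Num.conj m * z = Num.conj e)%R.
  by rewrite /m rmorphM /= mulrAC conjM_normC2 z1 rC1 mul1r.
have mw : (Num.conj m * w = e)%R.
  by rewrite /m rmorphM /= mulrAC zw -mulrA [X in e * X]mulrC conjM_normC2 e1 rC1 mulr1.
clearbody m.
have dg : normC2 (\det (mx2 (Num.conj m) 0 0 1)) = 1%R.
  by rewrite mx2_det mulr1 mulr0 subr0 normC2_conj m1.
have := covered_preserving (preserving_act dg) (covered_isosceles hal).
apply: covered_sub => B [[h1 h2 h3]] [s [t [s0 t0 st hB]]].
have hE : act (mx2 (Num.conj m) 0 0 1) B =
    Form (fa B) (fc B) ((s + t) * cos al)%R ((t - s) * sin al)%R.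
  have e2 : (Num.conj m * Complex (fx B) (fy B) = rC s * Num.conj e + rC t * e)%R.
    by rewrite hB mulrDr !mulrA ![(Num.conj m * rC _)%R]mulrC -!mulrA mz mw.
  rewrite /act /herm mx2_conjT !mx2M /coord !mx2_ij !mul0r !addr0 !rmorph1 !rmorph0.
  rewrite !mulr0 !mulr1 !addr0 !add0r !mul1r e2.
  congr Form; rewrite ?reim /=; try ring.
  have := m1; rewrite /normC2 => mm.
  transitivity ((complex.Re m ^+ 2 + complex.Im m ^+ 2) * fa B)%R; first by ring.
  by rewrite mm mul1r.
rewrite /= hE /=; split=> //.
- have := fdet_act (mx2 (Num.conj m) 0 0 1) B; rewrite dg mul1r hE => ->; exact: h3.
- rewrite /fx /fc /=; apply/andP; split; first by apply: mulr_ge0; [exact: addr_ge0|exact: ltW].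
  by rewrite ler_pM2r.
- rewrite /fx /fy /= normrM (gtr0_norm sa).
  have -> : ((s + t) * cos al * tan al = (s + t) * sin al)%R by rewrite /tan; field; rewrite gt_eqF.
  by rewrite ler_pM2r // ler_norml; apply/andP; split; lra.
Qed.

End CoveredSets.

(** * Ideal tetrahedra with one vertex at infinity and three on the unit circle *)

Section IdealSimplex.
Context {R : realType}.
Local Notation C := R[i].
Implicit Types (z w : C) (t s : R).

Definition P1 : set (@form R) := [set B | posform B /\ fdet B <= 1].

(** The cone spanned by the rank-one forms of infinity (coefficient t) and of the points z1, z2, z3
    (coefficients s1, s2, s3). *)
Definition disk_cone z1 z2 z3 : set (@form R) :=
  [set B | P1 B /\ exists t s1 s2 s3 : R, [/\ 0 <= t, 0 <= s1, 0 <= s2, 0 <= s3 &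
    [/\ fa B = t + (s1 + s2 + s3), fc B = s1 + s2 + s3
      & Complex (fx B) (fy B) = rC s1 * z1 + rC s2 * z2 + rC s3 * z3]]].

(** The linear relation between three plane vectors; its coefficients are, up to a common factor,
    the barycentric coordinates of 0. *)
Lemma crossC_sum z1 z2 z3 :
  rC (crossC z2 z3) * z1 + rC (crossC z3 z1) * z2 + rC (crossC z1 z2) * z3 = 0.
Proof. by apply: complex_ext; rewrite /crossC !reim /= ?reim; ring. Qed.

(** A quarter of it bounds a measure from above. *)
Lemma Lobachevsky_pi3_ge0 : 0 <= Lobachevsky (pi / 3) :> R.
Proof.
have p := @pi_ge2 R.
have h : 0 < (pi : R) / 3 < pi / 2 by apply/andP; split; lra.
have := @mu4_right_cone_le R (pi / 3) h.
by move=> /(le_trans (measure_ge0 _ _)); rewrite lee_fin pmulr_lge0.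
Qed.

(** The three rotations compose to the identity, so the sum of the half angles has sine 0; it lies
    strictly between 0 and 3 pi / 2, which leaves pi. *)
Lemma three_half_angles z1 z2 z3 : normC2 z1 = 1 -> normC2 z2 = 1 -> normC2 z3 = 1 ->
  0 < crossC z1 z2 -> 0 < crossC z2 z3 -> 0 < crossC z3 z1 ->
  half_angle z1 z2 + half_angle z2 z3 + half_angle z3 z1 = pi.
Proof.
move=> n1 n2 n3 h12 h23 h31.
have [/andP[a0 ap] ca sa] := unit_half_angle n1 n2 h12.
have [/andP[b0 bp] cb sb] := unit_half_angle n2 n3 h23.
have [/andP[c0 cp] cc sc] := unit_half_angle n3 n1 h31.
move: (half_angle z1 z2) (half_angle z2 z3) (half_angle z3 z1) a0 ap ca sa b0 bp cb sb c0 cp cc sc.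
move=> a b c a0 ap ca sa b0 bp cb sb c0 cp cc sc.
have e : (Num.conj z1 * z2) * (Num.conj z2 * z3) * (Num.conj z3 * z1) = 1.
  transitivity ((Num.conj z1 * z1) * (Num.conj z2 * z2) * (Num.conj z3 * z3)); first by ring.
  by rewrite !conjM_normC2 n1 n2 n3 rC1 !mulr1.
have hc : cos ((a + a) + (b + b) + (c + c)) = 1.
  have := congr1 (@complex.Re R) e; rewrite Re_mul [complex.Re (_ * _ * (_ * _))]Re_mul.
  rewrite [complex.Im (_ * _ * (_ * _))]Im_mul -ca -cb -cc.
  rewrite /crossC in sa sb sc; rewrite -sa -sb -sc => h.
  by rewrite cosD [cos (_ + _ + (_ + _))]cosD [sin (_ + _ + (_ + _))]sinD -[RHS]/(complex.Re (1 : C)) -h; ring.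
have hs : sin (a + b + c) = 0.
  have : cos ((a + b + c) + (a + b + c)) = 1 by rewrite -hc; congr cos; ring.
  rewrite cosD => h; have := cos2Dsin2 (a + b + c) => h2.
  have : sin (a + b + c) ^+ 2 = 0 by nra.
  by move=> /eqP; rewrite sqrf_eq0 => /eqP.
have [h|h|//] := ltgtP (a + b + c) pi.
  have : 0 < sin (a + b + c) by apply: sin_gt0_pi; apply/andP; split; lra.
  by rewrite hs ltxx.
have : 0 < sin (a + b + c - pi) by apply: sin_gt0_pi; apply/andP; split; lra.
by rewrite sinB sinpi cospi hs; lra.
Qed.

Lemma covered_sector_if z w : normC2 z = 1 -> normC2 w = 1 ->
  covered [set B | 0 < crossC z w /\ sector z w B]
    (if 0 < crossC z w then Lobachevsky (half_angle z w) / 2 else 0).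
Proof.
move=> z1 w1; case: ifPn => h.
  by apply: covered_sub (covered_sector z1 w1 h) => B [].
by apply: covered_sub covered_set0 => B [].
Qed.

(** The least of the r_i with p_i > 0, as in a ratio test. *)
Lemma best_ratio (p1 p2 p3 r1 r2 r3 : R) : (0 < p1 -> 0 <= r1) -> (0 < p2 -> 0 <= r2) ->
  (0 < p3 -> 0 <= r3) -> 0 < p1 + p2 + p3 ->
  exists m, [/\ 0 <= m, 0 < p1 -> m <= r1, 0 < p2 -> m <= r2, 0 < p3 -> m <= r3
   & [\/ 0 < p1 /\ m = r1, 0 < p2 /\ m = r2 | 0 < p3 /\ m = r3]].
Proof.
move=> d1 d2 d3 ps.
have D (x : R) : 0 < x \/ x <= 0 by case: (ltP 0 x); [left|right].
have two (p p' r r' : R) : (0 < p -> 0 <= r) -> (0 < p' -> 0 <= r') -> 0 < p \/ 0 < p' ->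
    exists m, [/\ 0 <= m, 0 < p -> m <= r, 0 < p' -> m <= r' & (0 < p /\ m = r) \/ (0 < p' /\ m = r')].
  move=> d d' h; have [hp|hp] := D p; last first.
    have p'0 : 0 < p' by case: h => // hp'; rewrite ltNge hp in hp'.
    by exists r'; split=> //; [exact: d'|rewrite ltNge hp|right].
  have [hp'|hp'] := D p'; last first.
    by exists r; split=> //; [exact: d|rewrite ltNge hp'|left].
  have [q|q] := leP r r'; first by exists r; split=> //; [exact: d|left].
  by exists r'; split=> //; [exact: d'|move=> _; exact: ltW|right].
have [h|h] := D (p1 + p2); last first.
  have p30 : 0 < p3 by lra.
  have [q1|q1] := D p1.
    have [m [m0 m1 m3 hm]] := two p1 p3 r1 r3 d1 d3 (or_introl q1).
    exists m; split=> //; first by move=> ?; lra.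
    by case: hm => ?; [apply: Or31|apply: Or33].
  have [m [m0 m2 m3 hm]] := two p2 p3 r2 r3 d2 d3 (or_intror p30).
  exists m; split=> //; first by rewrite ltNge q1.
  by case: hm => ?; [apply: Or32|apply: Or33].
have h12 : 0 < p1 \/ 0 < p2 by have [q1|q1] := D p1; [left|right; lra].
have [m [m0 m1 m2 hm]] := two p1 p2 r1 r2 d1 d2 h12.
have [q3|q3] := D p3; last first.
  exists m; split=> //; first by rewrite ltNge q3.
  by case: hm => ?; [apply: Or31|apply: Or32].
have [q|q] := leP m r3.
  by exists m; split=> //; case: hm => ?; [apply: Or31|apply: Or32].
exists r3; split=> //; [exact: d3|move=> /m1|move=> /m2|by apply: Or33].
  by apply: le_trans; exact: ltW.
by apply: le_trans; exact: ltW.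
Qed.

(** The triangle is covered by the sectors over its positively oriented sides, even when it does not
    contain 0. If all three sides are positive, the half angles sum to pi and the tangent bound
    applies; otherwise there are at most two sectors, each of measure at most half of the asserted
    bound. *)
Lemma covered_disk_cone_pos z1 z2 z3 : normC2 z1 = 1 -> normC2 z2 = 1 -> normC2 z3 = 1 ->
  0 < crossC z1 z2 + crossC z2 z3 + crossC z3 z1 ->
  covered (disk_cone z1 z2 z3) (3 / 2 * Lobachevsky (pi / 3)).
Proof.
move=> n1 n2 n3 hpos.
have := coveredU (covered_sector_if n1 n2) (coveredU (covered_sector_if n2 n3) (covered_sector_if n3 n1)).
set b := (X in covered _ X) => hcov.
have hb : b <= 3 / 2 * Lobachevsky (pi / 3).
  have L0 := Lobachevsky_pi3_ge0.
  have M z w : normC2 z = 1 -> normC2 w = 1 -> 0 < crossC z w ->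
    Lobachevsky (half_angle z w) / 2 <= 3 / 4 * Lobachevsky (pi / 3).
    by move=> hz hw /(unit_half_angle hz hw)[/Lobachevsky_max]; lra.
  rewrite /b; case: ifPn => h1; case: ifPn => h2; case: ifPn => h3; try lra.
  - have [a1 _ _] := unit_half_angle n1 n2 h1; have [a2 _ _] := unit_half_angle n2 n3 h2.
    have [a3 _ _] := unit_half_angle n3 n1 h3.
    have s := three_half_angles n1 n2 n3 h1 h2 h3.
    have := Lobachevsky_tangent a1; have := Lobachevsky_tangent a2; have := Lobachevsky_tangent a3.
    have : lsin (pi / 3) * (half_angle z1 z2 - pi / 3) + lsin (pi / 3) * (half_angle z2 z3 - pi / 3)
      + lsin (pi / 3) * (half_angle z3 z1 - pi / 3) = 0.
      transitivity (lsin (pi / 3) * (half_angle z1 z2 + half_angle z2 z3 + half_angle z3 z1 - pi)); first by field.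
      by rewrite s subrr mulr0.
    clear; lra.
  - by have := M _ _ n1 n2 h1; have := M _ _ n2 n3 h2; lra.
  - by have := M _ _ n1 n2 h1; have := M _ _ n3 n1 h3; lra.
  - by have := M _ _ n1 n2 h1; lra.
  - by have := M _ _ n2 n3 h2; have := M _ _ n3 n1 h3; lra.
  - by have := M _ _ n2 n3 h2; lra.
  - by have := M _ _ n3 n1 h3; lra.
apply: (covered_le hb); apply: covered_sub hcov => B [hP [t [s1 [s2 [s3 [t0 h1 h2 h3 [ha hc hxy]]]]]]].
have cpos : 0 < fc B by apply: posform_fc; case: hP.
have base : [/\ 0 < fc B, fc B <= fa B & fdet B <= 1] by split=> //; [rewrite ha hc; lra|case: hP].
have csum := crossC_sum z1 z2 z3.
have red (m : R) : Complex (fx B) (fy B) = rC (s1 - m * crossC z2 z3) * z1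
   + rC (s2 - m * crossC z3 z1) * z2 + rC (s3 - m * crossC z1 z2) * z3.
  rewrite hxy -[LHS]subr0 -(mulr0 (rC m)) -csum.
  have E (x y : R) : rC (x - m * y) = rC x - rC m * rC y.
    by apply: complex_ext; rewrite ?reim /=; ring.
  by rewrite !E; ring.
(* The smallest ratio s / (cross product) makes one barycentric coordinate vanish. *)
have main (m : R) : 0 <= m -> [/\ 0 <= s1 - m * crossC z2 z3, 0 <= s2 - m * crossC z3 z1 & 0 <= s3 - m * crossC z1 z2] ->
  [\/ 0 < crossC z2 z3 /\ s1 - m * crossC z2 z3 = 0, 0 < crossC z3 z1 /\ s2 - m * crossC z3 z1 = 0
    | 0 < crossC z1 z2 /\ s3 - m * crossC z1 z2 = 0] ->
  [set B | 0 < crossC z1 z2 /\ sector z1 z2 B] B \/ ([set B | 0 < crossC z2 z3 /\ sector z2 z3 B] B \/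
     [set B | 0 < crossC z3 z1 /\ sector z3 z1 B] B).
  move=> m0 [g1 g2 g3].
  (* The weights lose m times the positive total area, so their sum stays at most c. *)
  have ms : 0 <= m * (crossC z1 z2 + crossC z2 z3 + crossC z3 z1) by rewrite mulr_ge0 // ltW.
  case=> -[hp e0].
  - right; left; split=> //; split=> //; exists (s2 - m * crossC z3 z1), (s3 - m * crossC z1 z2); split=> //.
      by rewrite hc; lra.
    by rewrite (red m) e0 rC0 mul0r add0r.
  - right; right; split=> //; split=> //; exists (s3 - m * crossC z1 z2), (s1 - m * crossC z2 z3); split=> //.
      by rewrite hc; lra.
    by rewrite (red m) e0 rC0 mul0r addr0 addrC.
  - left; split=> //; split=> //; exists (s1 - m * crossC z2 z3), (s2 - m * crossC z3 z1); split=> //.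
      by rewrite hc; lra.
    by rewrite (red m) e0 rC0 mul0r addr0.
have key (s o m : R) : 0 <= s -> 0 <= m -> (0 < o -> m <= s / o) -> 0 <= s - m * o.
  move=> s0 m0 h; rewrite subr_ge0; have [po|po] := ltP 0 o; first by rewrite -ler_pdivlMr // h.
  by apply: le_trans s0; rewrite mulr_ge0_le0.
have z0 (s o : R) : 0 < o -> s - s / o * o = 0 by move=> po; rewrite divfK ?subrr // gt_eqF.
have pick (o1 o2 o3 : R) : 0 <= s1 -> 0 <= s2 -> 0 <= s3 -> 0 < o1 + o2 + o3 ->
  exists m, 0 <= m /\ [/\ 0 <= s1 - m * o1, 0 <= s2 - m * o2 & 0 <= s3 - m * o3] /\
   [\/ 0 < o1 /\ s1 - m * o1 = 0, 0 < o2 /\ s2 - m * o2 = 0 | 0 < o3 /\ s3 - m * o3 = 0].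
  move=> _ _ _ os.
  have ge s o : 0 <= s -> 0 < o -> 0 <= s / o by move=> ? ?; rewrite divr_ge0 // ltW.
  have best := best_ratio (ge s1 o1 h1) (ge s2 o2 h2) (ge s3 o3 h3) os.
  have [m [m0 l1 l2 l3 hm]] := best.
  exists m; split=> //; split; first by split; apply: key.
  by case: hm => -[po ->]; [apply: Or31|apply: Or32|apply: Or33]; split=> //; apply: z0.
have [m [m0 [g hm]]] := pick (crossC z2 z3) (crossC z3 z1) (crossC z1 z2) h1 h2 h3 (ltac:(lra)).
exact: (main m m0 g hm).
Qed.

Lemma crossCC z w : crossC w z = - crossC z w.
Proof. by rewrite /crossC !reim; ring. Qed.

(** A negative orientation is reversed by exchanging z1 and z2. *)
Lemma covered_disk_cone z1 z2 z3 : normC2 z1 = 1 -> normC2 z2 = 1 -> normC2 z3 = 1 ->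
  crossC z1 z2 + crossC z2 z3 + crossC z3 z1 != 0 ->
  covered (disk_cone z1 z2 z3) (3 / 2 * Lobachevsky (pi / 3)).
Proof.
move=> n1 n2 n3; rewrite neq_lt => /orP[h|]; last exact: covered_disk_cone_pos.
have h' : 0 < crossC z2 z1 + crossC z1 z3 + crossC z3 z2.
  by rewrite (crossCC z1 z2) (crossCC z3 z1) (crossCC z2 z3); lra.
apply: covered_sub (covered_disk_cone_pos n2 n1 n3 h') => B [hP [t [s1 [s2 [s3 [t0 h1 h2 h3 [ha hc hxy]]]]]]].
split=> //; exists t, s2, s1, s3; split=> //; split; rewrite ?ha ?hc ?hxy; [ring|ring|].
by rewrite [X in X + _]addrC.
Qed.

End IdealSimplex.

(** * Moving a simplicial cone into the position of an ideal tetrahedron *)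

Section SimplexReduction.
Context {R : realType}.
Local Notation C := R[i].
Implicit Types (v : 'cV[C]_2) (t s : R).

Definition outer v : 'M[C]_2 := v *m conjT v.

Lemma outerM (g : 'M[C]_2) v : outer (g *m v) = g *m outer v *m conjT g.
Proof. by rewrite /outer conjTM !mulmxA. Qed.

Lemma outer_vec2 (x y : C) : outer (vec2 x y) =
  mx2 (rC (normC2 x)) (x * Num.conj y) (y * Num.conj x) (rC (normC2 y)).
Proof.
rewrite [LHS]mx2E !mxE !big_ord1 !mxE /=.
by congr mx2; apply: complex_ext; rewrite ?reim /= /normC2; ring.
Qed.

Lemma outer_scaleM (g : 'M[C]_2) t v :
  g *m (rC t *: outer v) *m conjT g = rC t *: outer (g *m v).
Proof. by rewrite -scalemxAr -scalemxAl outerM. Qed.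

Lemma mulmx_sandwich4 (g h A1 A2 A3 A4 : 'M[C]_2) :
  g *m (A1 + A2 + A3 + A4) *m h = g *m A1 *m h + g *m A2 *m h + g *m A3 *m h + g *m A4 *m h.
Proof. by rewrite !mulmxDr !mulmxDl. Qed.

Lemma mx2Z (t a b c e : C) : t *: mx2 a b c e = mx2 (t * a) (t * b) (t * c) (t * e).
Proof. by rewrite [LHS]mx2E !mxE. Qed.

Lemma mx2D (a b c e a' b' c' e' : C) :
  mx2 a b c e + mx2 a' b' c' e' = mx2 (a + a') (b + b') (c + c') (e + e').
Proof. by rewrite [LHS]mx2E !mxE. Qed.

Definition indep4 (v1 v2 v3 v4 : 'cV[C]_2) : Prop := forall t1 t2 t3 t4 : R,
  rC t1 *: outer v1 + rC t2 *: outer v2 + rC t3 *: outer v3 + rC t4 *: outer v4 = 0 ->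
  [/\ t1 = 0, t2 = 0, t3 = 0 & t4 = 0].

Definition cone4 (v1 v2 v3 v4 : 'cV[C]_2) : set (@form R) :=
  [set B | exists t1 t2 t3 t4 : R, [/\ 0 <= t1, 0 <= t2, 0 <= t3 & 0 <= t4] /\
    herm B = rC t1 *: outer v1 + rC t2 *: outer v2 + rC t3 *: outer v3 + rC t4 *: outer v4].

Lemma cone4_act (g : 'M[C]_2) v1 v2 v3 v4 B :
  cone4 v1 v2 v3 v4 B -> cone4 (g *m v1) (g *m v2) (g *m v3) (g *m v4) (act g B).
Proof.
move=> [t1 [t2 [t3 [t4 [ht hB]]]]]; exists t1, t2, t3, t4; split=> //.
have e := herm_act g B; rewrite hB mulmx_sandwich4 in e; rewrite {}e.
by congr (_ + _ + _ + _); exact: outer_scaleM.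
Qed.

Lemma indep4_act (g : 'M[C]_2) v1 v2 v3 v4 : g \in unitmx -> indep4 v1 v2 v3 v4 ->
  indep4 (g *m v1) (g *m v2) (g *m v3) (g *m v4).
Proof.
move=> ug h t1 t2 t3 t4 e; apply: h.
have uT : conjT g \in unitmx.
  by rewrite unitmxE det_conjT unitfE conjC_eq0 -unitfE -unitmxE.
rewrite -4!outer_scaleM -mulmx_sandwich4 in e.
have := congr1 (fun M => invmx g *m M *m invmx (conjT g)) e.
by rewrite mulmx0 mul0mx -!mulmxA mulKmx // mulmxV // mulmx1.
Qed.

(** Relative to z1 the centre u solves the two linear equations of perpendicular bisectors, by
    Cramer's rule; r is the squared radius. *)
Lemma circumcenter (z1 z2 z3 : C) :
  complex.Im (Num.conj (z2 - z1) * (z3 - z1)) != 0 ->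
  exists m : C, exists2 r : R, 0 < r &
    [/\ normC2 (z1 - m) = r, normC2 (z2 - m) = r & normC2 (z3 - m) = r].
Proof.
set D := complex.Im _ => D0.
pose a := complex.Re (z2 - z1); pose b := complex.Im (z2 - z1).
pose c := complex.Re (z3 - z1); pose e := complex.Im (z3 - z1).
have ED : D = a * e - b * c by rewrite /D /a /b /c /e !reim; ring.
pose P := (normC2 (z2 - z1)) / 2; pose Q := (normC2 (z3 - z1)) / 2.
pose u := Complex ((P * e - Q * b) / D) ((Q * a - P * c) / D).
exists (z1 + u), (normC2 u).
  rewrite normC2_gt0; apply/eqP => u0.
  have e1 : P * e - Q * b = 0.
    by have := congr1 (@complex.Re R) u0; rewrite /u /= => /eqP; rewrite mulf_eq0 invr_eq0 (negbTE D0) orbF => /eqP.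
  have e2 : Q * a - P * c = 0.
    by have := congr1 (@complex.Im R) u0; rewrite /u /= => /eqP; rewrite mulf_eq0 invr_eq0 (negbTE D0) orbF => /eqP.
  have : P * D = 0 by rewrite ED; transitivity (a * (P * e - Q * b) + b * (Q * a - P * c)); [ring|rewrite e1 e2; ring].
  move=> /eqP; rewrite mulf_eq0 (negbTE D0) orbF /P mulf_eq0 invr_eq0 pnatr_eq0 orbF => /eqP n0.
  have : a ^+ 2 + b ^+ 2 = 0 by rewrite -n0.
  move=> /eqP; rewrite paddr_eq0 ?sqr_ge0 // !sqrf_eq0 => /andP[/eqP a0 /eqP b0].
  by move: D0; rewrite ED a0 b0 !mul0r subrr eqxx.
have E (w : C) : normC2 (w - u) = normC2 w - 2 * (complex.Re w * complex.Re u + complex.Im w * complex.Im u) + normC2 u.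
  by rewrite /normC2 !reim; ring.
split.
- by rewrite opprD addNKr normC2N.
- have -> : z2 - (z1 + u) = (z2 - z1) - u by ring.
  rewrite E -/a -/b /u /=.
  have -> : normC2 (z2 - z1) = 2 * P by rewrite /P; field.
  suff -> : a * ((P * e - Q * b) / D) + b * ((Q * a - P * c) / D) = P by ring.
  transitivity ((P * (a * e - b * c)) / D); first by field.
  by rewrite -ED mulfK.
- have -> : z3 - (z1 + u) = (z3 - z1) - u by ring.
  rewrite E -/c -/e /u /=.
  have -> : normC2 (z3 - z1) = 2 * Q by rewrite /Q; field.
  suff -> : c * ((P * e - Q * b) / D) + e * ((Q * a - P * c) / D) = Q by ring.
  transitivity ((Q * (a * e - b * c)) / D); first by field.
  by rewrite -ED mulfK.
Qed.

Lemma collinear_dep (z1 z2 z3 : C) : complex.Im (Num.conj (z2 - z1) * (z3 - z1)) = 0 ->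
  exists t1 t2 t3 : R, [/\ (t1 != 0) || (t2 != 0) || (t3 != 0), t1 + t2 + t3 = 0 &
    rC t1 * z1 + rC t2 * z2 + rC t3 * z3 = 0].
Proof.
move=> h; have [e|ne] := eqVneq z2 z1.
  exists 1, (-1), 0; split; [by rewrite oner_eq0|ring|].
  by rewrite e; apply: complex_ext; rewrite /= !reim /=; ring.
have n0 : normC2 (z2 - z1) != 0 by rewrite normC2_eq0 subr_eq0.
pose l := complex.Re (Num.conj (z2 - z1) * (z3 - z1)) / normC2 (z2 - z1).
exists (l - 1), (- l), 1; split; [by rewrite oner_eq0 orbT|ring|].
have hl : Num.conj (z2 - z1) * (z3 - z1) = rC (l * normC2 (z2 - z1)).
  by apply: complex_ext; rewrite /= ?h // /l divfK.
have e : z3 - z1 = rC l * (z2 - z1).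
  apply: (mulfI (x := Num.conj (z2 - z1))).
    by rewrite conjC_eq0 subr_eq0.
  by rewrite hl rCM -conjM_normC2; ring.
have -> : z3 = z1 + rC l * (z2 - z1) by rewrite -e; ring.
by apply: complex_ext; rewrite /= !reim /=; ring.
Qed.

(** One vertex is infinity, the others are z2, z3, z4. Collinear points would make the four rank-one
    forms dependent; so there is a circumcircle, and an affine map carries it to the unit circle. *)
Lemma covered_simplex_infty (k y2 y3 y4 z2 z3 z4 : C) :
  indep4 (vec2 k 0) (vec2 (z2 * y2) y2) (vec2 (z3 * y3) y3) (vec2 (z4 * y4) y4) ->
  covered (P1 `&` cone4 (vec2 k 0) (vec2 (z2 * y2) y2) (vec2 (z3 * y3) y3) (vec2 (z4 * y4) y4))
    (3 / 2 * Lobachevsky (pi / 3)).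
Proof.
move=> ind.
have O x y : outer (vec2 (x * y) y) = rC (normC2 y) *: mx2 (rC (normC2 x)) x (Num.conj x) 1.
  rewrite outer_vec2 [RHS]mx2E !mxE /=; congr mx2; rewrite ?mulr1 //.
  - by rewrite normC2M mulrC rCM.
  - by rewrite -conjM_normC2; ring.
  - by rewrite rmorphM /= -conjM_normC2; ring.
have O1 : outer (vec2 k 0) = rC (normC2 k) *: mx2 1 0 0 0.
  by rewrite outer_vec2 [RHS]mx2E !mxE /=; congr mx2; rewrite ?normC2_0 ?rmorph0 ?mulr0 ?mul0r ?mulr1.
have k0 : normC2 k != 0.
  apply/eqP => k0; have := ind 1 0 0 0; rewrite O1 k0 !rC0 !scale0r scaler0 !addr0 => /(_ erefl)[].
  by move/eqP; rewrite oner_eq0.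
have ynz : [/\ normC2 y2 != 0, normC2 y3 != 0 & normC2 y4 != 0].
  split; apply/eqP => y0.
  - have := ind 0 1 0 0; rewrite !O y0 !rC0 !scale0r scaler0 !addr0 => /(_ erefl)[_].
    by move/eqP; rewrite oner_eq0.
  - have := ind 0 0 1 0; rewrite !O y0 !rC0 !scale0r scaler0 !addr0 => /(_ erefl)[_ _].
    by move/eqP; rewrite oner_eq0.
  - have := ind 0 0 0 1; rewrite !O y0 !rC0 !scale0r scaler0 !addr0 => /(_ erefl)[_ _ _].
    by move/eqP; rewrite oner_eq0.
have [n2 n3 n4] := ynz.
have D0 : complex.Im (Num.conj (z3 - z2) * (z4 - z2)) != 0.
  apply/eqP => /collinear_dep [t2 [t3 [t4 [nz s0 e0]]]].
  (* The vertex at infinity absorbs the upper left entry, which the relation between the points does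
     not control. *)
  pose T := t2 * normC2 z2 + t3 * normC2 z3 + t4 * normC2 z4.
  have := ind (- T / normC2 k) (t2 / normC2 y2) (t3 / normC2 y3) (t4 / normC2 y4).
  rewrite O1 !O !scalerA -!rCM !divfK // !mx2Z !mx2D !mulr0 !add0r.
  have -> : rC (- T) * 1 + rC t2 * rC (normC2 z2) + rC t3 * rC (normC2 z3) + rC t4 * rC (normC2 z4) = 0.
    by apply: complex_ext; rewrite ?reim /= ?reim /= /T; ring.
  have -> : rC t2 * 1 + rC t3 * 1 + rC t4 * 1 = 0.
    by rewrite !mulr1 -!rCD s0.
  have -> : rC t2 * Num.conj z2 + rC t3 * Num.conj z3 + rC t4 * Num.conj z4 = 0.
    have := congr1 Num.conj e0; rewrite rmorph0 !rmorphD !rmorphM /= => <-.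
    have J (x : R) : Num.conj (rC x) = rC x by apply: complex_ext; rewrite ?reim /= ?oppr0.
    by rewrite !J.
  rewrite e0 => /(_ _)[].
    by rewrite [RHS]mx2E !mxE.
  move=> _ /eqP; rewrite mulf_eq0 invr_eq0 (negbTE n2) orbF => /eqP h2.
  move=> /eqP; rewrite mulf_eq0 invr_eq0 (negbTE n3) orbF => /eqP h3.
  move=> /eqP; rewrite mulf_eq0 invr_eq0 (negbTE n4) orbF => /eqP h4.
  by move: nz; rewrite h2 h3 h4 eqxx.
have [m [r r0 [r2 r3 r4]]] := circumcenter D0.
pose q := Num.sqrt r; have q0 : 0 < q by rewrite sqrtr_gt0.
have qq : q ^+ 2 = r by rewrite sqr_sqrtr // ltW.
(* A matrix with diagonal 1/p, p scales the plane by p^-2, so p is the square root of the radius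
   q. *)
pose p := Num.sqrt q; have p0 : 0 < p by rewrite sqrtr_gt0.
have pp : p ^+ 2 = q by rewrite sqr_sqrtr // ltW.
pose g := mx2 (rC p^-1) (- m * rC p^-1) 0 (rC p).
have rCV : rC p^-1 * rC p = 1 by rewrite -rCM mulVf ?rC1 // gt_eqF.
have dg : normC2 (\det g) = 1 by rewrite /g mx2_det mulr0 subr0 rCV normC2_1.
pose w z := (z - m) * rC q^-1.
have nw z : normC2 (z - m) = r -> normC2 (w z) = 1.
  move=> h; rewrite /w normC2M h /normC2 /= expr0n addr0 exprVn qq mulfV // gt_eqF //.
have cw : crossC (w z2) (w z3) + crossC (w z3) (w z4) + crossC (w z4) (w z2) != 0.
  have -> : crossC (w z2) (w z3) + crossC (w z3) (w z4) + crossC (w z4) (w z2)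
     = q^-1 ^+ 2 * complex.Im (Num.conj (z3 - z2) * (z4 - z2)).
    by rewrite /crossC /w ?reim /= ?reim /=; ring.
  by rewrite mulf_neq0 // expf_neq0 // invr_eq0 gt_eqF.
have := covered_preserving (preserving_act dg) (covered_disk_cone (nw _ r2) (nw _ r3) (nw _ r4) cw).
apply: covered_sub => B [[pB dB] cB].
have gz z y : g *m vec2 (z * y) y = vec2 (w z * (rC p * y)) (rC p * y).
  rewrite /g mx2_vec2 mul0r add0r /w; congr vec2.
  have e : rC q^-1 * rC p = rC p^-1.
    by rewrite -rCM; congr (rC _); rewrite -pp; field; rewrite gt_eqF.
  by rewrite -e; ring.
have gk : g *m vec2 k 0 = vec2 (rC p^-1 * k) 0 by rewrite /g mx2_vec2 !mulr0 mul0r !addr0.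
have [t1 [t2 [t3 [t4 [[t10 t20 t30 t40]]]]]] := cone4_act g cB.
rewrite gk !gz !O outer_vec2 !mx2Z !mx2D.
set B' := act g B => hB.
have pB' : posform B'.
  by apply: act_posform => //; rewrite -normC2_eq0 dg oner_eq0.
split; first by split=> //; rewrite fdet_act dg mul1r.
pose s (t : R) (y : C) := t * normC2 (rC p * y).
have s0 t y : 0 <= t -> 0 <= s t y by move=> ?; rewrite mulr_ge0 // normC2_ge0.
exists (t1 * normC2 (rC p^-1 * k)), (s t2 y2), (s t3 y3), (s t4 y4).
split; [by rewrite mulr_ge0 ?normC2_ge0|exact: s0|exact: s0|exact: s0|].
have e00 := congr1 (fun M : 'M[C]_2 => complex.Re (M 0 0)) hB.
have e11 := congr1 (fun M : 'M[C]_2 => complex.Re (M 1 1)) hB.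
have e01 := congr1 (fun M : 'M[C]_2 => M 0 1) hB.
rewrite /herm !mx2_ij /= in e00 e11 e01.
split.
- rewrite e00 ?reim /= (nw _ r2) (nw _ r3) (nw _ r4) /s; ring.
- rewrite e11 normC2_0 ?reim /= /s; ring.
- rewrite e01 /s !rCM; ring.
Qed.

(** A unitary matrix built from v and a vector orthogonal to it. *)
Lemma vec2_norm_det (v : 'cV[C]_2) : v != 0 ->
  exists2 g : 'M[C]_2, \det g = 1 & exists k, g *m v = vec2 k 0.
Proof.
rewrite [v]vec2E; move: (v 0 0) (v 1 0) => p q; rewrite vec2_eq0 => h.
pose n := Num.sqrt (normC2 p + normC2 q).
have N0 : 0 < normC2 p + normC2 q.
  rewrite lt_def addr_ge0 ?normC2_ge0 // andbT paddr_eq0 ?normC2_ge0 //.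
  by rewrite !normC2_eq0.
have n0 : 0 < n by rewrite sqrtr_gt0.
have nn : n * n = normC2 p + normC2 q by rewrite -expr2 sqr_sqrtr // ltW.
exists (mx2 (rC n^-1 * Num.conj p) (rC n^-1 * Num.conj q) (- (rC n^-1 * q)) (rC n^-1 * p)).
  rewrite mx2_det; transitivity (rC n^-1 * rC n^-1 * (Num.conj p * p + Num.conj q * q)); first by ring.
  rewrite !conjM_normC2 -rCD -!rCM -nn -[RHS]rC1; congr rC; field; by rewrite gt_eqF.
exists (rC n^-1 * Num.conj p * p + rC n^-1 * Num.conj q * q).
by rewrite mx2_vec2; congr vec2; ring.
Qed.

Lemma covered_simplex v1 v2 v3 v4 : indep4 v1 v2 v3 v4 ->
  covered (P1 `&` cone4 v1 v2 v3 v4) (3 / 2 * Lobachevsky (pi / 3)).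
Proof.
move=> ind.
have v10 : v1 != 0.
  apply/eqP => v10; have := ind 1 0 0 0; rewrite v10 /outer mul0mx !rC0 !scale0r scaler0 !addr0.
  by move=> /(_ erefl)[/eqP]; rewrite oner_eq0.
have [g dg [k gv1]] := vec2_norm_det v10.
have ug : g \in unitmx by rewrite unitmxE dg unitr1.
have ind' := indep4_act ug ind.
(* The other vertices are finite points: a vanishing second coordinate would make the rank-one form
   proportional to that of infinity. *)
have ny v : (forall t1 t : R, rC t1 *: outer (vec2 k 0) + rC t *: outer (g *m v) = 0 -> t1 = 0 /\ t = 0) ->
    g *m v = vec2 ((g *m v) 0 0 / (g *m v) 1 0 * (g *m v) 1 0) ((g *m v) 1 0).
  move=> h; rewrite {1}[g *m v]vec2E divfK //; apply/eqP => y0.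
  move: h; rewrite [g *m v]vec2E y0 !outer_vec2 normC2_0 rmorph0 !mulr0 !mul0r !rC0 => h.
  have [|n0 /eqP k0] := h (normC2 ((g *m v) 0 0)) (- normC2 k).
    rewrite !mx2Z mx2D !mulr0 addr0 -!rCM -rCD.
    have -> : (normC2 ((g *m v) 0 0) * normC2 k + - normC2 k * normC2 ((g *m v) 0 0) = 0) by ring.
    by rewrite [RHS]mx2E !mxE.
  have [|/eqP] := h 1 0; last by rewrite oner_eq0.
  move: k0; rewrite oppr_eq0 => /eqP ->.
  by rewrite n0 !mx2Z mx2D !rC0 !mulr0 addr0 [RHS]mx2E !mxE.
rewrite gv1 in ind'.
have h2 := ny v2 (fun t1 t e => let: And4 a b _ _ := ind' t1 t 0 0 (ltac:(by rewrite rC0 !scale0r !addr0)) in conj a b).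
have h3 := ny v3 (fun t1 t e => let: And4 a _ b _ := ind' t1 0 t 0 (ltac:(by rewrite rC0 !scale0r !addr0)) in conj a b).
have h4 := ny v4 (fun t1 t e => let: And4 a _ _ b := ind' t1 0 0 t (ltac:(by rewrite rC0 !scale0r !addr0)) in conj a b).
rewrite h2 h3 h4 in ind'.
have dg1 : normC2 (\det g) = 1 by rewrite dg normC2_1.
have := covered_preserving (preserving_act dg1) (covered_simplex_infty ind').
rewrite -h2 -h3 -h4 -gv1; apply: covered_sub => B [[pB dB] cB]; split; last exact: cone4_act.
split; last by rewrite fdet_act dg1 mul1r.
by apply: act_posform => //; rewrite dg oner_eq0.
Qed.

End SimplexReduction.

(** * Finitely generated cones and the lemma of Farkas *)

Section Farkas.
Context {R : realType} {k : nat}.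
Local Notation V := 'rV[R]_k.
Implicit Types (f g x y : V) (r t : R).

Definition dot f x : R := \sum_j f 0 j * x 0 j.

Lemma dotDr f x y : dot f (x + y) = dot f x + dot f y.
Proof. by rewrite -big_split; apply: eq_bigr => j _; rewrite mxE mulrDr. Qed.
Lemma dotDl f g x : dot (f + g) x = dot f x + dot g x.
Proof. by rewrite -big_split; apply: eq_bigr => j _; rewrite mxE mulrDl. Qed.
Lemma dotZr f r x : dot f (r *: x) = r * dot f x.
Proof. by rewrite /dot mulr_sumr; apply: eq_bigr => j _; rewrite mxE mulrCA. Qed.
Lemma dotZl f r x : dot (r *: f) x = r * dot f x.
Proof. by rewrite /dot mulr_sumr; apply: eq_bigr => j _; rewrite mxE mulrA. Qed.
Lemma dot0r f : dot f 0 = 0.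
Proof. by rewrite -(scale0r 0) dotZr mul0r. Qed.
Lemma dot0l x : dot 0 x = 0.
Proof. by rewrite -(scale0r 0) dotZl mul0r. Qed.
Lemma dotNr f x : dot f (- x) = - dot f x.
Proof. by rewrite -scaleN1r dotZr mulN1r. Qed.
Lemma dotNl f x : dot (- f) x = - dot f x.
Proof. by rewrite -scaleN1r dotZl mulN1r. Qed.
Lemma dotC f x : dot f x = dot x f.
Proof. by apply: eq_bigr => j _; rewrite mulrC. Qed.
Lemma dot_sumr (I : finType) (P : pred I) (F : I -> V) f :
  dot f (\sum_(i | P i) F i) = \sum_(i | P i) dot f (F i).
Proof. by apply: (big_morph (dot f)); [exact: dotDr|exact: dot0r]. Qed.
Lemma dotxx_gt0 x : x != 0 -> 0 < dot x x.
Proof.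
move=> x0; have [j xj] : exists j, x 0 j != 0.
  apply/existsP; apply: contraNT x0; rewrite negb_exists => /forallP h.
  by apply/eqP/rowP => j; rewrite mxE; apply/eqP; have := h j; rewrite negbK.
rewrite /dot (bigD1 j) //= ltr_wpDr ?sumr_ge0 //; first by move=> i _; rewrite -expr2 sqr_ge0.
by rewrite -expr2 lt_def sqrf_eq0 xj sqr_ge0.
Qed.

Section Family.
Context {I : finType}.
Implicit Types (u : I -> V) (A B : {set I}).

Definition ncomb u A x : Prop :=
  exists2 t : I -> R, (forall i, 0 <= t i) & x = \sum_(i in A) t i *: u i.

Lemma ncomb_ge0 u A x f : (forall i, i \in A -> 0 <= dot f (u i)) -> ncomb u A x -> 0 <= dot f x.
Proof.
move=> h [t t0 ->]; rewrite dot_sumr sumr_ge0 // => i iA.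
by rewrite dotZr mulr_ge0 // h.
Qed.

Lemma ncomb_sub u A B x : A \subset B -> ncomb u A x -> ncomb u B x.
Proof.
move=> AB [t t0 ->]; exists (fun i => if i \in A then t i else 0).
  by move=> i; case: ifP.
rewrite [RHS](big_setID A) /= (finset.setIidPr AB) [X in _ + X]big1 ?addr0.
  by apply: eq_bigr => i ->.
by move=> i; rewrite finset.in_setD => /andP[/negbTE -> _]; rewrite scale0r.
Qed.

Lemma ncombZ u A x r : 0 <= r -> ncomb u A x -> ncomb u A (r *: x).
Proof.
move=> r0 [t t0 ->]; exists (fun i => r * t i); first by move=> i; rewrite mulr_ge0.
by rewrite scaler_sumr; apply: eq_bigr => i _; rewrite scalerA.
Qed.

Lemma ncombD u A x y : ncomb u A x -> ncomb u A y -> ncomb u A (x + y).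
Proof.
move=> [t t0 ->] [s s0 ->]; exists (fun i => t i + s i); first by move=> i; rewrite addr_ge0.
by rewrite -big_split; apply: eq_bigr => i _; rewrite scalerDl.
Qed.

Lemma ncomb1 u A i : i \in A -> ncomb u A (u i).
Proof.
move=> iA; exists (fun j => (j == i)%:R); first by move=> j; case: eqP.
rewrite (bigD1 i) //= eqxx scale1r big1 ?addr0 // => j /andP[_ /negbTE ->].
by rewrite scale0r.
Qed.

End Family.

(* Bartl's induction: project along the last generator. *)
Lemma Farkas (I : finType) (A : {set I}) (u : I -> V) x :
  ncomb u A x \/ exists2 f, (forall i, i \in A -> 0 <= dot f (u i)) & dot f x < 0.
Proof.
elim: {A}_.+1 {-2}A (ltnSn #|A|) u x => // n IHn A An u x.
have [->|[a aA]] := set_0Vmem A.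
  have [->|x0] := eqVneq x 0.
    by left; exists (fun=> 0) => //; rewrite big_set0.
  right; exists (- x); first by move=> i; rewrite inE.
  by rewrite dotNl oppr_lt0 dotxx_gt0.
have An' : (#|A :\ a| < n)%N by move: An; rewrite (cardsD1 a) aA.
have [h|[f0 f0A f0x]] := IHn _ An' u x.
  by left; apply: ncomb_sub h; rewrite subD1set.
have [f0a|f0a] := leP 0 (dot f0 (u a)).
  by right; exists f0 => // i iA; have [->//|ia] := eqVneq i a; apply: f0A; rewrite !inE ia.
(* c is f0 normalized to 1 at [u a], so [u' i] is the projection of [u i] along [u a] into the
   kernel of f0. *)
pose c v := dot f0 v / dot f0 (u a).
pose u' i := u i - c (u i) *: u a.
have ca : c (u a) = 1 by rewrite /c divff // lt_eqF.
have [[t t0 e]|[g gA gx]] := IHn _ An' u' (x - c x *: u a).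
  (* The coefficient of [u a] is nonnegative because f0 is negative at x and at [u a] and
     nonnegative at the other generators. *)
  left; exists (fun i => if i == a then c x - \sum_(j in A :\ a) t j * c (u j) else t i).
    move=> i; case: ifP => // _; rewrite subr_ge0.
    apply: (@le_trans _ _ 0); last by rewrite /c mulr_le0 ?invr_le0 ?ltW.
    rewrite -oppr_ge0 -sumrN sumr_ge0 // => j jA; rewrite -mulrN mulr_ge0 //.
    by rewrite oppr_ge0 /c mulr_ge0_le0 ?invr_le0 ?(ltW f0a) // f0A.
  rewrite (big_setD1 a) //= eqxx.
  rewrite (eq_bigr (fun i => t i *: u' i + (t i * c (u i)) *: u a)); last first.
    by move=> i; rewrite !inE => /andP[/negbTE -> _]; rewrite /u' scalerBr scalerA subrK.
  rewrite big_split /= -e -scaler_suml scalerBl.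
  set y := (X in _ - X *: _); rewrite addrACA -addrA.
  by rewrite [- _ + _]addrC subrr addr0 addrC subrK.
right; pose h := g - (dot g (u a) / dot f0 (u a)) *: f0.
have hE v : dot h v = dot g (v - c v *: u a).
  by rewrite /h /c dotDl dotDr !dotNl !dotNr dotZl dotZr; congr (_ - _); ring.
exists h; last by rewrite hE.
move=> i iA; rewrite hE; have [->|ia] := eqVneq i a; first by rewrite ca scale1r subrr dot0r.
by apply: gA; rewrite !inE ia.
Qed.

End Farkas.

(** * Properties that hold for all large values of a parameter *)

Section NonRoots.
Context {R : realType}.

Lemma exists_nonroot (p : {poly R}) (N : R) : p != 0 -> exists2 r, N <= r & p.[r] != 0.
Proof.
move=> p0; apply: contrapT => h.
pose s := [seq N + i%:R | i <- iota 0 (size p)].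
have us : uniq s.
  by rewrite map_inj_uniq ?iota_uniq // => i j /addrI/eqP; rewrite eqr_nat => /eqP.
have al : all (root p) s.
  apply/allP => _ /mapP[i _ ->]; apply/negPn/negP => nr; apply: h.
  by exists (N + i%:R) => //; rewrite lerDl ler0n.
by have := max_poly_roots p0 al us; rewrite size_map size_iota ltnn.
Qed.

Lemma eventually_all (I : finType) (P : I -> R -> Prop) :
  (forall i, exists N, forall r, N <= r -> P i r) -> exists N, forall r, N <= r -> forall i, P i r.
Proof.
move=> h; have [N hN] := fin_all_exists h.
exists (\sum_i `|N i|) => r hr i; apply: hN; apply: le_trans hr.
by rewrite (bigD1 i) //= (le_trans (ler_norm _)) // lerDl sumr_ge0.
Qed.

Lemma eventually_affine_gt0 (a b : R) : 0 < a -> exists N, forall r, N <= r -> 0 < r * a + b.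
Proof.
move=> a0; exists (`|b| / a + 1) => r hr.
have : `|b| + a <= r * a.
  by rewrite -ler_pdivrMr // mulrDl divff ?gt_eqF.
have := ler_norm (- b); rewrite normrN; lra.
Qed.

End NonRoots.

(** * Facets of a generic cone in four-space: covering and counting *)

Section GenericCone.
Context {R : realType} {n : nat}.
Local Notation V := 'rV[R]_4.
Variable u : 'I_n -> V.
Implicit Types (f g l : V) (x y : V) (T F : {set 'I_n}).

(** Linear independence of any four generators, phrased through functionals. *)
Definition generic : Prop := forall T l, (4 <= #|T|)%N ->
  (forall i, i \in T -> dot l (u i) = 0) -> l = 0.

(* The facets of cone u, which is simplicial when u is generic. *)
Definition facet F : Prop := #|F| = 3 /\
  exists l, forall i, if i \in F then dot l (u i) = 0 else 0 < dot l (u i).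

Lemma exists_orthogonal (m : nat) (w : 'I_m -> V) : (m < 4)%N ->
  exists2 g, g != 0 & forall i, dot g (w i) = 0.
Proof.
move=> m4; pose M : 'M[R]_(4, m) := \matrix_(j, i) w i 0 j.
have : kermx M != 0.
  by rewrite kermx_eq0 /row_free neq_ltn (leq_ltn_trans (rank_leq_col M)).
move=> /rowV0Pn [g gM g0]; exists g => // i.
have /sub_kermxP e := gM.
have := congr1 (fun A : 'M[R]_(1, m) => A 0 i) e; rewrite !mxE => e2.
by rewrite -[RHS]e2; apply: eq_bigr => j _; rewrite mxE.
Qed.

Lemma exists_orthogonal_set (w : 'I_n -> V) T (y : V) : (#|T| < 3)%N ->
  exists2 g, g != 0 & dot g y = 0 /\ forall i, i \in T -> dot g (w i) = 0.
Proof.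
move=> T3; pose w' (i : 'I_(#|T|.+1)) := if unlift ord0 i is Some j then w (enum_val j) else y.
have [g g0 h] := @exists_orthogonal _ w' (T3 : (#|T|.+1 < 4)%N).
exists g => //; split; first by have := h ord0; rewrite /w' unlift_none.
move=> i iT; have := h (lift ord0 (enum_rank_in iT i)).
by rewrite /w' liftK enum_rankK_in.
Qed.

Hypothesis gen : generic.
Hypothesis n4 : (4 <= n)%N.

Let tight l : {set 'I_n} := [set i | dot l (u i) == 0].

Lemma card_tight l : l != 0 -> (#|tight l| <= 3)%N.
Proof.
move=> l0; rewrite leqNgt; apply/negP => h; move: l0; rewrite (gen (l := l) h) ?eqxx //.
by move=> i; rewrite inE => /eqP.
Qed.

Lemma nonzero_not_vanishing l : l != 0 -> exists i, dot l (u i) != 0.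
Proof.
move=> l0; apply/existsP; apply: contraNT l0; rewrite negb_exists => /forallP h.
apply/eqP; apply: (gen (T := [set: 'I_n]%SET)); first by rewrite cardsT card_ord.
by move=> i _; apply/eqP; have := h i; rewrite negbK.
Qed.

(* Moving within the dual cone, at fixed value on u p, until three generators are tight. *)
Lemma exists_facet_below p x l : ncomb u [set: 'I_n]%SET x ->
  (forall i, 0 <= dot l (u i)) -> dot l (u p) = 1 ->
  exists2 l', dot l' x <= dot l x &
    [/\ dot l' (u p) = 1, forall i, 0 <= dot l' (u i) & #|tight l'| = 3].
Proof.
move=> cx; have [m] := ubnP (3 - #|tight l|); elim: m l => // m IHm l lm l0 lp.
have lnz : l != 0 by apply: contra_eqN lp => /eqP ->; rewrite dot0l eq_sym oner_eq0.
have t3 := card_tight lnz.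
have [e|ne] := eqVneq #|tight l| 3; first by exists l.
have t2 : (#|tight l| < 3)%N by rewrite ltn_neqAle ne.
have [g0 g00 [g0p g0T]] := exists_orthogonal_set u (u p) t2.
(* One of the two signs of g0 does not increase the value at x and is negative on some generator, so
   that moving along it comes to a stop. *)
have [g gx [gp gT [i0 gi0]]] : exists2 g, dot g x <= 0 &
    [/\ dot g (u p) = 0, forall i, i \in tight l -> dot g (u i) = 0 & exists i, dot g (u i) < 0].
  have N h : dot h (u p) = 0 -> (forall i, i \in tight l -> dot h (u i) = 0) ->
      dot (- h) (u p) = 0 /\ (forall i, i \in tight l -> dot (- h) (u i) = 0).
    by move=> e1 e2; split=> [|i /e2 e]; rewrite dotNl ?e1 ?e oppr0.
  have [h1|h1] : (exists i, dot g0 (u i) < 0) \/ (forall i, 0 <= dot g0 (u i)).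
    case: (boolP [exists i, dot g0 (u i) < 0]) => [/existsP h|]; first by left.
    by rewrite negb_exists => /forallP h; right => i; rewrite leNgt h.
    have [h2|h2] := leP (dot g0 x) 0; first by exists g0.
    have [Np NT] := N _ g0p g0T.
    have [h3|h3] : (exists i, dot (- g0) (u i) < 0) \/ (forall i, 0 <= dot (- g0) (u i)).
      case: (boolP [exists i, dot (- g0) (u i) < 0]) => [/existsP h|]; first by left.
      by rewrite negb_exists => /forallP h; right => i; rewrite leNgt h.
      by exists (- g0); [rewrite dotNl oppr_le0 ltW|split].
    have := ncomb_ge0 (fun i _ => h3 i) cx; rewrite dotNl oppr_ge0 => h4.
    by have := lt_le_trans h2 h4; rewrite ltxx.
  have [Np NT] := N _ g0p g0T.
  have h4 := ncomb_ge0 (fun i _ => h1 i) cx.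
  exists (- g0); first by rewrite dotNl oppr_le0.
  split=> //; have [i hi] := nonzero_not_vanishing g00.
  by exists i; rewrite dotNl oppr_lt0 lt_def hi h1.
(* Ratio test: the minimum marks the first generator at which the moved functional reaches 0. *)
pose q i := dot l (u i) / - dot g (u i).
pose i1 := [arg min_(i < i0 | dot g (u i) < 0) q i]%O.
have [i1n i1m] : dot g (u i1) < 0 /\ forall i, dot g (u i) < 0 -> q i1 <= q i.
  by rewrite /i1; case: arg_minP.
have q0 : 0 <= q i1 by rewrite divr_ge0 // oppr_ge0 ltW.
have lge i : 0 <= dot (l + q i1 *: g) (u i).
  rewrite dotDl dotZl; have [gi|gi] := leP 0 (dot g (u i)); first by rewrite addr_ge0 // mulr_ge0.
  have := i1m i gi; rewrite {2}/q ler_pdivlMr ?oppr_gt0 // mulrN; lra.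
have lp' : dot (l + q i1 *: g) (u p) = 1 by rewrite dotDl dotZl gp mulr0 addr0.
suff h : (#|tight l| < #|tight (l + q i1 *: g)|)%N.
  have h' : (3 - #|tight (l + q i1 *: g)| < m)%N by apply: leq_trans (ltn_sub2l t2 h) _; rewrite -ltnS.
  have [l' hx hl'] := IHm (l + q i1 *: g) h' lge lp'.
  exists l' => //; apply: (le_trans hx); rewrite dotDl dotZl gerDl.
  exact: mulr_ge0_le0.
apply: proper_card; apply/properP; split.
  apply/fintype.subsetP => i it; rewrite inE dotDl dotZl gT // mulr0 addr0.
  by move: it; rewrite inE.
exists i1; last by rewrite inE; apply: contraTN i1n => /eqP h; rewrite gT ?inE ?h ?ltxx.
rewrite inE dotDl dotZl /q invrN mulrN mulNr divfK ?subrr //.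
by rewrite lt_eqF.
Qed.

Lemma tight_facet l : (forall i, 0 <= dot l (u i)) -> #|tight l| = 3 -> facet (tight l).
Proof.
move=> l0 t3; split=> //; exists l => i; rewrite inE; case: eqP => // /eqP ne.
by rewrite lt_def ne l0.
Qed.

(** Subtracting from x the largest possible multiple of [u p] ends in a facet. Dually, that multiple
    is the minimum of [dot l x] over the functionals l that are nonnegative on the cone and 1 at
    [u p]; it is attained at an l with three tight generators, and these span the facet. *)
Lemma generic_cover (lam : V) : (forall i, 0 < dot lam (u i)) -> forall p x, ncomb u [set: 'I_n]%SET x ->
  exists2 F, facet F & ncomb u (p |: F)%SET x.
Proof.
move=> lam0 p x cx.
pose admissible (F : {set 'I_n}) := exists l, [/\ dot l (u p) = 1, forall i, 0 <= dot l (u i), #|tight l| = 3 & tight l = F].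
have [l1 _ [l1p l10 l13]] : exists2 l', dot l' x <= dot ((dot lam (u p))^-1 *: lam) x &
    [/\ dot l' (u p) = 1, forall i, 0 <= dot l' (u i) & #|tight l'| = 3].
  apply: (exists_facet_below (p := p)) => // [i|]; rewrite dotZl.
    by rewrite mulr_ge0 ?invr_ge0 // ltW.
  by rewrite mulVf // gt_eqF.
have uniqL l l' : tight l = tight l' -> #|tight l| = 3 -> dot l (u p) = 1 -> dot l' (u p) = 1 -> l = l'.
  move=> e c3 lp lp'; apply/eqP; rewrite -subr_eq0; apply/eqP.
  have pT : p \notin tight l by rewrite inE lp oner_eq0.
  apply: (gen (T := (p |: tight l)%SET)); first by rewrite cardsU1 pT c3.
  move=> i; rewrite !inE dotDl dotNl => /orP[/eqP ->|h]; first by rewrite lp lp' subrr.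
  have h' : i \in tight l' by rewrite -e inE.
  by move: h h'; rewrite inE => /eqP -> /eqP ->; rewrite subrr.
have [val hval] : exists val : {set 'I_n} -> R, forall l, dot l (u p) = 1 -> #|tight l| = 3 -> val (tight l) = dot l x.
  have : forall F : {set 'I_n}, exists v : R, forall l, dot l (u p) = 1 -> #|tight l| = 3 -> tight l = F -> v = dot l x.
    move=> F; have [[l [lp l3 e]]|h] := pselect (exists l, [/\ dot l (u p) = 1, #|tight l| = 3 & tight l = F]).
      by exists (dot l x) => l' lp' l3' e'; rewrite (uniqL l l') // e e'.
    by exists 0 => l lp l3 e; exfalso; apply: h; exists l.
  move=> /fin_all_exists [val h]; exists val => l lp l3; exact: h.
pose F1 := [arg min_(F < tight l1 | `[< admissible F >]) val F]%O.
have [[l [lp l0 l3 lF]] lmin] : admissible F1 /\ forall F, admissible F -> val F1 <= val F.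
  rewrite /F1; case: arg_minP; first by apply/asboolP; exists l1.
  by move=> F /asboolP aF h; split=> // F' aF'; apply: h; apply/asboolP.
exists F1; first by rewrite -lF; exact: tight_facet.
have [h|[g gF gy]] := Farkas F1 u (x - dot l x *: u p).
  have pF : ncomb u ((p |: F1)%SET) (x - dot l x *: u p) by apply: ncomb_sub h; exact: finset.subsetUr.
  rewrite -[x](subrK (dot l x *: u p)); apply: ncombD => //; apply: ncombZ.
    by apply: ncomb_ge0 cx => i _.
  by apply: ncomb1; rewrite setU11.
exfalso.
(* If g separates the remainder from the facet, then for large r the functional r l + g is
   nonnegative on the generators, and after normalization at [u p] it beats the minimal l at x. *)
have [N hN] : exists N, forall r, N <= r -> forall i, i \notin F1 -> 0 < r * dot l (u i) + dot g (u i).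
  apply: eventually_all => i; have [iF|iF] := boolP (i \in F1).
    by exists 0 => r _ ; rewrite ?iF //; move=> /negP; rewrite iF.
  have li : 0 < dot l (u i) by rewrite lt_def l0 andbT; move: iF; rewrite -lF inE.
  by have [N hN] := eventually_affine_gt0 (dot g (u i)) li; exists N => r /hN.
have pF1 : p \notin F1 by rewrite -lF inE lp oner_eq0.
pose r := Num.max N 1; have r1 : 1 <= r by rewrite le_max lexx orbT.
have rN : N <= r by rewrite le_max lexx.
have r0 : 0 < r by exact: lt_le_trans r1.
have m0 i : 0 <= dot (r *: l + g) (u i).
  rewrite dotDl dotZl; have [iF|iF] := boolP (i \in F1); last by apply: ltW; exact: hN.
  by rewrite addr_ge0 ?gF // mulr_ge0 // ltW.
have mp : 0 < dot (r *: l + g) (u p) by rewrite dotDl dotZl; exact: hN.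
set s := dot (r *: l + g) (u p) in mp.
have m0' i : 0 <= dot (s^-1 *: (r *: l + g)) (u i) by rewrite dotZl mulr_ge0 // invr_ge0 ltW.
have m1' : dot (s^-1 *: (r *: l + g)) (u p) = 1 by rewrite dotZl mulVf // gt_eqF.
have [l' hx [l'p l'0 l'3]] := exists_facet_below cx m0' m1'.
have := lmin (tight l'); rewrite -lF !hval // => /(_ _) h.
have : dot l x <= dot l' x by apply: h; exists l'.
move=> /le_trans /(_ hx); rewrite dotZl -ler_pdivrMl ?invr_gt0 // invrK.
rewrite /s !dotDl !dotZl lp mulr1 mulrDl.
move: gy; rewrite dotDr dotNr dotZr; lra.
Qed.

(** Otherwise a nonzero functional vanishing at [u i], hence at [u j], and at two further generators
    would vanish at four of them. *)
Lemma generic_pair i j (a b : R) : i != j -> a *: u i = b *: u j -> b = 0.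
Proof.
move=> ij e; apply: contrapT => /eqP b0.
have /card_gt1P[k1 [k2 [h1 h2 k12]]] : (1 < #|~: [set i; j]%SET|)%N.
  by rewrite cardsCs finset.setCK cards2 ij card_ord ltn_subRL.
move: h1 h2; rewrite !inE !negb_or => /andP[k1i k1j] /andP[k2i k2j].
have c2 : (#|[set i; k1]%SET| < 3)%N by rewrite cards2; case: eqP.
have [g g0 [gy gT]] := exists_orthogonal_set u (u k2) c2.
have gj : dot g (u j) = 0.
  apply: (mulfI b0); rewrite mulr0 -dotZr -e dotZr gT ?mulr0 //.
  by rewrite !inE eqxx.
move: g0; rewrite (@gen (k2 |: (k1 |: [set i; j]))%SET g) ?eqxx //.
  by rewrite cardsU1 [in X in (_ < _ + X)%N]cardsU1 cards2 !inE !negb_or k1i k1j k2i k2j (eq_sym k2) k12 ij.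
move=> q; rewrite !inE => /or4P[] /eqP -> //; apply: gT; by rewrite !inE eqxx ?orbT.
Qed.

(** m is taken on the moment curve, off the finitely many hyperplanes where two of the ratios
    agree. *)
Lemma exists_height (lam : V) : (forall i, 0 < dot lam (u i)) ->
  exists m : V, injective (fun i => dot m (u i) / dot lam (u i)).
Proof.
move=> lam0; pose w i j := dot lam (u j) *: u i - dot lam (u i) *: u j.
have w0 i j : i != j -> w i j != 0.
  move=> ij; apply/eqP => /eqP; rewrite subr_eq0 => /eqP/(generic_pair ij) h.
  by have := lam0 i; rewrite h ltxx.
pose p i j : {poly R} := \poly_(k < 4) w i j 0 (inord k).
have p0 i j : i != j -> p i j != 0.
  move=> /w0; apply: contraNN => /eqP e; apply/eqP/rowP => k; rewrite [RHS]mxE.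
  have := congr1 (fun q : {poly R} => q`_k) e; rewrite coef_poly ltn_ord coef0 => <-.
  by rewrite inord_val.
pose P := \prod_i \prod_(j | i != j) p i j.
have P0 : P != 0 by apply/prodf_neq0 => i _; apply/prodf_neq0 => j; exact: p0.
have [s _ hs] := exists_nonroot 0 P0.
exists (\row_k s ^+ k) => i j e; apply/eqP; apply: contraT => ij.
move: hs; rewrite /P horner_prod (bigD1 i) //= horner_prod (bigD1 j) //=.
suff -> : (p i j).[s] = 0 by rewrite !mul0r eqxx.
have : dot (\row_k s ^+ k) (w i j) = 0.
  rewrite /w dotDr dotNr !dotZr; move: e => /eqP; rewrite eqr_div ?lt0r_neq0 // => /eqP e.
  by rewrite mulrC e mulrC subrr.
move=> <-; rewrite horner_poly; apply: eq_bigr => k _.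
by rewrite [in RHS]mxE mulrC inord_val.
Qed.

(** Each equation makes two of the unknowns opposite in sign or both zero, and three numbers cannot
    be pairwise opposite in sign. *)
Lemma no_three_opposite (x1 x2 x3 p12 p13 p21 p23 p31 p32 : R) :
  0 < p12 -> 0 < p13 -> 0 < p21 -> 0 < p23 -> 0 < p31 -> 0 < p32 ->
  x2 * p12 + x3 * p13 = 0 -> x1 * p21 + x3 * p23 = 0 -> x1 * p31 + x2 * p32 = 0 ->
  [/\ x1 = 0, x2 = 0 & x3 = 0].
Proof.
move=> h12 h13 h21 h23 h31 h32 e1 e2 e3.
have tri (x : R) : [\/ x < 0, 0 < x | x = 0].
  by case: (ltgtP x 0) => h; [apply: Or31|apply: Or32|apply: Or33].
have opp (x y p q : R) : 0 < p -> 0 < q -> x * p + y * q = 0 ->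
    [\/ x = 0 /\ y = 0, 0 < x /\ y < 0 | x < 0 /\ 0 < y].
  move=> p0 q0 e; have [x0|x0|x0] := tri x.
  - have xp : x * p < 0 by rewrite pmulr_llt0.
    have : 0 < y * q by lra.
    by rewrite pmulr_lgt0 // => y0; apply: Or33.
  - have xp : 0 < x * p by rewrite mulr_gt0.
    have : y * q < 0 by lra.
    by rewrite pmulr_llt0 // => y0; apply: Or32.
  - apply: Or31; split=> //; move: e; rewrite x0 mul0r add0r => /eqP.
    by rewrite mulf_eq0 (gt_eqF q0) orbF => /eqP.
have := opp _ _ _ _ h12 h13 e1; have := opp _ _ _ _ h21 h23 e2; have := opp _ _ _ _ h31 h32 e3.
by case=> -[a1 a2]; case=> -[b1 b2]; case=> -[c1 c2]; split=> //; lra.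
Qed.

(** The bound of Euler's formula for simplicial polytopes, by a sweep along the height [rho]. Every
    facet has a middle generator, and a generator v is the middle of at most two facets: these cut
    the hyperplane of height [rho v] in two-dimensional faces through [u v] of a three-dimensional
    cone. The lowest and the highest generator are the middle of none. *)
Lemma card_facets (lam : V) : (forall i, 0 < dot lam (u i)) ->
  (#|[set F : {set 'I_n} | `[< facet F >]]%SET| <= 2 * n - 4)%N.
Proof.
move=> lam0; have [m hinj] := exists_height lam0.
pose rho i := dot m (u i) / dot lam (u i).
have rinj i j : i != j -> rho i != rho j by apply: contra_neq; exact: hinj.
pose E v : {set {set 'I_n}} := [set F : {set 'I_n} | `[< facet F >] && (v \in F) &&
   [exists a in F, exists b in F, (rho a < rho v) && (rho v < rho b)]]%SET.
have covE F : facet F -> exists v, F \in E v.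
  move=> fF; have [F3 _] := fF.
  have /card_gt2P[x [y [z [[xF yF zF] [xy yz zx]]]]] : (2 < #|F|)%N by rewrite F3.
  have M a b c : a \in F -> b \in F -> c \in F -> rho a < rho b -> rho b < rho c -> exists v, F \in E v.
    move=> aF bF cF ab bc; exists b; rewrite inE bF andbT; apply/andP; split; first exact/asboolP.
    by apply/exists_inP; exists a => //; apply/exists_inP; exists c => //; rewrite ab bc.
  have := rinj _ _ xy; have := rinj _ _ yz; have := rinj _ _ zx.
  rewrite !neq_lt => /orP[h1|h1] /orP[h2|h2] /orP[h3|h3].
  - have := lt_trans h1 (lt_trans h3 h2); by rewrite ltxx.
  - exact: M h2 h1 || exact: (M y z x) || exact: (M z x y) || exact: (M y x z) || exact: (M x y z) || exact: (M x z y) || exact: (M z y x).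
  - exact: (M y z x) || exact: (M z x y) || exact: (M y x z) || exact: (M x y z) || exact: (M x z y) || exact: (M z y x).
  - exact: (M y z x) || exact: (M z x y) || exact: (M y x z) || exact: (M x y z) || exact: (M x z y) || exact: (M z y x).
  - exact: (M y z x) || exact: (M z x y) || exact: (M y x z) || exact: (M x y z) || exact: (M x z y) || exact: (M z y x).
  - exact: (M y z x) || exact: (M z x y) || exact: (M y x z) || exact: (M x y z) || exact: (M x z y) || exact: (M z y x).
  - exact: (M y z x) || exact: (M z x y) || exact: (M y x z) || exact: (M x y z) || exact: (M x z y) || exact: (M z y x).
  - have := lt_trans h1 (lt_trans h2 h3); by rewrite ltxx.
have E2 v : (#|E v| <= 2)%N.
  rewrite leqNgt; apply/negP => /card_gt2P[F1 [F2 [F3 [[h1 h2 h3] [n12 n23 n31]]]]].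
  pose h : V := m - rho v *: lam.
  have hE i : dot h (u i) = dot lam (u i) * (rho i - rho v).
    by rewrite dotDl dotNl dotZl mulrBr /rho mulrCA mulfV ?gt_eqF // mulr1 mulrC.
  have dec F : F \in E v -> exists z l, [/\ dot h z = 0, dot l (u v) = 0, dot l z = 0 &
      [/\ forall F' l', F' \in E v -> F' != F -> (forall i, if i \in F' then dot l' (u i) = 0 else 0 < dot l' (u i)) -> 0 < dot l' z
        & forall i, if i \in F then dot l (u i) = 0 else 0 < dot l (u i)]].
    rewrite inE => /andP[/andP[/asboolP[F3' [l hl]] vF] /exists_inP[a aF /exists_inP[b bF /andP[av vb]]]].
    have ha : 0 < - dot h (u a) by rewrite hE -mulrN mulr_gt0 // opprB subr_gt0.
    have hb : 0 < dot h (u b) by rewrite hE mulr_gt0 // subr_gt0.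
    have li i : i \in F -> dot l (u i) = 0 by have := hl i; case: ifP.
    have FE : F = [set a; v; b]%SET.
      apply/esym/eqP; rewrite eqEcard F3'; apply/andP; split.
        by apply/fintype.subsetP => i; rewrite !inE => /orP[/orP[]|] /eqP ->.
      have vb' : v != b by apply: contraTneq vb => ->; rewrite ltxx.
      have av' : a != v by apply: contraTneq av => ->; rewrite ltxx.
      have ab' : a != b by apply: contraTneq (lt_trans av vb) => ->; rewrite ltxx.
      by rewrite finset.setUC cardsU1 !inE negb_or cards2 av' (eq_sym b) ab' (eq_sym b) vb'.
    (* This is where the edge from [u a] to [u b] meets the hyperplane h = 0, which also contains
       [u v]. *)
    exists (dot h (u b) *: u a + (- dot h (u a)) *: u b), l; split.
    - by rewrite dotDr !dotZr; ring.
    - exact: li.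
    - by rewrite dotDr !dotZr !li // !mulr0 addr0.
    - split=> // F' l'; rewrite inE => /andP[/andP[/asboolP[F3'' _] vF'] _] ne hl'.
      have ge i : 0 <= dot l' (u i) by have := hl' i; case: ifP => _; [move=> ->|exact: ltW].
      rewrite dotDr !dotZr.
      have [aF'|aF'] := boolP (a \in F'); have [bF'|bF'] := boolP (b \in F').
      + exfalso; move: ne; apply/negP; rewrite negbK eq_sym eqEcard F3' F3'' leqnn andbT FE.
        by apply/fintype.subsetP => i; rewrite !inE => /orP[/orP[]|] /eqP ->.
      + have := hl' b; rewrite (negbTE bF') => lb.
        by rewrite ltr_wpDl ?mulr_gt0 // mulr_ge0 // ltW.
      + have := hl' a; rewrite (negbTE aF') => la.
        by rewrite ltr_wpDr ?mulr_gt0 // mulr_ge0 // ltW.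
      + have := hl' a; rewrite (negbTE aF') => la.
        by rewrite ltr_wpDr ?mulr_gt0 // mulr_ge0 // ltW.
  have [z1 [l1 [hz1 lv1 lz1 [pos1 hl1]]]] := dec _ h1.
  have [z2 [l2 [hz2 lv2 lz2 [pos2 hl2]]]] := dec _ h2.
  have [z3 [l3 [hz3 lv3 lz3 [pos3 hl3]]]] := dec _ h3.
  pose Z (k : 'I_4) : V := nth 0 [:: z1; z2; z3; u v] k.
  pose M : 'M[R]_4 := \matrix_(i, j) Z i 0 j.
  have hZ k : dot h (Z k) = 0.
    by case: k => [[|[|[|[|?]]]] ?] //=; rewrite /Z /= hE subrr mulr0.
  have dM : \det M = 0.
    apply/eqP; rewrite -det_tr; apply/det0P; exists h.
      apply/eqP => h0; move: h1; rewrite inE => /andP[_ /exists_inP[a _ /exists_inP[b _ /andP[av _]]]].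
      have := hE a; rewrite h0 dot0l => /esym/eqP; rewrite mulf_eq0 gt_eqF //= subr_eq0 => /eqP e.
      by rewrite e ltxx in av.
    apply/rowP => k; rewrite !mxE -[RHS](hZ k); apply: eq_bigr => j _; by rewrite !mxE.
  (* z1, z2, z3 and [u v] lie in the hyperplane h = 0 and are therefore dependent; l1, l2, l3
     applied to the relation give the three equations of [no_three_opposite]. *)
  have /det0P[c c0 cM] : \det M == 0 by rewrite dM.
  have rel l : \sum_(k < 4) c 0 k * dot l (Z k) = 0.
    have e : \sum_(k < 4) c 0 k *: Z k = 0.
      apply/rowP => j; rewrite [RHS]mxE summxE.
      have := congr1 (fun A : 'M[R]_(1, 4) => A 0 j) cM; rewrite !mxE => e.
      by rewrite -[RHS]e; apply: eq_bigr => k _; rewrite !mxE.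
    rewrite -[RHS](dot0r l) -e dot_sumr; apply: eq_bigr => k _; by rewrite dotZr.
  have R4 (f : 'I_4 -> R) : \sum_(k < 4) f k = f (inord 0) + f (inord 1) + f (inord 2) + f (inord 3).
    rewrite !big_ord_recl big_ord0 addr0 !addrA; congr (_ + _ + _ + _); congr f; apply: val_inj; by rewrite /= inordK.
  have Zi : [/\ Z (inord 0) = z1, Z (inord 1) = z2, Z (inord 2) = z3 & Z (inord 3) = u v].
    by split; rewrite /Z inordK.
  have [Z0 Z1 Z2 Z3] := Zi.
  have r1 := rel l1; have r2 := rel l2; have r3 := rel l3.
  rewrite !R4 Z0 Z1 Z2 Z3 in r1 r2 r3.
  rewrite lz1 lv1 !mulr0 add0r addr0 in r1.
  rewrite lz2 lv2 !mulr0 addr0 addr0 in r2.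
  rewrite lz3 lv3 !mulr0 addr0 addr0 in r3.
  have p12 := pos2 _ l1 h1 n12 hl1; have p13 := pos3 _ l1 h1 (ltac:(by rewrite eq_sym)) hl1.
  have p21 := pos1 _ l2 h2 (ltac:(by rewrite eq_sym)) hl2; have p23 := pos3 _ l2 h2 n23 hl2.
  have p31 := pos1 _ l3 h3 n31 hl3; have p32 := pos2 _ l3 h3 (ltac:(by rewrite eq_sym)) hl3.
  have [e0 e1 e2] := no_three_opposite p12 p13 p21 p23 p31 p32 r1 r2 r3.
  have e3 : c 0 (inord 3) = 0.
    have := rel lam; rewrite R4 e0 e1 e2 !mul0r !add0r Z3 => /eqP.
    by rewrite mulf_eq0 (gt_eqF (lam0 v)) orbF => /eqP.
  move: c0 => /negP; apply; apply/eqP/rowP => k; rewrite mxE.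
  have -> : k = inord k by rewrite inord_val.
  by case: k => [[|[|[|[|?]]]] ?] //=.
have n0 : (0 < n)%N by exact: leq_trans n4.
pose i0 := Ordinal n0.
pose vmin := [arg min_(i < i0) rho i]%O; pose vmax := [arg max_(i > i0) rho i]%O.
have hmin i : rho vmin <= rho i by rewrite /vmin; case: arg_minP => // j _; apply.
have hmax i : rho i <= rho vmax by rewrite /vmax; case: arg_maxP => // j _; apply.
have mm : vmin != vmax.
  have n1 : (1 < n)%N by apply: leq_trans n4.
  apply/eqP => e; have : Ordinal n0 != Ordinal n1 by [].
  by move=> /rinj /negP; apply; rewrite eq_le; apply/andP; split; apply: (le_trans (hmax _)); rewrite -e.
have Emin : E vmin = finset.set0.
  apply/finset.setP => F; rewrite !inE; apply/negP => /andP[_ /exists_inP[a _ /exists_inP[b _ /andP[h _]]]].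
  by have := lt_le_trans h (hmin a); rewrite ltxx.
have Emax : E vmax = finset.set0.
  apply/finset.setP => F; rewrite !inE; apply/negP => /andP[_ /exists_inP[a _ /exists_inP[b _ /andP[_ h]]]].
  by have := lt_le_trans h (hmax b); rewrite ltxx.
have sub : [set F : {set 'I_n} | `[< facet F >]]%SET \subset (\bigcup_v E v)%SET.
  apply/fintype.subsetP => F; rewrite inE => /asboolP/covE[v hv]; apply/finset.bigcupP; by exists v.
apply: (leq_trans (subset_leq_card sub)).
have leU (J : seq 'I_n) : (#|(\bigcup_(v <- J) E v)%SET| <= \sum_(v <- J) #|E v|)%N.
  elim/big_ind2: _ => //; first by rewrite cards0.
  by move=> a A b B hA hB; apply: leq_trans (leq_card_setU A B) _; exact: leq_add.
apply: (leq_trans (leU _)).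
rewrite (bigD1 vmin) //= Emin cards0 add0n (bigD1 vmax) ?(eq_sym vmax) //= Emax cards0 add0n.
apply: (@leq_trans (\sum_(v | (v != vmin) && (v != vmax)) 2)); first by apply: leq_sum => v _.
rewrite sum_nat_const mulnC; apply: (@leq_trans (2 * (n - 2))); last by rewrite mulnBr.
rewrite leq_mul2l /=.
have -> : #|[pred v | (v != vmin) && (v != vmax)]| = #|~: [set vmin; vmax]%SET|.
  by apply: eq_card => v; rewrite !inE negb_or.
by rewrite cardsCs finset.setCK cards2 mm card_ord.
Qed.

End GenericCone.

(** * Covering an arbitrary cone by few simplicial cones, by perturbation *)

Section FewTriples.
Context {R : realType} {n : nat}.
Local Notation V := 'rV[R]_4.
Variables (u : 'I_n -> V) (lam : V).
Hypotheses (n4 : (4 <= n)%N) (lam0 : forall i, 0 < dot lam (u i)).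

(** Points of the moment curve; up to scaling, r u + moment is a small perturbation of u when r is
    large. *)
Let moment (i : 'I_n) : V := \row_k ((i : nat)%:R ^+ k).
Let v (r : R) i : V := r *: u i + moment i.

Let covers (w : 'I_n -> V) (T : {set {set 'I_n}}) := forall p x,
  ncomb w [set: 'I_n]%SET x -> exists2 F, F \in T & ncomb w (p |: F)%SET x.

(** Each four-by-four minor is a polynomial in r whose value at 0 is a Vandermonde determinant of
    distinct nodes. *)
Lemma exists_generic (N : R) : exists2 r, N <= r & generic (v r).
Proof.
pose M (f : {ffun 'I_4 -> 'I_n}) : 'M[{poly R}]_4 :=
  \matrix_(a, k) ((u (f a) 0 k)%:P * 'X + ((f a : nat)%:R ^+ k)%:P).
have Mr f r : map_mx (horner_eval r) (M f) = \matrix_(a, k) v r (f a) 0 k.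
  by apply/matrixP => a k; rewrite !mxE /= /horner_eval !hornerE mulrC.
have M0 (f : {ffun 'I_4 -> 'I_n}) : injective f -> \det (M f) != 0.
  move=> fi; apply/eqP => /(congr1 (horner_eval 0)); rewrite -det_map_mx Mr.
  have -> : (\matrix_(a, k) v 0 (f a) 0 k) = (Vandermonde 4 (\row_a (f a : nat)%:R))^T :> 'M[R]_4.
    by apply/matrixP => a k; rewrite !mxE mul0r add0r.
  rewrite det_tr det_Vandermonde /horner_eval horner0 => /eqP; apply/negP.
  apply/prodf_neq0 => i _; apply/prodf_neq0 => j ij; rewrite !mxE subr_eq0 eqr_nat.
  by apply: contraTN ij => /eqP/val_inj/fi ->; rewrite ltnn.
have P0 : \prod_(f : {ffun 'I_4 -> 'I_n} | injectiveb f) \det (M f) != 0.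
  by apply/prodf_neq0 => f /injectiveP; exact: M0.
have [r Nr hr] := exists_nonroot N P0.
exists r => // T l T4 lT; apply/eqP; apply: contraTT hr => l0.
pose f : {ffun 'I_4 -> 'I_n} := [ffun a => enum_val (widen_ord T4 a)].
have fi : injective f by move=> a b; rewrite !ffunE => /enum_val_inj [] /val_inj.
rewrite negbK horner_prod (bigD1 f) /=; last exact/injectiveP.
suff -> : (\det (M f)).[r] = 0 by rewrite mul0r.
rewrite -/(horner_eval r _) -det_map_mx Mr -det_tr; apply/eqP/det0P; exists l => //.
apply/rowP => a; rewrite [RHS]mxE -(lT (f a)); last by rewrite ffunE enum_valP.
by rewrite mxE; apply: eq_bigr => k _; rewrite !mxE.
Qed.

(** A point missed by all cones of T is separated from each of them by Farkas. Adding a small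
    multiple of [lam] makes the separation strict on the generators, and a strict separation
    survives the perturbation. *)
Lemma covers_eventually T : ~ covers u T -> exists N, forall r, N <= r -> ~ covers (v r) T.
Proof.
move=> bad.
have [p [x [[t t0 xE] hF]]] : exists p x, ncomb u [set: 'I_n]%SET x /\
    forall F, F \in T -> ~ ncomb u (p |: F)%SET x.
  apply: contrapT => h; apply: bad => p x cx; apply: contrapT => h2; apply: h.
  by exists p, x; split=> // F FT cF; apply: h2; exists F.
have dl (f : V) r i : dot f (v r i) = r * dot f (u i) + dot f (moment i).
  by rewrite dotDr dotZr.
pose y r := \sum_(i in [set: 'I_n]%SET) t i *: v r i.
have yE (f : V) r : dot f (y r) = r * dot f x + \sum_(i in [set: 'I_n]%SET) t i * dot f (moment i).
  rewrite xE !dot_sumr mulr_sumr -big_split; apply: eq_bigr => i _ /=.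
  by rewrite !dotZr dl; ring.
have [N hN] : exists N, forall r, N <= r -> forall F, F \in T -> ~ ncomb (v r) (p |: F)%SET (y r).
  apply: eventually_all => F; have [FT|_] := boolP (F \in T); last by exists 0.
  have [/hF h|[g gF gx]] := Farkas (p |: F)%SET u x; first by have := h FT.
  pose del := - dot g x / (2 * (`|dot lam x| + 1)).
  have den : 0 < 2 * (`|dot lam x| + 1) by rewrite mulr_gt0 // ltr_wpDl.
  have del0 : 0 < del by rewrite divr_gt0 // oppr_gt0.
  pose f := g + del *: lam.
  have fpos i : i \in (p |: F)%SET -> 0 < dot f (u i).
    by move=> iF; rewrite dotDl dotZl ltr_wpDl ?gF // mulr_gt0.
  have fx : 0 < - dot f x.
    rewrite dotDl dotZl opprD subr_gt0.
    have h1 : del * (2 * (`|dot lam x| + 1)) = - dot g x by rewrite mulfVK ?gt_eqF.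
    have h2 := ler_wpM2l (ltW del0) (ler_norm (dot lam x)).
    have := mulr_ge0 (ltW del0) (normr_ge0 (dot lam x)); lra.
  have [N1 hN1] : exists N, forall r, N <= r -> forall i, i \in (p |: F)%SET -> 0 < dot f (v r i).
    apply: eventually_all => i; have [iF|_] := boolP (i \in (p |: F)%SET); last by exists 0.
    have [N h] := eventually_affine_gt0 (dot f (moment i)) (fpos _ iF).
    by exists N => r /h h' _; rewrite dl.
  have [N2 hN2] := eventually_affine_gt0 (- \sum_(i in [set: 'I_n]%SET) t i * dot f (moment i)) fx.
  exists (Num.max N1 N2) => r; rewrite ge_max => /andP[h1 h2] _ cF.
  have := ncomb_ge0 (fun i iF => ltW (hN1 _ h1 i iF)) cF; rewrite yE.
  by have := hN2 _ h2; rewrite mulrN -opprD oppr_gt0 => /lt_le_trans /[apply]; rewrite ltxx.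
exists N => r /hN h cov; have [|F FT cF] := cov p (y r); first by exists t.
exact: h cF.
Qed.

(* The facets of a generic perturbation serve, because failure on u is an open condition. *)
Lemma few_triples : exists T : {set {set 'I_n}}, [/\ (#|T| <= 2 * n - 4)%N,
  forall F, F \in T -> #|F| = 3 & forall p x, ncomb u [set: 'I_n]%SET x ->
    exists2 F, F \in T & ncomb u (p |: F)%SET x].
Proof.
have [N1 hN1] : exists N, forall r, N <= r -> forall i, 0 < dot lam (v r i).
  apply: eventually_all => i; have [N h] := eventually_affine_gt0 (dot lam (moment i)) (lam0 i).
  by exists N => r /h; rewrite dotDr dotZr.
have [N2 hN2] : exists N, forall r, N <= r -> forall T, ~ covers u T -> ~ covers (v r) T.
  apply: eventually_all => T; have [c|/covers_eventually [N h]] := pselect (covers u T).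
    by exists 0 => r _ /(_ c).
  by exists N => r /h.
have [r] := exists_generic (Num.max N1 N2); rewrite ge_max => /andP[/hN1 l0 r2] gen.
pose T := [set F : {set 'I_n} | `[< facet (v r) F >]]%SET.
exists T; split; first exact: (card_facets gen n4 l0).
  by move=> F; rewrite inE => /asboolP[].
apply: contrapT => /(hN2 _ r2); apply => p x cx.
have [F fF cF] := generic_cover gen n4 l0 p cx.
by exists F => //; rewrite inE; exact/asboolP.
Qed.

End FewTriples.

(** * At most twelve pairs of minimal vectors in a lattice of rank four *)

Section Kissing.
Context {R : realType}.
Local Notation L := 'rV[int]_4.
Variables (b : L -> L -> R) (m : R).
Hypotheses (bC : forall x y, b x y = b y x) (bD : forall x y z, b (x + y) z = b x z + b y z).
Hypotheses (m0 : 0 < m) (b_ge : forall x, x != 0 -> m <= b x x).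

Local Notation cls := ((bool * bool) * (bool * bool))%type.
Let xorc (x y : cls) : cls := ((x.1.1 (+) y.1.1, x.1.2 (+) y.1.2), (x.2.1 (+) y.2.1, x.2.2 (+) y.2.2)).
Let c0 : cls := ((false, false), (false, false)).

(** The class modulo 2L, a vector of F_2^4 with addition [xorc]. *)
Definition parity (x : L) : cls :=
  ((odd `|x 0 (inord 0)|, odd `|x 0 (inord 1)|), (odd `|x 0 (inord 2)|, odd `|x 0 (inord 3)|)).

Lemma odd_abszD (x y : int) : odd `|x + y| = odd `|x| (+) odd `|y|.
Proof. lia. Qed.

Lemma parityD x y : parity (x + y) = xorc (parity x) (parity y).
Proof. by rewrite /parity /xorc !mxE !odd_abszD. Qed.

Lemma parityN x : parity (- x) = parity x.
Proof. by rewrite /parity !mxE !abszN. Qed.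

Lemma parity_half x : parity x = c0 -> exists y, x = y + y.
Proof.
move=> [e0 e1 e2 e3]; exists (\row_i divz (x 0 i) 2); apply/rowP => i; rewrite !mxE.
have h (z : int) : odd `|z| = false -> z = (z %/ 2)%Z + (z %/ 2)%Z by lia.
apply: h; rewrite -(inord_val i).
by case: i => [[|[|[|[|?]]]] ?].
Qed.

Lemma bil0 z : b 0 z = 0.
Proof. by have := bD 0 0 z; rewrite addr0 => /eqP; rewrite -subr_eq0 opprD addNKr oppr_eq0 => /eqP. Qed.

Lemma bilN x z : b (- x) z = - b x z.
Proof. by apply/eqP; rewrite -addr_eq0 -bD addNr bil0. Qed.

Lemma bilDr z x y : b z (x + y) = b z x + b z y.
Proof. by rewrite bC bD (bC x) (bC y). Qed.

Lemma bilNr z x : b z (- x) = - b z x.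
Proof. by rewrite bC bilN bC. Qed.

Lemma minimal_parity u : b u u = m -> parity u <> c0.
Proof.
move=> um /parity_half[x e]; move: um; rewrite e bD !bilDr => h.
have x0 : x != 0 by apply/eqP => x0; move: m0; rewrite -h x0 !bil0 !addr0 ltxx.
by have := b_ge x0; have := m0; lra.
Qed.

(** (u + v) / 2 and (u - v) / 2 are lattice vectors whose norms add up to m, so one of them is 0. *)
Lemma minimal_parity_inj u v : b u u = m -> b v v = m -> parity u = parity v -> u = v \/ u = - v.
Proof.
move=> um vm e.
have /parity_half[x ex] : parity (u + v) = c0.
  by rewrite parityD e /xorc !addbb.
have eu : u = x + x - v by rewrite -ex addrK.
have [x0|x0] := eqVneq x 0; first by right; rewrite eu x0 addr0 add0r.
have [y0|y0] := eqVneq (x - v) 0.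
  by left; rewrite eu -addrA y0 addr0; apply/eqP; rewrite -subr_eq0 y0.
exfalso; have := m0; have := b_ge x0; have := b_ge y0.
move: um; rewrite {1 2}eu !(bD, bilDr, bilN, bilNr) (bC v x); lra.
Qed.

(** With 2x = u + v + w, the norms of x, x - u, x - v and x - w add up to 3m. Hence one of these
    four vectors is 0, and each case determines [b u v]. *)
Lemma minimal_line u v w : b u u = m -> b v v = m -> b w w = m ->
  parity w = xorc (parity u) (parity v) -> 2 * b u v = m \/ 2 * b u v = - m.
Proof.
move=> um vm wm e.
have /parity_half[x ex] : parity (u + v + w) = c0 by rewrite !parityD e /xorc /= !addbb.
have ew : w = x + x - (u + v) by rewrite -ex addrC addKr.
have key : b x x + b (x - w) (x - w) + b (x - u) (x - u) + b (x - v) (x - v) = 3 * m.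
  move: wm; rewrite ew !(opprD, opprK, bD, bilDr, bilN, bilNr) (bC v u) (bC u x) (bC v x); lra.
have [x0|x0] := eqVneq x 0.
  by right; move: wm; rewrite ew x0 addr0 add0r !(bD, bilDr, bilN, bilNr) (bC v u); lra.
have [xw|xw] := eqVneq (x - w) 0.
  right; have ew' : w = u + v.
    by move: ex; move/eqP: xw; rewrite subr_eq0 => /eqP -> /addIr.
  by move: wm; rewrite ew' !(bD, bilDr) (bC v u); lra.
have [xu|xu] := eqVneq (x - u) 0.
  left; have ew' : w = u - v.
    by move/eqP: xu; rewrite subr_eq0 => /eqP xu; rewrite ew xu opprD addrACA subrr add0r.
  by move: wm; rewrite ew' !(bD, bilDr, bilN, bilNr) (bC v u); lra.
have [xv|xv] := eqVneq (x - v) 0.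
  left; have ew' : w = v - u.
    by move/eqP: xv; rewrite subr_eq0 => /eqP xv; rewrite ew xv opprD addrACA subrr addr0.
  by move: wm; rewrite ew' !(bD, bilDr, bilN, bilNr) (bC v u); lra.
exfalso; have := m0; have := b_ge x0; have := b_ge xw; have := b_ge xu; have := b_ge xv; lra.
Qed.

(** The nonzero classes of a three-dimensional subspace of F_2^4 cannot all contain minimal vectors.
    Signs are chosen with 2 b(u, v) = 2 b(u, w) = - m. If 2 b(v, w) = m, then u + v is minimal and
    orthogonal to w, against [minimal_line]; if it is - m, then u + v + w has norm 0, although its
    class contains a minimal vector. *)
Lemma no_minimal_plane u v w uv uw vw uvw :
  b u u = m -> b v v = m -> b w w = m -> b uv uv = m -> b uw uw = m -> b vw vw = m -> b uvw uvw = m ->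
  parity uv = xorc (parity u) (parity v) -> parity uw = xorc (parity u) (parity w) ->
  parity vw = xorc (parity v) (parity w) -> parity uvw = xorc (parity uv) (parity w) -> False.
Proof.
move=> um vm wm uvm uwm vwm uvwm euv euw evw euvw.
have norm x : b x x = m -> 2 * b u x = m \/ 2 * b u x = - m ->
    exists y, [/\ b y y = m, 2 * b u y = - m & parity y = parity x].
  move=> xm [h|h]; last by exists x.
  by exists (- x); rewrite parityN bilN !bilNr; split=> //; lra.
have [v' [vm' uv' pv']] := norm _ vm (minimal_line um vm uvm euv).
have [w' [wm' uw' pw']] := norm _ wm (minimal_line um wm uwm euw).
rewrite -pv' -pw' in euv evw; rewrite -pw' in euvw.
have [h|h] := minimal_line vm' wm' vwm evw.
  have um' : b (u + v') (u + v') = m by rewrite !(bD, bilDr) (bC v' u); lra.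
  have pe : parity uvw = xorc (parity (u + v')) (parity w') by rewrite euvw euv parityD.
  by case: (minimal_line um' wm' uvwm pe); rewrite bD; have := m0; lra.
have z : b (u + v' + w') (u + v' + w') = 0.
  by rewrite !(bD, bilDr) (bC v' u) (bC w' u) (bC w' v'); lra.
have s0 : u + v' + w' = 0.
  apply/eqP; apply: contraT => /b_ge; rewrite z => h1; have := m0; lra.
have := minimal_parity uvwm; rewrite euvw euv -!parityD s0; apply.
by rewrite /parity !mxE.
Qed.

Let bools := [:: false; true].
Let classes : seq cls := [seq (p, q) | p <- [seq (x, y) | x <- bools, y <- bools],
                                       q <- [seq (x, y) | x <- bools, y <- bools]].

Lemma mem_classes x : x \in classes.
Proof. by case: x => [[[] []] [[] []]]. Qed.

Let bits (k : nat) : cls := ((odd k, odd k./2), (odd k./2./2, odd k./2./2./2)).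

(* Bases of the fifteen hyperplanes of F_2^4. *)
Let planes : seq (nat * nat * nat) := [:: (2, 4, 8); (1, 4, 8); (3, 4, 8); (1, 2, 8); (2, 5, 8);
  (1, 6, 8); (3, 5, 8); (1, 2, 4); (2, 4, 9); (1, 4, 10);
  (3, 4, 9); (1, 2, 12); (2, 5, 9); (1, 6, 10); (3, 5, 9)]%N.

Let plane (p q r : cls) := [:: p; q; r; xorc p q; xorc p r; xorc q r; xorc (xorc p q) r].

(** Each nonzero point lies on seven of the fifteen hyperplanes and two distinct ones on three in
    common, so at least four hyperplanes avoid both; verified by enumeration. *)
Lemma plane_avoiding_two_points (x y : cls) : exists p q r,
  all (fun z => (z != x) && (z != y) && (z != c0)) (plane p q r).
Proof.
have : all (fun x => all (fun y => has (fun t =>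
    all (fun z => (z != x) && (z != y) && (z != c0)) (plane (bits t.1.1) (bits t.1.2) (bits t.2)))
  planes) classes) classes by vm_compute.
move=> /allP/(_ x (mem_classes x))/allP/(_ y (mem_classes y))/hasP[[[p q] r] _ h].
by exists (bits p), (bits q), (bits r).
Qed.

(** Representatives of distinct pairs have distinct nonzero classes. Thirteen of them would leave
    out at most two of the fifteen, and a hyperplane avoiding these two contradicts
    [no_minimal_plane]. *)
Lemma kissing (s : seq L) : uniq s -> (forall v, v \in s -> b v v = m /\ - v \notin s) ->
  (size s <= 12)%N.
Proof.
move=> us sm; rewrite leqNgt; apply/negP => s13.
pose S := [set z in map parity s]%SET.
have inj : {in s &, injective parity}.
  move=> u v us' vs' e; have [um nu] := sm _ us'; have [vm nv] := sm _ vs'.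
  have [//|h] := minimal_parity_inj um vm e.
  by move: nv; rewrite -h us'.
have cS : #|S| = size s.
  by rewrite cardsE (card_uniqP _) ?size_map // map_inj_in_uniq.
have memS z : z \in S -> exists2 v, b v v = m & parity v = z.
  by rewrite inE => /mapP[v vs ->]; exists v => //; have [] := sm _ vs.
pose E := (~: S :\ c0)%SET.
have E2 : (#|E| <= 2)%N.
  have cS' : c0 \in (~: S)%SET.
    by rewrite inE; apply/negP => /memS[v vm /minimal_parity]; apply.
  have h16 : #|{: cls}| = 16 by rewrite !card_prod !card_bool.
  have := cardsC S; rewrite cS (cardsD1 c0 (~: S)%SET) cS' h16 -/E; lia.
have [x [y hxy]] : exists x y, forall z, z \in E -> z = x \/ z = y.
  exists (nth c0 (enum E) 0), (nth c0 (enum E) 1) => z; rewrite -mem_enum.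
  move: E2; rewrite cardE; case: (enum E) => [|x [|y [|? ?]]] //= _; rewrite !inE.
    by move/eqP; left.
  by case/orP => /eqP; [left|right].
have [p [q [r /allP h]]] := plane_avoiding_two_points x y.
have inS z : z \in plane p q r -> exists2 v, b v v = m & parity v = z.
  move=> /h /andP[/andP[zx zy] z0]; apply: memS; apply: contraT => zS.
  have : z \in E by rewrite inE [in X in _ && X]inE zS inE z0.
  by case/hxy => e; [move: zx|move: zy]; rewrite e eqxx.
have mem k : (k < 7)%N -> nth c0 (plane p q r) k \in plane p q r by move=> k7; apply: mem_nth.
have [u um ep] := inS _ (mem 0%N isT); have [v vm eq] := inS _ (mem 1%N isT).
have [w wm er] := inS _ (mem 2%N isT); have [uv uvm epq] := inS _ (mem 3%N isT).
have [uw uwm epr] := inS _ (mem 4%N isT); have [vw vwm eqr] := inS _ (mem 5%N isT).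
have [uvw uvwm epqr] := inS _ (mem 6%N isT).
rewrite /= in ep eq er epq epr eqr epqr.
by apply: (no_minimal_plane um vm wm uvm uwm vwm uvwm); rewrite ?epq ?epr ?eqr ?epqr ?ep ?eq ?er.
Qed.

End Kissing.

(** * The ring of integers of an imaginary quadratic field *)

Section IntegerRing.
Context {R : realType}.
Implicit Types (d p q : int).

(** [tro] and [nmo] are the trace and norm of omega, which is (1 + sqrt d) / 2 or sqrt d according
    to d modulo 4. *)
Definition tro d : int := if (d %% 4)%Z == 1 then 1 else 0.
Definition nmo d : int := if (d %% 4)%Z == 1 then ((1 - d) %/ 4)%Z else - d.

Lemma disc_tro d : disc d = tro d ^+ 2 - 4 * nmo d.
Proof. rewrite /disc /tro /nmo; case: eqP => h; rewrite ?expr2; lia. Qed.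

Definition absdisc d : R := `|disc d|%:~R.

Lemma absdisc_gt0 d : d < 0 -> 0 < absdisc d.
Proof. by move=> d0; rewrite /absdisc ltr0z /disc; case: ifP => _; lia. Qed.

Lemma absdiscE d : d < 0 -> absdisc d = 4 * (nmo d)%:~R - (tro d)%:~R ^+ 2.
Proof.
move=> d0; rewrite /absdisc ltr0_norm; last by rewrite /disc; case: ifP => _; lia.
by rewrite disc_tro opprB !(rmorphB, rmorphM, rmorphXn).
Qed.

(* p + q * omega, where 1, omega is a basis of the ring of integers. *)
Definition qint d p q : R[i] :=
  Complex (p%:~R + q%:~R * (tro d)%:~R / 2) (q%:~R * Num.sqrt (absdisc d) / 2).

Lemma qintD d p q p' q' : qint d p q + qint d p' q' = qint d (p + p') (q + q').
Proof. by apply: complex_ext; rewrite ?reim /= !rmorphD /=; ring. Qed.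

Lemma qintN d p q : - qint d p q = qint d (- p) (- q).
Proof. by apply: complex_ext; rewrite ?reim /= !rmorphN /=; ring. Qed.

Lemma qintM d p q p' q' : d < 0 ->
  qint d p q * qint d p' q' = qint d (p * p' - nmo d * q * q') (p * q' + q * p' + tro d * q * q').
Proof.
move=> d0; have e := absdiscE d0; have := sqr_sqrtr (ltW (absdisc_gt0 d0)); rewrite {2}e => h.
apply: complex_ext; rewrite ?reim /= !(rmorphD, rmorphN, rmorphM) /=; last by field.
move: h; set s := Num.sqrt _; move: (nmo d)%:~R (tro d)%:~R => n t h.
have -> : q%:~R * s / 2 * (q'%:~R * s / 2) = q%:~R * q'%:~R * (4 * n - t ^+ 2) / 4 by rewrite -h; field.
by field.
Qed.

Lemma qint_conj d p q : Num.conj (qint d p q) = qint d (p + tro d * q) (- q).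
Proof. by apply: complex_ext; rewrite ?reim /= !(rmorphD, rmorphN, rmorphM) /=; field. Qed.

Lemma qint_rC d p : qint d p 0 = rC p%:~R.
Proof. by apply: complex_ext; rewrite /= !mul0r ?addr0. Qed.

Lemma normC2_qint d p q : d < 0 ->
  normC2 (qint d p q) = (p ^+ 2 + tro d * p * q + nmo d * q ^+ 2)%:~R.
Proof.
move=> d0; apply: rC_inj; rewrite -conjM_normC2 qint_conj qintM // -(qint_rC d).
by congr qint; ring.
Qed.

Lemma qint_eq d p q p' q' : d < 0 -> qint d p q = qint d p' q' -> p = p' /\ q = q'.
Proof.
move=> d0 [e1 e2].
have eq : q = q'.
  apply: (@intr_inj R); move/(congr1 (fun x => x * 2)): e2; rewrite !divfK ?pnatr_eq0 //.
  by apply: mulIf; rewrite gt_eqF // sqrtr_gt0 absdisc_gt0.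
by split=> //; apply: (@intr_inj R); move: e1; rewrite eq; exact: addIr.
Qed.

Lemma qint_eq0 d p q : d < 0 -> (qint d p q == 0) = (p == 0) && (q == 0).
Proof.
move=> d0; have e0 : qint d 0 0 = 0 by rewrite qint_rC.
apply/eqP/andP => [|[/eqP -> /eqP ->] //].
by rewrite -e0 => /(qint_eq d0)[-> ->].
Qed.

Lemma quadratic_integral (z : R[i]) (a n : int) :
  z ^+ 2 - a%:~R * z + n%:~R = 0 -> integral_over_Z z.
Proof.
move=> e; exists ('X^2 + (- (a%:P * 'X) + n%:P)); split.
  rewrite monicE lead_coefDl ?lead_coefXn // size_polyXn.
  apply: leq_ltn_trans (size_polyD _ _) _; rewrite size_polyN gtn_max; apply/andP; split.
    by rewrite ltnS mul_polyC (leq_trans (size_scale_leq _ _)) // size_polyX.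
  by rewrite ltnS (leq_trans (size_polyC_leq1 _)).
rewrite /root -[eqbRHS]e; apply/eqP.
rewrite !(rmorphD, rmorphN, rmorphM, rmorphXn) /= map_polyX !map_polyC /= !hornerE.
by rewrite expr2.
Qed.

(** Gauss's lemma: a multiple of X - x with integer coefficients divides the monic polynomial p over
    the integers, so its leading coefficient is a unit. *)
Lemma rational_integral (x : rat) : integral_over_Z (ratr x : R[i]) -> exists n : int, x = n%:~R.
Proof.
move=> [p [pm rp]].
have : root (map_poly intr p) x.
  rewrite -(fmorph_root (ratr : {rmorphism rat -> R[i]})) -map_poly_comp.
  by rewrite (eq_map_poly (g := intr)) // => n; rewrite /= ratr_int.
rewrite -dvdp_XsubCl => /dvdpP_rat_int[p1 [a a0 e] [r er]].
have sp1 : size p1 = 2.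
  by have := congr1 (fun q : {poly rat} => size q) e; rewrite size_XsubC size_scale // size_rat_int_poly.
have := congr1 lead_coef er; rewrite (monicP pm) lead_coefM => /esym u.
have u1 : lead_coef p1 \is a GRing.unit by apply/unitrPr; exists (lead_coef r).
have := congr1 (fun q : {poly rat} => q`_1) e; have := congr1 (fun q : {poly rat} => q`_0) e.
rewrite !coefB !coefX !coefC /= !coefZ !coef_map /= sub0r subr0.
have -> : p1`_1 = lead_coef p1 by rewrite lead_coefE sp1.
move: u1; rewrite unfold_in => /orP[] /eqP -> e0 e1; move: e0 e1.
  by rewrite mulr1 => e0 e1; exists (- p1`_0); apply: oppr_inj; rewrite rmorphN opprK e0 -e1 mul1r.
rewrite rmorphN /= mulrN1 => e0 e1; exists p1`_0; apply: oppr_inj; rewrite e0.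
by rewrite -[a]opprK -e1 mulN1r.
Qed.

(** A prime factor of the denominator of r would divide d twice. *)
Lemma squarefree_denominator d (r : rat) (e : int) : squarefree_int d ->
  d%:~R * r ^+ 2 = e%:~R -> exists c : int, r = c%:~R.
Proof.
move=> sf h; have den0 : (denq r)%:~R != 0 :> rat by rewrite intr_eq0 denq_neq0.
have e1 : d * numq r ^+ 2 = e * denq r ^+ 2.
  apply: (@intr_inj rat); rewrite !(rmorphXn, rmorphM) /= -h -{2}[r]divq_num_den expr_div_n.
  by rewrite -mulrA divfK // expf_neq0.
have e2 : (`|d| * `|numq r| ^ 2 = `|e| * `|denq r| ^ 2)%N.
  by have := congr1 absz e1; rewrite !(abszX, abszM).
have [d1|d1] := eqVneq `|denq r|%N 1%N.
  exists (numq r); rewrite -[LHS]divq_num_den.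
  have -> : denq r = 1 by have := denq_gt0 r; lia.
  by rewrite divr1.
have p1 : (1 < `|denq r|)%N by have := denq_gt0 r; lia.
have pp := pdiv_prime p1; set p := pdiv _ in pp.
have pd : (p %| `|denq r|)%N by exact: pdiv_dvd.
exfalso; have := sf p pp; apply/negP; rewrite negbK.
have : (p ^ 2 %| `|d| * `|numq r| ^ 2)%N by rewrite e2 dvdn_mull // dvdn_exp2r.
rewrite Gauss_dvdl // coprimeXl // coprimeXr // coprime_sym.
by have := coprime_num_den r; exact: coprime_dvdr.
Qed.

Lemma squarefree_mod4 d : squarefree_int d -> (d %% 4)%Z != 0.
Proof. by move=> /(_ 2%N isT); apply: contra => /eqP; lia. Qed.

Lemma ratr_complex (x : rat) : rC (ratr x) = ratr x :> R[i].
Proof. exact: (fmorph_rat (real_complex R)). Qed.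

Lemma sqrtd_sqr d : d < 0 -> sqrtd d ^+ 2 = d%:~R :> R[i].
Proof.
move=> d0; have -> : d%:~R = rC d%:~R :> R[i] by apply/esym; exact: (rmorph_int (real_complex R)).
have h : Num.sqrt (- d%:~R) ^+ 2 = - d%:~R :> R by rewrite sqr_sqrtr // oppr_ge0 lerz0 ltW.
rewrite expr2; apply: complex_ext; rewrite !reim /= ?mulr0 ?mul0r ?addr0 // sub0r -expr2 h.
by rewrite opprK.
Qed.

Lemma sqrt_absdisc d : d < 0 ->
  Num.sqrt (absdisc d) = (if (d %% 4)%Z == 1 then 1 else 2) * Num.sqrt (- d%:~R) :> R.
Proof.
move=> d0; rewrite /absdisc /disc; case: ifP => _; first by rewrite mul1r ltr0_norm // rmorphN.
rewrite normrM (ltr0_norm d0) rmorphM /= rmorphN /= sqrtrM ?ler0n //.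
have -> : `|4|%:~R = 2 ^+ 2 :> R by rewrite -natrX.
by rewrite sqrtr_sqr ger0_norm.
Qed.

Lemma integral_conj (z : R[i]) : integral_over_Z z -> integral_over_Z (Num.conj z).
Proof.
move=> [p [pm rp]]; exists p; split=> //.
rewrite (_ : map_poly _ p = map_poly Num.conj (map_poly intr p)) ?rmorph_root //.
by rewrite -map_poly_comp; apply: eq_map_poly => n /=; rewrite rmorph_int.
Qed.

(** For an integral z = p + q sqrt d, the trace a = 2p and the norm n = p^2 - d q^2 are integers,
    and then so is c = 2q because d is squarefree. The relation a^2 - 4n = d c^2 modulo 4 decides
    the parities of a and c. *)
Lemma OFP d (z : R[i]) : d < 0 -> squarefree_int d -> OF d z <-> exists p q : int, z = qint d p q.
Proof.
move=> d0 sf; have sd := sqrtd_sqr d0; split=> [[[p [q e]] iz]|[p [q ->]]].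
  have icz := integral_conj iz.
  have cE : Num.conj z = rC (ratr p) - rC (ratr q) * sqrtd d.
    by rewrite e; apply: complex_ext; rewrite !reim /=; ring.
  have int_over (w : R[i]) : integral_over_Z w <-> integralOver (intr : int -> R[i]) w.
    by split=> [[s [s1 s2]]|[s s1 s2]]; exists s.
  have [a ea] : exists a : int, 2 * p = a%:~R.
    apply: rational_integral; apply/int_over.
    have -> : ratr (2 * p) = z + Num.conj z.
      by rewrite cE e !ratr_complex rmorphM /= rmorph_nat; ring.
    by apply: integral_add; exact/int_over.
  have [n en] : exists n : int, p ^+ 2 - d%:~R * q ^+ 2 = n%:~R.
    apply: rational_integral; apply/int_over.
    have -> : ratr (p ^+ 2 - d%:~R * q ^+ 2) = z * Num.conj z.
      rewrite cE e !ratr_complex !(rmorphXn, rmorphB, rmorphM) /= ratr_int -sd; ring.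
    by apply: integral_mul; exact/int_over.
  have [c ec] : exists c : int, 2 * q = c%:~R.
    apply: (@squarefree_denominator d (2 * q) (a ^+ 2 - 4 * n)) => //.
    by rewrite !(rmorphXn, rmorphB, rmorphM) /= -ea -en; ring.
  have rel : a ^+ 2 - 4 * n = d * c ^+ 2.
    by apply: (@intr_inj rat); rewrite !(rmorphXn, rmorphB, rmorphM) /= -ea -ec -en; ring.
  have m4 := squarefree_mod4 sf.
  have pE : ratr p = a%:~R / 2 :> R.
    by rewrite -[a%:~R](ratr_int R) -ea rmorphM /= rmorph_nat mulrC mulKf // pnatr_eq0.
  have qE : ratr q = c%:~R / 2 :> R.
    by rewrite -[c%:~R](ratr_int R) -ec rmorphM /= rmorph_nat mulrC mulKf // pnatr_eq0.
  have zE : z = Complex (a%:~R / 2) (c%:~R / 2 * Num.sqrt (- d%:~R)).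
    by rewrite e pE qE; apply: complex_ext; rewrite !reim /=; ring.
  have [d1|d1] := eqVneq (d %% 4)%Z 1.
    have [k ek] : exists k, a - c = 2 * k.
      have [d' ed] : exists d', d = 4 * d' + 1 by exists (d %/ 4)%Z; lia.
      exists ((a - c) %/ 2)%Z.
      have [a' [ea' ha]] : exists a' ea, a = 2 * a' + ea /\ (ea = 0 \/ ea = 1).
        by exists (a %/ 2)%Z, (a %% 2)%Z; lia.
      have [c' [ec' hc]] : exists c' ec, c = 2 * c' + ec /\ (ec = 0 \/ ec = 1).
        by exists (c %/ 2)%Z, (c %% 2)%Z; lia.
      move: rel; case: ha => -> ha; case: hc => -> hc; rewrite ed !expr2.
      by case: ha => ->; case: hc => ->; lia.
    exists k, c; rewrite zE; have tE : tro d = 1 by rewrite /tro d1.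
    apply: complex_ext; rewrite /= ?tE.
      have -> : a = 2 * k + c by lia.
      by rewrite !(rmorphD, rmorphM) /=; field.
    by rewrite sqrt_absdisc // d1 eqxx mul1r; field.
  have [[a' ea'] [c' ec']] : (exists a', a = 2 * a') /\ (exists c', c = 2 * c').
    have [d' [ed [ed1 hd]]] : exists d' ed, d = 4 * d' + ed /\ (ed = 2 \/ ed = 3).
      by exists (d %/ 4)%Z, (d %% 4)%Z; lia.
    have [a' [ea' [ha1 ha]]] : exists a' ea, a = 2 * a' + ea /\ (ea = 0 \/ ea = 1).
      by exists (a %/ 2)%Z, (a %% 2)%Z; lia.
    have [c' [ec' [hc1 hc]]] : exists c' ec, c = 2 * c' + ec /\ (ec = 0 \/ ec = 1).
      by exists (c %/ 2)%Z, (c %% 2)%Z; lia.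
    suff [h1 h2] : ea' = 0 /\ ec' = 0.
      by split; [exists a'|exists c']; lia.
    move: rel; rewrite ha1 hc1 ed1 !expr2.
    by case: ha => ->; case: hc => ->; case: hd => ->; lia.
  exists a', c'; rewrite zE; have tE : tro d = 0 by rewrite /tro (negbTE d1).
  apply: complex_ext; rewrite /= ?tE ?ea' ?ec' !rmorphM /=.
    by field.
  by rewrite sqrt_absdisc // (negbTE d1); field.
split; last first.
  apply: (@quadratic_integral _ (2 * p + tro d * q) (p ^+ 2 + tro d * p * q + nmo d * q ^+ 2)).
  have rz (k : int) : k%:~R = qint d k 0.
    by rewrite qint_rC -(rmorph_int (real_complex R)).
  rewrite !rz expr2 !qintM // qintN !qintD; apply/eqP; rewrite qint_eq0 //.
  by apply/andP; split; apply/eqP; ring.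
exists (p%:~R + q%:~R * (tro d)%:~R / 2), (q%:~R * (if (d %% 4)%Z == 1 then 2^-1 else 1)).
rewrite !(rmorphD, rmorphM) /= !ratr_int fmorphV rmorph_nat.
apply: complex_ext; rewrite !reim /=; first by ring.
rewrite sqrt_absdisc // !mul0r !addr0 add0r.
by case: eqP => _; rewrite ?fmorphV ?rmorph_nat ?rmorph1; field.
Qed.

End IntegerRing.

(** * Bases of ideals, their index, and the inverse square of an ideal *)

Section IdealBasis.
Context {R : realType}.
Variable d : int.
Hypotheses (d0 : d < 0) (sf : squarefree_int d).
Implicit Types (z w : R[i]) (p q g a b : int).

Lemma OF_qint p q : OF d (qint d p q : R[i]).
Proof. by apply/(OFP _ d0 sf); exists p, q. Qed.

Lemma OF_int p : OF d (rC p%:~R : R[i]).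
Proof. by rewrite -(qint_rC d); exact: OF_qint. Qed.

Lemma OF0 : OF d (0 : R[i]). Proof. exact: (OF_int 0). Qed.
Lemma OF1 : OF d (1 : R[i]). Proof. exact: (OF_int 1). Qed.

Lemma OFD z w : OF d z -> OF d w -> OF d (z + w).
Proof. by move=> /(OFP _ d0 sf)[p [q ->]] /(OFP _ d0 sf)[p' [q' ->]]; rewrite qintD; exact: OF_qint. Qed.

Lemma OFN z : OF d z -> OF d (- z).
Proof. by move=> /(OFP _ d0 sf)[p [q ->]]; rewrite qintN; exact: OF_qint. Qed.

Lemma OFM z w : OF d z -> OF d w -> OF d (z * w).
Proof. by move=> /(OFP _ d0 sf)[p [q ->]] /(OFP _ d0 sf)[p' [q' ->]]; rewrite qintM //; exact: OF_qint. Qed.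

Lemma OF_conj z : OF d z -> OF d (Num.conj z).
Proof. by move=> /(OFP _ d0 sf)[p [q ->]]; rewrite qint_conj; exact: OF_qint. Qed.

Lemma OF_norm z : OF d z -> exists n : int, normC2 z = n%:~R.
Proof. by move=> /(OFP _ d0 sf)[p [q ->]]; rewrite normC2_qint //; eexists. Qed.

Lemma OF_norm_ge1 z : OF d z -> z != 0 -> 1 <= normC2 z.
Proof. by move=> /OF_norm[n e]; rewrite -normC2_gt0 e ltr0z ler1z. Qed.

Lemma int_subgroup (P : int -> Prop) : P 0 -> (forall x y, P x -> P y -> P (x - y)) ->
  (exists2 x, P x & x != 0) -> exists2 g : int, 0 < g & forall x, P x <-> (g %| x)%Z.
Proof.
move=> P0 PB [x0 Px0 x00].
have PN x : P x -> P (- x) by move=> Px; rewrite -sub0r; exact: PB.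
have PD x y : P x -> P y -> P (x + y) by move=> Px Py; rewrite -[y]opprK; apply: PB => //; exact: PN.
have PMn x (n : nat) : P x -> P (x * n%:Z).
  move=> Px; elim: n => [|n IHn]; first by rewrite mulr0.
  by rewrite -addn1 PoszD mulrDr mulr1; exact: PD.
have PM x k : P x -> P (k * x).
  move=> Px; rewrite mulrC; case: k => n; first exact: PMn.
  by rewrite NegzE mulrN; apply: PN; exact: PMn.
have ex : exists n : nat, (0 < n)%N && `[< P n%:Z >].
  exists `|x0|%N; rewrite absz_gt0 x00; apply/asboolP; rewrite abszE.
  by case: (ger0P x0) => _ //; exact: PN.
case: (ex_minnP ex) => g /andP[g0 /asboolP Pg] gmin; exists g%:Z => // x; split.
  move=> Px; rewrite dvdzE /= -[g]/(`|g%:Z|%N) -dvdzE; apply/eqP.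
  have r0 : 0 <= (x %% g%:Z)%Z by apply: modz_ge0; lia.
  have rg : (x %% g%:Z)%Z < g%:Z by apply: ltz_pmod.
  apply/eqP; apply: contraT => nd; have := gmin `|(x %% g%:Z)%Z|%N.
  rewrite absz_gt0 => h; have : (g <= `|(x %% g)%Z|)%N.
    apply: h; apply/andP; split; first by apply: contra nd => /eqP/dvdz_mod0P.
    apply/asboolP; rewrite gez0_abs //.
    have -> : (x %% g)%Z = x - (x %/ g)%Z * g by have := divz_eq x g; lia.
    by apply: PB => //; exact: PM.
  lia.
by move=> /dvdzP[k ->]; exact: PM.
Qed.

(** g (Z a + Z (b + omega)), the standard shape of an ideal. *)
Definition ideal_of g a b : set R[i] :=
  [set z | exists u v, z = qint d (g * (a * u + b * v)) (g * v)].

(** g generates the omega-coordinates of I, and g a its rational integers. That a divides the norm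
    of b + omega expresses stability under multiplication. *)
Lemma ideal_basis (I : set R[i]) : nz_ideal d I -> exists g a b, [/\ 0 < g, 0 < a,
  (a %| b ^+ 2 + tro d * b + nmo d)%Z & I = ideal_of g a b].
Proof.
move=> [IO [I0 [IB [IM [z0 [Iz0 z00]]]]]].
have IN z : I z -> I (- z) by move=> Iz; rewrite -sub0r; exact: IB.
have ID z w : I z -> I w -> I (z + w) by move=> Iz Iw; rewrite -[w]opprK; apply: IB => //; exact: IN.
have q0 : qint d 0 0 = 0 :> R[i] by rewrite qint_rC.
have eqI p q p' q' : I (qint d p q) -> p = p' -> q = q' -> I (qint d p' q') by move=> h <- <-.
have I0' : I (qint d 0 0) by rewrite q0.
have [n0 n00 In0] : exists2 n : int, n != 0 & I (qint d n 0).
  have [n en] := OF_norm (IO _ Iz0); exists n.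
    by rewrite -(intr_eq0 R) -en normC2_eq0.
  by rewrite qint_rC -en -conjM_normC2; apply: (IM) => //; apply: OF_conj; exact: IO.
have [g g0 hg] : exists2 g : int, 0 < g & forall q, (exists p, I (qint d p q)) <-> (g %| q)%Z.
  apply: int_subgroup; first by exists 0.
    move=> x y [p Ip] [p' Ip']; exists (p - p'); have := IB _ _ Ip Ip'.
    by rewrite qintN qintD.
  exists n0 => //; exists 0; have h := IM _ _ (OF_qint 0 1) In0; rewrite qintM // in h.
  by apply: (eqI _ _ _ _ h); ring.
have [m m0 hm] : exists2 m : int, 0 < m & forall p, I (qint d p 0) <-> (m %| p)%Z.
  apply: int_subgroup; [by []|move=> x y h1 h2|by exists n0].
  by have := IB _ _ h1 h2; rewrite qintN qintD subr0.
have omM p q : I (qint d p q) -> I (qint d (- nmo d * q) (p + tro d * q)).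
  move=> h0; have h := IM _ _ (OF_qint 0 1) h0; rewrite qintM // in h.
  by apply: (eqI _ _ _ _ h); ring.
have /dvdzP[a ea] : (g %| m)%Z.
  apply/hg; have h : I (qint d m 0) by apply/hm.
  by have := omM _ _ h; rewrite !mulr0 addr0; exists 0.
have [b' Ib'] : exists p, I (qint d p g) by apply/hg; exact: dvdzz.
have /dvdzP[b eb] : (g %| b')%Z.
  have /hg/dvdzP[k ek] : exists p, I (qint d p (b' + tro d * g)) by exists (- nmo d * g); exact: omM.
  by apply/dvdzP; exists (k - tro d); rewrite mulrBl -ek addrK.
have a0 : 0 < a by move: m0; rewrite ea pmulr_lgt0.
have key p q : I (qint d p q) <-> exists u v, p = g * (a * u + b * v) /\ q = g * v.
  have shift v : I (qint d (p - v * b') (q - v * g)) <-> I (qint d p q).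
    have h : I (qint d (v * b') (v * g)).
      have h := IM _ _ (OF_qint v 0) Ib'; rewrite qintM // in h.
      by apply: (eqI _ _ _ _ h); ring.
    split=> [h'|h']; last by have := IB _ _ h' h; rewrite qintN qintD.
    by have := ID _ _ h' h; rewrite qintD !subrK.
  split=> [h|[u [v [ep eq]]]].
    have /dvdzP[v ev] : (g %| q)%Z by apply/hg; exists p.
    have /shift := h => /(_ v); rewrite ev subrr => /hm/dvdzP[u eu].
    exists u, v; split; last by rewrite mulrC.
    by rewrite -[p](subrK (v * b')) eu ea eb; ring.
  apply/(shift v); rewrite (_ : q - _ = 0); last by rewrite eq; ring.
  by apply/hm/dvdzP; exists u; rewrite ep ea eb; ring.
exists g, a, b; split=> //.
  have h : I (qint d (g * b) g) by rewrite mulrC -eb.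
  have := IM _ _ (OF_conj (OF_qint b 1)) h; rewrite qint_conj qintM // => /key[u [v []]].
  rewrite mulr1 => e1 /eqP e2.
  have ev : v = 0.
    apply: (mulfI (lt0r_neq0 g0)); rewrite mulr0; move/eqP: e2 => <-; ring.
  apply/dvdzP; exists u; apply: (mulfI (lt0r_neq0 g0)).
  transitivity ((b + tro d) * (g * b) - nmo d * -1 * g); first by ring.
  by rewrite e1 ev; ring.
apply/seteqP; split=> z /=.
  move=> Iz; have [p [q ez]] := (OFP _ d0 sf).1 (IO _ Iz); move: Iz; rewrite ez.
  by move=> /key[u [v [-> ->]]]; exists u, v.
by move=> [u [v ->]]; apply/key; exists u, v.
Qed.

(** The elements r + q omega with 0 <= r < g a and 0 <= q < g lie in distinct classes. *)
Lemma ideal_index g a b n : 0 < g -> 0 < a ->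
  ideal_norm_is d (ideal_of g a b) n -> (`|(g ^+ 2 * a)%R| <= n)%N.
Proof.
move=> g0 a0 hn; have ga0 : 0 < g * a by rewrite mulr_gt0.
pose f (k : nat) : R[i] := qint d (k%:Z %% (g * a))%Z (k%:Z %/ (g * a))%Z.
pose cl (x : R[i]) : set R[i] := [set y | OF d y /\ ideal_of g a b (x - y)].
rewrite -card_le_II -(card_le_eqr hn).
have inj : set_inj `I_(`|(g ^+ 2 * a)%R|%N) (cl \o f).
  move=> i j; rewrite !inE /= => im jm e.
  have : cl (f i) (f j).
    rewrite e; split; first exact: OF_qint.
    by exists 0, 0; rewrite subrr !(mulr0, addr0) qint_rC.
  move=> [_ [u [v]]]; rewrite /f qintN qintD => /(qint_eq d0)[e1 e2].
  have bnd (k : nat) : (k < `|(g ^+ 2 * a)%R|)%N -> 0 <= (k%:Z %/ (g * a))%Z < g.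
    move=> km; rewrite divz_ge0 // /=; rewrite ltz_divLR //.
    by move: km; rewrite -ltz_nat gez0_abs ?mulr_ge0 ?sqr_ge0 ?ltW // expr2 mulrA.
  have v0 : v = 0.
    have /andP[h1 h2] := bnd _ im; have /andP[h3 h4] := bnd _ jm; nia.
  have u0 : u = 0.
    have h1 := modz_ge0 i (lt0r_neq0 ga0); have h2 := modz_ge0 j (lt0r_neq0 ga0).
    have h3 := ltz_pmod i ga0; have h4 := ltz_pmod j ga0.
    have e3 : (i%:Z %% (g * a))%Z - (j%:Z %% (g * a))%Z = (g * a) * u by rewrite e1 v0; ring.
    nia.
  apply/eqP; rewrite -eqz_nat (divz_eq i (g * a)) (divz_eq j (g * a)).
  by apply/eqP; congr (_ * _ + _); [move: e2; rewrite v0|move: e1; rewrite v0 u0]; lia.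
rewrite -(card_le_eql (inj_card_eq inj)); apply: subset_card_le => _ [k _ <-].
by exists (f k) => //; exact: OF_qint.
Qed.

(* Otherwise disc d / p ^ 2 would be a discriminant. *)
Lemma primitive_form a b c p : prime `|p|%N -> a * c = b ^+ 2 + tro d * b + nmo d ->
  (p %| a)%Z -> (p %| 2 * b + tro d)%Z -> (p %| c)%Z -> False.
Proof.
move=> pp e /dvdzP[a' ea] /dvdzP[b' eb] /dvdzP[c' ec].
have eD : disc d = p ^+ 2 * (b' ^+ 2 - 4 * (a' * c')).
  rewrite disc_tro; have -> : nmo d = a * c - b ^+ 2 - tro d * b by rewrite e; ring.
  have -> : tro d = b' * p - 2 * b by rewrite -eb; ring.
  by rewrite ea ec; ring.
have sfp (k : int) : d = p ^+ 2 * k -> False.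
  move=> dk; have := sf pp; rewrite dk abszM abszX; apply/negP; rewrite negbK.
  exact: dvdn_mulr.
have [d1|d1] := boolP ((d %% 4)%Z == 1); first by apply: (sfp (b' ^+ 2 - 4 * (a' * c'))); rewrite -eD /disc d1.
move: eD; rewrite /disc (negbTE d1) => eD; have m4 := squarefree_mod4 sf.
have [b2 [eb2 [hb hb2]]] : exists k e, b' = 2 * k + e /\ (e = 0 \/ e = 1).
  by exists (b' %/ 2)%Z, (b' %% 2)%Z; lia.
have [p2 [ep2 [hp hp2]]] : exists k e, p = 2 * k + e /\ (e = 0 \/ e = 1).
  by exists (p %/ 2)%Z, (p %% 2)%Z; lia.
case: hp2 => ep; last first.
  case: hb2 => eb2'; last by move: eD; rewrite hp hb ep eb2' !expr2; lia.
  apply: (sfp (b2 ^+ 2 - a' * c')); apply: (@mulfI _ (4 : int)) => //.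
  by rewrite eD hb eb2'; ring.
have : `|p|%N = 2%N.
  by apply/esym/eqP; rewrite -(dvdn_prime2 (isT : prime 2) pp); apply/dvdnP; exists `|p2|%N; rewrite hp ep addr0 abszM mulnC.
move=> p22; have p4 : p ^+ 2 = 4 by have [->|->] : p = 2 \/ p = -2 by lia.
move: eD; rewrite p4 hb !expr2 => eD.
by case: hb2 => e2; move: d1 m4; rewrite e2 in eD; lia.
Qed.

(** The quadratic form with coefficients a, 2b + tro d, c is primitive since its discriminant is
    fundamental. This is the invertibility of the ideal, on which the covolume of I^-2 depends. *)
Lemma primitive_coprime a b c : 0 < a -> a * c = b ^+ 2 + tro d * b + nmo d ->
  coprimez (gcdz a (2 * b + tro d)) c.
Proof.
move=> a0 e; rewrite coprimezE /coprime; apply/negPn/negP => h.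
set g := gcdn _ _ in h.
have g0 : (0 < g)%N by rewrite gcdn_gt0 /= gcdn_gt0 absz_gt0 lt0r_neq0.
have pp := pdiv_prime (_ : 1 < g)%N; have g1 : (1 < g)%N by lia.
have := pp g1; set p := pdiv g => {}pp.
have pg : (p %| g)%N by exact: pdiv_dvd.
have pd (k : int) : (g %| `|k|)%N -> (p%:Z %| k)%Z by move=> gk; rewrite dvdzE /=; exact: dvdn_trans gk.
apply: (@primitive_form a b c p%:Z) => //; apply: pd.
- by apply: dvdn_trans (dvdn_gcdl _ _) _; exact: dvdn_gcdl.
- by apply: dvdn_trans (dvdn_gcdl _ _) _; exact: dvdn_gcdr.
- exact: dvdn_gcdr.
Qed.

(* The elements x, y generate I and the strip of width rho and direction sigma is a
   fundamental parallelogram of the inverse of I ^ 2. *)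
Lemma ideal_data (I : set R[i]) n : nz_ideal d I -> ideal_norm_is d I n ->
  exists x y : R[i], exists (rho : R) (sigma : R[i]),
  [/\ I = [set z | exists u v, OF d u /\ OF d v /\ z = u * x + v * y], I x /\ I y,
      0 < rho /\ 0 < complex.Im sigma,
      Num.sqrt (absdisc d) / 2 / n%:R ^+ 2 <= rho * complex.Im sigma &
      forall tau, OF d (tau * x ^+ 2) -> OF d (tau * (x * y)) -> OF d (tau * y ^+ 2) ->
        exists k l : int, tau = rC k%:~R * rC rho + rC l%:~R * sigma].
Proof.
move=> nI; have [g [a [b [g0 a0 /dvdzP[c ec] eI]]]] := ideal_basis nI; rewrite eI.
move=> /(ideal_index g0 a0) hn.
have e : a * c = b ^+ 2 + tro d * b + nmo d by rewrite ec mulrC.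
have cop := primitive_coprime a0 e.
set h := gcdz _ _ in cop.
have h0 : 0 < h by rewrite lt_def gcdz_eq0 negb_and lt0r_neq0.
have /dvdzP[a1 ea1] : (h %| a)%Z by exact: dvdz_gcdl.
have /dvdzP[b1 eb1] : (h %| 2 * b + tro d)%Z by exact: dvdz_gcdr.
have [u0 [w0 eh]] : exists u w : int, u * a + w * (2 * b + tro d) = h by exists (egcdz a (2 * b + tro d)).1, (egcdz a (2 * b + tro d)).2; case: egcdzP.
clearbody h.
have cop1 : coprimez a1 b1.
  apply/coprimezP; exists (u0, w0) => /=; apply: (mulIf (lt0r_neq0 h0)).
  transitivity (u0 * (a1 * h) + w0 * (b1 * h)); first by ring.
  by rewrite -ea1 -eb1 eh mul1r.
have x2 : qint d (g * a) 0 ^+ 2 = rC ((g * a) ^+ 2)%:~R :> R[i] by rewrite qint_rC expr2 -rCM rmorphXn.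
have ga0 : 0 < (g * a)%:~R :> R by rewrite ltr0z mulr_gt0.
pose s2 : R := ((g * a)%:~R ^+ 2)^-1.
have s20 : 0 < s2 by rewrite invr_gt0 exprn_gt0.
(* With x = g a and y = g (b + omega), integrality of tau x^2 means tau = (U + V omega) / (g a)^2.
   The other two conditions force h to divide V and fix U modulo a a1; rho and sigma generate the
   solutions, and w0 is a Bezout coefficient of h. *)
pose sigma := rC s2 * qint d (a * (c * w0) - h * (b + tro d)) h.
have Ims : complex.Im sigma = s2 * (h%:~R * Num.sqrt (absdisc d) / 2).
  by rewrite /sigma !reim /= mul0r addr0.
exists (qint d (g * a) 0), (qint d (g * b) g), (s2 * (a * a1)%:~R), sigma.
have gen u v : qint d (g * (a * u + b * v)) (g * v) = qint d u 0 * qint d (g * a) 0 + qint d v 0 * qint d (g * b) g :> R[i].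
  by rewrite !qintM // qintD; congr qint; ring.
have a10 : 0 < a1 by move: a0; rewrite ea1 pmulr_lgt0.
split.
- apply/seteqP; split=> z /=.
    by move=> [u [v ->]]; exists (qint d u 0), (qint d v 0); split; [|split; [|exact: gen]]; exact: OF_qint.
  move=> [u [v [/(OFP _ d0 sf)[p [q ->]] [/(OFP _ d0 sf)[p' [q' ->]] ->]]]].
  exists (p - b * q + (- c * q' : int)), (a * q + p' + (b + tro d) * q').
  rewrite !qintM // qintD; congr qint; last by ring.
  rewrite (_ : nmo d = a * c - b ^+ 2 - tro d * b); last by rewrite e; ring.
  by ring.
- by split; [exists 1, 0|exists 0, 1]; congr qint; ring.
- split; first by rewrite mulr_gt0 // ltr0z mulr_gt0.
  have D0 : 0 < Num.sqrt (absdisc d) / 2 :> R by rewrite divr_gt0 // sqrtr_gt0 absdisc_gt0.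
  by rewrite Ims -mulrA; apply: mulr_gt0 => //; apply: mulr_gt0 => //; rewrite ltr0z.
- rewrite Ims; set D := Num.sqrt _.
  have D0 : 0 <= D by exact: sqrtr_ge0.
  (* Because a = a1 h, the covolume is sqrt|Delta| / 2 divided by the square of g^2 a. *)
  have -> : s2 * (a * a1)%:~R * (s2 * (h%:~R * D / 2)) = D / 2 / ((g ^+ 2 * a)%:~R) ^+ 2.
    have an : a%:~R != 0 :> R by rewrite intr_eq0 lt0r_neq0.
    have gn : g%:~R != 0 :> R by rewrite intr_eq0 lt0r_neq0.
    have ea' : a1%:~R = a%:~R / h%:~R :> R.
      by rewrite ea1 rmorphM /= mulfK // intr_eq0 lt0r_neq0.
    have hn' : h%:~R != 0 :> R by rewrite intr_eq0 lt0r_neq0.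
    by rewrite /s2 !(rmorphXn, rmorphM) /= ea'; field; rewrite an gn hn'.
  apply: ler_wpM2l; first by rewrite divr_ge0.
  have p0 : 0 < (g ^+ 2 * a)%:~R :> R by rewrite ltr0z mulr_gt0 // exprn_gt0.
  have : (g ^+ 2 * a)%:~R <= n%:R :> R.
    by rewrite -[n%:R]/(n%:Z%:~R) ler_int -[leLHS]gez0_abs // ltW // mulr_gt0 // exprn_gt0.
  move=> le; rewrite lef_pV2 ?posrE ?exprn_gt0 //; last exact: lt_le_trans le.
  by rewrite lerXn2r // nnegrE ltW //; exact: lt_le_trans le.
move=> tau /(OFP _ d0 sf)[U [V e1]] /(OFP _ d0 sf)[P [Q e2]] /(OFP _ d0 sf)[P' [Q' e3]].
have gz (k : int) : qint d (g * k) 0 = qint d g 0 * qint d k 0 :> R[i].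
  by rewrite qintM //; congr qint; ring.
have qg : qint d g 0 != 0 :> R[i] by rewrite qint_eq0 // negb_and lt0r_neq0.
(* The coordinates of the identity (tau x^2) y = (tau x y) x, divided by g. *)
have [r1 r2] : U * b - nmo d * V = a * P /\ U + V * b + tro d * V = a * Q.
  apply: (@qint_eq R d) => //; apply: (mulfI qg).
  transitivity (tau * (qint d (g * a) 0) ^+ 2 * qint d (g * b) g).
    by rewrite e1 !qintM //; congr qint; ring.
  have -> : tau * (qint d (g * a) 0) ^+ 2 * qint d (g * b) g = tau * (qint d (g * a) 0 * qint d (g * b) g) * qint d (g * a) 0 by ring.
  by rewrite e2 !qintM //; congr qint; ring.
have [r3 r4] : P * b - nmo d * Q = a * P' /\ P + Q * b + tro d * Q = a * Q'.
  apply: (@qint_eq R d) => //; apply: (mulfI qg).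
  transitivity (tau * (qint d (g * a) 0 * qint d (g * b) g) * qint d (g * b) g).
    by rewrite e2 !qintM //; congr qint; ring.
  have -> : tau * (qint d (g * a) 0 * qint d (g * b) g) * qint d (g * b) g = tau * (qint d (g * b) g) ^+ 2 * qint d (g * a) 0 by ring.
  by rewrite e3 !qintM //; congr qint; ring.
have eP : P = Q * b - V * c.
  apply: (mulfI (lt0r_neq0 a0)); rewrite -r1.
  have -> : U = a * Q - V * b - tro d * V by rewrite -r2; ring.
  by rewrite (_ : nmo d = a * c - b ^+ 2 - tro d * b); [ring|rewrite e; ring].
have eQ : a * Q' = Q * (2 * b + tro d) - V * c by rewrite -r4 eP; ring.
have /dvdzP[v ev] : (h %| V)%Z.
  rewrite -(Gauss_dvdzl _ cop); apply/dvdzP; exists (Q * b1 - a1 * Q').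
  by rewrite mulrBl -!mulrA -eb1 [Q' * h]mulrC mulrA -ea1 eQ; ring.
have /dvdzP[m em] : (a1 %| Q - c * w0 * v)%Z.
  rewrite -(Gauss_dvdzl _ cop1); apply/dvdzP; exists (Q' + c * u0 * v).
  apply: (mulIf (lt0r_neq0 h0)).
  transitivity (Q * (b1 * h) - c * v * (w0 * (b1 * h))); first by ring.
  transitivity ((Q' + c * u0 * v) * (a1 * h)); last by ring.
  rewrite -eb1 -ea1.
  have -> : w0 * (2 * b + tro d) = h - u0 * a by rewrite -eh; ring.
  have -> : Q * (2 * b + tro d) = a * Q' + V * c by rewrite eQ; ring.
  by rewrite ev; ring.
exists m, v.
have xn : rC ((g * a)%:~R ^+ 2) != 0 :> R[i] by apply/eqP => /rC_inj; apply/eqP; rewrite gt_eqF // exprn_gt0.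
have -> : tau = rC s2 * qint d U V.
  rewrite -e1 x2 rmorphXn /= mulrCA -rCM /s2 mulVf ?rC1 ?mulr1 //.
  by rewrite gt_eqF // exprn_gt0.
have eU : U = a * (c * w0 * v + m * a1) - h * v * (b + tro d).
  have -> : U = a * Q - V * b - tro d * V by rewrite -r2; ring.
  by rewrite -[Q](subrK (c * w0 * v)) em ev; ring.
rewrite eU ev /sigma rCM mulrCA -(qint_rC d m) -(qint_rC d v) -(qint_rC d (a * a1)) [rC s2 * (_ * _)]mulrC.
rewrite [qint d v 0 * _]mulrCA [_ * rC s2]mulrC -mulrA -mulrDr !qintM // qintD; congr (_ * qint _ _ _); ring.
Qed.

End IdealBasis.

(** * Comparison of sums through finite lists and codes *)

Section FiniteSums.
Context {R : realType}.

Lemma esum_le_lists (T : choiceType) (A : set T) (f : T -> R) (K : R) :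
  (forall s : seq T, uniq s -> (forall x, x \in s -> A x) -> \sum_(x <- s) f x <= K) ->
  (esum A (fun x => (f x)%:E) <= K%:E)%E.
Proof.
move=> h; apply: ge_ereal_sup => _ [X [fX XA] <-].
rewrite fsbig_finite //= sumEFin lee_fin; apply: h => // x.
by rewrite in_fset_set // inE => /XA.
Qed.

Lemma sum_le_code (T : eqType) (C : finType) (s : seq T) (f : T -> R) (code : T -> C) (F : C -> R) :
  uniq s -> {in s &, injective code} -> (forall c, 0 <= F c) ->
  (forall x, x \in s -> f x <= F (code x)) -> \sum_(x <- s) f x <= \sum_c F c.
Proof.
move=> us inj F0 fF; apply: (@le_trans _ _ (\sum_(x <- s) F (code x))).
  by rewrite big_seq [leRHS]big_seq; apply: ler_sum.
rewrite -(big_map code xpredT F) big_uniq ?map_inj_in_uniq //=.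
by rewrite [leRHS](bigID (mem (map code s))) /= lerDl sumr_ge0.
Qed.

(* x / (1 + |x|) increases by at least a quarter of 1 / (1 + x ^ 2) between consecutive integers. *)
Lemma inv_sqr_le_increment (k : int) : (1 + (k%:~R : R) ^+ 2)^-1 <=
  4 * ((k%:~R : R) / (1 + `|k%:~R|) - (k%:~R - 1) / (1 + `|k%:~R - 1|)).
Proof.
have [k0|k1] : k <= 0 \/ 1 <= k by lia.
  have x0 : k%:~R <= 0 :> R by rewrite lerz0.
  move: (k%:~R : R) x0 => x x0; rewrite ler0_norm // ler0_norm; last lra.
  have -> : x / (1 - x) - (x - 1) / (1 - (x - 1)) = ((1 - x) * (2 - x))^-1.
    have n1 : 1 - x != 0 by rewrite gt_eqF //; lra.
    have n2 : 2 - x != 0 by rewrite gt_eqF //; lra.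
    have -> : 1 - (x - 1) = 2 - x by ring.
    by field; rewrite n1 n2.
  rewrite -ler_pdivrMl // -invfM lef_pV2 ?posrE; first nra.
  - by rewrite mulr_gt0 // ltr_wpDr ?sqr_ge0.
  - by rewrite mulr_gt0 //; lra.
have x1 : 1 <= k%:~R :> R by rewrite ler1z.
move: (k%:~R : R) x1 => x x1; rewrite ger0_norm ?ger0_norm; try lra.
have -> : x / (1 + x) - (x - 1) / (1 + (x - 1)) = ((1 + x) * x)^-1.
  have n1 : 1 + x != 0 by rewrite gt_eqF //; lra.
  have n2 : x != 0 by rewrite gt_eqF //; lra.
  have -> : 1 + (x - 1) = x by ring.
  by field; rewrite n1 n2.
rewrite -ler_pdivrMl // -invfM lef_pV2 ?posrE; first nra.
- by rewrite mulr_gt0 // ltr_wpDr ?sqr_ge0.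
- by rewrite mulr_gt0 //; lra.
Qed.

(** The increments telescope, and x / (1 + |x|) varies by at most 2. *)
Lemma sum_inv_sqr_le (M n : nat) : \sum_(i < n) (1 + ((i%:Z - M%:Z)%:~R : R) ^+ 2)^-1 <= 8.
Proof.
pose phi (x : R) := x / (1 + `|x|).
have phi1 x : `|phi x| <= 1.
  have h : 0 < 1 + `|x| by rewrite ltr_wpDr.
  by rewrite normrM normfV (ger0_norm (ltW h)) ler_pdivrMr // mul1r lerDr.
pose psi (i : nat) := phi ((i%:Z - M%:Z)%:~R - 1).
apply: (@le_trans _ _ (\sum_(i < n) 4 * (psi i.+1 - psi i))).
  apply: ler_sum => i _; apply: (le_trans (inv_sqr_le_increment _)).
  rewrite ler_pM2l // /psi /phi; have -> : (i.+1%:Z - M%:Z)%:~R - 1 = (i%:Z - M%:Z)%:~R :> R.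
    by rewrite -addn1 PoszD !(rmorphD, rmorphB) /=; ring.
  by [].
rewrite -mulr_sumr -(big_mkord xpredT (fun i => psi i.+1 - psi i)) telescope_sumr //.
have := phi1 ((n%:Z - M%:Z)%:~R - 1); have := phi1 ((0%:Z - M%:Z)%:~R - 1).
rewrite -/(psi n) -/(psi 0) !ler_norml => /andP[h1 h2] /andP[h3 h4]; lra.
Qed.

End FiniteSums.

(** * Finiteness of zeta_F(2) *)

Section ZetaFinite.
Context {R : realType}.
Variable d : int.
Hypotheses (d0 : d < 0) (sf : squarefree_int d).
Implicit Types (p q g a b : int).

(** Thue's pigeonhole: with Q the integer square root of a, the Q + 1 residues of b i for 0 <= i <=
    Q fall into Q blocks of length Q + 2, since a <= Q (Q + 2). *)
Lemma thue (a : nat) (b : int) : (0 < a)%N -> exists r q : int,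
  [/\ q != 0, r ^+ 2 <= 4 * a%:Z, q ^+ 2 <= a%:Z & (a %| r - b * q)%Z].
Proof.
move=> a0; have [Q [Q0 Qa aQ]] : exists Q : nat, [/\ (0 < Q)%N, (Q * Q <= a)%N & (a < Q.+1 * Q.+1)%N].
  have ex : exists Q : nat, (Q * Q <= a)%N by exists 0.
  have bd Q : (Q * Q <= a)%N -> (Q <= a)%N by case: Q => // Q; nia.
  case: (ex_maxnP ex bd) => Q h1 h2; exists Q; split=> //; first by apply: h2.
  by rewrite ltnNge; apply/negP => /h2; rewrite ltnn.
pose res (i : nat) := `|((b * i%:Z) %% a%:Z)%Z|%N.
have resE i : (res i)%:Z = ((b * i%:Z) %% a%:Z)%Z.
  by rewrite /res gez0_abs // modz_ge0 //; lia.
have resa i : (res i < a)%N.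
  by rewrite -ltz_nat resE; apply: ltz_pmod.
have bkt i : (res i %/ (Q + 2) < Q)%N.
  by rewrite ltn_divLR ?addn2 //; have := resa i; nia.
pose f (i : 'I_Q.+1) := Ordinal (bkt i).
have /injectivePn[i [j ij eij]] : ~~ injectiveb f.
  apply/negP => /injectiveP/leq_card; rewrite !card_ord ltnn //.
exists ((res i)%:Z - (res j)%:Z), (i%:Z - j%:Z); split.
- by rewrite subr_eq0 eqz_nat.
- move: eij => /(congr1 val) /= e.
  have := divn_eq (res i) (Q + 2); have := divn_eq (res j) (Q + 2); rewrite e.
  have := ltn_pmod (res i) (_ : 0 < Q + 2)%N; have := ltn_pmod (res j) (_ : 0 < Q + 2)%N.
  rewrite !addn2 // => /(_ isT) h1 /(_ isT) h2 h3 h4.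
  have b1 : `|(res i)%:Z - (res j)%:Z| <= Q%:Z + 1 by lia.
  rewrite -real_normK ?num_real //; apply: (@le_trans _ _ ((Q%:Z + 1) ^+ 2)); first by rewrite lerXn2r // nnegrE; lia.
  by rewrite expr2; nia.
- have b1 : `|i%:Z - j%:Z| <= Q%:Z by have := ltn_ord i; have := ltn_ord j; lia.
  rewrite -real_normK ?num_real //; apply: (@le_trans _ _ (Q%:Z ^+ 2)); first by rewrite lerXn2r // nnegrE.
  by rewrite expr2; nia.
- apply/dvdzP; rewrite !resE; exists (divz (b * j%:Z) a - divz (b * i%:Z) a).
  have := divz_eq (b * i%:Z) a; have := divz_eq (b * j%:Z) a; lia.
Qed.

(** For nonzero x = p + q omega and k this is the ideal (x / k) J with J = [ideal_of d g a b],
    written without division. *)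
Definition code_ideal p q k g a b : set R[i] := [set y | exists z,
  ideal_of d g a b z /\ z * rC (normC2 (qint d p q)) = y * Num.conj (qint d p q) * rC k%:~R].

Lemma ideal_of_mod g a b : ideal_of d g a b = ideal_of d g a (b %% a)%Z :> set R[i].
Proof.
apply/seteqP; split=> z [u [v ->]]; [exists (u + (b %/ a)%Z * v), v|exists (u - (b %/ a)%Z * v), v];
  congr qint; have := divz_eq b a; move: (b %/ a)%Z (b %% a)%Z => k r e; rewrite e; ring.
Qed.

(** From r^2 <= 4a and q^2 <= a, the norm of r + q omega is at most (4 + 5/2 + nmo d) a. *)
Let C : int := nmo d + 7.

Lemma nmo_gt0 : 0 < nmo d.
Proof.
have := absdisc_gt0 (R := R) d0; rewrite absdiscE // => h.
by rewrite -(ltr0z R); have := sqr_ge0 ((tro d)%:~R : R); lra.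
Qed.

Lemma tro01 : tro d = 0 \/ tro d = 1.
Proof. by rewrite /tro; case: ifP; [right|left]. Qed.

Lemma normC2_qint_ge p q : (p%:~R ^+ 2 + q%:~R ^+ 2) / 2 <= normC2 (qint d p q) :> R.
Proof.
rewrite normC2_qint // -!rmorphXn -rmorphD /= ler_pdivrMr // -[2]/((2 : int)%:~R) -rmorphM ler_int.
have h1 := sqr_ge0 (p + q); have h2 : 0 <= (nmo d - 1) * q ^+ 2 by rewrite mulr_ge0 ?sqr_ge0 //; have := nmo_gt0; lia.
have h3 := sqr_ge0 q; have := sqr_ge0 p; move: h1 h2 h3; case: tro01 => ->; rewrite !expr2; lia.
Qed.

(* A short element x of I makes conj x I / n an ideal dividing the small integer |x| ^ 2 / n. *)
Lemma ideal_code (I : set R[i]) n : nz_ideal d I -> ideal_norm_is d I n ->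
  exists p q k g a b, [/\ [/\ 0 <= k <= C, 0 <= g <= C, 0 <= a <= C & 0 <= b <= C],
    code_ideal p q k g a b = I &
    (n%:R ^+ 2)^-1 <= 9 * (C%:~R : R) ^+ 2 * (1 + (p%:~R : R) ^+ 2)^-1 * (1 + (q%:~R : R) ^+ 2)^-1].
Proof.
move=> nI In; have [g [a [b [g0 a0 /dvdzP[c ec] eI]]]] := ideal_basis d0 sf nI.
have hn : (`|(g ^+ 2 * a)%R| <= n)%N.
  by rewrite eI in In; apply: (ideal_index d0 sf g0 a0 In).
have aa : (0 < `|a|)%N by rewrite absz_gt0 lt0r_neq0.
have [r [q [q0 r4 qa /dvdzP[u eu]]]] := thue b aa.
have aE : `|a|%N%:Z = a by rewrite gez0_abs // ltW.
rewrite aE in r4 qa eu.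
have nmo0 := nmo_gt0.
pose N := r ^+ 2 + tro d * r * q + nmo d * q ^+ 2.
have NC : N <= C * a.
  have h1 := sqr_ge0 (r - q); have h2 : 0 <= nmo d * (a - q ^+ 2) by rewrite mulr_ge0 ?subr_ge0 // ltW.
  by move: h1 h2 r4 qa a0; rewrite /N /C; case: tro01 => ->; rewrite !expr2; lia.
have /dvdzP[k ek] : (a %| N)%Z.
  apply/dvdzP; exists (q ^+ 2 * c + u * (a * u + 2 * b * q + tro d * q)).
  transitivity (q ^+ 2 * (b ^+ 2 + tro d * b + nmo d) + u * (a * u + 2 * b * q + tro d * q) * a); last by rewrite ec; ring.
  by rewrite /N; have -> : r = u * a + b * q; [rewrite -eu subrK|ring].
pose x : R[i] := qint d (g * r) (g * q).
have x0 : x != 0 by rewrite qint_eq0 // !mulf_eq0 (gt_eqF g0) (negbTE q0) andbF.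
have nx : normC2 x = (g ^+ 2 * a * k)%:~R.
  have -> : g ^+ 2 * a * k = g ^+ 2 * N by rewrite ek; ring.
  by rewrite normC2_qint // /N; congr (_%:~R); ring.
have k0 : 0 < k.
  have : 0 < (g ^+ 2 * a * k)%:~R :> R by rewrite -nx normC2_gt0.
  by rewrite ltr0z pmulr_rgt0 // mulr_gt0 // exprn_gt0.
have kC : k <= C by move: NC; rewrite ek ler_pM2r.
pose n0 : R := (g ^+ 2 * a)%:~R.
have n00 : rC n0 != 0 :> R[i].
  by apply/eqP => /rC_inj/eqP; apply/negP; rewrite intr_eq0 lt0r_neq0 // mulr_gt0 // exprn_gt0.
have Ix : I x by rewrite eI; exists u, q; congr qint; rewrite -[r](subrK (b * q)) eu; ring.
pose J : set R[i] := [set z | exists2 y, I y & z * rC n0 = y * Num.conj x].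
have [IO [I0 [IB [IM _]]]] := nI.
have Jk : J (rC k%:~R).
  exists x => //; rewrite mulrC -[RHS]mulrC conjM_normC2 nx -rCM; congr rC.
  by rewrite -rmorphM; congr (_%:~R); ring.
have nJ : nz_ideal d J.
  split; [|split; [|split; [|split]]].
  - move=> z [y]; rewrite eI => -[s [v ->]] e.
    (* Explicit coordinates of y conj x / (g^2 a); they are integers because a divides r - b q and
       the norm of b + omega. *)
    suff -> : z = qint d (s * (r + tro d * q) + b * u * v + v * q * c) (u * v - s * q) by exact: OF_qint.
    apply: (mulIf n00); rewrite e -(qint_rC d) /x qint_conj !qintM //.
    have er : r = u * a + b * q by rewrite -eu subrK.
    congr qint; last by rewrite er; ring.
    transitivity (g ^+ 2 * (a * s * (r + tro d * q) + b * v * (u * a) + v * q * (b ^+ 2 + tro d * b + nmo d))).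
      by rewrite er; ring.
    by rewrite ec; ring.
  - by exists 0 => //; rewrite !mul0r.
  - move=> z w [y Iy ey] [y' Iy' ey']; exists (y - y'); first exact: IB.
    by rewrite !mulrBl ey ey'.
  - by move=> s z Os [y Iy ey]; exists (s * y); [exact: IM|rewrite -!mulrA ey].
  - exists (rC k%:~R); split=> //; apply/eqP => /rC_inj/eqP.
    by rewrite intr_eq0 gt_eqF.
have [g' [a' [b' [g'0 a'0 _ eJ]]]] := ideal_basis d0 sf nJ.
have [g'C a'C] : g' <= C /\ a' <= C.
  have : ideal_of d g' a' b' (rC k%:~R : R[i]) by rewrite -eJ.
  move=> [u' [v']]; rewrite -(qint_rC d) => /(qint_eq d0)[e1 /esym/eqP e2].
  move: e2; rewrite mulf_eq0 (gt_eqF g'0) /= => /eqP e2; rewrite e2 mulr0 addr0 in e1.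
  have w0 : 0 < a' * u' by move: k0; rewrite e1 pmulr_rgt0.
  have u'0 : 0 < u' by move: w0; rewrite pmulr_rgt0.
  have gu : 0 < g' * u' by rewrite mulr_gt0.
  split; apply: le_trans kC; rewrite e1; first by apply: ler_peMr; [exact: ltW|lia].
  by rewrite mulrCA; apply: ler_peMr; [exact: ltW|lia].
exists (g * r), (g * q), k, g', a', (b' %% a')%Z; split.
- by split; lia.
- have xc0 : Num.conj x != 0 by rewrite conjc_eq0.
  have kn0 : rC k%:~R != 0 :> R[i] by apply/eqP => /rC_inj/eqP; rewrite intr_eq0 gt_eqF.
  have nxE : rC (normC2 x) = rC n0 * rC k%:~R :> R[i] by rewrite nx rmorphM /= rCM.
  rewrite /code_ideal -ideal_of_mod -eJ -/x nxE; apply/seteqP; split=> y /=.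
    move=> [z [[y' Iy' e'] e]]; suff -> : y = y' by [].
    by apply: (mulIf xc0); rewrite -e'; apply: (mulIf kn0); rewrite -e; ring.
  move=> Iy; exists (y * Num.conj x / rC n0); split; first by exists y => //; rewrite divfK.
  by rewrite mulrA divfK.
have n1 : 0 < n0 by rewrite ltr0z mulr_gt0 // exprn_gt0.
have nn : n0 <= n%:R.
  by rewrite -[n%:R]/(n%:Z%:~R) ler_int -[leLHS]gez0_abs // ltW // mulr_gt0 // exprn_gt0.
have C0 : 0 < C%:~R :> R by rewrite ltr0z; exact: lt_le_trans kC.
have xn : normC2 x <= C%:~R * n0.
  by rewrite nx rmorphM /= -/n0 mulrC ler_pM2r // ler_int.
have := normC2_qint_ge (g * r) (g * q); rewrite -/x.
have P1 : 1 <= (g * q)%:~R ^+ 2 :> R.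
  rewrite -rmorphXn ler1z; have : g * q != 0 by rewrite mulf_neq0 // lt0r_neq0.
  move=> gq0; have : 0 < (g * q) ^+ 2 by rewrite exprn_even_gt0 // gq0 orbT.
  lia.
move: (g * r)%:~R (g * q)%:~R P1 (C%:~R) C0 xn => P Q Q1 Cr C0 xn h.
have AB : 0 < (1 + P ^+ 2) * (1 + Q ^+ 2) by rewrite mulr_gt0 // ltr_wpDr ?sqr_ge0.
have n2 : 0 < n%:R ^+ 2 :> R by rewrite exprn_gt0 //; exact: lt_le_trans nn.
rewrite -mulrA -invfM ler_pdivlMr // mulrC ler_pdivrMr //.
have h2 : (P ^+ 2 + Q ^+ 2) / 2 <= Cr * n%:R by apply: (le_trans h); apply: (le_trans xn); rewrite ler_pM2l.
have h3 : ((P ^+ 2 + Q ^+ 2) / 2) ^+ 2 <= (Cr * n%:R) ^+ 2.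
  by rewrite lerXn2r // nnegrE ?divr_ge0 ?addr_ge0 ?sqr_ge0 // mulr_ge0 // ltW.
rewrite -mulrA -exprMn; apply: le_trans (ler_wpM2l _ h3) => //.
move: (sqr_ge0 P) (sqr_ge0 Q) Q1; move: (P ^+ 2) (Q ^+ 2) => A B A0 B0 B1; nra.
Qed.

Lemma ideal_norm_unique (I : set R[i]) n m :
  ideal_norm_is d I n -> ideal_norm_is d I m -> n = m.
Proof.
move=> hn hm; have h := card_eq_trans (card_esym hn) hm.
by apply/eqP; move: h; rewrite card_eq_le !card_le_II -eqn_leq.
Qed.

(** An ideal is recovered from its code, whose last four entries lie between 0 and C, and its
    inverse squared norm is dominated by a product of two summable factors in p and in q. *)
Lemma zetaF2_lt_pinfty : (zetaF2 (R := R) d < +oo)%E.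
Proof.
pose K := `|C|%N.
have C0 : 0 < C by have := nmo_gt0; rewrite /C; lia.
apply: (@le_lt_trans _ _ (9 * (C%:~R : R) ^+ 2 * (64 * (K.+1 * K.+1 * (K.+1 * K.+1))%:R))%:E); last exact: ltry.
apply: esum_le_lists => s us sA.
have /choice[code hc] : forall x : set R[i] * nat, exists t : (int * int) * ((int * int) * (int * int)),
    nz_ideal d x.1 /\ ideal_norm_is d x.1 x.2 ->
    [/\ [/\ 0 <= t.2.1.1 <= C, 0 <= t.2.1.2 <= C, 0 <= t.2.2.1 <= C & 0 <= t.2.2.2 <= C],
      code_ideal t.1.1 t.1.2 t.2.1.1 t.2.1.2 t.2.2.1 t.2.2.2 = x.1 &
      (x.2%:R ^+ 2)^-1 <= 9 * (C%:~R : R) ^+ 2 * (1 + (t.1.1%:~R : R) ^+ 2)^-1 * (1 + (t.1.2%:~R : R) ^+ 2)^-1].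
  move=> x; have [[hI hn]|h] := pselect (nz_ideal d x.1 /\ ideal_norm_is d x.1 x.2).
    have [p [q [k [g [a [b H]]]]]] := ideal_code hI hn.
    by exists ((p, q), ((k, g), (a, b))).
  by exists ((0, 0), ((0, 0), (0, 0))) => /h.
pose M := (\sum_(x <- s) (`|(code x).1.1| + `|(code x).1.2|))%N.
have hM x : x \in s -> (`|(code x).1.1| <= M)%N /\ (`|(code x).1.2| <= M)%N.
  move=> xs; rewrite /M (big_rem x) //=; lia.
pose f (i : 'I_(M + M).+1) : R := (1 + ((i%:Z - M%:Z)%:~R : R) ^+ 2)^-1.
have f0 i : 0 <= f i by rewrite invr_ge0 addr_ge0 // sqr_ge0.
pose F (c : ('I_(M + M).+1 * 'I_(M + M).+1) * (('I_K.+1 * 'I_K.+1) * ('I_K.+1 * 'I_K.+1))) : R :=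
  9 * (C%:~R : R) ^+ 2 * f c.1.1 * f c.1.2.
pose sh (p : int) : 'I_(M + M).+1 := inord `|(p + M%:Z)%R|%N.
pose rs (p : int) : 'I_K.+1 := inord `|p|%N.
have shE p : (`|p| <= M)%N -> (sh p)%:Z - M%:Z = p by move=> h; rewrite /sh inordK; lia.
have rsE p : 0 <= p <= C -> (rs p)%:Z = p by move=> h; rewrite /rs inordK /K; lia.
pose cd x := ((sh (code x).1.1, sh (code x).1.2),
  ((rs (code x).2.1.1, rs (code x).2.1.2), (rs (code x).2.2.1, rs (code x).2.2.2))).
apply: (le_trans (@sum_le_code _ _ _ s (fun x => (x.2%:R ^+ 2)^-1) cd F us _ _ _)).
- move=> x y xs ys [e1 e2 e3 e4 e5 e6].
  have [[x1 x2 x3 x4] xI _] := hc _ (sA _ xs); have [[y1 y2 y3 y4] yI _] := hc _ (sA _ ys).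
  have [mx1 mx2] := hM _ xs; have [my1 my2] := hM _ ys.
  have eI : x.1 = y.1.
    rewrite -xI -yI -(shE _ mx1) -(shE _ mx2) -(rsE _ x1) -(rsE _ x2) -(rsE _ x3) -(rsE _ x4).
    by rewrite e1 e2 e3 e4 e5 e6 shE // shE // !rsE.
  have [_ nx] := sA _ xs; have [_ ny] := sA _ ys; rewrite eI in nx.
  by rewrite [x]surjective_pairing [y]surjective_pairing eI (ideal_norm_unique nx ny).
- by move=> c; do 2! apply: mulr_ge0 => //; rewrite mulr_ge0 ?sqr_ge0.
- move=> x xs; have [_ _ h] := hc _ (sA _ xs); have [mx1 mx2] := hM _ xs.
  by rewrite /F /f /= shE // shE.
rewrite /F -(pair_bigA _ (fun i j => 9 * (C%:~R : R) ^+ 2 * f i.1 * f i.2)) /=.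
rewrite (eq_bigr (fun i => 9 * (C%:~R : R) ^+ 2 * f i.1 * f i.2 * (K.+1 * K.+1 * (K.+1 * K.+1))%:R)); last first.
  by move=> i _; rewrite sumr_const !card_prod !card_ord mulr_natr.
rewrite -mulr_suml [leRHS]mulrA; apply: ler_wpM2r; first exact: ler0n.
rewrite -(pair_bigA _ (fun i j => 9 * (C%:~R : R) ^+ 2 * f i * f j)) /=.
rewrite (eq_bigr (fun i => 9 * (C%:~R : R) ^+ 2 * f i * \sum_j f j)); last first.
  by move=> i _; rewrite mulr_sumr.
rewrite -mulr_suml -mulr_sumr -mulrA; apply: ler_wpM2l; first by rewrite mulr_ge0 // sqr_ge0.
have h := @sum_inv_sqr_le R M (M + M).+1.
have -> : 64 = 8 * 8 :> R by rewrite -natrM.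
by apply: ler_pM => //; exact: sumr_ge0.
Qed.

End ZetaFinite.

(** * Minimizing a linear functional over a locally polyhedral set *)

Section VoronoiReduction.
Context {R : realType} {k : nat}.
Local Notation V := 'rV[R]_k.+1.
Implicit Types (f g h x p : V).

Lemma continuous_sum_seq (T : topologicalType) (I : Type) (r : seq I) (F : I -> T -> R) :
  (forall i, continuous (F i)) -> continuous (fun z => \sum_(i <- r) F i z).
Proof.
move=> cF z; elim: r => [|i r IHr].
  by under eq_fun do rewrite big_nil; exact: cvg_cst.
by under eq_fun do rewrite big_cons; apply: cvgD => //; exact: cF.
Qed.

Lemma continuous_dotl x : continuous (fun f : V => dot f x).
Proof.
apply: continuous_sum_seq => j f.
apply: (@continuousM R V (fun f : V => f 0 j) (fun=> x 0 j)); last exact: cst_continuous.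
exact: coord_continuous.
Qed.

Lemma continuous_dotxx : continuous (fun f : V => dot f f).
Proof.
apply: continuous_sum_seq => j f.
by apply: (@continuousM R V (fun f : V => f 0 j) (fun f : V => f 0 j)); exact: coord_continuous.
Qed.

(** In the application K is the polyhedron of forms with values at least 1 on the lattice and P the
    set of rank-one forms of lattice vectors; [Klocal] says that small moves from f are restricted
    only by the constraints active at f. *)
Variables (K P : set V) (b : V).
Hypothesis K0 : exists f, K f.
Hypothesis Kcompact : forall c, compact [set f | K f /\ dot f b <= c].
Hypothesis Klocal : forall f h, K f -> (forall p, P p -> dot f p = 1 -> 0 <= dot h p) ->
  exists2 s, 0 < s & K (f + s *: h).
Hypothesis Pfinite : forall f, K f -> exists s : seq V, forall p, P p -> dot f p = 1 -> p \in s.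

(* A minimizer of the linear functional that has the largest norm is a vertex of K. *)
Lemma exists_vertex : exists f, [/\ K f,
  forall h, (forall p, P p -> dot f p = 1 -> dot h p = 0) -> h = 0 &
  exists s : seq (R * V), (forall q, q \in s -> [/\ 0 <= q.1, P q.2 & dot f q.2 = 1]) /\
    b = \sum_(q <- s) q.1 *: q.2].
Proof.
have wc (A : set V) (F : V -> R) : continuous F -> {within A, continuous F}.
  exact: continuous_subspaceT.
have [f0 Kf0] := K0.
have [f1 Kf1 min1] : exists2 f1, K f1 & forall f, K f -> dot f1 b <= dot f b.
  have ne : [set f | K f /\ dot f b <= dot f0 b] !=set0 by exists f0.
  have [f1] := EVT_min_rV ne (@Kcompact _) (wc _ _ (@continuous_dotl b)).
  rewrite inE => -[Kf1 l1] m1; exists f1 => // f Kf.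
  have [h|h] := leP (dot f b) (dot f0 b); first by apply: m1; rewrite inE.
  by apply: le_trans (ltW h).
have ne : [set f | K f /\ dot f b <= dot f1 b] !=set0 by exists f1.
have [f2] := EVT_max_rV ne (@Kcompact _) (wc _ _ continuous_dotxx).
rewrite inE => -[Kf2 l2] m2.
have min2 f : K f -> dot f2 b <= dot f b by move=> Kf; apply: le_trans l2 _; exact: min1.
have mono s h : 0 < s -> K (f2 + s *: h) -> 0 <= dot h b.
  by move=> s0 /min2; rewrite dotDl dotZl lerDl pmulr_rge0.
exists f2; split=> //.
  move=> h hP.
  have [s s0 Ks] : exists2 s, 0 < s & K (f2 + s *: h).
    by apply: Klocal => // p Pp e; rewrite hP.
  have [t t0 Kt] : exists2 t, 0 < t & K (f2 + t *: - h).
    by apply: Klocal => // p Pp e; rewrite dotNl hP ?oppr0.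
  have hb : dot h b = 0.
    by apply/eqP; rewrite eq_le -oppr_ge0 -dotNl (mono _ _ t0 Kt) (mono _ _ s0 Ks).
  (* Both f2 + s h and f2 - t h are minimizers, so neither is longer than f2; expanding the squares
     forces h = 0. *)
  have n1 : dot (f2 + s *: h) (f2 + s *: h) <= dot f2 f2.
    by apply: m2; rewrite inE; split=> //; rewrite dotDl dotZl hb mulr0 addr0.
  have n2 : dot (f2 + t *: - h) (f2 + t *: - h) <= dot f2 f2.
    by apply: m2; rewrite inE; split=> //; rewrite dotDl dotZl dotNl hb oppr0 mulr0 addr0.
  apply/eqP; apply: contraT => /dotxx_gt0 hh.
  move: n1 n2; rewrite !(dotDl, dotDr, dotZl, dotZr, dotNl, dotNr) (dotC h f2).
  move: (dot f2 f2) (dot f2 h) (dot h h) hh => u v w w0 n1 n2.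
  have e1 : 2 * v + s * w <= 0 by rewrite -(pmulr_rle0 _ s0); lra.
  have e2 : - 2 * v + t * w <= 0 by rewrite -(pmulr_rle0 _ t0); lra.
  have := mulr_gt0 s0 w0; have := mulr_gt0 t0 w0; lra.
have [s hs] := Pfinite Kf2.
pose w (i : 'I_(size s)) := s`_i.
pose A := [set i | `[< P (w i) /\ dot f2 (w i) = 1 >]]%SET.
(* A separating g would be an admissible direction along which the value at b decreases. *)
have [[t t0 e]|[g gA gb]] := Farkas A w b.
  exists [seq (t i, w i) | i <- enum A]; split.
    move=> q hq; have [i iA ->] := mapP hq.
    by move: iA; rewrite mem_enum inE => /asboolP[h1 h2]; split; [exact: t0|exact: h1|exact: h2].
  by rewrite big_map big_enum.
have [r r0 Kr] : exists2 r, 0 < r & K (f2 + r *: g).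
  apply: Klocal => // p Pp e; have ps := hs _ Pp e.
  have ip : (index p s < size s)%N by rewrite index_mem.
  have := gA (Ordinal ip); rewrite /w /= nth_index //; apply.
  by rewrite inE; apply/asboolP; rewrite /w /= nth_index.
by have := mono _ _ r0 Kr; rewrite leNgt gb.
Qed.

End VoronoiReduction.

(** * Eigenvalue bounds for Hermitian forms *)

Section FormBounds.
Context {R : realType}.
Local Notation C := R[i].
Implicit Types (B : @form R) (v : 'cV[C]_2).

Definition vnorm v : R := normC2 (v 0 0) + normC2 (v 1 0).

Lemma vnorm_ge0 v : 0 <= vnorm v.
Proof. by rewrite addr_ge0 // normC2_ge0. Qed.

(** Determinant over trace, a lower bound for the smaller eigenvalue of a positive form. *)
Definition hmin B : R := fdet B / (fa B + fc B).

Lemma hmin_gt0 B : posform B -> 0 < hmin B.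
Proof. by move=> pB; have [a0 dd] := pB; rewrite divr_gt0 // addr_gt0 // posform_fc. Qed.

(** Subtracting l = [hmin B] from the diagonal leaves a form with positive diagonal and determinant
    l^2. *)
Lemma hval_ge B v : posform B -> hmin B * vnorm v <= hval B v.
Proof.
move=> pB; have [a0 d0] := pB; have c0 := posform_fc pB.
have s0 : 0 < fa B + fc B by rewrite addr_gt0.
set l := hmin B; have l0 : 0 < l by exact: hmin_gt0.
have ls : l * (fa B + fc B) = fdet B by rewrite /l /hmin divfK // gt_eqF.
have la : l < fa B.
  rewrite -(ltr_pM2r s0) ls; apply: le_lt_trans (fdet_le_mul B) _.
  by rewrite ltr_pM2l // ltrDr.
pose B' := Form (fa B - l) (fc B - l) (fx B) (fy B).
have hB' : hval B' v = hval B v - l * vnorm v by rewrite !hvalE /vnorm; cbn [fa fc fx fy Form fst snd B']; ring.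
rewrite -subr_ge0 -hB' -(@pmulr_rge0 _ (fa B')); last by rewrite /fa /= subr_gt0.
rewrite hval_complete_square addr_ge0 ?normC2_ge0 // mulr_ge0 ?normC2_ge0 //.
have -> : fdet B' = fdet B - l * (fa B + fc B) + l ^+ 2 by rewrite /fdet /fa /fc /fx /fy /=; ring.
by rewrite ls subrr add0r sqr_ge0.
Qed.

Definition hmax B : R := `|fa B| + `|fc B| + `|fx B| + `|fy B|.

Lemma hval_le B v : `|hval B v| <= hmax B * vnorm v.
Proof.
have crossRe (z w : C) : `|complex.Re (Num.conj z * w)| <= (normC2 z + normC2 w) / 2.
  rewrite !reim /normC2 ler_norml; move: (complex.Re z) (complex.Im z) (complex.Re w) (complex.Im w) => p q r s.
  have := sqr_ge0 (p + r); have := sqr_ge0 (q + s); have := sqr_ge0 (p - r); have := sqr_ge0 (q - s).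
  rewrite !expr2 => *; apply/andP; split; lra.
have crossIm (z w : C) : `|complex.Im (Num.conj z * w)| <= (normC2 z + normC2 w) / 2.
  rewrite !reim /normC2 ler_norml; move: (complex.Re z) (complex.Im z) (complex.Re w) (complex.Im w) => p q r s.
  have := sqr_ge0 (p + s); have := sqr_ge0 (q + r); have := sqr_ge0 (p - s); have := sqr_ge0 (q - r).
  rewrite !expr2 => *; apply/andP; split; lra.
rewrite hvalE Re_mul /=; have h1 := crossRe (v 0 0) (v 1 0); have h2 := crossIm (v 0 0) (v 1 0).
move: h1 h2; rewrite /hmax /vnorm; have := normC2_ge0 (v 0 0); have := normC2_ge0 (v 1 0).
move: (normC2 (v 0 0)) (normC2 (v 1 0)) => n m m0 n0.
set r := complex.Re _; set s := complex.Im _ => h1 h2.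
apply: (@le_trans _ _ (`|fa B| * n + `|fc B| * m + 2 * (`|fx B| * `|r| + `|fy B| * `|s|))).
  apply: (le_trans (ler_normD _ _)); apply: lerD.
    by apply: (le_trans (ler_normD _ _)); rewrite !normrM (ger0_norm n0) (ger0_norm m0).
  rewrite normrM ger0_norm // ler_pM2l //.
  by apply: (le_trans (ler_normB _ _)); rewrite !normrM.
have := ler_wpM2l (normr_ge0 (fx B)) h1; have := ler_wpM2l (normr_ge0 (fy B)) h2.
have := mulr_ge0 (normr_ge0 (fa B)) m0; have := mulr_ge0 (normr_ge0 (fc B)) n0.
move: `|fa B| `|fc B| `|fx B| `|fy B| `|r| `|s| => *; nra.
Qed.

(* The trace of the product of the two matrices. *)
Definition hpair A B : R := fa A * fa B + fc A * fc B + 2 * (fx A * fx B + fy A * fy B).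

Lemma hpair_rankone A v : hpair A (rankone v) = hval A v.
Proof. by rewrite /hpair rankoneE hvalE /fa /fc /fx /fy /= !reim /=; ring. Qed.

(** B minus [hmin B] on the diagonal is still semidefinite, and two semidefinite forms pair
    nonnegatively by Cauchy-Schwarz. The resulting trace bound is the source of compactness. *)
Lemma hpair_ge B : posform B -> exists2 t : R, 0 < t & forall A,
  0 <= fa A -> 0 <= fc A -> 0 <= fdet A -> t * (fa A + fc A) <= hpair A B.
Proof.
move=> pB; have [a0 d0] := pB; have c0 := posform_fc pB.
exists (hmin B) => [|A aA cA dA]; first exact: hmin_gt0.
set l := hmin B; have l0 : 0 < l by exact: hmin_gt0.
have s0 : 0 < fa B + fc B by rewrite addr_gt0.
have ls : l * (fa B + fc B) = fdet B by rewrite /l /hmin divfK // gt_eqF.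
have la : l < fa B.
  rewrite -(ltr_pM2r s0) ls; apply: le_lt_trans (fdet_le_mul B) _.
  by rewrite ltr_pM2l // ltrDr.
have lc : l < fc B.
  rewrite -(ltr_pM2r s0) ls; apply: le_lt_trans (fdet_le_mul B) _.
  by rewrite mulrC ltr_pM2l // ltrDl.
rewrite -subr_ge0 /hpair.
have : fx B ^+ 2 + fy B ^+ 2 <= (fa B - l) * (fc B - l).
  have -> : (fa B - l) * (fc B - l) = fa B * fc B - l * (fa B + fc B) + l ^+ 2 by ring.
  by rewrite ls /fdet; have := sqr_ge0 l; lra.
move: dA; rewrite /fdet => dA.
have -> : fa A * fa B + fc A * fc B + 2 * (fx A * fx B + fy A * fy B) - l * (fa A + fc A) =
  fa A * (fa B - l) + fc A * (fc B - l) + 2 * (fx A * fx B + fy A * fy B) by ring.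
move: la lc; rewrite -(subr_gt0 l (fa B)) -(subr_gt0 l (fc B)); move: (fa B - l) (fc B - l) => p q p0 q0 hB.
have hA : fx A ^+ 2 + fy A ^+ 2 <= fa A * fc A by lra.
have cs : (fx A * fx B + fy A * fy B) ^+ 2 <= (fx A ^+ 2 + fy A ^+ 2) * (fx B ^+ 2 + fy B ^+ 2).
  by rewrite -subr_ge0; have := sqr_ge0 (fx A * fy B - fy A * fx B); congr (_ <= _); ring.
set z := fx A * fx B + fy A * fy B in cs *.
have h1 : z ^+ 2 <= (fa A * fc A) * (p * q).
  apply: (le_trans cs); apply: ler_pM => //; by rewrite addr_ge0 // sqr_ge0.
have h2 : (2 * z) ^+ 2 <= (fa A * p + fc A * q) ^+ 2.
  rewrite exprMn; apply: (@le_trans _ _ (2 ^+ 2 * ((fa A * fc A) * (p * q)))); first by rewrite ler_pM2l.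
  by rewrite -subr_ge0; have := sqr_ge0 (fa A * p - fc A * q); congr (_ <= _); ring.
have h3 : `|2 * z| <= fa A * p + fc A * q.
  by rewrite -(@ler_pXn2r _ 2) ?nnegrE ?addr_ge0 ?mulr_ge0 ?(ltW p0) ?(ltW q0) // real_normK ?num_real.
by move: h3; rewrite ler_norml => /andP[]; lra.
Qed.

End FormBounds.

(** * Short lattice vectors *)

Section Lattice.
Context {R : realType}.
Variable d : int.
Hypotheses (d0 : d < 0) (sf : squarefree_int d).
Local Notation C := R[i].
Local Notation lat := (@lat_nz R d).
Implicit Types (B : @form R) (v : 'cV[C]_2).

(* In lat_nz the inequality v != 0 is between functions, not matrices. *)
Lemma latE v : lat v <-> [/\ OF d (v 0 0), OF d (v 1 0) & v != 0].
Proof.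
have e : (fun_of_matrix v != 0) = (v != 0).
  congr negb; apply/eqP/eqP => [e|->].
    by apply/matrixP => i j; rewrite mxE; exact: (congr1 (fun f => f i j) e).
  by apply/funext => i; apply/funext => j; rewrite mxE.
split=> [[h v0]|[h1 h2 v0]]; first by rewrite -e; split; [exact: h|exact: h|exact: v0].
rewrite -e in v0; split=> //; case=> [[|[|?]] ?] //.
  by rewrite (_ : Ordinal _ = 0) //; apply: val_inj.
by rewrite (_ : Ordinal _ = 1) //; apply: val_inj.
Qed.

(** [hmin B] bounds the norms of both coordinates, hence the four integers that describe the
    vector. *)
Lemma finitely_many_short B (r : R) : posform B ->
  exists s : seq 'cV[C]_2, forall v, lat v -> hval B v <= r -> v \in s.
Proof.
move=> pB; have l0 := hmin_gt0 pB.
pose rho := `|2 * (r / hmin B)|.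
have [M hM] : exists M : nat, rho < M%:R by exists (Num.bound rho); apply: archi_boundP; exact: normr_ge0.
have small p q : normC2 (qint d p q) <= r / hmin B :> R -> (`|p| <= M)%N /\ (`|q| <= M)%N.
  move=> h; have := normC2_qint_ge (R := R) d0 p q.
  have e (z : int) : (`|z|%N)%:R <= (z%:~R : R) ^+ 2.
    have -> : (z%:~R : R) ^+ 2 = (`|z| * `|z|)%N%:R.
      by rewrite -real_normK ?num_real // -intr_norm expr2 -intrM -abszE -PoszM.
    by rewrite ler_nat; case: `|z|%N => // n; rewrite leq_pmulr.
  have := e p; have := e q; have := sqr_ge0 (p%:~R : R); have := sqr_ge0 (q%:~R : R).
  have := ler_norm (2 * (r / hmin B)); rewrite -/rho => *.
  by split; rewrite -(ler_nat R); apply/ltW/(le_lt_trans _ hM); lra.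
pose rg := [seq i%:Z - M%:Z | i <- iota 0 (M + M).+1].
have inr (z : int) : (`|z| <= M)%N -> z \in rg.
  move=> h; apply/mapP; exists `|(z + M%:Z)%R|%N; first by rewrite mem_iota; lia.
  lia.
exists [seq vec2 x y | x <- [seq qint d p q | p <- rg, q <- rg], y <- [seq qint d p q | p <- rg, q <- rg]].
move=> v /latE[/(OFP _ d0 sf)[p [q e1]] /(OFP _ d0 sf)[p' [q' e2]] v0] hv.
have nv : vnorm v <= r / hmin B.
  by rewrite ler_pdivlMr // mulrC; apply: le_trans hv; exact: hval_ge.
have n1 : normC2 (v 0 0) <= r / hmin B by apply: le_trans nv; rewrite lerDl normC2_ge0.
have n2 : normC2 (v 1 0) <= r / hmin B by apply: le_trans nv; rewrite lerDr normC2_ge0.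
rewrite e1 in n1; rewrite e2 in n2.
have [p1 q1] := small _ _ n1; have [p2 q2] := small _ _ n2.
rewrite [v]vec2E e1 e2; apply: allpairs_f; apply: allpairs_f; exact: inr.
Qed.

End Lattice.

(** * The polyhedron of forms with values at least 1 on the lattice *)

Section Voronoi.
Context {R : realType}.
Variable d : int.
Hypotheses (d0 : d < 0) (sf : squarefree_int d).
Local Notation C := R[i].
Local Notation lat := (@lat_nz R d).
Implicit Types (B : @form R) (v : 'cV[C]_2) (f : 'rV[R]_4).

(** Dirichlet's approximation: L^2 + 1 integer multiples of beta, reduced modulo O_F, fall into L^2
    cells. *)
Lemma dirichlet (beta : C) (e : R) : 0 < e -> exists u w : C,
  [/\ OF d u, OF d w, w != 0 & normC2 (u + beta * w) < e].
Proof.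
move=> e0; set om := Num.sqrt (absdisc d) / 2 : R; set t := (tro d)%:~R / 2 : R.
have om0 : 0 < om by rewrite divr_gt0 // sqrtr_gt0 absdisc_gt0.
have t01 : 0 <= t <= 1 by rewrite /t; case: (tro01 d) => ->; lra.
have [L L0 hL] : exists2 L : nat, (0 < L)%N & 4 + om ^+ 2 < e * (L%:R * L%:R).
  have [n hn] : exists n : nat, (4 + om ^+ 2) / e < n%:R.
    exists (Num.bound ((4 + om ^+ 2) / e)); apply: archi_boundP.
    by rewrite divr_ge0 ?addr_ge0 ?sqr_ge0 // ltW.
  exists n.+1 => //; rewrite mulrC -ltr_pdivrMr //; apply: (lt_le_trans hn).
  by rewrite -natrM ler_nat; lia.
(* [cs k] and [ct k] are the coordinates of k beta in the basis 1, omega. *)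
pose ct (k : nat) : R := complex.Im (beta * rC k%:R) / om.
pose cs (k : nat) : R := complex.Re (beta * rC k%:R) - ct k * t.
pose fr (x : R) := x - (Num.floor x)%:~R.
have fr0 x : 0 <= fr x by rewrite subr_ge0 floor_le.
have fr1 x : fr x < 1 by rewrite ltrBlDl -(rmorphD _ _ 1) floorD1_gt.
have Lp : 0 < L%:R :> R by rewrite ltr0n.
have cellP x : (`|Num.floor (L%:R * fr x)| < L)%N /\
    (`|Num.floor (L%:R * fr x)|%N)%:R <= L%:R * fr x < (`|Num.floor (L%:R * fr x)|%N)%:R + 1.
  have h0 : 0 <= L%:R * fr x by rewrite mulr_ge0.
  have e1 : (`|Num.floor (L%:R * fr x)|%N)%:Z = Num.floor (L%:R * fr x).
    by rewrite gez0_abs // floor_ge0.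
  rewrite -[(`|_|%N)%:R]/((`|Num.floor (L%:R * fr x)|%N)%:Z%:~R) e1 floor_le -(rmorphD _ _ 1) floorD1_gt; split=> //.
  rewrite -ltz_nat e1 floor_lt_int -[ltRHS]mulr1; apply: le_lt_trans (_ : L%:R * fr x < _) => //.
  by rewrite ltr_pM2l.
pose cell x := Ordinal (cellP x).1.
pose F (k : 'I_(L * L).+1) := (cell (cs k), cell (ct k)).
have /injectivePn[i [j ij eij]] : ~~ injectiveb F.
  by apply/negP => /injectiveP/leq_card; rewrite card_prod !card_ord ltnn.
have close x y : cell x = cell y -> `|fr x - fr y| < L%:R^-1.
  move=> /(congr1 val) /= exy; have [_ /andP[h1 h2]] := cellP x; have [_ /andP[h3 h4]] := cellP y.
  rewrite exy in h1 h2; rewrite -(ltr_pM2l Lp) divff ?gt_eqF // -{1}(ger0_norm (ltW Lp)) -normrM mulrBr ltr_norml.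
  apply/andP; split; lra.
have [c1 c2] : cell (cs i) = cell (cs j) /\ cell (ct i) = cell (ct j).
  by split; [exact: (congr1 fst eij)|exact: (congr1 snd eij)].
have {c1 c2} [h1 h2] := (close _ _ c1, close _ _ c2).
pose u (k : nat) : C := - qint d (Num.floor (cs k)) (Num.floor (ct k)).
exists (u i - u j), (rC (i%:Z - j%:Z)%:~R); split.
- by apply: OFD => //; do ?apply: OFN => //; exact: OF_qint.
- exact: OF_int.
- by apply/eqP => /rC_inj/eqP; rewrite intr_eq0 subr_eq0 eqz_nat; apply/negP.
have ze k : beta * rC k%:R = Complex (cs k + ct k * t) (ct k * om).
  by apply: complex_ext; rewrite [LHS]/= /cs /ct; [rewrite subrK|rewrite divfK // gt_eqF].
have -> : u i - u j + beta * rC (i%:Z - j%:Z)%:~R =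
    Complex ((fr (cs i) - fr (cs j)) + (fr (ct i) - fr (ct j)) * t) ((fr (ct i) - fr (ct j)) * om).
  rewrite rmorphB /= (_ : rC (_ - _) = rC i%:R - rC j%:R); last first.
    by apply: complex_ext; rewrite !reim //= subr0.
  rewrite mulrBr !ze /u /qint; apply: complex_ext; rewrite !reim /= /fr /om /t; ring.
move: h1 h2; move: (fr (cs i) - fr (cs j)) (fr (ct i) - fr (ct j)) => x y h1 h2.
have il : 0 < L%:R^-1 :> R by rewrite invr_gt0.
have yt : `|y * t| <= L%:R^-1.
  rewrite normrM; case/andP: t01 => t0 t1; rewrite (ger0_norm t0).
  apply: (le_trans (ler_pM _ _ (ltW h2) t1)); by rewrite ?mulr1.
have n1 : `|x + y * t| <= 2 * L%:R^-1.
  by apply: (le_trans (ler_normD _ _)); lra.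
have n2 : (x + y * t) ^+ 2 <= (2 * L%:R^-1) ^+ 2.
  by rewrite -real_normK ?num_real // lerXn2r // nnegrE // ltW // mulr_gt0.
have n3 : (y * om) ^+ 2 <= L%:R^-1 ^+ 2 * om ^+ 2.
  rewrite exprMn ler_wpM2r ?sqr_ge0 // -real_normK ?num_real //.
  by rewrite lerXn2r // ?nnegrE // ltW.
rewrite /normC2 /=; apply: (@le_lt_trans _ _ ((4 + om ^+ 2) / (L%:R * L%:R))).
  by rewrite invfM; move: n2 n3; rewrite !expr2; lra.
by rewrite ltr_pdivrMr // mulr_gt0.
Qed.

(** The off-diagonal coordinates are halved so that [dot] against [form_row] is the trace
    pairing. *)
Definition row_form f : form := Form (f 0 (inord 0)) (f 0 (inord 1)) (f 0 (inord 2) / 2) (f 0 (inord 3) / 2).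
Definition form_row B : 'rV[R]_4 := \row_i nth 0 [:: fa B; fc B; fx B; fy B] i.

Lemma sum_ord4 (V : nmodType) (F : 'I_4 -> V) :
  \sum_i F i = F (inord 0) + F (inord 1) + F (inord 2) + F (inord 3).
Proof.
rewrite !big_ord_recl big_ord0 addr0 !addrA; congr (_ + _ + _ + _); congr F; apply: val_inj;
  by rewrite /= inordK.
Qed.

Lemma dot_form_row f B : dot f (form_row B) = hpair (row_form f) B.
Proof.
rewrite /dot sum_ord4 !mxE !inordK //= /hpair /row_form /fa /fc /fx /fy /=.
by field.
Qed.

(** The Ryshkov polyhedron, whose vertices are the perfect forms of minimum 1. *)
Definition above_one B : Prop := (forall v, 0 <= hval B v) /\ forall v, lat v -> 1 <= hval B v.

(** A degenerate semidefinite form takes arbitrarily small values on lattice vectors, by Dirichlet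
    approximation of its kernel. *)
Lemma above_one_posform B : above_one B -> posform B.
Proof.
move=> [psd ge1].
have a1 : 1 <= fa B.
  have <- : hval B (vec2 1 0) = fa B by rewrite hvalE vec2_0 vec2_1 normC2_1 normC2_0 !reim /=; ring.
  apply: ge1.
  by apply/latE; rewrite vec2_0 vec2_1 vec2_eq0 oner_eq0; split=> //; [exact: OF1|exact: OF0].
have a0 : 0 < fa B by exact: lt_le_trans a1.
have an : rC (fa B) != 0 by apply/eqP => /rC_inj/eqP; rewrite gt_eqF.
split=> //; rewrite lt_def; apply/andP; split; last first.
  have := psd (vec2 (- Complex (fx B) (fy B)) (rC (fa B))).
  rewrite -(pmulr_rge0 _ a0) hval_complete_square vec2_0 vec2_1 mulrN mulrC addNr normC2_0 add0r.
  by rewrite pmulr_lge0 // normC2_gt0.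
apply/eqP => det0.
have [u [w [Ou Ow w0 h]]] := @dirichlet (Complex (fx B) (fy B) / rC (fa B)) ((fa B)^-1) (ltac:(by rewrite invr_gt0)).
have := ge1 (vec2 u w); rewrite -(ler_pM2l a0) hval_complete_square det0 mul0r addr0 vec2_0 vec2_1 mulr1 => hv.
have lv : lat (vec2 u w) by apply/latE; rewrite vec2_0 vec2_1 vec2_eq0 negb_and w0 orbT.
have := hv lv; apply/negP; rewrite -ltNge.
have -> : rC (fa B) * u + Complex (fx B) (fy B) * w = rC (fa B) * (u + Complex (fx B) (fy B) / rC (fa B) * w).
  by rewrite mulrDr mulrA mulrCA divff // mulr1.
rewrite normC2M (_ : normC2 (rC (fa B)) = fa B ^+ 2); last by rewrite /normC2 /= expr0n addr0.
by rewrite expr2 -mulrA gtr_pMr // -ltr_pdivlMl // mulr1.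
Qed.

Lemma row_formD f g (s : R) v : hval (row_form (f + s *: g)) v = hval (row_form f) v + s * hval (row_form g) v.
Proof. by rewrite -!hpair_rankone -!dot_form_row dotDl dotZl. Qed.

(** s is so small that s g changes every value by at most half of it. Vectors of value above 2 then
    stay above 1, and the finitely many others are treated one by one. *)
Lemma above_one_local f g : above_one (row_form f) ->
  (forall v, lat v -> hval (row_form f) v = 1 -> 0 <= hval (row_form g) v) ->
  exists2 s, 0 < s & above_one (row_form (f + s *: g)).
Proof.
move=> Kf hg; have pf := above_one_posform Kf; have [psd ge1] := Kf.
have [l hl] := finitely_many_short d0 sf 2 pf.
have m0 := hmin_gt0 pf; set B := row_form f in Kf hg pf psd ge1 hl m0 *.
set H := row_form g in hg *.
have M0 : 0 <= hmax H by rewrite /hmax !addr_ge0.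
pose s0 := hmin B / (2 * (hmax H + 1)).
have s00 : 0 < s0 by rewrite divr_gt0 // mulr_gt0 //; lra.
have sM s : 0 <= s -> s <= s0 -> forall v, `|s * hval H v| <= hval B v / 2.
  move=> sp ss v; rewrite normrM (ger0_norm sp).
  apply: (@le_trans _ _ (s0 * (hmax H * vnorm v))).
    by apply: ler_pM => //; exact: hval_le.
  apply: (@le_trans _ _ (hmin B * vnorm v / 2)); last by rewrite ler_wpM2r ?invr_ge0 //; exact: hval_ge.
  have -> : hmin B * vnorm v / 2 = s0 * ((hmax H + 1) * vnorm v).
    by rewrite /s0; field; rewrite gt_eqF //; lra.
  by rewrite ler_pM2l // ler_wpM2r ?vnorm_ge0 //; lra.
have [s1 s10 hs1] : exists2 s1, 0 < s1 & forall v, v \in l -> lat v -> forall s, 0 <= s -> s <= s1 ->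
    1 <= hval B v + s * hval H v.
  elim: l {hl} => [|w l [s1 s10 hs1]]; first by exists 1.
  have [lw|nlw] := pselect (lat w); last first.
    by exists s1 => // v; rewrite inE => /orP[/eqP ->|/hs1].
  have [e|ne] := eqVneq (hval B w) 1.
    exists s1 => // v; rewrite inE => /orP[/eqP -> _ s sp _|/hs1] //.
    by rewrite e lerDl mulr_ge0 // hg.
  have gt1 : 1 < hval B w by rewrite lt_def ne ge1.
  pose s2 := (hval B w - 1) / (`|hval H w| + 1).
  have n1 : 0 < `|hval H w| + 1 by rewrite ltr_wpDl.
  have s20 : 0 < s2 by rewrite divr_gt0 // subr_gt0.
  exists (Num.min s1 s2); first by rewrite lt_min s10.
  move=> v; rewrite inE => /orP[/eqP -> _ s sp|vl lv s sp]; rewrite le_min => /andP[h1 h2]; last exact: hs1.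
  have : s * (`|hval H w| + 1) <= hval B w - 1 by rewrite -ler_pdivlMr.
  have := ler_wpM2l sp (ler_norm (- hval H w)); rewrite normrN; lra.
pose s := Num.min s0 s1; have sp : 0 < s by rewrite lt_min s00.
have ss0 : s <= s0 by rewrite /s ge_min lexx.
have ss1 : s <= s1 by rewrite /s ge_min lexx orbT.
exists s; first exact: sp.
split=> v; rewrite row_formD -/B -/H.
  have := sM s (ltW sp) ss0 v; rewrite ler_norml => /andP[h1 _]; have := psd v; lra.
move=> lv; have [h|h] := leP (hval B v) 2.
  by apply: hs1 => //; [exact: hl|exact: ltW].
have := sM s (ltW sp) ss0 v; rewrite ler_norml => /andP[h1 _]; lra.
Qed.

Lemma continuous_closed_ge (p : 'rV[R]_4) (r : R) : closed [set f : 'rV[R]_4 | r <= dot f p].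
Proof.
by apply: (closed_comp (f := fun f : 'rV[R]_4 => dot f p) (D := [set x | r <= x]));
  [move=> f _; exact: continuous_dotl|exact: closed_ge].
Qed.

(** Closed as an intersection of half-spaces; bounded because the pairing with B controls the trace,
    and the trace controls the entries. *)
Lemma above_one_compact B c : posform B ->
  compact [set f | above_one (row_form f) /\ dot f (form_row B) <= c].
Proof.
move=> pB; have [t t0 ht] := hpair_ge pB.
pose r := c / t.
pose bx (i : 'I_4) : set R := `[- (2 * r), 2 * r]%classic.
have cb := @rV_compact R 4 bx (fun i => @segment_compact R _ _).
apply: subclosed_compact cb _.
  have -> : [set f | above_one (row_form f) /\ dot f (form_row B) <= c] =
      \bigcap_v [set f | 0 <= dot f (form_row (rankone v))] `&`
      (\bigcap_(v in [set v | lat v]) [set f | 1 <= dot f (form_row (rankone v))] `&`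
      [set f | - c <= dot f (- form_row B)]).
    apply/seteqP; split=> f /=.
      move=> [[h1 h2] h3]; split; last split.
      - by move=> v _ /=; rewrite dot_form_row hpair_rankone.
      - by move=> v lv /=; rewrite dot_form_row hpair_rankone; exact: h2.
      - by rewrite dotNr lerN2.
    move=> [h1 [h2 h3]]; split; last by move: h3; rewrite dotNr lerN2.
    split=> v; first by have := h1 v I; rewrite /= dot_form_row hpair_rankone.
    by move=> lv; have := h2 v lv; rewrite /= dot_form_row hpair_rankone.
  apply: closedI; first by apply: closed_bigI => v _; exact: continuous_closed_ge.
  apply: closedI; first by apply: closed_bigI => v _; exact: continuous_closed_ge.
  exact: continuous_closed_ge.
move=> f [af fc']; have pf := above_one_posform af.
have [a0 dd] := pf; have c0 := posform_fc pf.
have sc : fa (row_form f) + fc (row_form f) <= r.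
  rewrite ler_pdivlMr // mulrC; apply: le_trans fc'; rewrite dot_form_row.
  by apply: ht; exact: ltW.
have b0 : 0 < r by apply: lt_le_trans sc; exact: addr_gt0.
have sq (x : R) : (x / 2) ^+ 2 <= fa (row_form f) * fc (row_form f) -> - (2 * r) <= x <= 2 * r.
  move=> h; have h2 : (x / 2) ^+ 2 <= r ^+ 2.
    apply: (le_trans h); apply: (@le_trans _ _ ((fa (row_form f) + fc (row_form f)) ^+ 2)).
      by have := mulr_gt0 a0 c0; have := sqr_ge0 (fa (row_form f)); have := sqr_ge0 (fc (row_form f)); rewrite !expr2; lra.
    by rewrite lerXn2r // nnegrE ltW // addr_gt0.
  have : `|x / 2| <= r by rewrite -(@ler_pXn2r _ 2) // ?nnegrE ?(ltW b0) // real_normK ?num_real.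
  by rewrite ler_norml => /andP[]; lra.
have hx : fx (row_form f) ^+ 2 + fy (row_form f) ^+ 2 <= fa (row_form f) * fc (row_form f).
  by move: dd; rewrite /fdet; lra.
move=> i; rewrite /bx /= in_itv /= -(inord_val i).
case: i => [[|[|[|[|?]]]] ?] //=.
- by move: a0 c0 sc; rewrite /row_form /fa /fc /= => *; apply/andP; split; lra.
- by move: a0 c0 sc; rewrite /row_form /fa /fc /= => *; apply/andP; split; lra.
- apply: sq; have := sqr_ge0 (fy (row_form f)); move: hx; rewrite {1 3}/row_form /fx /=; lra.
- apply: sq; have := sqr_ge0 (fx (row_form f)); move: hx; rewrite {2 3}/row_form /fy /=; lra.
Qed.

End Voronoi.

(** * Perfect forms and Voronoi reduction *)

Section PerfectForms.
Context {R : realType}.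
Variable d : int.
Hypotheses (d0 : d < 0) (sf : squarefree_int d).
Local Notation C := R[i].
Local Notation lat := (@lat_nz R d).
Implicit Types (A : 'M[C]_2) (B : @form R) (v w : 'cV[C]_2) (f h : 'rV[R]_4).

Definition row_mx2 (p : 'rV[R]_4) : 'M[C]_2 :=
  mx2 (rC (p 0 (inord 0))) (Complex (p 0 (inord 2)) (p 0 (inord 3)))
      (Complex (p 0 (inord 2)) (- p 0 (inord 3))) (rC (p 0 (inord 1))).

Lemma row_mx2_form_row B : row_mx2 (form_row B) = herm B.
Proof. by rewrite /row_mx2 !mxE !inordK. Qed.

Lemma row_mx2D p q : row_mx2 (p + q) = row_mx2 p + row_mx2 q.
Proof.
rewrite /row_mx2 !mxE mx2D; congr mx2; apply: complex_ext; rewrite ?reim /= ?addr0 //.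
by rewrite opprD.
Qed.

Lemma row_mx2Z (t : R) p : row_mx2 (t *: p) = rC t *: row_mx2 p.
Proof.
by rewrite /row_mx2 !mxE mx2Z; congr mx2; apply: complex_ext; rewrite ?reim /=; ring.
Qed.

Lemma row_mx20 : row_mx2 0 = 0.
Proof. by rewrite -(scale0r 0) row_mx2Z rC0 scale0r. Qed.

Lemma row_mx2_inj : injective row_mx2.
Proof.
move=> p q h; have e i j := congr1 (fun M : 'M[C]_2 => M i j) h.
apply/rowP => i; rewrite -(inord_val i).
case: i => [[|[|[|[|?]]]] ?] //=.
- by have := e 0 0; rewrite !mx2_ij => /rC_inj.
- by have := e 1 1; rewrite !mx2_ij => /rC_inj.
- by have := e 0 1; rewrite !mx2_ij => -[].
- by have := e 0 1; rewrite !mx2_ij => -[].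
Qed.

Definition ray v : 'rV[R]_4 := form_row (rankone v).

Lemma row_mx2_ray v : row_mx2 (ray v) = outer v.
Proof. by rewrite row_mx2_form_row herm_rankone. Qed.

Lemma row_mx2_sum (I : Type) (r : seq I) (P : pred I) (t : I -> R) (v : I -> 'cV[C]_2) :
  row_mx2 (\sum_(i <- r | P i) t i *: ray (v i)) = \sum_(i <- r | P i) rC (t i) *: outer (v i).
Proof.
rewrite (big_morph row_mx2 row_mx2D row_mx20).
by apply: eq_bigr => i _; rewrite row_mx2Z row_mx2_ray.
Qed.

Lemma rayN v : ray (- v) = ray v.
Proof.
apply: row_mx2_inj; rewrite !row_mx2_ray /outer.
have -> : conjT (- v) = - conjT v by apply/matrixP => i j; rewrite !mxE rmorphN.
by rewrite mulNmx mulmxN opprK.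
Qed.

Definition min_cone A : set (@form R) := [set B | exists s : seq (R * 'cV[C]_2),
  (forall q, q \in s -> 0 <= q.1 /\ Min d A q.2) /\ herm B = \sum_(q <- s) rC q.1 *: outer q.2].

Lemma rC_gt0 (x : R) : (0 < rC x :> C) = (0 < x).
Proof. by rewrite -rC0 ltcR. Qed.

Lemma posdef_posform A : posdef A -> posform (coord A) /\ herm (coord A) = A.
Proof.
move=> [hA pA]; have e := coordK hA; split=> //.
have hv v : herm_eval A v = rC (hval (coord A) v) by rewrite -{1}e herm_eval_hval.
have a0 : 0 < fa (coord A).
  have := pA (vec2 1 0); rewrite vec2_eq0 oner_eq0 => /(_ isT).
  by rewrite hv rC_gt0 hvalE vec2_0 vec2_1 normC2_1 normC2_0 !reim /=; lra.
have an : rC (fa (coord A)) != 0 by apply/eqP => /rC_inj/eqP; rewrite gt_eqF.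
split=> //; set B := coord A in e a0 an hv *.
have := pA (vec2 (- Complex (fx B) (fy B)) (rC (fa B))); rewrite vec2_eq0 (negbTE an) andbF => /(_ isT).
rewrite hv rC_gt0.
rewrite -(pmulr_rgt0 _ a0) hval_complete_square vec2_0 vec2_1 mulrN mulrC addNr normC2_0 add0r.
by rewrite pmulr_lgt0 // normC2_gt0.
Qed.

Lemma posform_posdef B : posform B -> posdef (herm B).
Proof.
move=> pB; split; first exact: hermitian_herm.
by move=> v v0; rewrite herm_eval_hval rC_gt0; exact: posform_hval.
Qed.

Lemma minval_le A v : posdef A -> lat v -> minval d A <= hval (coord A) v.
Proof.
move=> pA lv; have [pB e] := posdef_posform pA; apply: ge_inf; last first.
  by exists v => //; rewrite -{1}e herm_eval_hval.
exists 0 => _ [w /latE[_ _ w0] <-]; rewrite -e herm_eval_hval /=.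
by apply: ltW; exact: posform_hval.
Qed.

Lemma MinP A v : posdef A -> Min d A v <-> lat v /\ hval (coord A) v = minval d A.
Proof.
move=> pA; have [pB e] := posdef_posform pA; rewrite /Min /= -{1}e herm_eval_hval.
by split=> -[h1 h2]; split=> //; [exact: rC_inj|rewrite h2].
Qed.

(** Pairing with B is minimized over the Ryshkov polyhedron. The minimum is attained at a vertex, a
    perfect form of minimum 1, and optimality places B in the cone of its minimal vectors. *)
Lemma voronoi B : posform B -> exists A, perfect d A /\ min_cone A B.
Proof.
move=> pB.
pose K := [set f | @above_one R d (row_form f)].
pose P := [set p | exists2 v, lat v & p = ray v].
have dr f v : dot f (ray v) = hval (row_form f) v by rewrite dot_form_row hpair_rankone.
have K0 : exists f, K f.
  (* The identity form: a nonzero element of O_F has norm at least 1. *)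
  exists (\row_i nth 0 [:: 1; 1; 0; 0] i); rewrite /K /=.
  have hv v : hval (row_form (\row_i nth 0 [:: 1; 1; 0; 0] i)) v = vnorm v.
    by rewrite hvalE /row_form /fa /fc /fx /fy /= !mxE !inordK //= /vnorm !reim /=; ring.
  split=> v; first by rewrite hv vnorm_ge0.
  move=> /latE[h1 h2 v0]; rewrite hv /vnorm.
  have [v00|v00] := eqVneq (v 0 0) 0.
    rewrite ler_wpDl ?normC2_ge0 //.
    apply: (OF_norm_ge1 d0 sf) => //; apply: contra v0 => /eqP v10.
    by rewrite [v]vec2E v00 v10 vec2_eq0 eqxx.
  by rewrite ler_wpDr ?normC2_ge0 //; exact: (OF_norm_ge1 d0 sf).
have Klocal f h : K f -> (forall p, P p -> dot f p = 1 -> 0 <= dot h p) ->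
    exists2 s, 0 < s & K (f + s *: h).
  move=> Kf hp; apply: above_one_local => // v lv e; rewrite -dr; apply: hp; first by exists v.
  by rewrite dr.
have Pfin f : K f -> exists s : seq 'rV[R]_4, forall p, P p -> dot f p = 1 -> p \in s.
  move=> Kf; have [l hl] := finitely_many_short d0 sf 1 (above_one_posform d0 sf Kf).
  exists (map ray l) => _ [v lv ->]; rewrite dr => e; apply: map_f; apply: hl => //.
  by rewrite e.
have [f [Kf span [s [sP eB]]]] := exists_vertex K0 (fun c => above_one_compact d0 sf (c := c) pB) Klocal Pfin.
have pf := above_one_posform d0 sf Kf; have pA := posform_posdef pf.
set A := herm (row_form f) in pA.
have cA : coord A = row_form f by rewrite hermK.
have [v1 lv1 hv1] : exists2 v, lat v & hval (row_form f) v = 1.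
  apply: contrapT => h; have : const_mx 1 = 0 :> 'rV[R]_4.
    apply: span => _ [v lv ->]; rewrite dr => e; exfalso; apply: h; by exists v.
  by move=> /rowP/(_ 0); rewrite !mxE => /eqP; rewrite oner_eq0.
have m1 : minval d A = 1.
  apply/eqP; rewrite eq_le -{1}hv1 -cA minval_le //=.
  apply: lb_le_inf; first by exists (complex.Re (herm_eval A v1)), v1.
  by move=> _ [v lv <-]; rewrite herm_eval_hval; exact: Kf.2.
have PMin p : P p -> dot f p = 1 -> exists2 v, Min d A v & p = ray v.
  by move=> [v lv ->]; rewrite dr => e; exists v => //; apply/MinP => //; rewrite cA m1.
have [g hg] : exists g : 'rV[R]_4 -> 'cV[C]_2, forall p, P p -> dot f p = 1 -> Min d A (g p) /\ p = ray (g p).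
  have /choice[g hg] : forall p, exists v, P p -> dot f p = 1 -> Min d A v /\ p = ray v.
    move=> p; have [[Pp e]|h] := pselect (P p /\ dot f p = 1).
      by have [v h1 h2] := PMin p Pp e; exists v.
    by exists 0 => h1 h2; exfalso; apply: h.
  by exists g.
exists A; split; last first.
  exists [seq (q.1, g q.2) | q <- s]; split.
    move=> q hq; have [q' q's ->] := mapP hq; have [h1 h2 h3] := sP _ q's.
    by split=> //; have [] := hg _ h2 h3.
  rewrite big_map -row_mx2_form_row eB -row_mx2_sum; congr row_mx2.
  rewrite big_seq [RHS]big_seq; apply: eq_bigr => q qs; have [h1 h2 h3] := sP _ qs.
  by have [_ <-] := hg _ h2 h3.
split=> // H hH.
have [l hl] := Pfin f Kf.
(* Both signs of every active ray serve as generators, so that Farkas yields arbitrary real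
   combinations. *)
pose w (i : bool * 'I_(size l)) := (-1) ^+ i.1 *: l`_i.2.
pose T := [set i : bool * 'I_(size l) | `[< P l`_i.2 /\ dot f l`_i.2 = 1 >]]%SET.
have [[t t0 e]|[h hT hx]] := Farkas T w (form_row (coord H)).
  exists [seq (t i * (-1) ^+ i.1, g l`_i.2) | i <- enum T]; split.
    move=> q hq; have [i iT ->] := mapP hq.
    by move: iT; rewrite mem_enum inE => /asboolP[h1 h2]; have [] := hg _ h1 h2.
  rewrite big_map big_enum /= -{1}(coordK hH) -row_mx2_form_row e -row_mx2_sum; congr row_mx2.
  apply: eq_bigr => i; rewrite inE => /asboolP[h1 h2]; have [_ <-] := hg _ h1 h2.
  by rewrite /w scalerA.
exfalso; move: hx; suff -> : h = 0 by rewrite dot0l ltxx.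
apply: span => p Pp e; have pl := hl _ Pp e.
have ip : (index p l < size l)%N by rewrite index_mem.
have Tp b : ((b, Ordinal ip) : bool * 'I_(size l)) \in T.
  by rewrite inE; apply/asboolP; rewrite /= nth_index.
have := hT _ (Tp false); have := hT _ (Tp true).
rewrite /w /= !nth_index // expr0 expr1 scale1r scaleN1r dotNr oppr_ge0 => h1 h2.
by apply/eqP; rewrite eq_le h1.
Qed.

End PerfectForms.

(** * Minimal vectors of a perfect form *)

Section MinimalVectors.
Context {R : realType}.
Variable d : int.
Hypotheses (d0 : d < 0) (sf : squarefree_int d).
Local Notation C := R[i].
Local Notation lat := (@lat_nz R d).
Local Notation L := 'rV[int]_4.
Implicit Types (A : 'M[C]_2) (B : @form R) (v w : 'cV[C]_2) (u : L).

Definition latv u : 'cV[C]_2 :=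
  vec2 (qint d (u 0 (inord 0)) (u 0 (inord 1))) (qint d (u 0 (inord 2)) (u 0 (inord 3))).

Lemma latvD u u' : latv (u + u') = latv u + latv u'.
Proof.
by rewrite [RHS]vec2E /latv !mxE /= !qintD.
Qed.

Lemma latvN u : latv (- u) = - latv u.
Proof. by rewrite [RHS]vec2E /latv !mxE /= !qintN. Qed.

Lemma latv_inj : injective latv.
Proof.
move=> u u' h; have e0 := congr1 (fun v : 'cV[C]_2 => v 0 0) h; have e1 := congr1 (fun v : 'cV[C]_2 => v 1 0) h.
rewrite !vec2_0 in e0; rewrite !vec2_1 in e1.
have [h0 h1] := qint_eq d0 e0; have [h2 h3] := qint_eq d0 e1.
by apply/rowP => i; rewrite -(inord_val i); case: i => [[|[|[|[|?]]]] ?].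
Qed.

Lemma latvP v : lat v <-> exists2 u, u != 0 & v = latv u.
Proof.
have l0 : latv 0 = 0 by rewrite /latv !mxE !qint_rC [RHS]vec2E !mxE.
split=> [/latE[/(OFP _ d0 sf)[p [q e1]] /(OFP _ d0 sf)[p' [q' e2]] v0]|[u u0 ->]].
  have ev : v = latv (\row_i nth 0 [:: p; q; p'; q'] i).
    by rewrite [v]vec2E /latv !mxE !inordK //= e1 e2.
  by exists (\row_i nth 0 [:: p; q; p'; q'] i) => //; apply: contra v0 => /eqP z; rewrite ev z l0.
apply/latE; rewrite vec2_0 vec2_1; split; [exact: OF_qint|exact: OF_qint|].
by apply: contra u0 => /eqP z; apply/eqP/latv_inj; rewrite z l0.
Qed.

(** The real part of the Hermitian product, which is the symmetric bilinear form on Z^4 that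
    [kissing] needs. *)
Definition hbil B v w : R := complex.Re ((conjT v *m herm B *m w) 0 0).

Lemma hbilC B v w : hbil B v w = hbil B w v.
Proof.
rewrite /hbil; set M := conjT v *m herm B *m w.
have -> : conjT w *m herm B *m v = conjT M.
  by rewrite /M !conjTM conjTK (hermitian_herm B) mulmxA.
by rewrite /conjT !mxE Re_conj.
Qed.

Lemma hbilDl B v v' w : hbil B (v + v') w = hbil B v w + hbil B v' w.
Proof.
rewrite /hbil (_ : conjT (v + v') = conjT v + conjT v'); last first.
  by apply/matrixP => i j; rewrite !mxE rmorphD.
by rewrite !mulmxDl mxE Re_add.
Qed.

Lemma hbil_hval B v : hbil B v v = hval B v. Proof. by []. Qed.

Lemma half_list (s : seq 'cV[C]_2) : (forall v, v \in s -> v != 0) -> exists r,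
  [/\ uniq r, {subset r <= s}, forall v, v \in r -> - v \notin r &
      forall v, v \in s -> v \in r \/ - v \in r].
Proof.
elim: s => [|v s IHs] s0; first by exists [::].
have [|r [r1 r2 r3 r4]] := IHs; first by move=> w ws; apply: s0; rewrite inE ws orbT.
have [h|h] := boolP ((v \in r) || (- v \in r)).
  exists r; split=> // [w wr|w]; first by rewrite inE r2 ?orbT.
  by rewrite inE => /orP[/eqP ->|/r4 //]; case/orP: h; [left|right].
move: h; rewrite negb_or => /andP[h1 h2]; exists (v :: r); split.
- by rewrite /= h1.
- by move=> w; rewrite !inE => /orP[->//|/r2 ->]; rewrite orbT.
- have vv : - v != v.
    apply: contra (s0 v (mem_head _ _)); rewrite -subr_eq0 -opprD oppr_eq0 => /eqP e.
    have e2 : (1 + 1 : C) *: v = 0 by rewrite scalerDl !scale1r.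
    by move/eqP: e2; rewrite scaler_eq0 => /orP[|//]; rewrite -(natrD _ 1 1) pnatr_eq0.
  move=> w; rewrite !inE negb_or => /orP[/eqP ->|wr]; first by rewrite vv h2.
  rewrite r3 // andbT; apply: contra h2 => /eqP <-; by rewrite opprK.
- move=> w; rewrite inE => /orP[/eqP ->|/r4[]h]; first by left; exact: mem_head.
    by left; rewrite inE h orbT.
  by right; rewrite inE h orbT.
Qed.

(* The w i represent the minimal vectors up to sign, so there are at most twelve. *)
Lemma min_list A : perfect d A -> exists (n : nat) (w : 'I_n -> 'cV[C]_2),
  [/\ (n <= 12)%N, forall i, Min d A (w i),
      forall f, (forall i, dot f (ray (w i)) = 0) -> f = 0 &
      forall B, min_cone d A B -> ncomb (fun i => ray (w i)) [set: 'I_n]%SET (form_row B)].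
Proof.
move=> [pA span]; have [pB eA] := posdef_posform pA.
have [s hs] := finitely_many_short d0 sf (minval d A) pB.
pose s' := [seq v <- s | `[< Min d A v >]].
have s'P v : v \in s' <-> Min d A v.
  rewrite mem_filter; split=> [/andP[/asboolP]//|mv]; apply/andP; split; first exact/asboolP.
  by have [lv e] := (MinP d v pA).1 mv; apply: hs => //; rewrite e.
have [|r [ur rs rN rc]] := @half_list s'.
  by move=> v /s'P/(MinP d v pA)[/latE[]].
have rMin v : v \in r -> Min d A v by move=> /rs /s'P.
have [un hun] : exists un : 'cV[C]_2 -> L, forall v, lat v -> latv (un v) = v.
  have /choice[un hun] : forall v, exists u, lat v -> latv u = v.
    move=> v; have [lv|nl] := pselect (lat v); last by exists 0.
    by have [u _ e] := (latvP v).1 lv; exists u.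
  by exists un.
have rl v : v \in r -> lat v by move=> /rMin/(MinP d v pA)[].
have unr v : v \in r -> latv (un v) = v by move=> /rl/hun.
(* The identity matrix is not an empty combination, so a minimal vector exists, and its value is
   positive. *)
have m0 : 0 < minval d A.
  have [t [tM te]] := span 1%:M (ltac:(by rewrite /Defs.hermitian mx2_1 mx2_conjT !(rmorph1, rmorph0))).
  case: t tM te => [|q t] tM te.
    by move: te; rewrite big_nil => /matrixP/(_ 0 0); rewrite !mxE => /eqP; rewrite oner_eq0.
  have [/latE[_ _ v0] <-] := (MinP d q.2 pA).1 (tM q (mem_head _ _)).
  exact: posform_hval.
have r12 : (size r <= 12)%N.
  rewrite -(size_map un).
  apply: (@kissing R (fun u u' => hbil (coord A) (latv u) (latv u')) (minval d A)) => //.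
  - by move=> x y; rewrite hbilC.
  - by move=> x y z; rewrite latvD hbilDl.
  - move=> x x0; rewrite hbil_hval; apply: minval_le => //; apply/latvP; by exists x.
  - by rewrite map_inj_in_uniq // => v w vr wr /(congr1 latv); rewrite !unr.
  - move=> _ /mapP[v vr ->]; split.
      by rewrite hbil_hval unr //; have [] := (MinP d v pA).1 (rMin v vr).
    apply/mapP => -[w wr e]; have := rN v vr; rewrite -(unr v vr) -latvN e (unr w wr).
    by rewrite wr.
pose n := size r; pose w (i : 'I_n) := r`_i.
have wr i : w i \in r by exact: mem_nth.
have rw v : v \in r -> exists i, w i = v.
  move=> vr; have iv : (index v r < n)%N by rewrite index_mem.
  by exists (Ordinal iv); rewrite /w /= nth_index.
have rayw v : Min d A v -> exists i, ray (w i) = ray v.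
  move=> /s'P/rc[/rw[i <-]|/rw[i e]]; first by exists i.
  by exists i; rewrite e rayN.
exists n, w; split=> //; first by move=> i; exact: rMin.
  move=> f h; apply/eqP; apply: contraT => /dotxx_gt0.
  have [t [tM te]] := span (row_mx2 f) (ltac:(by rewrite /Defs.hermitian /row_mx2 mx2_conjT;
    congr mx2; apply: complex_ext; rewrite ?reim /= ?oppr0 ?opprK)).
  have ef : f = \sum_(q <- t) q.1 *: ray q.2.
    by apply: row_mx2_inj; rewrite te (row_mx2_sum t xpredT (fun q => q.1) (fun q => q.2)).
  suff -> : dot f f = 0 by rewrite ltxx.
  rewrite {2}ef.
  rewrite (big_morph (dot f) (dotDr f) (dot0r f)) big_seq big1 // => q /tM/rayw[i e].
  by rewrite dotZr -e h mulr0.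
move=> B [t [tP te]].
have -> : form_row B = \sum_(q <- t) q.1 *: ray q.2.
  apply: row_mx2_inj.
  by rewrite row_mx2_form_row te (row_mx2_sum t xpredT (fun q => q.1) (fun q => q.2)).
elim: t tP {te} => [|q t IHt] tP.
  by rewrite big_nil; exists (fun=> 0) => //; rewrite big1 // => i _; rewrite scale0r.
rewrite big_cons; apply: ncombD; last by apply: IHt => p pt; apply: tP; rewrite inE pt orbT.
have [q0 /rayw[i <-]] := tP q (mem_head _ _).
by apply: ncombZ => //; apply: ncomb1; rewrite inE.
Qed.

End MinimalVectors.

(** * Measure of the cone of a perfect form *)

Section ConeVolume.
Context {R : realType}.
Variable d : int.
Hypotheses (d0 : d < 0) (sf : squarefree_int d).
Local Notation C := R[i].
Implicit Types (A : 'M[C]_2) (B : @form R) (v w : 'cV[C]_2) (f h : 'rV[R]_4).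

Lemma covered_fa0 : covered [set B : @form R | fa B = 0] 0.
Proof.
have -> : [set B : @form R | fa B = 0] = ([set 0] `*` setT) `*` setT.
  apply/seteqP; split=> -[[a c] [x y]] /=; rewrite /fa /=; last by move=> [[-> _] _].
  by move=> ->.
have m0 : measurable ([set 0] : set (measurableTypeR R)) by exact: measurable_set1.
exists (([set 0] `*` setT) `*` setT); split=> //.
  by apply: measurableX => //; apply: measurableX.
rewrite [X in (X <= _)%E](product_measure1E leb2 leb2) //; last exact: measurableX.
rewrite [X in (X * _)%E](product_measure1E (@lebesgue_measure R) (@lebesgue_measure R)) //.
rewrite [X in (X * _ * _ <= _)%E](_ : _ = 0%E); last exact: lebesgue_measure_set1.
by rewrite !mul0e.
Qed.

Lemma dot_form_rowE f B : dot f (form_row B) = f 0 (inord 0) * fa B + f 0 (inord 1) * fc B +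
  f 0 (inord 2) * fx B + f 0 (inord 3) * fy B.
Proof. by rewrite /dot sum_ord4 !mxE !inordK. Qed.

Lemma covered_linear_fa (f0 f1 f2 f3 : R) : f0 != 0 ->
  covered [set B : @form R | f0 * fa B + f1 * fc B + f2 * fx B + f3 * fy B = 0] 0.
Proof.
move=> n0; pose g (c x y : R) := (f1 * c + f2 * x + f3 * y) / f0.
have mg : measurable_fun [set: @form R] (fun B => g (fc B) (fx B) (fy B)).
  apply: measurable_funM; last exact: measurable_cst.
  apply: measurable_funD; [apply: measurable_funD|]; apply: measurable_funM => //;
    [exact: measurable_fc|exact: measurable_fx|exact: measurable_fy].
have := covered_preserving (preserving_shear_a mg) covered_fa0.
apply: covered_sub => B /= h; rewrite /g {1}/fa /=.
by apply: (mulfI n0); rewrite mulr0 mulrDr [f0 * (_ / f0)]mulrC divfK //; lra.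
Qed.

Lemma covered_linear_fc (f0 f1 f2 f3 : R) : f1 != 0 ->
  covered [set B : @form R | f0 * fa B + f1 * fc B + f2 * fx B + f3 * fy B = 0] 0.
Proof.
move=> n1; have := covered_preserving preserving_flip (covered_linear_fa f0 f2 (- f3) n1).
by apply: covered_sub => B /=; rewrite /fa /fc /fx /fy /=; lra.
Qed.

(** A shear reduces to the hyperplane a = 0 if a occurs, the flip of a and c handles c, and a
    unipotent matrix produces a coefficient of c when only x and y occur. *)
Lemma covered_hyperplane f : f != 0 -> covered [set B | dot f (form_row B) = 0] 0.
Proof.
move=> f0; have [h0|h0] := eqVneq (f 0 (inord 0)) 0; last first.
  by apply: covered_sub (covered_linear_fa _ _ _ h0) => B; rewrite /= dot_form_rowE; exact.
have [h1|h1] := eqVneq (f 0 (inord 1)) 0; last first.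
  by apply: covered_sub (covered_linear_fc _ _ _ h1) => B; rewrite /= dot_form_rowE; exact.
set p := f 0 (inord 2); set q := f 0 (inord 3).
have pq : - (p ^+ 2 + q ^+ 2) != 0.
  rewrite oppr_eq0 paddr_eq0 ?sqr_ge0 // !sqrf_eq0; apply: contra f0 => /andP[/eqP e2 /eqP e3].
  apply/eqP/rowP => i; rewrite -(inord_val i) mxE.
  by case: i => [[|[|[|[|?]]]] ?].
have := covered_preserving (preserving_upper (Complex p q)) (covered_linear_fc 0 p q pq).
apply: covered_sub => B /=; rewrite dot_form_rowE h0 h1 -/p -/q => e.
have -> : fc (act (mx2 1 (Complex p q) 0 1) B) = fc B.
  by rewrite /act mx2_conjT /herm !mx2M /coord !mx2_ij {1}/fc /= ?reim /=; ring.
have -> : fx (act (mx2 1 (Complex p q) 0 1) B) = fx B + p * fc B.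
  by rewrite /act mx2_conjT /herm !mx2M /coord !mx2_ij {1}/fx /= ?reim /=; ring.
have -> : fy (act (mx2 1 (Complex p q) 0 1) B) = fy B + q * fc B.
  by rewrite /act mx2_conjT /herm !mx2M /coord !mx2_ij {1}/fy /= ?reim /=; ring.
by rewrite -[RHS]e; ring.
Qed.

Lemma covered_bigU (I : eqType) (s : seq I) (S : I -> set (@form R)) (b : I -> R) :
  (forall i, i \in s -> covered (S i) (b i)) ->
  covered [set B | exists2 i, i \in s & S i B] (\sum_(i <- s) b i).
Proof.
elim: s => [|i s IHs] h.
  by rewrite big_nil; apply: covered_sub covered_set0 => B [].
rewrite big_cons.
have h1 := h i (mem_head _ _).
have h2 : covered [set B | exists2 i, i \in s & S i B] (\sum_(i <- s) b i).
  by apply: IHs => j js; apply: h; rewrite inE js orbT.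
apply: covered_sub (coveredU h1 h2) => B [j]; rewrite inE => /orP[/eqP ->|js] Sj; first by left.
by right; exists j.
Qed.

Lemma sum_enum (n m : nat) (A : {set 'I_n}) : #|A| = m -> exists2 e : 'I_m -> 'I_n,
  forall k, e k \in A & forall (V : nmodType) (G : 'I_n -> V), \sum_(i in A) G i = \sum_k G (e k).
Proof.
move=> cA; exists (fun k => enum_val (cast_ord (esym cA) k)); first by move=> k; exact: enum_valP.
move=> V G; rewrite big_enum_val (reindex (cast_ord (esym cA))) //.
by exists (cast_ord cA) => i _; rewrite ?cast_ordK ?cast_ordKV.
Qed.

(** If p lies in F, or if the four rays are dependent, the cone lies in a hyperplane. *)
Lemma covered_simplicial (n : nat) (w : 'I_n -> 'cV[C]_2) (p : 'I_n) (F : {set 'I_n}) : #|F| = 3 ->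
  covered [set B | P1 B /\ ncomb (fun i => ray (w i)) (p |: F)%SET (form_row B)]
    (if p \in F then 0 else 3 / 2 * Lobachevsky (pi / 3)).
Proof.
move=> F3; have L0 := @Lobachevsky_pi3_ge0 R.
have hyper f : f != 0 -> (forall i, i \in (p |: F)%SET -> dot f (ray (w i)) = 0) ->
    covered [set B | P1 B /\ ncomb (fun i => ray (w i)) (p |: F)%SET (form_row B)] 0.
  move=> f0 h; apply: covered_sub (covered_hyperplane f0) => B [_ [t t0 e]] /=.
  by rewrite e dot_sumr big1 // => i iF; rewrite dotZr h ?mulr0.
have [pF|pF] := boolP (p \in F).
  have F3' : (#|F| < 4)%N by rewrite F3.
  have [f f0 hf] := exists_orthogonal (fun k => ray (w (enum_val k))) F3'.
  apply: (hyper f f0) => i; rewrite (finset.setUidPr _) ?finset.sub1set // => iF.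
  by have := hf (enum_rank_in iF i); rewrite enum_rankK_in.
have c4 : #|(p |: F)%SET| = 4 by rewrite cardsU1 pF F3.
have [e eA esum] := sum_enum c4.
pose v k := w (e k).
pose M : 'M[R]_4 := \matrix_(k, j) ray (v k) 0 j.
have [/eqP dM|dM] := eqVneq (\det M) 0.
  move: dM; rewrite -det_tr => /det0P[f f0 fM].
  apply: covered_le (hyper f f0 _); first by rewrite mulr_ge0.
  have hk k : dot f (ray (v k)) = 0.
    have := congr1 (fun X : 'rV[R]_4 => X 0 k) fM; rewrite !mxE => h; rewrite -[RHS]h.
    by apply: eq_bigr => j _; rewrite !mxE.
  move=> i iA; have := esum R (fun j => (j == i)%:R * dot f (ray (w j))).
  rewrite (bigD1 i) //= eqxx mul1r big1 ?addr0 => [->|j /andP[_ /negbTE ->]]; last by rewrite mul0r.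
  by rewrite big1 // => k _; rewrite (hk k) mulr0.
have sum4 t : \sum_k t k *: ray (v k) = t (inord 0) *: ray (v (inord 0)) + t (inord 1) *: ray (v (inord 1))
    + t (inord 2) *: ray (v (inord 2)) + t (inord 3) *: ray (v (inord 3)) by rewrite sum_ord4.
have ind : indep4 (v (inord 0)) (v (inord 1)) (v (inord 2)) (v (inord 3)).
  move=> t1 t2 t3 t4 h; pose t : 'rV[R]_4 := \row_i nth 0 [:: t1; t2; t3; t4] i.
  have te : [/\ t 0 (inord 0) = t1, t 0 (inord 1) = t2, t 0 (inord 2) = t3 & t 0 (inord 3) = t4].
    by split; rewrite mxE inordK.
  case: te => e1 e2 e3 e4.
  have tM : t *m M = 0.
    have z : \sum_k t 0 k *: ray (v k) = 0.
      apply: row_mx2_inj; rewrite row_mx2_sum row_mx20 sum_ord4 e1 e2 e3 e4; exact: h.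
    apply/rowP => j; have := congr1 (fun X : 'rV[R]_4 => X 0 j) z; rewrite summxE !mxE => z'.
    by rewrite -[RHS]z'; apply: eq_bigr => k _; rewrite !mxE.
  have t0 : t = 0.
    apply/eqP; apply: contraT => tn; move: dM; have -> : \det M = 0; last by rewrite eqxx.
    by apply/eqP/det0P; exists t.
  by rewrite -e1 -e2 -e3 -e4 t0 !mxE.
apply: covered_sub (covered_simplex ind) => B [PB [t t0 eB]]; split=> //.
exists (t (e (inord 0))), (t (e (inord 1))), (t (e (inord 2))), (t (e (inord 3))); split=> //.
by rewrite -row_mx2_form_row eB esum (row_mx2_sum _ xpredT (fun k => t (e k)) v) sum_ord4.
Qed.

(** Double counting: every triple is missed by n - 3 of the points. *)
Lemma sum_missing (n : nat) (T : {set {set 'I_n}}) : (forall F, F \in T -> #|F| = 3) ->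
  (\sum_(p < n) \sum_(F in T) (p \notin F) = #|T| * (n - 3))%N.
Proof.
move=> T3; rewrite exchange_big /= -sum_nat_const; apply: eq_bigr => F FT.
have <- : #|~: F| = (n - 3)%N by rewrite cardsCs finset.setCK card_ord T3.
by rewrite -sum1_card [RHS]big_mkcond /=; apply: eq_bigr => p _; rewrite !inE; case: (p \in F).
Qed.

(* For some apex p at most fifteen facets avoid p, by averaging over all apexes. *)
Lemma covered_min_cone A : perfect d A ->
  covered [set B | P1 B /\ min_cone d A B] (15 * (3 / 2 * Lobachevsky (pi / 3))).
Proof.
move=> pA; have L0 := @Lobachevsky_pi3_ge0 R.
have [n [w [n12 wM span cone]]] := min_list d0 sf pA.
have n4 : (4 <= n)%N.
  rewrite leqNgt; apply/negP => n4; have [f f0 hf] := exists_orthogonal (fun i => ray (w i)) n4.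
  by rewrite (span f hf) eqxx in f0.
pose lam : 'rV[R]_4 := \row_i nth 0 [:: 1; 1; 0; 0] i.
have lam0 i : 0 < dot lam (ray (w i)).
  have [lw _] := (MinP d (w i) pA.1).1 (wM i).
  have [_ _ w0] := (latE d _).1 lw.
  rewrite /lam dot_form_rowE !mxE !inordK //= rankoneE /fa /fc /= !mul1r !mul0r !addr0.
  rewrite lt_def addr_ge0 ?normC2_ge0 // andbT paddr_eq0 ?normC2_ge0 // !normC2_eq0 -vec2_eq0 -vec2E.
  exact: w0.
have [T [cT T3 Tc]] := few_triples n4 lam0.
have [p hp] : exists p, (\sum_(F in T) (p \notin F) <= 15)%N.
  apply: contrapT => h; have h16 p : (16 <= \sum_(F in T) (p \notin F))%N.
    by rewrite ltnNge; apply/negP => hp; apply: h; exists p.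
  (* The average (2n - 4)(n - 3) / n increases with n in this range and is 180 / 12 = 15 at n =
     12. *)
  have arith k : (4 <= k)%N -> (k <= 12)%N -> ((2 * k - 4) * (k - 3) < k * 16)%N by do 13 (case: k => [|k] //).
  have h1 : (n * 16 <= #|T| * (n - 3))%N.
    rewrite -(sum_missing T3) -{1}(card_ord n) -sum_nat_const; exact: leq_sum.
  have h2 : (#|T| * (n - 3) <= (2 * n - 4) * (n - 3))%N by rewrite leq_mul2r cT orbT.
  by have := leq_ltn_trans (leq_trans h1 h2) (arith n n4 n12); rewrite ltnn.
pose S F := [set B : @form R | P1 B /\ ncomb (fun i => ray (w i)) (p |: F)%SET (form_row B)].
have cov := @covered_bigU _ (enum T) S (fun F => if p \in F then 0 else 3 / 2 * Lobachevsky (pi / 3))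
  (fun F FT => covered_simplicial w p (T3 F (ltac:(by rewrite mem_enum in FT)))).
apply: covered_le (covered_sub _ cov); last first.
  move=> B [PB /cone cB]; have [F FT h] := Tc p _ cB.
  by exists F; rewrite ?mem_enum.
have -> : \sum_(F <- enum T) (if p \in F then 0 else 3 / 2 * Lobachevsky (pi / 3)) =
    \sum_(F in T) (p \notin F)%:R * (3 / 2 * Lobachevsky (pi / 3)) :> R.
  by rewrite big_enum; apply: eq_bigr => F _; case: (p \in F); rewrite ?mul0r ?mul1r.
by rewrite -mulr_suml -natr_sum ler_wpM2r ?ler_nat // mulr_ge0.
Qed.

End ConeVolume.

(** * Integrability in a cusp *)

Section Cusp.
Context {R : realType}.
Local Notation C := R[i].
Local Notation leb := (@lebesgue_measure R).
Local Notation RR := (measurableTypeR R).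
Implicit Types (B : @form R) (v : 'cV[C]_2).

(** The region where a may be large while c, x and y are O(1 / a). *)
Definition cusp (K : R) : set (@form R) := [set B | 0 <= fa B /\
  [/\ (1 + fa B) * `|fc B| <= K, (1 + fa B) * `|fx B| <= K & (1 + fa B) * `|fy B| <= K]].

Definition cusp_fun (K : R) B : R := K * (1 + fa B) * \1_(cusp K) B.

Lemma measurable_cusp K : measurable (cusp K).
Proof.
have mn (f : @form R -> R) : measurable_fun [set: @form R] f ->
    measurable [set B | (1 + fa B) * `|f B| <= K].
  move=> mf; apply: measurable_set_le; last exact: measurable_cst.
  apply: measurable_funM; first by apply: measurable_funD; [exact: measurable_cst|exact: measurable_fa].
  exact: measurableT_comp.
rewrite (_ : cusp K = [set B | 0 <= fa B] `&` ([set B | (1 + fa B) * `|fc B| <= K] `&`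
    ([set B | (1 + fa B) * `|fx B| <= K] `&` [set B | (1 + fa B) * `|fy B| <= K]))).
  apply: measurableI; first by apply: measurable_set_le; [exact: measurable_cst|exact: measurable_fa].
  apply: measurableI; first exact: mn measurable_fc.
  by apply: measurableI; [exact: mn measurable_fx|exact: mn measurable_fy].
apply/seteqP; split=> B /=; first by move=> [h0 [h1 h2 h3]].
by move=> [h0 [h1 [h2 h3]]].
Qed.

Lemma measurable_cusp_fun K : measurable_fun [set: @form R] (cusp_fun K).
Proof.
apply: measurable_funM; last exact: measurable_indic (measurable_cusp K).
apply: measurable_funM; first exact: measurable_cst.
by apply: measurable_funD; [exact: measurable_cst|exact: measurable_fa].
Qed.

Lemma cusp_fun_ge0 K B : 0 <= K -> 0 <= cusp_fun K B.
Proof.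
move=> K0; rewrite /cusp_fun indicE; have [|_] := boolP (B \in cusp K); last by rewrite mulr0.
by rewrite inE => -[a0 _]; rewrite mulr1 mulr_ge0 // addr_ge0.
Qed.

Lemma lebesgue_itv_sym (r : R) : 0 <= r -> leb `[- r, r] = (2 * r)%:E.
Proof.
move=> r0; rewrite lebesgue_measure_itv /= lte_fin.
case: ltP => [_|h]; first by rewrite -EFinD; congr (_%:E); ring.
have -> : r = 0 by lra.
by rewrite mulr0.
Qed.

Lemma norm_le_div (a x K : R) : 0 <= a ->
  ((1 + a) * `|x| <= K) = (- (K / (1 + a)) <= x <= K / (1 + a)).
Proof.
move=> a0; have a1 : 0 < 1 + a by rewrite ltr_wpDr.
by rewrite -ler_norml ler_pdivlMr // mulrC.
Qed.

Lemma integral_cusp_xy K a c : 0 <= K ->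
  (\int[leb2]_q (cusp_fun K ((a : RR, c : RR), q))%:E =
   (if (0 <= a) && ((1 + a) * `|c| <= K) then K * (1 + a) * (2 * (K / (1 + a))) ^+ 2 else 0)%:E)%E.
Proof.
move=> K0; case: ifPn => [/andP[a0 hc]|h].
  set I := (`[- (K / (1 + a)), K / (1 + a)] : set R).
  have mI : measurable (I : set RR) by exact: measurable_itv.
  have e q : cusp_fun K ((a : RR, c : RR), q) = K * (1 + a) * \1_(I `*` I) q.
    rewrite /cusp_fun /fa /=; congr (_ * _); rewrite !indicE; congr (_%:R); congr nat_of_bool.
    apply/idP/idP; rewrite !inE /cusp /fa /fc /fx /fy /=.
      by move=> [_ [_ h1 h2]]; split; rewrite /I /= in_itv /= -norm_le_div.
    by rewrite /I /= !in_itv /= -!norm_le_div // => -[h1 h2].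
  under eq_integral do rewrite e.
  rewrite (@integral_indicator_scale R _ _ leb2 (I `*` I)); last 2 first.
  - exact: measurableX.
  - by rewrite mulr_ge0 // addr_ge0.
  have lI : leb I = (2 * (K / (1 + a)))%:E by apply: lebesgue_itv_sym; rewrite divr_ge0 // addr_ge0.
  rewrite [X in (_ * X)%E](product_measure1E leb leb) //.
  rewrite [X in (_ * (X * _))%E]lI [X in (_ * (_ * X))%E]lI.
  by rewrite -!EFinM; congr (_%:E); ring.
rewrite integral0_eq // => q _; rewrite /cusp_fun indicE memNset ?mulr0 //.
by rewrite /cusp /fa /fc /= => -[a0 [hc _ _]]; move: h; rewrite a0 hc.
Qed.

Lemma integral_cusp_c K a : 0 <= K ->
  (\int[leb]_c (if (0 <= a) && ((1 + a) * `|c| <= K) then K * (1 + a) * (2 * (K / (1 + a))) ^+ 2 else 0)%:E =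
   (if 0 <= a then 8 * K ^+ 4 * (1 + a) ^- 2 else 0)%:E)%E.
Proof.
move=> K0; case: ifPn => [a0|h]; last first.
  by rewrite integral0_eq // => c _; rewrite (negbTE h).
set I := (`[- (K / (1 + a)), K / (1 + a)] : set R).
have e c : (if true && ((1 + a) * `|c| <= K) then K * (1 + a) * (2 * (K / (1 + a))) ^+ 2 else 0) =
    (K * (1 + a) * (2 * (K / (1 + a))) ^+ 2) * \1_I c.
  rewrite /= norm_le_div // indicE /I mem_setE in_itv /=; case: ifP => _; by rewrite ?mulr1 ?mulr0.
have a1 : 0 < 1 + a by rewrite ltr_wpDr.
under eq_integral do rewrite e.
rewrite (@integral_indicator_scale R _ _ leb I); last 2 first.
- exact: measurable_itv.
- by rewrite mulr_ge0 ?sqr_ge0 // mulr_ge0 // ltW.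
rewrite [X in (_ * X)%E]lebesgue_itv_sym; last by rewrite divr_ge0 // ltW.
by rewrite -EFinM; congr (_%:E); field; rewrite gt_eqF.
Qed.

Lemma integral_inv_sqr_le (k : R) (n : nat) : 0 <= k ->
  (\int[leb]_(a in `[0%R, n%:R]) (k * (1 + a) ^- 2)%:E <= k%:E)%E.
Proof.
move=> k0.
have hd (x : R) : 0 <= x <= n%:R -> is_derive x 1 (fun x : R => k * - (1 + x)^-1) (k * (1 + x) ^- 2).
  move=> /andP[x0 _]; have x1 : 1 + x != 0 by rewrite gt_eqF // ltr_wpDr.
  have h1 := is_deriveD (is_derive_cst (1 : R) x (1 : R)) (is_derive_id x (1 : R)).
  have h := is_deriveM (is_derive_cst k x 1) (is_deriveN (is_deriveV x1 h1)).
  by apply: (is_derive_eq h); rewrite /GRing.scale /=; field.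
have hc (x : R) : 0 <= x <= n%:R -> {for x, continuous (fun x : R => k * (1 + x) ^- 2)}.
  move=> /andP[x0 _]; have x1 : 1 + x != 0 by rewrite gt_eqF // ltr_wpDr.
  have c1 : (fun x : R => 1 + x) @ x --> 1 + x by apply: cvgD; [exact: cvg_cst|exact: cvg_id].
  apply: cvgM; first exact: cvg_cst.
  apply: cvgV; first by rewrite expf_neq0.
  by rewrite (_ : (fun _ => _) = (fun x : R => (1 + x) * (1 + x))); [exact: cvgM|apply/funext => y; rewrite expr2].
rewrite (FTC2_closed (ler0n _ n) hd hc) lee_fin addr0 invr1.
have : 0 <= k * (1 + n%:R : R)^-1 by rewrite mulr_ge0 // invr_ge0 addr_ge0.
lra.
Qed.

(** At fixed a the fibre is a cube of side 2K / (1 + a), so the weight K (1 + a) leaves 8 K^4 / (1 +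
    a)^2, which is integrable over a >= 0. *)
Lemma integral_cusp_fun K : 0 <= K -> (\int[mu4]_B (cusp_fun K B)%:E <= (8 * K ^+ 4)%:E)%E.
Proof.
move=> K0; have g0 B : (0 <= (cusp_fun K B)%:E)%E by rewrite lee_fin cusp_fun_ge0.
have mg : measurable_fun [set: @form R] (fun B => (cusp_fun K B)%:E).
  by apply/measurable_EFinP; exact: measurable_cusp_fun.
rewrite -[leLHS]/(\int[leb2 \x leb2]_B (cusp_fun K B)%:E)%E fubini_tonelli1 //.
rewrite -[leLHS]/(\int[leb \x leb]_p (fubini_F leb2 (fun B => (cusp_fun K B)%:E)) p)%E.
have mF : measurable_fun [set: (RR * RR)%type] (fubini_F leb2 (fun B => (cusp_fun K B)%:E)).
  exact: measurable_fun_fubini_tonelli_F.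
rewrite fubini_tonelli1 //; last by move=> p; apply: integral_ge0.
set J := fubini_F leb _.
have mJ : measurable_fun [set: RR] J.
  by apply: measurable_fun_fubini_tonelli_F => // p; exact: integral_ge0.
have JE a : J a = (if 0 <= a then 8 * K ^+ 4 * (1 + a) ^- 2 else 0)%:E.
  rewrite /J /fubini_F; under eq_integral => c _ do rewrite integral_cusp_xy //.
  exact: integral_cusp_c.
have -> : (\int[leb]_a J a = \int[leb]_(a in `[0%R, +oo[) J a)%E.
  rewrite [RHS]integral_mkcond; apply: eq_integral => a _; rewrite patchE mem_setE in_itv /= andbT.
  by case: ifP => // h; rewrite JE h.
have -> : `[(0 : R), +oo[%classic = \bigcup_n `[0%R, n%:R].
  apply/seteqP; split=> x /=.
    rewrite in_itv /= andbT => x0; have [n hn] : exists n : nat, x < n%:R.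
      by exists (Num.bound x); exact: archi_boundP.
    by exists n => //=; rewrite in_itv /= x0 ltW.
  by move=> [n _]; rewrite /= !in_itv /= andbT => /andP[].
have K4 : 0 <= 8 * K ^+ 4 by rewrite mulr_ge0 // exprn_ge0.
have JE' (a : R) : 0 <= a -> J a = (8 * K ^+ 4 * (1 + a) ^- 2)%:E by move=> a0; rewrite JE a0.
apply: ge0_integral_le_exhaust.
- move=> n m nm; apply/subsetPset => x /=; rewrite !in_itv /= => /andP[-> h] /=.
  by apply: (le_trans h); rewrite ler_nat.
- by move=> i; exact: measurable_itv.
- by move=> i; exact: measurable_funTS.
- move=> i x; rewrite /= in_itv /= => /andP[x0 _]; rewrite JE' // lee_fin.
  by rewrite mulr_ge0 // invr_ge0 sqr_ge0.
- move=> n; apply: le_trans (integral_inv_sqr_le n K4).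
  rewrite le_eqVlt; apply/orP; left; apply/eqP; apply: eq_integral => a.
  by rewrite inE /= in_itv /= => /andP[a0 _]; exact: JE'.
Qed.

End Cusp.

(** * Forms in the cone of a perfect form lie in cusp regions *)

Section Domination.
Context {R : realType}.
Variable d : int.
Hypotheses (d0 : d < 0) (sf : squarefree_int d).
Local Notation C := R[i].
Implicit Types (A : 'M[C]_2) (B : @form R) (v w : 'cV[C]_2).

Lemma hpairC (B D : @form R) : hpair B D = hpair D B :> R.
Proof. by rewrite /hpair; ring. Qed.

Lemma row_formK B : row_form (\row_i nth 0 [:: fa B; fc B; 2 * fx B; 2 * fy B] i) = B.
Proof. by rewrite /row_form !mxE !inordK //= [RHS]FormE; congr Form; field. Qed.

Lemma hval_ncomb (n : nat) (w : 'I_n -> 'cV[C]_2) (t : 'I_n -> R) B v :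
  form_row B = \sum_i t i *: ray (w i) -> hval B v = \sum_i t i * hval (rankone (w i)) v.
Proof.
set f : 'rV[R]_4 := \row_i nth 0 [:: fa (rankone v); fc (rankone v); 2 * fx (rankone v); 2 * fy (rankone v)] i.
have hf D : hval D v = dot f (form_row D) by rewrite dot_form_row row_formK hpairC hpair_rankone.
by move=> e; rewrite hf e dot_sumr; apply: eq_bigr => i _; rewrite dotZr hf.
Qed.

Lemma act_ncomb (n : nat) (w : 'I_n -> 'cV[C]_2) (t : 'I_n -> R) (g : 'M[C]_2) B :
  form_row B = \sum_i t i *: ray (w i) -> form_row (act g B) = \sum_i t i *: ray (g *m w i).
Proof.
move=> e; apply: row_mx2_inj; rewrite row_mx2_form_row row_mx2_sum herm_act -row_mx2_form_row e row_mx2_sum.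
rewrite mulmx_sumr mulmx_suml; apply: eq_bigr => i _; exact: outer_scaleM.
Qed.

Lemma hval_rankone w v : hval (rankone w) v = normC2 ((conjT v *m w) 0 0).
Proof.
rewrite /hval /herm_eval herm_rankone /outer !mulmxA -[_ *m conjT w *m v]mulmxA mxE big_ord1.
have -> : conjT w *m v = conjT (conjT v *m w) by rewrite conjTM conjTK.
by rewrite [conjT (_ *m _)]/conjT !mxE mulrC conjM_normC2.
Qed.

Lemma exists_first_vector w : w != 0 -> exists2 g : 'M[C]_2, \det g = 1 & g *m w = vec2 1 0.
Proof.
move=> w0; have n0 : normC2 (w 0 0) + normC2 (w 1 0) != 0.
  rewrite paddr_eq0 ?normC2_ge0 // !normC2_eq0 -vec2_eq0 -vec2E; exact: w0.
set N := normC2 (w 0 0) + normC2 (w 1 0) in n0.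
have rN : rC N != 0 :> C by apply/eqP => /rC_inj/eqP; apply/negP.
have e : Num.conj (w 0 0) * w 0 0 + Num.conj (w 1 0) * w 1 0 = rC N by rewrite !conjM_normC2 -rCD.
exists (mx2 (Num.conj (w 0 0) / rC N) (Num.conj (w 1 0) / rC N) (- w 1 0) (w 0 0)).
  rewrite mx2_det mulrN opprK mulrAC -[_ / rC N * w 1 0]mulrAC -mulrDl e divff //.
rewrite [X in _ *m X]vec2E mx2_vec2; congr vec2; last by ring.
by rewrite mulrAC [_ / rC N * w 1 0]mulrAC -mulrDl e divff.
Qed.

Lemma abs_re_mul_le (x z : C) : `|complex.Re (x * Num.conj z)| <= (normC2 x + normC2 z) / 2 /\
  `|complex.Im (x * Num.conj z)| <= (normC2 x + normC2 z) / 2.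
Proof.
rewrite !reim /normC2 !ler_norml; move: (complex.Re x) (complex.Im x) (complex.Re z) (complex.Im z) => p q r s.
have := sqr_ge0 (p + r); have := sqr_ge0 (q + s); have := sqr_ge0 (p - r); have := sqr_ge0 (q - s).
have := sqr_ge0 (p + s); have := sqr_ge0 (q + r); have := sqr_ge0 (p - s); have := sqr_ge0 (q - r).
by rewrite !expr2 => *; split; apply/andP; split; lra.
Qed.

(* In the coordinates where w j is the first basis vector, det B <= 1 forces c <= 1 / t j. *)
Lemma cusp_bound_max (n : nat) (w : 'I_n -> 'cV[C]_2) (j : 'I_n) : w j != 0 ->
  exists g : 'M[C]_2, \det g = 1 /\ exists K : R, 0 <= K /\ forall K', K <= K' -> forall B t, P1 B ->
    (forall i, 0 <= t i) -> (forall i, t i <= t j) -> form_row B = \sum_i t i *: ray (w i) ->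
    cusp K' (act g B) /\ 2 + fa B + fc B <= K' * (1 + fa (act g B)).
Proof.
move=> wj; have [g g1 gw] := exists_first_vector wj; exists g; split=> //.
pose x i := (g *m w i) 0 0; pose z i := (g *m w i) 1 0.
pose X := \sum_i normC2 (x i); pose Z := \sum_i normC2 (z i).
pose Yi i := (normC2 (x i) + normC2 (z i)) / 2 / normC2 (z i).
pose Y := \sum_i Yi i; pose W := \sum_i vnorm (w i).
have X0 : 0 <= X by apply: sumr_ge0 => i _; exact: normC2_ge0.
have Z0 : 0 <= Z by apply: sumr_ge0 => i _; exact: normC2_ge0.
have Yi0 i : 0 <= Yi i by rewrite divr_ge0 ?normC2_ge0 // divr_ge0 // addr_ge0 // normC2_ge0.
have Y0 : 0 <= Y by apply: sumr_ge0 => i _.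
have W0 : 0 <= W by apply: sumr_ge0 => i _; exact: vnorm_ge0.
have YZX : 0 <= (1 + Y) * (1 + Z + X) by rewrite mulr_ge0 // !addr_ge0.
exists (2 + W + (1 + Y) * (1 + Z + X)); split; first by rewrite addr_ge0 // addr_ge0.
move=> K' hK B t [pB dB] t0 tj eB.
have eB' := act_ncomb g eB; set B' := act g B in eB' *.
have g0 : \det g != 0 by rewrite g1 oner_eq0.
have pB' : posform B' by exact: act_posform.
have dB' : fdet B' <= 1 by rewrite /B' fdet_act g1 normC2_1 mul1r.
have [a0 dp] := pB'; have c0 := posform_fc pB'.
have comp (k : 'I_4) (F : @form R -> R) : (forall D, F D = form_row D 0 k) ->
    F B' = \sum_i t i * F (rankone (g *m w i)).
  move=> hF; rewrite hF eB' summxE; apply: eq_bigr => i _; by rewrite mxE -hF.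
have ea : fa B' = \sum_i t i * normC2 (x i).
  rewrite (comp (inord 0) fa) => [|D]; last by rewrite mxE inordK.
  by apply: eq_bigr => i _; rewrite rankoneE.
have ec : fc B' = \sum_i t i * normC2 (z i).
  rewrite (comp (inord 1) fc) => [|D]; last by rewrite mxE inordK.
  by apply: eq_bigr => i _; rewrite rankoneE.
have ex : fx B' = \sum_i t i * complex.Re (x i * Num.conj (z i)).
  rewrite (comp (inord 2) fx) => [|D]; last by rewrite mxE inordK.
  by apply: eq_bigr => i _; rewrite rankoneE.
have ey : fy B' = \sum_i t i * complex.Im (x i * Num.conj (z i)).
  rewrite (comp (inord 3) fy) => [|D]; last by rewrite mxE inordK.
  by apply: eq_bigr => i _; rewrite rankoneE.
have xj : x j = 1 by rewrite /x gw vec2_0.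
have sum_le (u : 'I_n -> R) : (forall i, 0 <= u i) -> \sum_i t i * u i <= t j * \sum_i u i.
  by move=> u0; rewrite mulr_sumr; apply: ler_sum => i _; exact: ler_wpM2r.
set s := t j in tj sum_le.
have as_ : s <= fa B'.
  rewrite ea (bigD1 j) //= xj normC2_1 mulr1 lerDl sumr_ge0 // => i _.
  by rewrite mulr_ge0 ?normC2_ge0.
have aX : fa B' <= s * X by rewrite ea; apply: sum_le => i; exact: normC2_ge0.
have cZ : fc B' <= s * Z by rewrite ec; apply: sum_le => i; exact: normC2_ge0.
have sc : s * fc B' <= 1.
  (* The value of B' at this vector is c det B' <= c, while the summand j alone contributes s
     c^2. *)
  pose v := vec2 (rC (fc B')) (- Complex (fx B') (- fy B')).
  have hv : hval B' v = fc B' * fdet B'.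
    by rewrite hvalE /v vec2_0 vec2_1 /normC2 !reim /fdet /=; ring.
  have hv2 : s * fc B' ^+ 2 <= hval B' v.
    rewrite (hval_ncomb v eB') (bigD1 j) //= hval_rankone gw.
    have -> : normC2 ((conjT v *m vec2 1 0) 0 0) = fc B' ^+ 2.
      by rewrite /conjT !mxE sum_ord2 !mxE /= mulr1 mulr0 addr0 /normC2 !reim /=; ring.
    rewrite lerDl sumr_ge0 // => i _; by rewrite mulr_ge0 // hval_rankone normC2_ge0.
  have : s * fc B' ^+ 2 <= fc B'.
    by apply: (le_trans hv2); rewrite hv ger_pMr.
  by rewrite expr2 mulrA -{3}[fc B']mul1r ler_pM2r.
have s0 : 0 <= s by exact: t0.
have ac : fa B' * fc B' <= X.
  apply: (@le_trans _ _ (s * X * fc B')); first by rewrite ler_pM2r.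
  by rewrite mulrAC -{2}[X]mul1r ler_wpM2r.
have c1Z : fc B' <= 1 + Z.
  have : fc B' * fc B' <= Z.
    apply: (@le_trans _ _ (s * Z * fc B')); first by rewrite ler_pM2r.
    by rewrite mulrAC -{2}[Z]mul1r ler_wpM2r.
  by have := sqr_ge0 (fc B' - 1); rewrite !expr2; nra.
have main : (1 + fa B') * fc B' <= 1 + Z + X by rewrite mulrDl mul1r; lra.
(* An off-diagonal summand vanishes with [z i] and is otherwise at most a constant times t_i
   |z_i|^2, so the off-diagonal entries are O(c). *)
have off (F : 'I_n -> R) : (forall i, `|F i| <= (normC2 (x i) + normC2 (z i)) / 2) ->
    (forall i, z i = 0 -> F i = 0) -> (1 + fa B') * `|\sum_i t i * F i| <= (1 + Y) * (1 + Z + X).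
  move=> F1 F2.
  have h : `|\sum_i t i * F i| <= fc B' * Y.
    rewrite ec mulr_suml; apply: (le_trans (ler_norm_sum _ _ _)); apply: ler_sum => i _.
    rewrite normrM (ger0_norm (t0 i)) -mulrA ler_wpM2l //.
    have [zi|zi] := eqVneq (z i) 0; first by rewrite F2 // normr0 mulr_ge0 ?normC2_ge0.
    have nz : 0 < normC2 (z i) by rewrite normC2_gt0.
    apply: (le_trans (F1 i)); apply: (@le_trans _ _ (normC2 (z i) * Yi i)).
      by rewrite /Yi [normC2 _ * _]mulrC divfK // gt_eqF.
    rewrite ler_pM2l // /Y (bigD1 i) //= lerDl sumr_ge0 // => k _; exact: Yi0.
  apply: (@le_trans _ _ ((1 + fa B') * (fc B' * Y))).
    by rewrite ler_wpM2l // addr_ge0 // ltW.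
  rewrite mulrA [X in _ <= X]mulrC; apply: ler_pM => //; last by rewrite lerDr.
  by rewrite mulr_ge0 ?addr_ge0 // ltW.
have hZX : 1 + Z + X <= (1 + Y) * (1 + Z + X) by rewrite mulrDl mul1r lerDl mulr_ge0 // !addr_ge0.
split.
  split; first exact: ltW.
  split.
  - rewrite ger0_norm ?(ltW c0) //; lra.
  - rewrite ex; apply: (@le_trans _ _ ((1 + Y) * (1 + Z + X))); last lra.
    apply: off => [i|i ->]; last by rewrite rmorph0 mulr0.
    by have [] := abs_re_mul_le (x i) (z i).
  - rewrite ey; apply: (@le_trans _ _ ((1 + Y) * (1 + Z + X))); last lra.
    apply: off => [i|i ->]; last by rewrite rmorph0 mulr0.
    by have [] := abs_re_mul_le (x i) (z i).
have tr : fa B + fc B <= s * W.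
  have -> : fa B + fc B = \sum_i t i * vnorm (w i).
    have -> : fa B = form_row B 0 (inord 0) by rewrite mxE inordK.
    have -> : fc B = form_row B 0 (inord 1) by rewrite mxE inordK.
    rewrite eB !summxE -big_split; apply: eq_bigr => i _ /=; rewrite !mxE !inordK //= rankoneE /vnorm /fa /fc /=.
    by symmetry; exact: mulrDr.
  by apply: sum_le => i; exact: vnorm_ge0.
have h1 : s * W <= W * fa B' by rewrite mulrC ler_wpM2l.
have h2 : (2 + W) * (1 + fa B') <= K' * (1 + fa B').
  by rewrite ler_pM2r ?ltr_wpDl //; lra.
apply: le_trans h2; have := mulr_ge0 W0 (ltW a0); lra.
Qed.

End Domination.

(** * Measurable pieces with integrable trace *)

Section FundamentalPiece.
Context {R : realType}.
Variable d : int.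
Hypotheses (d0 : d < 0) (sf : squarefree_int d).
Local Notation C := R[i].
Implicit Types (A : 'M[C]_2) (B : @form R).

(** B lies in the cusp region of a generator with the largest coefficient; G adds up the
    corresponding integrable functions over all generators. *)
Lemma domination A : perfect d A -> exists G : @form R -> R, [/\ measurable_fun [set: @form R] G,
  forall B, 0 <= G B, (\int[mu4]_B (G B)%:E < +oo)%E &
  forall B, P1 B -> min_cone d A B -> 2 + fa B + fc B <= G B].
Proof.
move=> pA; have [n [w [_ Mw _ cone]]] := min_list d0 sf pA.
have w0 i : w i != 0.
  by have [/(latE d)[_]] := Mw i.
pose ok j (p : 'M[C]_2 * R) := \det p.1 = 1 /\ 0 <= p.2 /\ forall K', p.2 <= K' -> forall B t, P1 B ->
    (forall i, 0 <= t i) -> (forall i, t i <= t j) -> form_row B = \sum_i t i *: ray (w i) ->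
    cusp K' (act p.1 B) /\ 2 + fa B + fc B <= K' * (1 + fa (act p.1 B)).
have /choice[p hp] : forall j, exists p, ok j p.
  by move=> j; have [g [g1 [K [K0 hK]]]] := cusp_bound_max (w0 j); exists (g, K).
pose K := \sum_j (p j).2.
have K0 : 0 <= K by apply: sumr_ge0 => j _; have [_ []] := hp j.
have Kj j : (p j).2 <= K.
  by rewrite /K (bigD1 j) //= lerDl sumr_ge0 // => i _; have [_ []] := hp i.
have mc j : measurable_fun [set: @form R] (fun B => cusp_fun K (act (p j).1 B)).
  by apply: measurableT_comp; [exact: measurable_cusp_fun|exact: measurable_act].
have c0 j B : 0 <= cusp_fun K (act (p j).1 B) by exact: cusp_fun_ge0.
exists (fun B => \sum_j cusp_fun K (act (p j).1 B)); split.
- by apply: measurable_sum.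
- by move=> B; apply: sumr_ge0 => j _.
- under eq_integral do rewrite -sumEFin.
  rewrite ge0_integral_sum //; first last.
  + by move=> j B _; rewrite lee_fin.
  + by move=> j; apply/measurable_EFinP.
  apply: (@le_lt_trans _ _ (\sum_(j < n) (8 * K ^+ 4)%:E)%E); last by rewrite sumEFin ltry.
  apply: lee_sum => j _; have [g1 _] := hp j.
  have pr : preserving mu4 mu4 (act (p j).1) by apply: preserving_act; rewrite g1 normC2_1.
  have mE : measurable_fun [set: @form R] (fun B => (cusp_fun K B)%:E).
    by apply/measurable_EFinP; exact: measurable_cusp_fun.
  have E0 B : [set: @form R] B -> (0 <= (cusp_fun K B)%:E)%E by rewrite lee_fin => _; exact: cusp_fun_ge0.
  have e := preserving_integral pr measurableT mE E0.
  rewrite preimage_setT in e; rewrite -e; exact: integral_cusp_fun.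
- move=> B PB /cone[t t0 eB].
  have eB' : form_row B = \sum_i t i *: ray (w i).
    by rewrite eB; apply: eq_bigl => i; rewrite finset.inE.
  have [i0 _|none] := pickP (fun _ : 'I_n => true); last first.
    have [[a0 _] _] := PB; have : form_row B 0 (inord 0) = 0.
      by rewrite eB' big1 ?mxE // => i _; have := none i.
    by rewrite mxE inordK //= => e0; move: a0; rewrite e0 ltxx.
  pose j := [arg max_(j > i0) t j]%O.
  have jmax i : t i <= t j by rewrite /j; case: Order.TotalTheory.arg_maxP => // k _; apply.
  have [g1 [_ /(_ K (Kj j) B t PB t0 jmax eB')[h1 h2]]] := hp j.
  rewrite (bigD1 j) //=; apply: (@le_trans _ _ (cusp_fun K (act (p j).1 B))).
    by rewrite /cusp_fun indicE mem_set // mulr1.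
  by rewrite lerDl sumr_ge0.
Qed.

Lemma measurable_P1 : measurable (@P1 R).
Proof.
have -> : @P1 R = [set B | 0 < fa B] `&` ([set B | 0 < fdet B] `&` [set B | fdet B <= 1]).
  by apply/seteqP; split => [B [[]]|B []] //= ? [].
apply: measurableI; first by apply: measurable_set_lt => //; exact: measurable_fa.
apply: measurableI; first by apply: measurable_set_lt => //; exact: measurable_fdet.
by apply: measurable_set_le => //; exact: measurable_fdet.
Qed.

(** The measurable set supplied by [covered_min_cone] is cut down to the region where 2 + a + c <=
    G; this keeps the whole cone and makes the trace integrable. *)
Lemma fundamental_piece A : perfect d A -> exists D : set (@form R), [/\ measurable D, D `<=` @P1 R,
  forall B, P1 B -> min_cone d A B -> D B, (mu4 D <= (15 * (3 / 2 * Lobachevsky (pi / 3)))%:E)%E &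
  (\int[mu4]_(B in D) (2 + fa B + fc B)%:E < +oo)%E].
Proof.
move=> pA; have [G [mG G0 iG hG]] := domination pA; have [E [mE PE Eb]] := covered_min_cone d0 sf pA.
have mT : measurable_fun [set: @form R] (fun B => 2 + fa B + fc B).
  by apply: measurable_funD; [apply: measurable_funD => //; exact: measurable_fa|exact: measurable_fc].
have mS : measurable [set B : @form R | 2 + fa B + fc B <= G B] by exact: measurable_set_le.
pose D := E `&` (@P1 R `&` [set B : @form R | 2 + fa B + fc B <= G B]).
have mD : measurable D by apply: measurableI => //; apply: measurableI => //; exact: measurable_P1.
exists D; split.
- exact: mD.
- by move=> B [_ []].
- by move=> B PB mB; split; [apply: PE|split=> //; exact: hG].
- by apply: le_trans Eb; apply: le_measure; [rewrite inE; exact: mD|rewrite inE; exact: mE|exact: subIsetl].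
apply: le_lt_trans iG; apply: (@le_trans _ _ (\int[mu4]_(B in D) (G B)%:E)%E).
  apply: ge0_le_integral.
  - exact: mD.
  - by move=> B [_ [[[a0 db] _] _]]; rewrite lee_fin !addr_ge0 // ltW // (posform_fc (conj a0 db)).
  - by apply/measurable_EFinP; apply: measurable_funTS; done.
  - by apply/measurable_EFinP; apply: measurable_funTS; done.
  - by move=> B DB; rewrite lee_fin; exact: DB.2.2.
apply: ge0_subset_integral.
- exact: mD.
- exact: measurableT.
- by apply/measurable_EFinP.
- by move=> B _; rewrite lee_fin.
- exact: subsetT.
Qed.

End FundamentalPiece.

(** * Gaussian sums over shifted integers *)

Section GaussSums.
Context {R : realType}.
Local Notation RR := (measurableTypeR R).
Local Notation leb := (@lebesgue_measure R).
Implicit Types (k b : R) (r : seq int).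

Lemma sum_single_le (I : eqType) (r : seq I) (P : pred I) (F : I -> R) (G : R) : uniq r -> 0 <= G ->
  (forall i, F i <= G) -> (forall i j, P i -> P j -> F i != 0 -> F j != 0 -> i = j) -> \sum_(i <- r | P i) F i <= G.
Proof.
move=> ur G0 FG F1; have [/hasP[i ir /andP[Pi Fi]]|/hasPn none] := boolP (has (fun i => P i && (F i != 0)) r).
  rewrite big_mkcond (bigD1_seq i) //= Pi big1 ?addr0 // => j ji; case: ifP => // Pj.
  by apply/eqP/negPn/negP => Fj; move/eqP: ji; apply; exact: F1.
rewrite big_seq_cond big1 // => i /andP[ir Pi]; apply/eqP/negPn/negP => Fi.
by have /negP := none i ir; apply; rewrite Pi.
Qed.

(** Comparison with the integral of exp(- x^2) over x >= 0: the intervals of length k ending at k (n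
    + b) are disjoint, and on each of them the integrand is at least its value at the right end. *)
Lemma half_gauss_sum k b (m : int) r : 0 < k -> 0 <= m%:~R + b -> uniq r ->
  k * (\sum_(n <- r | m < n) expR (- (k * (n%:~R + b)) ^+ 2)) <= Num.sqrt pi / 2.
Proof.
move=> k0 mb ur; pose J (n : int) : set R := `]k * (n%:~R - 1 + b), k * (n%:~R + b)]%classic.
pose D : set R := `[0%R, +oo[%classic.
pose F n x : R := gauss_fun (k * (n%:~R + b)) * \1_(J n) x.
have F0 n x : 0 <= F n x by rewrite mulr_ge0 // gauss_fun_ge0.
have mJ n : measurable (J n) by exact: measurable_itv.
have mD : measurable D by exact: measurable_itv.
have mFT n : measurable_fun [set: RR] (F n).
  by apply: measurable_funM => //; apply: measurable_indic; exact: mJ.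
have mF n : measurable_fun D (fun x => (F n x)%:E).
  by apply/measurable_EFinP; apply: measurable_funTS; exact: mFT.
have mlow n : m < n -> 0 <= k * (n%:~R - 1 + b).
  move=> mn; rewrite mulr_ge0 ?(ltW k0) //; have : m%:~R <= n%:~R - 1 :> R by rewrite -(rmorphB _ n 1) ler_int; lia.
  lra.
have iF n : m < n -> (\int[leb]_(x in D) (F n x)%:E = (k * gauss_fun (k * (n%:~R + b)))%:E)%E.
  move=> mn; under eq_integral do rewrite EFinM.
  rewrite ge0_integralZl_EFin ?gauss_fun_ge0 //; last first.
    by apply/measurable_EFinP; apply: measurable_indic; exact: mJ.
  rewrite integral_indic; [|exact: mD|exact: mJ].
  have -> : J n `&` D = J n.
    apply/seteqP; split => x; first by case.
    by rewrite /J /D /= !in_itv /= andbT => /andP[h1 h2]; split; [exact/andP|have := mlow n mn; lra].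
  have lJ : leb (J n) = k%:E.
    rewrite /J lebesgue_measure_itv /= lte_fin ltr_pM2l // ltrD2r ltrBlDr ltrDl ltr01 -EFinB.
    by congr (_%:E); ring.
  by rewrite -[X in (_ * X)%E]/(leb (J n)) lJ -EFinM mulrC.
rewrite -lee_fin -integral0y_gauss -big_filter.
have us : uniq [seq n <- r | m < n] by exact: filter_uniq.
have sm n : n \in [seq n <- r | m < n] -> m < n by rewrite mem_filter => /andP[].
set s := [seq n <- r | m < n] in us sm *; rewrite mulr_sumr -sumEFin.
have -> : (\sum_(n <- s) (k * expR (- (k * (n%:~R + b)) ^+ 2))%:E =
    \int[leb]_(x in D) (\sum_(n <- s) F n x)%:E)%E.
  under [RHS]eq_integral do rewrite -sumEFin.
  rewrite ge0_integral_sum //; last by move=> n x _; rewrite lee_fin.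
  by apply: eq_big_seq => n /sm/iF ->.
apply: ge0_le_integral => //.
- by move=> x _; rewrite lee_fin sumr_ge0.
- by apply/measurable_EFinP; apply: measurable_funTS; apply: measurable_sum => n; exact: mFT.
- by apply/measurable_EFinP; apply: measurable_funTS; exact: measurable_gauss_fun.
move=> x; rewrite /D /= in_itv /= andbT => x0; rewrite lee_fin big_seq; apply: sum_single_le => //.
- exact: gauss_fun_ge0.
- move=> n; rewrite /F indicE; case: (boolP (x \in J n)) => [|_]; last by rewrite mulr0 gauss_fun_ge0.
  rewrite inE /J /= in_itv /= => /andP[_ h]; rewrite mulr1 /gauss_fun ler_expR lerN2.
  by rewrite ler_sqr ?nnegrE // (le_trans x0).
- move=> i j /sm mi /sm mj; rewrite /F !indicE.
  case: (boolP (x \in J i)) => [|_]; last by rewrite mulr0 eqxx.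
  case: (boolP (x \in J j)) => [|_]; last by rewrite mulr0 eqxx.
  rewrite !inE /J /= !in_itv /= => /andP[h1 h2] /andP[h3 h4] _ _.
  have := lt_le_trans h1 h4; have := lt_le_trans h3 h2.
  rewrite !ltr_pM2l // !ltrD2r -!(rmorphB _ _ 1) !ltr_int; lia.
Qed.

(** The sum is split where n + b changes sign; each half costs half of the Gaussian integral and one
    further term of size at most 1. *)
Lemma gauss_sum_le k b r : 0 < k -> uniq r ->
  \sum_(n <- r) expR (- (k * (n%:~R + b)) ^+ 2) <= Num.sqrt pi / k + 2.
Proof.
move=> k0 ur.
have half b' (m : int) r' : uniq r' -> 0 <= m%:~R + b' ->
    \sum_(n <- r' | m <= n) expR (- (k * (n%:~R + b')) ^+ 2) <= Num.sqrt pi / 2 / k + 1.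
  move=> ur' mb; rewrite (bigID (fun n => m < n)) /=; apply: lerD.
    rewrite ler_pdivlMr // mulrC; apply: le_trans (half_gauss_sum k0 mb ur').
    by rewrite ler_pM2l // le_eqVlt; apply/orP; left; apply/eqP; apply: eq_bigl => n; lia.
  apply: sum_single_le => //; first by move=> i; rewrite -expR0 ler_expR oppr_le0 sqr_ge0.
  by move=> i j; lia.
have /andP[fb1 fb2] := floor_itv b; set f := Num.floor b in fb1 fb2.
pose m := - f.
have mb : 0 <= m%:~R + b by rewrite rmorphN /=; lra.
rewrite (bigID (fun n : int => m <= n)) /=.
have h1 := half b m r ur mb.
have h2 : \sum_(n <- r | ~~ (m <= n)) expR (- (k * (n%:~R + b)) ^+ 2) <= Num.sqrt pi / 2 / k + 1.
  have ur' : uniq [seq - n | n <- r] by rewrite map_inj_uniq //; exact: oppr_inj.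
  have mb' : 0 <= (1 - m)%:~R + - b.
    by move: fb2; rewrite rmorphB rmorphN rmorphD /=; lra.
  have := half (- b) (1 - m) _ ur' mb'; rewrite big_map; apply: le_trans.
  rewrite le_eqVlt; apply/orP; left; apply/eqP; apply: eq_big => n; first by lia.
  by move=> _; congr (expR (- _)); rewrite rmorphN /=; ring.
have -> : Num.sqrt pi / k = Num.sqrt pi / 2 / k + Num.sqrt pi / 2 / k :> R by field; rewrite gt_eqF.
lra.
Qed.

End GaussSums.

(** * Upper bound for the theta series of a form *)

Section ThetaBound.
Context {R : realType}.
Variable d : int.
Hypothesis d0 : d < 0.
Local Notation C := R[i].
Local Notation L := 'rV[int]_4.
Implicit Types B : @form R.

Local Notation Io := (Num.sqrt (absdisc d) / 2 : R).

(** Completing squares successively in the four integer coordinates; [gauss_sum_le] is uniform in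
    the shifts b0, b1, b2. *)
Lemma hval_latv B : posform B -> exists (b0 : int -> int -> int -> R) (b1 : int -> int -> R) (b2 : int -> R),
  forall u, hval B (latv d u) =
    (Num.sqrt (fa B) * ((u 0 (inord 0))%:~R + b0 (u 0 (inord 1)) (u 0 (inord 2)) (u 0 (inord 3)))) ^+ 2 +
    (Num.sqrt (fa B) * Io * ((u 0 (inord 1))%:~R + b1 (u 0 (inord 2)) (u 0 (inord 3)))) ^+ 2 +
    (Num.sqrt (fdet B / fa B) * ((u 0 (inord 2))%:~R + b2 (u 0 (inord 3)))) ^+ 2 +
    (Num.sqrt (fdet B / fa B) * Io * ((u 0 (inord 3))%:~R + 0)) ^+ 2.
Proof.
move=> [a0 db].
have S0 : Num.sqrt (absdisc d) != 0 :> R by rewrite gt_eqF // sqrtr_gt0 absdisc_gt0.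
pose t : R := (tro d)%:~R / 2.
pose bv p q : C := Complex (fx B) (fy B) * qint d p q.
exists (fun q p' q' => q%:~R * t + complex.Re (bv p' q') / fa B), (fun p' q' => complex.Im (bv p' q') / fa B / Io),
  (fun q' => q'%:~R * t) => u.
have sa := sqr_sqrtr (ltW a0); have sd := sqr_sqrtr (ltW (divr_gt0 db a0)).
apply: (mulfI (lt0r_neq0 a0)); rewrite hval_complete_square !exprMn sa sd vec2_0 vec2_1.
rewrite -/(bv (u 0 (inord 2)) (u 0 (inord 3))); move: (bv _ _) => z.
rewrite /normC2 !reim /= !mul0r !subr0 !addr0.
rewrite /t; move: S0 (u 0 (inord 0))%:~R (u 0 (inord 1))%:~R (u 0 (inord 2))%:~R (u 0 (inord 3))%:~R.
move=> S0 p q p' q'; field.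
by rewrite (lt0r_neq0 a0) S0.
Qed.

Lemma ler_sum_subset (I : eqType) (s T : seq I) (F : I -> R) : uniq s -> {subset s <= T} ->
  (forall i, 0 <= F i) -> \sum_(i <- s) F i <= \sum_(i <- T) F i.
Proof.
move=> us sT F0; elim: s us T sT => [|x s IH] /= us T sT; first by rewrite big_nil sumr_ge0.
move: us => /andP[xs us]; have xT : x \in T by apply: sT; rewrite inE eqxx.
rewrite (perm_big _ (perm_to_rem xT)) /= !big_cons lerD2l; apply: IH => // y ys.
have : y \in x :: rem x T by rewrite -(perm_mem (perm_to_rem xT)); apply: sT; rewrite inE ys orbT.
by rewrite inE => /orP[/eqP e|//]; rewrite -e ys in xs.
Qed.

(** The sums are evaluated from the inside out, each bound being uniform in the outer indices. *)
Lemma nested_sum_le (I : seq int) (F3 : int -> R) (F2 : int -> int -> R) (F1 : int -> int -> int -> R)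
    (F0 : int -> int -> int -> int -> R) (T0 T1 T2 T3 : R) :
  (forall q' p' q p, 0 <= F0 q' p' q p) -> (forall q' p' q, 0 <= F1 q' p' q) ->
  (forall q' p', 0 <= F2 q' p') -> (forall q', 0 <= F3 q') ->
  (forall q' p' q, \sum_(p <- I) F0 q' p' q p <= T0) -> (forall q' p', \sum_(q <- I) F1 q' p' q <= T1) ->
  (forall q', \sum_(p' <- I) F2 q' p' <= T2) -> \sum_(q' <- I) F3 q' <= T3 ->
  \sum_(q' <- I) \sum_(p' <- I) \sum_(q <- I) \sum_(p <- I) (F0 q' p' q p * F1 q' p' q * F2 q' p' * F3 q')
  <= T0 * T1 * T2 * T3.
Proof.
move=> p0 p1 p2 p3 h0 h1 h2 h3.
have t0 : 0 <= T0 by apply: le_trans (h0 0 0 0); apply: sumr_ge0.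
have t1 : 0 <= T1 by apply: le_trans (h1 0 0); apply: sumr_ge0.
have t2 : 0 <= T2 by apply: le_trans (h2 0); apply: sumr_ge0.
apply: (@le_trans _ _ (T0 * T1 * T2 * \sum_(q' <- I) F3 q')); last by rewrite ler_wpM2l ?mulr_ge0.
rewrite mulr_sumr; apply: ler_sum => q' _.
apply: (@le_trans _ _ (T0 * T1 * (\sum_(p' <- I) F2 q' p') * F3 q')); last first.
  by rewrite ler_wpM2r // ler_wpM2l ?mulr_ge0.
rewrite mulr_sumr mulr_suml; apply: ler_sum => p' _.
apply: (@le_trans _ _ (T0 * (\sum_(q <- I) F1 q' p' q) * F2 q' p' * F3 q')); last first.
  by rewrite !ler_wpM2r // ler_wpM2l.
rewrite mulr_sumr !mulr_suml; apply: ler_sum => q _.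
by rewrite -!mulr_suml !ler_wpM2r.
Qed.

(** The list is enlarged to a box of coordinates, over which the four Gaussian factors are summed
    one after the other. *)
Lemma theta_le B (e P Q : R) (s : seq L) : posform B -> 0 < e -> uniq s ->
  P = e * Num.sqrt (fa B) -> Q = e * Num.sqrt (fdet B / fa B) ->
  \sum_(u <- s) expR (- (e ^+ 2 * hval B (latv d u))) <=
  (Num.sqrt pi / P + 2) * (Num.sqrt pi / (P * Io) + 2) * (Num.sqrt pi / Q + 2) * (Num.sqrt pi / (Q * Io) + 2).
Proof.
move=> pB e0 us eP eQ; have [b0 [b1 [b2 hv]]] := hval_latv pB; have [a0 db] := pB.
have I0 : 0 < Io by rewrite divr_gt0 // sqrtr_gt0 absdisc_gt0.
have P0 : 0 < P by rewrite eP mulr_gt0 // sqrtr_gt0.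
have Q0 : 0 < Q by rewrite eQ mulr_gt0 // sqrtr_gt0 divr_gt0.
pose code (u : L) := ((u 0 (inord 3), u 0 (inord 2)), (u 0 (inord 1), u 0 (inord 0))).
pose cs (u : L) : seq int := [:: u 0 (inord 0); u 0 (inord 1); u 0 (inord 2); u 0 (inord 3)].
pose I := undup (flatten (map cs s)).
have uI : uniq I by exact: undup_uniq.
pose II := [seq (x, y) | x <- I, y <- I]; pose T := [seq (z, w) | z <- II, w <- II].
pose F3 (q' : int) := expR (- (Q * Io * (q'%:~R + 0)) ^+ 2).
pose F2 (q' p' : int) := expR (- (Q * (p'%:~R + b2 q')) ^+ 2).
pose F1 (q' p' q : int) := expR (- (P * Io * (q%:~R + b1 p' q')) ^+ 2).
pose F0 (q' p' q p : int) := expR (- (P * (p%:~R + b0 q p' q')) ^+ 2).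
pose G z := F0 z.1.1 z.1.2 z.2.1 z.2.2 * F1 z.1.1 z.1.2 z.2.1 * F2 z.1.1 z.1.2 * F3 z.1.1.
have inj : injective code.
  move=> u u' [e3 e2 e1 e0']; apply/rowP => i; rewrite -(inord_val i).
  by case: i => [[|[|[|[|]]]]].
have -> : \sum_(u <- s) expR (- (e ^+ 2 * hval B (latv d u))) = \sum_(z <- map code s) G z.
  rewrite big_map; apply: eq_bigr => u _; rewrite /G /F0 /F1 /F2 /F3 /= -!expRD hv.
  by congr expR; rewrite eP eQ; ring.
apply: (@le_trans _ _ (\sum_(z <- T) G z)).
  apply: ler_sum_subset; first by rewrite map_inj_uniq.
    move=> _ /mapP[u us' ->]; have mI x : x \in cs u -> x \in I.
      by move=> hx; rewrite mem_undup; apply/flatten_mapP; exists u.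
    apply/allpairsP; exists (((u 0 (inord 3), u 0 (inord 2)), (u 0 (inord 1), u 0 (inord 0)))); split=> //.
      by apply/allpairsP; exists (u 0 (inord 3), u 0 (inord 2)); split=> //; apply: mI; rewrite !inE eqxx ?orbT.
    by apply/allpairsP; exists (u 0 (inord 1), u 0 (inord 0)); split=> //; apply: mI; rewrite !inE eqxx ?orbT.
  by move=> z; rewrite /G !mulr_ge0 ?expR_ge0.
rewrite /T big_allpairs /II big_allpairs.
under eq_bigr do under eq_bigr do rewrite big_allpairs.
apply: (nested_sum_le (F0 := F0) (F1 := F1) (F2 := F2) (F3 := F3)) => *; rewrite ?expR_ge0 //; apply: gauss_sum_le => //; by rewrite mulr_gt0.
Qed.

End ThetaBound.

(** * The theta bound at small scale *)

Section ThetaSmall.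
Context {R : realType}.
Variable d : int.
Hypothesis d0 : d < 0.
Local Notation L := 'rV[int]_4.

(** Multiplying out, the leading term is (pi / Io)^2 = 4 pi^2 / |Delta|. The rest is at most a
    constant times e (1 + p^2)(1 + q^2), where (1 + p^2)(1 + q^2) = 1 + a + det / a + det is at most
    2 + a + c. *)
Lemma theta_small : exists2 M : R, 0 <= M & forall (e : R) (B : @form R) (s : seq L),
  0 < e -> e <= 1 -> P1 B -> uniq s ->
  e ^+ 4 * (fdet B * \sum_(u <- s) expR (- (e ^+ 2 * hval B (latv d u)))) <=
  4 * pi ^+ 2 / absdisc d + e * M * (2 + fa B + fc B).
Proof.
pose Io : R := Num.sqrt (absdisc d) / 2; pose S : R := Num.sqrt pi.
have D0 : 0 < absdisc d :> R := absdisc_gt0 d0.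
have I0 : 0 < Io by rewrite divr_gt0 // sqrtr_gt0.
have S0 : 0 <= S by exact: sqrtr_ge0.
have S2 : S ^+ 2 = pi by rewrite sqr_sqrtr // pi_ge0.
have I2 : Io ^+ 2 = absdisc d / 4 by rewrite expr_div_n sqr_sqrtr ?(ltW D0) //; congr (_ / _); ring.
pose A : R := pi / Io; pose M1 := S + S / Io + 4.
have A0 : 0 <= A by rewrite divr_ge0 ?pi_ge0 // ltW.
have SI0 : 0 <= S / Io by rewrite divr_ge0 // ltW.
have M10 : 0 <= M1 by rewrite !addr_ge0.
have Mp : 0 <= 2 * A * M1 + M1 ^+ 2 by rewrite addr_ge0 ?sqr_ge0 // mulr_ge0 // mulr_ge0.
exists (2 * A * M1 + M1 ^+ 2) => //.
move=> e B s e0 e1 [[a0 db] dB1] us; have c0 := posform_fc (conj a0 db).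
pose p : R := Num.sqrt (fa B); pose q : R := Num.sqrt (fdet B / fa B).
have p2 : p ^+ 2 = fa B by rewrite sqr_sqrtr // ltW.
have q2 : q ^+ 2 = fdet B / fa B by rewrite sqr_sqrtr // ltW // divr_gt0.
have p0 : 0 < p by rewrite sqrtr_gt0.
have q0 : 0 < q by rewrite sqrtr_gt0 divr_gt0.
have pq : fdet B = p ^+ 2 * q ^+ 2 by rewrite p2 q2 mulrC divfK // gt_eqF.
have half x : 0 < x -> (S + 2 * e * x) * (S / Io + 2 * e * x) <= A + e * M1 * (1 + x ^+ 2).
  move=> x0; have -> : A = S * (S / Io) by rewrite /A -S2 expr2 mulrA.
  have h1 : 2 * x <= 1 + x ^+ 2 by have := sqr_ge0 (1 - x); rewrite !expr2; lra.
  have h2 : e * (S + S / Io) * (2 * x) <= e * (S + S / Io) * (1 + x ^+ 2).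
    by rewrite ler_wpM2l // mulr_ge0 ?(ltW e0) // addr_ge0.
  have h3 : e * (e * (4 * x ^+ 2)) <= e * (4 * (1 + x ^+ 2)).
    rewrite ler_pM2l //; apply: (@le_trans _ _ (1 * (4 * x ^+ 2))).
      by rewrite ler_wpM2r // mulr_ge0 // sqr_ge0.
    by lra.
  have -> : (S + 2 * e * x) * (S / Io + 2 * e * x) =
    S * (S / Io) + e * (S + S / Io) * (2 * x) + e * (e * (4 * x ^+ 2)) by ring.
  have -> : e * M1 * (1 + x ^+ 2) = e * (S + S / Io) * (1 + x ^+ 2) + e * (4 * (1 + x ^+ 2)) by rewrite /M1; ring.
  lra.
have th := theta_le d0 (conj a0 db) e0 us erefl erefl; rewrite -/p -/q -/Io -/S in th.
apply: (@le_trans _ _ (e ^+ 4 * (fdet B * ((S / (e * p) + 2) * (S / (e * p * Io) + 2) *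
    (S / (e * q) + 2) * (S / (e * q * Io) + 2))))).
  by rewrite ler_pM2l ?exprn_gt0 // ler_pM2l.
have -> : e ^+ 4 * (fdet B * ((S / (e * p) + 2) * (S / (e * p * Io) + 2) *
    (S / (e * q) + 2) * (S / (e * q * Io) + 2))) =
    ((S + 2 * e * p) * (S / Io + 2 * e * p)) * ((S + 2 * e * q) * (S / Io + 2 * e * q)).
  by rewrite pq; field; rewrite !gt_eqF.
pose u := 1 + p ^+ 2; pose w := 1 + q ^+ 2.
have u1 : 1 <= u by rewrite lerDl sqr_ge0.
have w1 : 1 <= w by rewrite lerDl sqr_ge0.
have nn x : 0 < x -> 0 <= (S + 2 * e * x) * (S / Io + 2 * e * x).
  by move=> x0; rewrite mulr_ge0 // addr_ge0 // !mulr_ge0 // ltW.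
apply: (@le_trans _ _ ((A + e * M1 * u) * (A + e * M1 * w))).
  by apply: ler_pM; rewrite ?nn //; exact: half.
have uw : u * w <= 2 + fa B + fc B.
  rewrite /u /w mulrDl mul1r mulrDr mulr1 -pq p2 q2.
  have : fdet B / fa B <= fc B by rewrite ler_pdivrMr // mulrC fdet_le_mul.
  lra.
have e_pos : 0 <= e by exact: ltW.
have u_uw : u <= u * w by rewrite ler_peMr // (le_trans ler01).
have w_uw : w <= u * w by rewrite ler_peMl // (le_trans ler01).
have uw0 : 0 <= u * w by apply: le_trans u_uw; apply: le_trans u1.
have -> : 4 * pi ^+ 2 / absdisc d = A ^+ 2 by rewrite /A expr_div_n I2; field; rewrite gt_eqF.
have -> : (A + e * M1 * u) * (A + e * M1 * w) =
  A ^+ 2 + (e * (A * M1) * (u + w) + e * (e * (M1 ^+ 2 * (u * w)))) by ring.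
rewrite lerD2l; apply: (@le_trans _ _ (e * (2 * A * M1 + M1 ^+ 2) * (u * w))); last first.
  by apply: ler_wpM2l uw; exact: mulr_ge0 e_pos Mp.
have h1 : e * (A * M1) * (u + w) <= e * (A * M1) * (2 * (u * w)).
  apply: ler_wpM2l; first exact: mulr_ge0 e_pos (mulr_ge0 A0 M10).
  by rewrite mulr_natl mulr2n; exact: lerD.
have h2 : e * (e * (M1 ^+ 2 * (u * w))) <= e * (1 * (M1 ^+ 2 * (u * w))).
  by apply: ler_wpM2l => //; apply: ler_wpM2r => //; rewrite mulr_ge0 ?sqr_ge0.
have -> : e * (2 * A * M1 + M1 ^+ 2) * (u * w) =
  e * (A * M1) * (2 * (u * w)) + e * (1 * (M1 ^+ 2 * (u * w))) by ring.
exact: lerD.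
Qed.

End ThetaSmall.

(** * Cusp strips and one-variable integrals *)

Section StripIntegral.
Context {R : realType}.
Local Notation RR := (measurableTypeR R).
Local Notation leb := (@lebesgue_measure R).
Local Notation leb2 := (@leb2 R).
Local Notation mu4 := (@mu4 R).
Implicit Types (r k h s c : R) (B : @form R).

(** With r = rho, h = Im sigma and k = Re sigma / Im sigma this is a fundamental domain for the
    translations of (x + iy) / c by the complex conjugates of Z rho + Z sigma, whence the sign of
    y. *)
Definition strip r k h : set (@form R) := [set B | [/\ 0 <= - fy B, - fy B < h * fc B,
  0 <= fx B + k * fy B & fx B + k * fy B < r * fc B]].

Lemma measurable_strip r k h : measurable (strip r k h).
Proof.
have mx := @measurable_fx R; have my := @measurable_fy R; have mc := @measurable_fc R.
have -> : strip r k h = [set B : @form R | 0 <= - fy B] `&` ([set B : @form R | - fy B < h * fc B] `&`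
    ([set B : @form R | 0 <= fx B + k * fy B] `&` [set B : @form R | fx B + k * fy B < r * fc B])).
  by apply/seteqP; split => [B []|B [? [? []]]].
have my' : measurable_fun [set: @form R] (fun B : @form R => - fy B).
  have m : measurable_fun [set: @form R] ((-%R : R -> R) \o (@fy R)).
    by apply: measurableT_comp; [exact: oppr_measurable|exact: my].
  exact: m.
have mxy : measurable_fun [set: @form R] (fun B : @form R => fx B + k * fy B).
  by apply: measurable_funD => //; apply: measurable_funM.
have mkc (t : R) : measurable_fun [set: @form R] (fun B : @form R => t * fc B) by apply: measurable_funM.
by repeat apply: measurableI; first [apply: measurable_set_lt|apply: measurable_set_le] => //.
Qed.

Lemma preserving_shear2 k :
  preserving leb2 leb2 (fun p : (RR * RR)%type => ((p.1 : R) + k * (p.2 : R) : RR, p.2)%R).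
Proof.
have h2 := preserving_swap leb leb.
have h1 : preserving leb2 leb2 (fun q : (RR * RR)%type => (q.1, (q.2 : R) + k * (q.1 : R) : RR)%R).
  apply: (@preserving_prod _ _ _ _ _ leb leb idfun (fun y x : RR => (x : R) + k * (y : R) : RR)%R).
  - exact: preserving_idR.
  - by move=> y; exact: preserving_shift.
  - by apply: measurable_funD => //; apply: measurable_funM.
exact: (preserving_comp (preserving_comp h2 h1) h2).
Qed.

(** A shear turns the parallelogram into a rectangle. *)
Lemma strip_area r k h c : 0 <= r -> 0 <= h -> 0 <= c ->
  measurable [set q : (RR * RR)%type | strip r k h ((0 : RR, c : RR), q)] /\
  leb2 [set q : (RR * RR)%type | strip r k h ((0 : RR, c : RR), q)] = (r * h * c ^+ 2)%:E.
Proof.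
move=> r0 h0 c0; set A := [set q | _].
pose X : set RR := `[0, r * c[%classic; pose Y : set RR := `](- (h * c)), 0]%classic.
have mX : measurable X by exact: measurable_itv.
have mY : measurable Y by exact: measurable_itv.
have [ms hs] := preserving_shear2 k.
have e : A = (fun p : (RR * RR)%type => ((p.1 : R) + k * (p.2 : R) : RR, p.2)%R) @^-1` (X `*` Y).
  apply/seteqP; split => -[x y]; rewrite /A /strip /fx /fy /fc /X /Y /= !in_itv /=.
    by move=> [h1 h2 h3 h4]; split; apply/andP; split; lra.
  by move=> [/andP[h1 h2] /andP[h3 h4]]; split; lra.
split; first by rewrite e -[X in measurable X]setTI; apply: ms => //; exact: measurableX.
rewrite e hs; last exact: measurableX.
rewrite [LHS](product_measure1E leb leb) //.
have lX : leb X = (r * c)%:E.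
  rewrite lebesgue_measure_itv /= lte_fin; case: ltP => [_|H]; first by rewrite sube0.
  by congr (_%:E); apply/eqP; rewrite eq_le H mulr_ge0.
have lY : leb Y = (h * c)%:E.
  rewrite lebesgue_measure_itv /= lte_fin oppr_lt0; case: ltP => [_|H]; first by rewrite -EFinB; congr (_%:E); ring.
  by congr (_%:E); apply/eqP; rewrite eq_le H mulr_ge0.
by rewrite [X in (X * _)%E]lX [X in (_ * X)%E]lY -EFinM; congr (_%:E); ring.
Qed.

Lemma integral_linear (K b : R) : 0 <= b ->
  (\int[leb]_(a in `[0%R, b]) (K * a)%:E = (K * b ^+ 2 / 2)%:E)%E.
Proof.
move=> b0; have hd (x : R) : 0 <= x <= b -> is_derive x 1 (fun x : R => (K / 2) * (x * x)) (K * x).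
  move=> _; have h := is_deriveM (is_derive_cst (K / 2) x 1) (is_deriveM (is_derive_id x (1 : R)) (is_derive_id x (1 : R))).
  by apply: (is_derive_eq h); rewrite /GRing.scale /=; field.
have hc (x : R) : 0 <= x <= b -> {for x, continuous (fun x : R => K * x)}.
  by move=> _; apply: cvgM; [exact: cvg_cst|exact: cvg_id].
by rewrite (FTC2_closed b0 hd hc); congr (_%:E); field.
Qed.

Lemma integral_gamma2 (K s N : R) : 0 < s -> 0 <= N ->
  (\int[leb]_(c in `[0%R, N]) (K * (c * expR (- (s * c))))%:E =
   (K * (s ^- 2 - (N / s + s ^- 2) * expR (- (s * N))))%:E)%E.
Proof.
move=> s0 N0; have hd (x : R) : 0 <= x <= N ->
    is_derive x 1 (fun x : R => - K * ((x / s + s ^- 2) * expR (- (s * x)))) (K * (x * expR (- (s * x)))).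
  move=> _.
  have h1 : is_derive (x : R) 1 (fun x : R => - (s * x)) (- s).
    have h := is_deriveN (is_deriveM (is_derive_cst s x 1) (is_derive_id x (1 : R))).
    by apply: (is_derive_eq h); rewrite /GRing.scale /=; ring.
  have h2 : is_derive (x : R) 1 (fun x : R => expR (- (s * x))) (- s * expR (- (s * x))).
    have h := @is_derive1_comp R expR (fun x : R => - (s * x)) x _ _ (is_derive_expR _) h1.
    by apply: (is_derive_eq h); rewrite mulrC.
  have h3 : is_derive (x : R) 1 (fun x : R => x / s + s ^- 2) s^-1.
    have h := is_deriveD (is_deriveM (is_derive_id x (1 : R)) (is_derive_cst s^-1 x 1)) (is_derive_cst (s ^- 2) x (1 : R)).
    by apply: (is_derive_eq h); rewrite /GRing.scale /=; ring.
  have h := is_deriveM (is_derive_cst (- K) x 1) (is_deriveM h3 h2).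
  by apply: (is_derive_eq h); rewrite /GRing.scale /=; field; rewrite gt_eqF.
have hc (x : R) : 0 <= x <= N -> {for x, continuous (fun x : R => K * (x * expR (- (s * x))))}.
  move=> _; apply: cvgM; first exact: cvg_cst.
  apply: cvgM; first exact: cvg_id.
  apply: (cvg_comp (fun x : R => - (s * x)) expR); last exact: continuous_expR.
  by apply: cvgN; apply: cvgM; [exact: cvg_cst|exact: cvg_id].
by rewrite (FTC2_closed N0 hd hc); congr (_%:E); rewrite mulr0 oppr0 expR0; ring.
Qed.

End StripIntegral.

(** * Lower bound for the integral over a cusp strip *)

Section StripIntegralBound.
Context {R : realType}.
Local Notation RR := (measurableTypeR R).
Local Notation leb := (@lebesgue_measure R).
Local Notation leb2 := (@leb2 R).
Local Notation mu4 := (@mu4 R).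
Variables (r k h s : R).
Hypotheses (r0 : 0 < r) (h0 : 0 < h) (s0 : 0 < s).

(** The range of (a, c) in sheared coordinates, where the determinant is a c; c is truncated at
    N. *)
Let W (N : R) : set (RR * RR)%type := [set p | [/\ 0 <= p.1, 0 <= p.2, p.2 <= N & p.1 * p.2 <= 1]].
Let w N (p : (RR * RR)%type) : R := p.1 * p.2 * expR (- (s * p.2)) * \1_(W N) p.

Let w_ge0 N p : 0 <= w N p.
Proof.
rewrite /w indicE; have [|_] := boolP (p \in W N); last by rewrite mulr0.
by rewrite inE => -[h1 h2 _ _]; rewrite mulr1 !mulr_ge0 ?expR_ge0.
Qed.

Let measurable_w N : measurable_fun [set: (RR * RR)%type] (w N).
Proof.
have m1 : measurable_fun [set: (RR * RR)%type] (fun p : (RR * RR)%type => p.1 : R) by exact: measurable_fst.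
have m2 : measurable_fun [set: (RR * RR)%type] (fun p : (RR * RR)%type => p.2 : R) by exact: measurable_snd.
have m12 : measurable_fun [set: (RR * RR)%type] (fun p : (RR * RR)%type => (p.1 : R) * (p.2 : R)) by apply: measurable_funM.
apply: measurable_funM.
  apply: measurable_funM => //; apply: measurableT_comp; first exact: measurable_expR.
  have m : measurable_fun [set: (RR * RR)%type] ((-%R : R -> R) \o (fun p : (RR * RR)%type => s * (p.2 : R))).
    by apply: measurableT_comp; [exact: oppr_measurable|apply: measurable_funM].
  exact: m.
apply: measurable_indic.
have -> : W N = [set p | 0 <= p.1] `&` ([set p | 0 <= p.2] `&` ([set p | p.2 <= N] `&` [set p | p.1 * p.2 <= 1])).
  by apply/seteqP; split => [B []|B [? [? []]]].
by repeat apply: measurableI; apply: measurable_set_le.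
Qed.

Let g N (B : @form R) : R := w N B.1 * \1_(strip r k h) B.

Let inner N p : (\int[leb2]_q (g N (p, q))%:E = (w N p * (r * h * p.2 ^+ 2))%:E)%E.
Proof.
have [p2|p2] := leP 0 (p.2 : R); last first.
  have w0 : w N p = 0 by rewrite /w indicE memNset ?mulr0 // => -[_ ? _ _]; lra.
  by rewrite integral0_eq ?w0 ?mul0r // => q _; rewrite /g w0 mul0r.
have [mA lA] := strip_area k (ltW r0) (ltW h0) p2.
have e q : g N (p, q) = w N p * \1_[set q : (RR * RR)%type | strip r k h ((0 : RR, p.2), q)] q by [].
under eq_integral do rewrite e.
rewrite (@integral_indicator_scale R _ _ leb2 _ _ mA (w_ge0 N p)).
by rewrite [X in (_ * X)%E]lA -EFinM.
Qed.

Let middle N c : 0 <= N -> (\int[leb]_a (w N (a, c) * (r * h * c ^+ 2))%:E =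
  (if (0 <= c) && (c <= N) then r * h / 2 * (c * expR (- (s * c))) else 0)%:E)%E.
Proof.
move=> N0; case: ifPn => [/andP[c0 cN]|hc]; last first.
  rewrite integral0_eq // => a _; rewrite /w indicE memNset ?mulr0 ?mul0r // => -[_ h1 h2 _].
  by move: hc; rewrite /= in h1 h2; rewrite h1 h2.
move: c0; rewrite le_eqVlt => /orP[/eqP <-|c0].
  by rewrite integral0_eq ?mul0r ?mulr0 // => a _; rewrite /w /= mulr0 !mul0r.
have ci : 0 <= c^-1 by rewrite invr_ge0 ltW.
have := integral_linear (c * expR (- (s * c)) * (r * h * c ^+ 2)) ci.
have -> : c * expR (- (s * c)) * (r * h * c ^+ 2) * c^-1 ^+ 2 / 2 = r * h / 2 * (c * expR (- (s * c))).
  by field; rewrite gt_eqF.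
move=> <-; rewrite [RHS]integral_mkcond; apply: eq_integral => a _.
rewrite patchE mem_setE in_itv /= /w indicE.
have -> : ((a, c) \in W N) = (0 <= a <= c^-1).
  apply/idP/andP; rewrite inE /W /=.
    by move=> [a0 _ _ h1]; split=> //; rewrite -[c^-1]mul1r ler_pdivlMr.
  by move=> [a0 h1]; split=> //; [exact: ltW|move: h1; rewrite -[c^-1]mul1r ler_pdivlMr].
by case: ifP => _; rewrite ?mulr0 ?mul0r //=; congr (_%:E); rewrite mulr1; ring.
Qed.

Let total N : 0 <= N ->
  (\int[mu4]_B (g N B)%:E = (r * h / 2 * (s ^- 2 - (N / s + s ^- 2) * expR (- (s * N))))%:E)%E.
Proof.
move=> N0.
have g0 B : (0 <= (g N B)%:E)%E by rewrite lee_fin mulr_ge0.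
have mg : measurable_fun [set: @form R] (fun B => (g N B)%:E).
  apply/measurable_EFinP; apply: measurable_funM; last exact: measurable_indic (measurable_strip _ _ _).
  by apply: measurableT_comp.
rewrite -[LHS]/(\int[leb2 \x leb2]_B (g N B)%:E)%E fubini_tonelli1 //.
rewrite -[LHS]/(\int[leb \x leb]_p (fubini_F leb2 (fun B => (g N B)%:E)) p)%E.
have e : fubini_F leb2 (fun B => (g N B)%:E) = fun p : (RR * RR)%type => (w N p * (r * h * p.2 ^+ 2))%:E.
  by apply/funext => p; exact: inner.
have mF : measurable_fun [set: (RR * RR)%type] (fubini_F leb2 (fun B => (g N B)%:E)).
  exact: measurable_fun_fubini_tonelli_F.
rewrite e in mF *; rewrite fubini_tonelli2 //; last first.
  move=> p; rewrite lee_fin; apply: mulr_ge0 => //; apply: mulr_ge0; last exact: sqr_ge0.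
  exact: ltW (mulr_gt0 r0 h0).
rewrite -(integral_gamma2 (r * h / 2) s0 N0) [RHS]integral_mkcond; apply: eq_integral => c _.
by rewrite /fubini_G middle // patchE mem_setE in_itv /=; case: ifP.
Qed.

(** Adds |x + iy|^2 / c to a, so that the determinant becomes a c when c > 0; there c^(-1) as a real
    power is 1 / c. *)
Let shear (B : @form R) : @form R := Form (fa B + (fx B ^+ 2 + fy B ^+ 2) * fc B `^ (-1)) (fc B) (fx B) (fy B).

Let preserving_shear : preserving mu4 mu4 shear.
Proof.
apply: (@preserving_shear_a R (fun c x y => (x ^+ 2 + y ^+ 2) * c `^ (-1))).
apply: measurable_funM.
  by apply: measurable_funD; apply: measurable_funX; [exact: measurable_fx|exact: measurable_fy].
have m : measurable_fun [set: @form R] ((@powR R ^~ (-1)) \o (@fc R)).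
  by apply: measurableT_comp; [exact: measurable_powR|exact: measurable_fc].
exact: m.
Qed.

(** In sheared coordinates the fibre over (a, c) has area r h c^2. Integrating a c exp(- s c) over 0
    < a <= 1 / c leaves r h / 2 times the integral of c exp(- s c), which is s^-2. *)
Lemma strip_integral_ge : ((r * h / (2 * s ^+ 2))%:E <=
  \int[mu4]_(B in @P1 R `&` strip r k h) (fdet B * expR (- (s * fc B)))%:E)%E.
Proof.
have mS : measurable (@P1 R `&` strip r k h) by apply: measurableI; [exact: measurable_P1|exact: measurable_strip].
pose f (B : @form R) := fdet B * expR (- (s * fc B)).
have mf : measurable_fun [set: @form R] f.
  apply: measurable_funM; first exact: measurable_fdet.
  apply: measurableT_comp; first exact: measurable_expR.
  have m : measurable_fun [set: @form R] ((-%R : R -> R) \o (fun B => s * fc B)).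
    by apply: measurableT_comp; [exact: oppr_measurable|apply: measurable_funM => //; exact: measurable_fc].
  exact: m.
have f0 B : (@P1 R `&` strip r k h) B -> (0 <= (f B)%:E)%E.
  by move=> [[[_ db] _] _]; rewrite lee_fin mulr_ge0 ?expR_ge0 // ltW.
have mfS : measurable_fun (@P1 R `&` strip r k h) (fun B => (f B)%:E).
  by apply/measurable_EFinP; apply: measurable_funTS.
rewrite -[X in (_ <= X)%E]/(\int[mu4]_(B in @P1 R `&` strip r k h) (f B)%:E)%E.
rewrite (preserving_integral preserving_shear mS mfS f0).
have bound N : 0 <= N -> ((r * h / 2 * (s ^- 2 - (N / s + s ^- 2) * expR (- (s * N))))%:E <=
    \int[mu4]_(B in shear @^-1` (@P1 R `&` strip r k h)) (f (shear B))%:E)%E.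
  move=> N0; rewrite -(total N0) [X in (_ <= X)%E]integral_mkcond; apply: ge0_le_integral => //.
  - by move=> B _; rewrite lee_fin mulr_ge0.
  - apply/measurable_EFinP; apply: measurable_funM; last exact: measurable_indic (measurable_strip _ _ _).
    by apply: measurableT_comp.
  - have [ms _] := preserving_shear.
    apply/(measurable_restrictT _ _).1.
      by rewrite -[X in measurable X]setTI; exact: ms.
    by apply/measurable_EFinP; apply: measurable_funTS; apply: measurableT_comp.
  - move=> B _; rewrite patchE /g /w !indicE.
    have [|hB] := boolP (B \in shear @^-1` (@P1 R `&` strip r k h)).
      rewrite inE => -[[[sa sd] _] ss].
      have c0 : 0 < fc B by have := posform_fc (conj sa sd).
      have e : fdet (shear B) = fa B * fc B.
        rewrite /shear /fdet /Form /fa /fc /fx /fy /= powR_inv1 ?(ltW c0) //.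
        by field; rewrite gt_eqF.
      rewrite lee_fin /f e -[fc (shear B)]/(fc B).
      have n0 : 0 <= fa B * fc B * expR (- (s * fc B)).
        by rewrite -e mulr_ge0 ?expR_ge0 // ltW.
      by case: (_ \in _); case: (_ \in _); rewrite ?mulr1 ?mulr0 // ?mul0r.
    have [|_] := boolP (B.1 \in W N); last by rewrite mulr0 mul0r.
    have [|_] := boolP (B \in strip r k h); last by rewrite mulr0.
    rewrite !inE => sB [a0 c0 _ ac1]; rewrite !mulr1 lee_fin.
    have [|ac] := ltP 0 (fa B * fc B); last first.
      by rewrite -[B.1.1 * _]/(fa B * fc B) pmulr_lle0 ?expR_gt0.
    move=> ac; move/negP: hB; case; rewrite inE.
    have c1 : 0 < fc B by rewrite lt_def [X in _ && X]c0 andbT; apply: contraTneq ac => ->; rewrite mulr0 ltxx.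
    have a1 : 0 < fa B by rewrite lt_def [X in _ && X]a0 andbT; apply: contraTneq ac => ->; rewrite mul0r ltxx.
    have e : fdet (shear B) = fa B * fc B.
      rewrite /shear /fdet /Form /fa /fc /fx /fy /= powR_inv1 //.
      by field; rewrite gt_eqF.
    split=> //; split; last by rewrite e.
    split; last by rewrite e.
    by rewrite /shear /Form /fa /= ltr_pwDl // mulr_ge0 ?powR_ge0 // addr_ge0 ?sqr_ge0.
apply/lee_subgt0Pr => e e0.
(* Truncating at c = m / s loses the proportion (m + 1) exp(- m) <= 8 / m, and m is chosen so that
   the loss is at most e. *)
pose m := (Num.bound (r * h / (s ^+ 2) * 4 / e)).+1%:R : R.
have mb : r * h / (s ^+ 2) * 4 / e <= m.
  have hp : 0 <= r * h / (s ^+ 2) * 4 / e by rewrite !mulr_ge0 ?invr_ge0 ?sqr_ge0 // ltW.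
  by apply/ltW/(lt_trans (archi_boundP hp)); rewrite ltr_nat.
have m1 : 1 <= m by rewrite ler1n.
have m0 : 0 < m by lra.
apply: le_trans (bound (m / s) _); last by rewrite divr_ge0 // ltW.
rewrite -EFinB lee_fin; have -> : s * (m / s) = m by rewrite mulrC divfK // gt_eqF.
have -> : r * h / (2 * s ^+ 2) = r * h / 2 * s ^- 2 by field; rewrite gt_eqF.
have em : (m + 1) * expR (- m) <= 8 / m.
  have q : m ^+ 2 / 4 <= expR m.
    have h1 : m / 2 <= expR (m / 2) by apply: le_trans (expR_ge1Dx _); rewrite lerDr.
    have -> : m = m / 2 + m / 2 by field.
    rewrite expRD; have -> : (m / 2 + m / 2) ^+ 2 / 4 = m / 2 * (m / 2) by field.
    by apply: ler_pM => //; rewrite divr_ge0 // ltW.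
  rewrite expRN ler_pdivrMr ?expR_gt0 //; apply: (@le_trans _ _ (8 / m * (m ^+ 2 / 4))).
    have -> : 8 / m * (m ^+ 2 / 4) = 2 * m by field; rewrite gt_eqF.
    lra.
  by rewrite ler_wpM2l // divr_ge0 // ltW.
have -> : (m / s / s + s ^- 2) * expR (- m) = s ^- 2 * ((m + 1) * expR (- m)) by field; rewrite gt_eqF.
have q0 : 0 <= r * h / 2 * s ^- 2 by rewrite !mulr_ge0 ?invr_ge0 ?sqr_ge0 // ltW.
have h1 : r * h / 2 * s ^- 2 * ((m + 1) * expR (- m)) <= r * h / 2 * s ^- 2 * (8 / m).
  by rewrite ler_wpM2l.
have h2 : r * h / 2 * s ^- 2 * (8 / m) <= e.
  have -> : r * h / 2 * s ^- 2 * (8 / m) = r * h / (s ^+ 2) * 4 / m by field; rewrite !gt_eqF.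
  by rewrite ler_pdivrMr // [e * m]mulrC -ler_pdivrMr.
have -> : r * h / 2 * (s ^- 2 - s ^- 2 * ((m + 1) * expR (- m))) =
  r * h / 2 * s ^- 2 - r * h / 2 * s ^- 2 * ((m + 1) * expR (- m)) by ring.
by rewrite lerD2l lerN2; exact: le_trans h1 h2.
Qed.

End StripIntegralBound.

(** * Coordinates at a cusp vector and its stabilizer *)

Section CuspFrame.
Context {R : realType}.
Local Notation C := R[i].
Local Notation mu4 := (@mu4 R).
Implicit Types (x y t : C) (v : 'cV[C]_2) (g m : 'M[C]_2) (B : @form R).

Lemma act_upperE t B : let B' := act (mx2 1 t 0 1) B in
  [/\ fc B' = fc B, fx B' = fx B + complex.Re t * fc B & fy B' = fy B + complex.Im t * fc B].
Proof.
case: t => p q; case: B => -[a c] [x y].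
rewrite /act /herm mx2_conjT !mx2M /coord !mx2_ij /fa /fc /fx /fy /= !(mul0r, mul1r, add0r, addr0, oppr0, mulr0, subr0).
by split=> //; ring.
Qed.

(** The frame is chosen so that the lower right entry of [act g B] is the value of B at v. *)
Lemma exists_frame v : v != 0 -> exists2 g, \det g = 1 & conjT g *m vec2 0 1 = v.
Proof.
move=> v0; have n0 : normC2 (v 0 0) + normC2 (v 1 0) != 0.
  rewrite paddr_eq0 ?normC2_ge0 // !normC2_eq0 -vec2_eq0 -vec2E; exact: v0.
set N := normC2 (v 0 0) + normC2 (v 1 0) in n0.
have rN : rC N != 0 :> C by apply/eqP => /rC_inj/eqP; apply/negP.
have e : Num.conj (v 0 0) * v 0 0 + Num.conj (v 1 0) * v 1 0 = rC N by rewrite !conjM_normC2 -rCD.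
exists (mx2 (v 1 0 / rC N) (- (v 0 0 / rC N)) (Num.conj (v 0 0)) (Num.conj (v 1 0))).
  rewrite mx2_det; set a := v 0 0 in e *; set b := v 1 0 in e *.
  have -> : b / rC N * Num.conj b - - (a / rC N) * Num.conj a = (Num.conj a * a + Num.conj b * b) / rC N by ring.
  by rewrite e divff.
rewrite mx2_conjT mx2_vec2 !mulr0 !mulr1 !add0r !conjCK [RHS]vec2E; by [].
Qed.

Lemma fc_frame g v B : conjT g *m vec2 0 1 = v -> fc (act g B) = hval B v.
Proof.
move=> e; have := hval_act g B (vec2 0 1); rewrite e => <-.
rewrite hvalE vec2_0 vec2_1 normC2_0 normC2_1 rmorph0 mul0r mulr0 /=; ring.
Qed.

Lemma P1_act g B : normC2 (\det g) = 1 -> P1 (act g B) <-> P1 B.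
Proof.
have fwd (h : 'M[C]_2) (D : @form R) : normC2 (\det h) = 1 -> P1 D -> P1 (act h D).
  move=> h1 [pD dD]; split; last by rewrite fdet_act h1 mul1r.
  by apply: act_posform => //; rewrite -normC2_gt0 h1.
move=> g1; split; last exact: fwd.
have ug : g \in unitmx by rewrite unitmxE unitfE -normC2_gt0 g1.
have i1 : normC2 (\det (invmx g)) = 1.
  have := normC2M (\det (invmx g)) (\det g).
  by rewrite -det_mulmx mulVmx // det1 normC2_1 g1 mulr1.
by move=> /(fwd (invmx g) _ i1); rewrite actK // mulVmx.
Qed.

Lemma frame_integral_ge g v (r k h s : R) : \det g = 1 -> conjT g *m vec2 0 1 = v ->
  0 < r -> 0 < h -> 0 < s ->
  ((r * h / (2 * s ^+ 2))%:E <=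
   \int[mu4]_(B in @P1 R `&` (act g @^-1` strip r k h)) (fdet B * expR (- (s * hval B v)))%:E)%E.
Proof.
move=> g1 gv r0 h0 s0; apply: (le_trans (strip_integral_ge k r0 h0 s0)).
have mS : measurable (@P1 R `&` strip r k h) by apply: measurableI; [exact: measurable_P1|exact: measurable_strip].
pose f (B : @form R) := fdet B * expR (- (s * fc B)).
have mf : measurable_fun [set: @form R] f.
  apply: measurable_funM; first exact: measurable_fdet.
  apply: measurableT_comp; first exact: measurable_expR.
  have m : measurable_fun [set: @form R] ((-%R : R -> R) \o (fun B => s * fc B)).
    by apply: measurableT_comp; [exact: oppr_measurable|apply: measurable_funM => //; exact: measurable_fc].
  exact: m.
have f0 B : (@P1 R `&` strip r k h) B -> (0 <= (f B)%:E)%E.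
  by move=> [[[_ db] _] _]; rewrite lee_fin mulr_ge0 ?expR_ge0 // ltW.
have mfS : measurable_fun (@P1 R `&` strip r k h) (fun B => (f B)%:E).
  by apply/measurable_EFinP; apply: measurable_funTS.
have n1 : normC2 (\det g) = 1 by rewrite g1 normC2_1.
rewrite -[X in (X <= _)%E]/(\int[mu4]_(B in @P1 R `&` strip r k h) (f B)%:E)%E.
rewrite (preserving_integral (preserving_act n1) mS mfS f0).
have -> : act g @^-1` (@P1 R `&` strip r k h) = @P1 R `&` (act g @^-1` strip r k h).
  by apply/seteqP; split => B [/(P1_act _ n1) h1 h2].
rewrite le_eqVlt; apply/orP; left; apply/eqP; apply: eq_integral => B _.
by rewrite /f fdet_act n1 mul1r (fc_frame _ gv).
Qed.

Lemma int_gap (z : int) (w w' W : R) : 0 < W -> 0 <= w -> w < W -> 0 <= w' -> w' < W ->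
  w' = w + z%:~R * W -> z = 0.
Proof.
move=> W0 w0 wW w0' wW' e; have h1 : z%:~R * W < 1 * W by lra.
have h2 : (-1) * W < z%:~R * W by lra.
rewrite ltr_pM2r // in h1; rewrite ltr_pM2r // in h2.
have : z < 1 by rewrite -(@ltr_int R).
have : -1 < z by rewrite -(@ltr_int R) rmorphN.
lia.
Qed.

Variable d : int.
Hypotheses (d0 : d < 0) (sf : squarefree_int d).

(** In the frame g, a matrix of determinant 1 fixing the cusp vector is the translation by some t.
    Integrality of its entries gives the three conditions on tau = conj t, so tau lies in the
    lattice of rho and sigma; and a strip contains at most one point of each orbit of
    translations. *)
Lemma strip_stabilizer x y (rho : R) (sigma : C) g m B : 0 < rho -> 0 < complex.Im sigma ->
  (forall tau, OF d (tau * x ^+ 2) -> OF d (tau * (x * y)) -> OF d (tau * y ^+ 2) ->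
    exists k l : int, tau = rC k%:~R * rC rho + rC l%:~R * sigma) ->
  \det g = 1 -> conjT g *m vec2 0 1 = vec2 x y ->
  \det m = 1 -> conjT m *m vec2 x y = vec2 x y -> (forall i j, OF d (m i j)) ->
  0 < fc (act g B) ->
  strip rho (complex.Re sigma / complex.Im sigma) (complex.Im sigma) (act g B) ->
  strip rho (complex.Re sigma / complex.Im sigma) (complex.Im sigma) (act g (act m B)) -> m = 1%:M.
Proof.
move=> r0 s0 hL g1 gv m1 mv mO c0 S1 S2.
have ug : g \in unitmx by rewrite unitmxE g1 unitr1.
pose u := g *m m *m invmx g.
have um : conjT u *m vec2 0 1 = vec2 0 1.
  have vg : conjT (invmx g) *m vec2 x y = vec2 0 1.
    by rewrite -gv mulmxA -conjTM mulmxV // mx2_1 mx2_conjT rmorph0 rmorph1 mx2_vec2; congr vec2; ring.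
  by rewrite /u !conjTM -!mulmxA gv mv vg.
have u1 : \det u = 1 by rewrite /u !det_mulmx m1 g1 mulr1 mul1r det_inv g1 invr1.
have [u10 u11] : u 1 0 = 0 /\ u 1 1 = 1.
  have e := um; rewrite [u]mx2E mx2_conjT mx2_vec2 !mulr0 !mulr1 !add0r in e.
  have e0 : Num.conj (u 1 0) = 0 by have := congr1 (fun w : 'cV[C]_2 => w 0 0) e; rewrite !vec2_0.
  have e1 : Num.conj (u 1 1) = 1 by have := congr1 (fun w : 'cV[C]_2 => w 1 0) e; rewrite !vec2_1.
  by split; apply: (can_inj conjCK); rewrite ?e0 ?e1 ?rmorph0 ?rmorph1.
pose t := u 0 1.
have eu : u = mx2 1 t 0 1.
  rewrite [LHS]mx2E u10 u11; congr mx2.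
  by have e := u1; rewrite [u]mx2E mx2_det u10 u11 mulr1 mulr0 subr0 in e.
have gum : g *m m = u *m g by rewrite /u -mulmxA mulVmx // mulmx1.
have acte : act g (act m B) = act u (act g B) by rewrite -!actM gum.
set p := g 0 0; set q := g 0 1; have [g10 g11] : g 1 0 = Num.conj x /\ g 1 1 = Num.conj y.
  have e := gv; rewrite [g]mx2E mx2_conjT mx2_vec2 !mulr0 !mulr1 !add0r in e.
  have := congr1 (fun w : 'cV[C]_2 => w 0 0) e; have := congr1 (fun w : 'cV[C]_2 => w 1 0) e.
  by rewrite !vec2_0 !vec2_1 => <- <-; rewrite !conjCK.
have eg : g = mx2 p q (Num.conj x) (Num.conj y) by rewrite [LHS]mx2E g10 g11.
have det1 : p * Num.conj y - q * Num.conj x = 1 by rewrite -mx2_det -eg.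
pose gi := mx2 (Num.conj y) (- q) (- Num.conj x) p.
have gig : gi *m g = 1%:M.
  rewrite eg mx2M mx2_1; congr mx2; rewrite -?det1; ring.
have em : m = mx2 (1 + t * (Num.conj x * Num.conj y)) (t * Num.conj y ^+ 2)
    (- (t * Num.conj x ^+ 2)) (1 - t * (Num.conj x * Num.conj y)).
  have -> : m = gi *m (u *m g) by rewrite -gum mulmxA gig mul1mx.
  rewrite eu eg !mx2M !mul1r !mul0r !add0r.
  by congr mx2; rewrite -?det1; ring.
pose tau := Num.conj t.
have [k [l et]] : exists k l : int, tau = rC k%:~R * rC rho + rC l%:~R * sigma.
  apply: hL.
  - have := OF_conj d0 sf (OFN d0 sf (mO 1 0)); rewrite em mx2_10 opprK.
    by rewrite rmorphM rmorphXn /= conjCK.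
  - have := OF_conj d0 sf (OFD d0 sf (mO 0 0) (OFN d0 sf (OF1 d0 sf))); rewrite em mx2_00 addrC addKr.
    by rewrite !rmorphM /= !conjCK.
  - have := OF_conj d0 sf (mO 0 1); rewrite em mx2_01.
    by rewrite rmorphM rmorphXn /= conjCK.
have tE : t = Num.conj (rC k%:~R * rC rho + rC l%:~R * sigma) by rewrite -et conjCK.
have reT : complex.Re t = k%:~R * rho + l%:~R * complex.Re sigma by rewrite tE !reim /=; ring.
have imT : complex.Im t = - (l%:~R * complex.Im sigma) by rewrite tE !reim /=; ring.
have [ec ex ey] := act_upperE t (act g B); rewrite -eu -acte in ec ex ey.
move: S1 S2 => [a1 a2 a3 a4]; rewrite /strip /= ec ex ey reT imT => -[b1 b2 b3 b4].
set c := fc (act g B) in ec ex ey a2 a4 b1 b2 b3 b4 c0.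
have l0 : l = 0.
  have h := int_gap (mulr_gt0 s0 c0) a1 a2 b1 b2; apply: h.
  by ring.
have k0 : k = 0.
  have h := int_gap (mulr_gt0 r0 c0) a3 a4 b3 b4; apply: h.
  by rewrite l0 /=; ring.
have t0 : t = 0 by rewrite tE k0 l0 !mul0r add0r rmorph0.
by rewrite em t0 mx2_1 !mul0r oppr0 !addr0.
Qed.

End CuspFrame.

(** * GL_2(O_F), ideals of vectors, and units *)

Section IntegralMatrices.
Context {R : realType}.
Variable d : int.
Hypotheses (d0 : d < 0) (sf : squarefree_int d).
Local Notation C := R[i].
Implicit Types (m h : 'M[C]_2) (v : 'cV[C]_2) (u z : C) (B : @form R).

Definition glo m : Prop := exists m', [/\ forall i j, OF d (m i j), forall i j, OF d (m' i j) & m *m m' = 1%:M].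

Lemma OF_mulmx n p q (a : 'M[C]_(n, p)) (b : 'M[C]_(p, q)) :
  (forall i j, OF d (a i j)) -> (forall i j, OF d (b i j)) -> forall i j, OF d ((a *m b) i j).
Proof.
move=> ha hb i j; rewrite mxE; apply: (big_ind (OF d)).
- exact: OF0 d0 sf.
- by move=> z w; exact: OFD.
- by move=> k _; exact: OFM.
Qed.

Lemma OF_conjT n p (a : 'M[C]_(n, p)) : (forall i j, OF d (a i j)) -> forall i j, OF d (conjT a i j).
Proof. by move=> ha i j; rewrite /conjT !mxE; exact: OF_conj. Qed.

Lemma glo_inv m : glo m -> exists2 m', glo m' & m *m m' = 1%:M /\ m' *m m = 1%:M.
Proof.
move=> [m' [hm hm' e]]; have e' := mulmx1C e; by exists m' => //; exists m.
Qed.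

Lemma gloM m h : glo m -> glo h -> glo (m *m h).
Proof.
move=> [m' [hm hm' e]] [h' [hh hh' e']]; exists (h' *m m'); split; try exact: OF_mulmx.
by rewrite mulmxA -[m *m h *m h']mulmxA e' mulmx1.
Qed.

Lemma unit_conj u : normC2 u = 1 -> u * Num.conj u = 1.
Proof. by move=> u1; rewrite mulrC conjM_normC2 u1. Qed.

Lemma glo_scale u m : OF d u -> normC2 u = 1 -> glo m -> glo (u *: m).
Proof.
move=> hu u1 [m' [hm hm' e]]; exists (Num.conj u *: m'); split.
- by move=> i j; rewrite mxE; exact: OFM.
- by move=> i j; rewrite mxE; apply: OFM => //; exact: OF_conj.
- by rewrite -scalemxAl -scalemxAr scalerA unit_conj // scale1r.
Qed.

Lemma OF_det m : (forall i j, OF d (m i j)) -> OF d (\det m).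
Proof.
move=> hm; rewrite [m]mx2E mx2_det; apply: OFD => //; first exact: OFM.
by apply: OFN => //; exact: OFM.
Qed.

(** The norms of det m and of the determinant of the inverse are at least 1 and multiply to 1. *)
Lemma glo_det m : glo m -> normC2 (\det m) = 1.
Proof.
move=> [m' [hm hm' e]].
have e1 : normC2 (\det m) * normC2 (\det m') = 1 by rewrite -normC2M -det_mulmx e det1 normC2_1.
have nz a b : normC2 a * normC2 b = 1 :> R -> a != 0.
  by move=> h; apply/eqP => a0; move: h; rewrite a0 normC2_0 mul0r => /eqP; rewrite eq_sym oner_eq0.
have h1 := OF_norm_ge1 d0 sf (OF_det hm) (nz _ _ e1).
have h2 : 1 <= normC2 (\det m').
  by apply: (OF_norm_ge1 d0 sf (OF_det hm')); apply: (nz _ (\det m)); rewrite mulrC.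
by apply/eqP; rewrite eq_le h1 andbT -e1 ler_peMr // normC2_ge0.
Qed.

(** The ideal generated by the coordinates of v, an invariant of its orbit under GL_2(O_F). *)
Definition span2 v : set C := [set z | exists a b, OF d a /\ OF d b /\ z = a * v 0 0 + b * v 1 0].

Lemma span2_mul h v : (forall i j, OF d (h i j)) -> span2 (h *m v) `<=` span2 v.
Proof.
move=> hh z [a [b [ha [hb ->]]]].
exists (a * h 0 0 + b * h 1 0), (a * h 0 1 + b * h 1 1); split; [|split].
- by apply: OFD => //; exact: OFM.
- by apply: OFD => //; exact: OFM.
- by rewrite !mxE !sum_ord2; ring.
Qed.

Lemma span2_glo m v : glo m -> span2 (conjT m *m v) = span2 v.
Proof.
move=> [m' [hm hm' e]]; apply/seteqP; split; first by apply: span2_mul; exact: OF_conjT.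
have {1}-> : v = conjT m' *m (conjT m *m v).
  by rewrite mulmxA -conjTM e mx2_1 mx2_conjT rmorph0 rmorph1 -mx2_1 mul1mx.
by apply: span2_mul; exact: OF_conjT.
Qed.

Lemma units_list : exists (W : nat) (un : 'I_W -> C),
  [/\ (0 < W)%N, injective un, forall i, OF d (un i) /\ normC2 (un i) = 1 &
      forall z, OF d z -> normC2 z = 1 -> exists i, un i = z].
Proof.
pose B : @form R := Form 1 1 0 0.
have pB : posform B by rewrite /posform /fdet /B /fa /fc /fx /fy /= expr0n !subr0 mulr1.
have [s hs] := finitely_many_short d0 sf 1 pB.
pose P z := OF d z /\ normC2 z = 1.
pose l := undup [seq z <- [seq v 0 0 | v : 'cV[C]_2 <- s] | `[< P z >]].
have lP z : z \in l <-> P z.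
  rewrite mem_undup mem_filter; split=> [/andP[/asboolP]//|Pz]; apply/andP; split; first exact/asboolP.
  have [hz z1] := Pz; apply/mapP; exists (vec2 z 0); last by rewrite vec2_0.
  apply: hs.
    apply/latE; rewrite vec2_0 vec2_1; split=> //; first exact: OF0 d0 sf.
    by rewrite vec2_eq0 negb_and -normC2_eq0 z1 oner_eq0.
  rewrite hvalE vec2_0 vec2_1 normC2_0 z1 /B /fa /fc /fx /fy /= !reim /=; lra.
exists (size l), (fun i => nth 0 l i); split.
- have : 1 \in l by apply/lP; split; [exact: OF1 d0 sf|exact: normC2_1].
  by case: l {lP}.
- move=> i j /eqP; rewrite nth_uniq ?undup_uniq // => /eqP; exact: val_inj.
- by move=> i; apply/lP; exact: mem_nth.
- move=> z hz z1; have zl : z \in l by apply/lP.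
  by have := zl; rewrite -index_mem => il; exists (Ordinal il); rewrite /= nth_index.
Qed.

End IntegralMatrices.

(** * Pointwise comparison of cell sums with the theta series *)

Section PointwiseBound.
Context {R : realType}.
Variable d : int.
Hypotheses (d0 : d < 0) (sf : squarefree_int d).
Local Notation C := R[i].
Local Notation L := 'rV[int]_4.
Implicit Types (m : 'M[C]_2) (B D : @form R).

Variables (E K : nat) (v : 'I_E -> 'cV[C]_2) (rho : 'I_E -> R) (sigma : 'I_E -> C)
  (g : 'I_E -> 'M[C]_2) (k : 'I_K -> 'M[C]_2).
Hypotheses (rho0 : forall e, 0 < rho e) (sig0 : forall e, 0 < complex.Im (sigma e))
  (vO : forall e, OF d (v e 0 0) /\ OF d (v e 1 0))
  (latE' : forall e tau, OF d (tau * v e 0 0 ^+ 2) -> OF d (tau * (v e 0 0 * v e 1 0)) ->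
    OF d (tau * v e 1 0 ^+ 2) -> exists a b : int, tau = rC a%:~R * rC (rho e) + rC b%:~R * sigma e)
  (v0 : forall e, v e != 0)
  (span_inj : forall e e', span2 d (v e) = span2 d (v e') -> e = e')
  (g1 : forall e, \det (g e) = 1) (gv : forall e, conjT (g e) *m vec2 0 1 = v e)
  (kO : forall j, glo d (k j))
  (k_inj : forall j j' u, OF d u -> normC2 u = 1 -> k j = u *: k j' -> j = j').

Definition cell e : set (@form R) := act (g e) @^-1`
  strip (rho e) (complex.Re (sigma e) / complex.Im (sigma e)) (complex.Im (sigma e)).

Definition cell_fun e s B : R := fdet B * expR (- (s * hval B (v e))) * \1_(cell e) B.

(** The quotient of the two matrices has determinant 1 and fixes the cusp vector, so
    [strip_stabilizer] makes it the identity; and the [k j] are distinct modulo units. *)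
Lemma act_cell_inj D e j j' u u' : P1 D -> OF d u -> normC2 u = 1 -> OF d u' -> normC2 u' = 1 ->
  cell e (act (k j) D) -> cell e (act (k j') D) ->
  conjT (u *: k j) *m v e = conjT (u' *: k j') *m v e ->
  \det (u *: k j) = \det (u' *: k j') -> j = j' /\ u = u'.
Proof.
move=> PD hu u1 hu' u1' c1 c2 ev edet.
have G1 := glo_scale d0 sf hu u1 (kO j); have G2 := glo_scale d0 sf hu' u1' (kO j').
set m1 := u *: k j in ev edet G1; set m2 := u' *: k j' in ev edet G2.
have [m2' G2' [e2 e2']] := glo_inv G2.
have a1 : act (k j) D = act m1 D by rewrite /m1 act_scale.
have a2 : act (k j') D = act m2 D by rewrite /m2 act_scale.
pose m := m1 *m m2'.
have em : m *m m2 = m1 by rewrite /m -mulmxA e2' mulmx1.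
have nz2 : \det m2 != 0 by rewrite -normC2_gt0 (glo_det d0 sf G2).
have m_det : \det m = 1.
  by apply: (mulIf nz2); rewrite mul1r -det_mulmx em edet.
have mv : conjT m *m v e = v e.
  rewrite /m conjTM -mulmxA ev mulmxA -conjTM e2 mx2_1 mx2_conjT rmorph0 rmorph1.
  by rewrite -mx2_1 mul1mx.
have [_ [mO _ _]] := gloM d0 sf G1 G2'.
have P2 : P1 (act m2 D) by apply/P1_act => //; exact: (glo_det d0 sf G2).
have c0 : 0 < fc (act (g e) (act m2 D)).
  by apply: posform_fc; apply: act_posform; [rewrite g1 oner_eq0|have [] := P2].
have gv' : conjT (g e) *m vec2 0 1 = vec2 (v e 0 0) (v e 1 0) by rewrite -vec2E; exact: gv.
have mv' : conjT m *m vec2 (v e 0 0) (v e 1 0) = vec2 (v e 0 0) (v e 1 0) by rewrite -vec2E; exact: mv.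
have S2 : cell e (act m2 D) by rewrite -a2; exact: c2.
have S1 : cell e (act m (act m2 D)) by rewrite -actM em -a1; exact: c1.
have m_1 : m = 1%:M.
  exact: (strip_stabilizer d0 sf (rho0 e) (sig0 e) (latE' (e := e)) (g1 e) gv' m_det mv' mO c0 S2 S1).
have e12 : m1 = m2 by rewrite -em m_1 mul1mx.
have ej : j = j'.
  apply: (k_inj (OFM d0 sf (OF_conj d0 sf hu) hu')); first by rewrite normC2M normC2_conj u1 u1' mul1r.
  by rewrite -scalerA -/m2 -e12 /m1 scalerA mulrC unit_conj // scale1r.
split=> //; have k0 : \det (k j) != 0 by rewrite -normC2_gt0 (glo_det d0 sf (kO j)).
have [i [i' hi]] : exists i i', k j i i' != 0.
  apply: contrapT => h; move: k0; rewrite (_ : k j = 0) ?det0 ?eqxx //.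
  by apply/matrixP => i i'; rewrite mxE; apply/eqP; apply: contraT => n; case: h; exists i, i'.
apply: (mulIf hi); have := congr1 (fun a : 'M[C]_2 => a i i') e12.
by rewrite /m1 /m2 -ej !mxE.
Qed.

(* The triples (cusp, coset, unit) whose cell contains D inject into pairs of a lattice *)
(* vector and a unit, so that the number of units cancels. *)
Lemma sum_cells_le D s : P1 D -> exists2 l : seq L, uniq l &
  \sum_e \sum_j cell_fun e s (act (k j) D) <= fdet D * \sum_(w <- l) expR (- (s * hval D (latv d w))).
Proof.
move=> PD; have [W [un [W0 un_inj unP unS]]] := @units_list R d d0 sf.
pose T := ('I_E * 'I_K * 'I_W)%type.
pose P (t : T) := `[< cell t.1.1 (act (k t.1.2) D) >].
pose m (t : T) := un t.2 *: k t.1.2.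
(* The lattice vector at which the exponential belonging to t is evaluated: its ideal recovers the
   cusp, and its value with the determinant [dl t] recovers the rest of t. *)
pose phi (t : T) := conjT (m t) *m v t.1.1.
have Gm t : glo d (m t) by have [h1 h2] := unP t.2; exact: (glo_scale d0 sf h1 h2 (kO _)).
have /choice[code hcode] : forall t, exists w : L, latv d w = phi t.
  move=> t; have h : @lat_nz R d (phi t).
    have hO : forall i j, OF d (phi t i j).
      apply: OF_mulmx => //; first by have [m' [hm _ _]] := Gm t; exact: OF_conjT.
      move=> i j; rewrite [v _]vec2E !mxE; have [h1 h2] := vO t.1.1; by case: ifP.
    apply/latE; split; [exact: hO|exact: hO|].
    have [m' _ [e1 e2]] := glo_inv (Gm t); apply: contra (v0 t.1.1) => /eqP z; apply/eqP.
    have : conjT m' *m phi t = 0 by rewrite z mulmx0.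
    by rewrite /phi mulmxA -conjTM e1 mx2_1 mx2_conjT rmorph0 rmorph1 -mx2_1 mul1mx.
  by have [w _ e] := (latvP d0 sf (phi t)).1 h; exists w.
have /choice[dl hdl] : forall t, exists i, un i = \det (m t).
  move=> t; apply: unS; last exact: (glo_det d0 sf (Gm t)).
  by have [m' [hm _ _]] := Gm t; exact: OF_det.
have inj t t' : P t -> P t' -> code t = code t' -> dl t = dl t' -> t = t'.
  move=> /asboolP c1 /asboolP c2 ec ed.
  have ephi : phi t = phi t' by rewrite -!hcode ec.
  have edet : \det (m t) = \det (m t') by rewrite -!hdl ed.
  have ee : t.1.1 = t'.1.1.
    have sp t0 : span2 d (phi t0) = span2 d (v t0.1.1) := span2_glo d0 sf _ (Gm t0).
    by apply: span_inj; rewrite -!sp ephi.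
  have [h1 h2] := unP t.2; have [h1' h2'] := unP t'.2.
  have c2' : cell t.1.1 (act (k t'.1.2) D) by rewrite ee.
  have ev : conjT (m t) *m v t.1.1 = conjT (m t') *m v t.1.1 by rewrite -/(phi t) ephi /phi ee.
  have [ej /un_inj eu] := @act_cell_inj D t.1.1 t.1.2 t'.1.2 (un t.2) (un t'.2) PD h1 h2 h1' h2' c1 c2' ev edet.
  by rewrite [t]surjective_pairing [t.1]surjective_pairing ee ej eu -!surjective_pairing.
pose F w := expR (- (s * hval D (latv d w))).
have F0 w : 0 <= F w by exact: expR_ge0.
pose l := undup [seq code t | t <- enum {: T}].
exists l; first exact: undup_uniq.
(* For each of the W possible determinants the lattice vectors are distinct. *)
have part : \sum_(t | P t) F (code t) <= W%:R * \sum_(w <- l) F w.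
  rewrite (partition_big dl predT) //=.
  apply: (@le_trans _ _ (\sum_(i < W) \sum_(w <- l) F w)); last first.
    by rewrite sumr_const card_ord mulr_natl.
  apply: ler_sum => i _; rewrite -big_filter_cond -big_filter.
  set r := [seq t <- _ | dl t == i]; rewrite -(big_map code predT F); apply: ler_sum_subset => //.
    rewrite map_inj_in_uniq ?filter_uniq ?index_enum_uniq // => t t'.
    rewrite !mem_filter => /andP[/eqP d1 /andP[p1 _]] /andP[/eqP d2 /andP[p2 _]] ec.
    by apply: inj => //; rewrite d1 d2.
  by move=> w /mapP[t _ ->]; rewrite mem_undup; apply: map_f; rewrite mem_enum.
(* The summand is independent of the unit, so every pair (e, j) is counted W times. *)
have lhs : fdet D * (\sum_(t | P t) F (code t)) = W%:R * \sum_e \sum_j cell_fun e s (act (k j) D).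
  have e1 e j i : F (code (e, j, i)) = expR (- (s * hval (act (k j) D) (v e))).
    rewrite /F hcode /phi /m /=; have [_ h2] := unP i.
    by rewrite -hval_act act_scale.
  rewrite big_mkcond mulr_sumr /=.
  transitivity (\sum_e \sum_j \sum_(i < W) cell_fun e s (act (k j) D)).
    rewrite pair_big pair_big /=; apply: eq_bigr => -[[e j] i] _ /=.
    rewrite /cell_fun fdet_act (glo_det d0 sf (kO j)) mul1r e1 /P /= indicE.
    case: asboolP => h; first by rewrite mem_set // mulr1.
    by rewrite memNset // !mulr0.
  rewrite mulr_sumr; apply: eq_bigr => e _; rewrite mulr_sumr; apply: eq_bigr => j _.
  by rewrite sumr_const card_ord mulr_natl.
have D0 : 0 <= fdet D by have [[_ /ltW]] := PD.
have W0' : 0 < W%:R :> R by rewrite ltr0n.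
rewrite -(ler_pM2l W0') -lhs mulrCA; exact: ler_wpM2l.
Qed.

End PointwiseBound.

(** * Folding an integral back to finitely many pieces *)

Section Unfolding.
Context {R : realType}.
Variable d : int.
Hypotheses (d0 : d < 0) (sf : squarefree_int d).
Local Notation C := R[i].
Local Notation mu4 := (@mu4 R).
Implicit Types (B : @form R).

Lemma measurable_cell_fun E (v : 'I_E -> 'cV[C]_2) rho sigma g e (s : R) :
  measurable_fun [set: @form R] (cell_fun v rho sigma g e s).
Proof.
apply: measurable_funM; last first.
  apply: measurable_indic; rewrite -[X in measurable X]setTI; apply: measurable_act => //.
  exact: measurable_strip.
apply: measurable_funM; first exact: measurable_fdet.
apply: measurableT_comp; first exact: measurable_expR.
have mh : measurable_fun [set: @form R] (fun B => hval B (v e)).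
  have -> : (fun B : @form R => hval B (v e)) = (fun B : @form R => fc (act (mx2 1 0 (Num.conj (v e 0 0)) (Num.conj (v e 1 0))) B)).
    apply/funext => B; symmetry; apply: fc_frame.
    by rewrite mx2_conjT mx2_vec2 !mulr0 !mulr1 !add0r !conjCK [RHS]vec2E.
  by apply: measurableT_comp; [exact: measurable_fc|exact: measurable_act].
have m : measurable_fun [set: @form R] ((-%R : R -> R) \o (fun B => s * hval B (v e))).
  by apply: measurableT_comp; [exact: oppr_measurable|apply: measurable_funM].
exact: m.
Qed.

Lemma cell_fun_ge0 E (v : 'I_E -> 'cV[C]_2) rho sigma g e (s : R) B : P1 B -> 0 <= cell_fun v rho sigma g e s B.
Proof. by move=> [[_ db] _]; rewrite /cell_fun !mulr_ge0 ?expR_ge0 // ltW. Qed.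

Lemma sum_le_of_cover (I : finType) (f : @form R -> R) (S : @form R -> Prop) (T : I -> set (@form R)) B :
  (forall i B, T i B -> 0 <= f B) -> (S B -> exists i, T i B) -> (S B -> 0 <= f B) ->
  (((EFin \o f) \_ S) B <= \sum_i ((EFin \o f) \_ (T i)) B)%E.
Proof.
move=> f0 cov fS; have n0 i : (0 <= ((EFin \o f) \_ (T i)) B)%E.
  by rewrite patchE; case: ifP => //; rewrite inE lee_fin => /f0.
rewrite patchE; case: ifPn => [|_]; last by apply: sume_ge0.
rewrite inE => SB; have [i Ti] := cov SB.
rewrite (bigD1 i) //= [X in (_ <= X + _)%E]patchE mem_set //; apply: leeDl; exact: sume_ge0.
Qed.

Variables (N : nat) (D : 'I_N -> set (@form R)) (b J : R).
Hypotheses (mD : forall i, measurable (D i)) (DP : forall i, D i `<=` @P1 R)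
  (Db : forall i, (mu4 (D i) <= b%:E)%E) (DJ : forall i, (\int[mu4]_(B in D i) (2 + fa B + fc B)%:E <= J%:E)%E).

(** S is covered by the translates of the pieces under the [k j]. Moving each translate back by
    invariance brings the sum over j under the integral over [D i], where the pointwise bound
    applies. *)
Lemma integral_pieces_le K (k : 'I_K -> 'M[C]_2) (f : @form R -> R) (P Q : R) (S : set (@form R)) :
  (forall j, glo d (k j)) -> measurable_fun [set: @form R] f -> (forall B, P1 B -> 0 <= f B) ->
  0 <= P -> 0 <= Q -> (forall B, P1 B -> \sum_j f (act (k j) B) <= P + Q * (2 + fa B + fc B)) ->
  measurable S -> S `<=` @P1 R -> (forall B, S B -> exists i j, exists2 B', D i B' & B = act (k j) B') ->
  (\int[mu4]_(B in S) (f B)%:E <= (N%:R * (P * b + Q * J))%:E)%E.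
Proof.
move=> kO mf f0 P0 Q0 fle mS SP cov.
have /choice[k' hk'] : forall j, exists m, [/\ glo d m, k j *m m = 1%:M & m *m k j = 1%:M].
  by move=> j; have [m gm [e1 e2]] := glo_inv (kO j); exists m.
pose T (p : 'I_N * 'I_K) : set (@form R) := act (k' p.2) @^-1` D p.1.
have gd (m : 'M[C]_2) : glo d m -> normC2 (\det m) = 1 by exact: glo_det.
have mT p : measurable (T p).
  by rewrite -[X in measurable X]setTI; apply: measurable_act.
have TP p B : T p B -> P1 B.
  move=> /DP/P1_act h; apply: h; apply: gd; by have [] := hk' p.2.
have mE : measurable_fun [set: @form R] (EFin \o f) by apply/measurable_EFinP.
have mTf p : measurable_fun [set: @form R] ((EFin \o f) \_ (T p)).
  by apply: (measurable_restrictT _ (mT p)).1; apply: measurable_funTS.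
have T0 p B : (0 <= ((EFin \o f) \_ (T p)) B)%E.
  by rewrite patchE; case: ifP => //; rewrite inE lee_fin => /TP/f0.
apply: (@le_trans _ _ (\sum_(p : 'I_N * 'I_K) \int[mu4]_(B in T p) (f B)%:E)%E).
  rewrite integral_mkcond; under [X in (_ <= X)%E]eq_bigr do rewrite integral_mkcond.
  rewrite -ge0_integral_sum //; apply: ge0_le_integral => //.
  - by move=> B _; rewrite patchE; case: ifP => //; rewrite inE lee_fin => /SP/f0.
  - by apply: (measurable_restrictT _ mS).1; apply: measurable_funTS.
  - by apply: emeasurable_sum.
  - move=> B _; apply: sum_le_of_cover.
    + by move=> p B' /TP/f0.
    + move=> /cov[i [j [B' DB' ->]]]; exists (i, j); rewrite /T /= actK //; by have [] := hk' j.
    + by move=> /SP/f0.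
have shift p : (\int[mu4]_(B in T p) (f B)%:E = \int[mu4]_(B in D p.1) (f (act (k p.2) B))%:E)%E.
  have [gm e1 e2] := hk' p.2.
  have mF : measurable_fun (D p.1) (fun B => (f (act (k p.2) B))%:E).
    by apply/measurable_EFinP; apply: measurable_funTS; apply: measurableT_comp => //; exact: measurable_act.
  rewrite (preserving_integral (preserving_act (gd _ gm)) (mD p.1) mF); last first.
    by move=> B /DP PB; rewrite lee_fin; apply: f0; apply/P1_act => //; exact: gd.
  by apply: eq_integral => B _; rewrite actK.
under eq_bigr do rewrite shift.
rewrite -(pair_bigA _ (fun i j => (\int[mu4]_(B in D i) (f (act (k j) B))%:E)%E)) /=.
have -> : (N%:R * (P * b + Q * J))%:E = (\sum_(i < N) (P * b + Q * J)%:E)%E.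
  by rewrite sumEFin sumr_const card_ord mulr_natl.
apply: lee_sum => i _.
have mfa (j : 'I_K) : measurable_fun (D i) (fun B => (f (act (k j) B))%:E).
  by apply/measurable_EFinP; apply: measurable_funTS; apply: measurableT_comp => //; exact: measurable_act.
have fa0 (j : 'I_K) B : D i B -> (0 <= (f (act (k j) B))%:E)%E.
  by move=> /DP PB; rewrite lee_fin; apply: f0; apply/P1_act => //; exact: gd.
rewrite -ge0_integral_sum; [|exact: mD|exact: mfa|by move=> j B DB; exact: fa0].
have mT3 : measurable_fun [set: @form R] (fun B : @form R => 2 + fa B + fc B).
  by apply: measurable_funD; [apply: measurable_funD => //; exact: measurable_fa|exact: measurable_fc].
have t0 B : D i B -> 0 <= 2 + fa B + fc B.
  by move=> /DP[[a0 db] _]; rewrite !addr_ge0 // ltW // (posform_fc (conj a0 db)).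
apply: (@le_trans _ _ (\int[mu4]_(B in D i) (P%:E + (Q * (2 + fa B + fc B))%:E))%E).
  apply: ge0_le_integral.
  - exact: mD.
  - by move=> B DB; apply: sume_ge0 => j _; exact: fa0.
  - by apply: emeasurable_sum => j; exact: mfa.
  - apply: emeasurable_funD; first exact: measurable_cst.
    by apply/measurable_EFinP; apply: measurable_funTS; apply: measurable_funM.
  - by move=> B DB; rewrite sumEFin -EFinD lee_fin; apply: fle; exact: DP DB.
have mQ : measurable_fun (D i) (fun B : @form R => (2 + fa B + fc B)%:E).
  by apply/measurable_EFinP; apply: measurable_funTS.
rewrite ge0_integralD.
- rewrite EFinD; apply: leeD.
    rewrite integral_cst; last exact: mD.
    by rewrite EFinM; apply: lee_wpmul2l; [rewrite lee_fin|exact: Db].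
  under eq_integral do rewrite EFinM.
  rewrite ge0_integralZl_EFin //; first by rewrite EFinM; apply: lee_wpmul2l; [rewrite lee_fin|exact: DJ].
- exact: mD.
- by move=> B _; rewrite lee_fin.
- exact: measurable_cst.
- by move=> B DB; rewrite lee_fin mulr_ge0 // t0.
- by apply/measurable_EFinP; apply: measurable_funTS; apply: measurable_funM.
Qed.

End Unfolding.

(** * The unfolded inequality for finitely many cusps *)

Section MainInequality.
Context {R : realType}.
Variable d : int.
Hypotheses (d0 : d < 0) (sf : squarefree_int d).
Local Notation C := R[i].
Local Notation L := 'rV[int]_4.
Local Notation mu4 := (@mu4 R).
Implicit Types (B : @form R) (h : 'M[C]_2).

Definition unit_multiples h : set 'M[C]_2 :=
  [set h' | exists u, [/\ OF d u, normC2 u = 1 & h' = u *: h]].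

(** Unit scalars act trivially on forms, so one matrix is selected from each set of unit
    multiples. *)
Definition unit_rep h : 'M[C]_2 := xget 0 (unit_multiples h).

Lemma unit_repP h : exists u, [/\ OF d u, normC2 u = 1 & unit_rep h = u *: h].
Proof.
have : unit_multiples h (unit_rep h); last by [].
apply: xgetPex; exists h; exists 1; split; [exact: OF1 d0 sf|exact: normC2_1|by rewrite scale1r].
Qed.

Lemma unit_rep_eq h h' u : OF d u -> normC2 u = 1 -> unit_rep h = u *: unit_rep h' ->
  unit_rep h = unit_rep h'.
Proof.
move=> hu u1; have [a [ha a1 ea]] := unit_repP h; have [b [hb b1 eb]] := unit_repP h' => e0.
have e : a *: h = u *: (b *: h') by rewrite -ea -eb.
suff ee : unit_multiples h = unit_multiples h' by rewrite /unit_rep ee.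
have eh : h = (Num.conj a * (u * b)) *: h'.
  by rewrite -[in RHS]scalerA -[in RHS]scalerA -e scalerA mulrC unit_conj // scale1r.
have eh' : h' = (Num.conj (u * b) * a) *: h.
  by rewrite -scalerA e [u *: _]scalerA scalerA [Num.conj _ * _]mulrC unit_conj ?scale1r // normC2M u1 b1 mulr1.
have ab : OF d (Num.conj a * (u * b)) by apply: OFM => //; [exact: OF_conj|exact: OFM].
have ba : OF d (Num.conj (u * b) * a) by apply: OFM => //; apply: OF_conj => //; exact: OFM.
apply/seteqP; split => z [w [hw w1 ->]].
- exists (w * (Num.conj a * (u * b))); split; first exact: OFM.
    by rewrite !normC2M normC2_conj w1 a1 u1 b1 !mulr1.
  by rewrite {1}eh scalerA.
- exists (w * (Num.conj (u * b) * a)); split; first exact: OFM.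
    by rewrite !normC2M normC2_conj normC2M w1 a1 u1 b1 !mulr1.
  by rewrite {1}eh' scalerA.
Qed.

(** An enumeration of all integral matrices, by which P1 is exhausted with finitely many translates
    at a time. *)
Definition enum_mx (n : nat) : 'M[C]_2 :=
  if unpickle n is Some pq then
    mx2 (latv d (pq : L * L).1 0 0) (latv d pq.2 0 0) (latv d pq.1 1 0) (latv d pq.2 1 0) else 0.

Lemma enum_mx_surj h : (forall i j, OF d (h i j)) -> exists n, enum_mx n = h.
Proof.
move=> hO; have col (x y : C) : OF d x -> OF d y -> exists u : L, latv d u 0 0 = x /\ latv d u 1 0 = y.
  move=> /(OFP _ d0 sf)[p [q ->]] /(OFP _ d0 sf)[p' [q' ->]].
  exists (\row_i nth 0 [:: p; q; p'; q'] i); by rewrite /latv !mxE !inordK.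
have [u [u1 u2]] := col _ _ (hO 0 0) (hO 1 0); have [w [w1 w2]] := col _ _ (hO 0 1) (hO 1 1).
by exists (pickle (u, w)); rewrite /enum_mx pickleK u1 u2 w1 w2 -mx2E.
Qed.

Definition reps (n : nat) : seq 'M[C]_2 :=
  undup [seq unit_rep (enum_mx i) | i <- iota 0 n & `[< glo d (enum_mx i) >]].

Lemma repsP n h : h \in reps n <->
  exists i, [/\ (i < n)%N, glo d (enum_mx i) & h = unit_rep (enum_mx i)].
Proof.
rewrite mem_undup; split=> [hm|[i [ni gi ->]]].
  case: (mapP hm) => i; by rewrite mem_filter mem_iota => /andP[/asboolP gi /andP[_ ni]] ->; exists i.
by apply: map_f; rewrite mem_filter mem_iota; apply/andP; split; [exact/asboolP|].
Qed.

Lemma glo_reps n h : h \in reps n -> glo d h.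
Proof.
move=> /repsP[i [_ gi ->]]; have [u [hu u1 ->]] := unit_repP (enum_mx i); exact: glo_scale.
Qed.

Variables (N : nat) (D : 'I_N -> set (@form R)) (b J : R).
Hypotheses (mD : forall i, measurable (D i)) (DP : forall i, D i `<=` @P1 R)
  (Db : forall i, (mu4 (D i) <= b%:E)%E) (DJ : forall i, (\int[mu4]_(B in D i) (2 + fa B + fc B)%:E <= J%:E)%E)
  (J0 : 0 <= J) (cover : forall B, P1 B -> exists i h, glo d h /\ exists2 B', D i B' & B = act h B').

Definition orbit_piece n : set (@form R) :=
  [set B | exists2 h, h \in reps n & exists i, exists2 B', D i B' & B = act h B'].

Lemma orbit_pieceP n B : orbit_piece n B -> exists i (j : 'I_(size (reps n))),
  exists2 B', D i B' & B = act (nth 0 (reps n) j) B'.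
Proof.
move=> [h hn [i [B' DB ->]]]; have := hn; rewrite -index_mem => il.
by exists i, (Ordinal il); exists B' => //=; rewrite nth_index.
Qed.

Lemma orbit_piece_P1 n : orbit_piece n `<=` @P1 R.
Proof.
by move=> B [h hn [i [B' /DP PB ->]]]; apply/P1_act => //; apply: (glo_det d0 sf); exact: glo_reps hn.
Qed.

Lemma measurable_orbit_piece n : measurable (orbit_piece n).
Proof.
have hj (j : 'I_(size (reps n))) : glo d (nth 0 (reps n) j) by apply: (@glo_reps n); exact: mem_nth.
have /choice[k' hk'] : forall j : 'I_(size (reps n)),
    exists m, nth 0 (reps n) j *m m = 1%:M /\ m *m nth 0 (reps n) j = 1%:M.
  by move=> j; have [m gm [e1 e2]] := glo_inv (hj j); exists m.
have -> : orbit_piece n = \bigcup_(p in [set: 'I_N * 'I_(size (reps n))]) (act (k' p.2) @^-1` D p.1).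
  apply/seteqP; split => B.
    move=> /orbit_pieceP[i [j [B' DB ->]]]; exists (i, j) => //=.
    by have [e1 e2] := hk' j; rewrite actK.
  move=> [[i j] _ /= DB]; exists (nth 0 (reps n) j); first exact: mem_nth.
  by exists i; exists (act (k' j) B) => //; have [e1 e2] := hk' j; rewrite actK.
apply: fin_bigcup_measurable; first exact: finite_finset.
by move=> p _; rewrite -[X in measurable X]setTI; apply: measurable_act.
Qed.

Lemma orbit_piece_cover : \bigcup_n orbit_piece n = @P1 R.
Proof.
apply/seteqP; split; first by move=> B [n _]; exact: orbit_piece_P1.
move=> B /cover[i [h [gh [B' DB ->]]]]; have [_ [hO _ _]] := gh; have [n en] := enum_mx_surj hO.
exists n.+1 => //; exists (unit_rep h); first by apply/repsP; exists n; rewrite en.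
by exists i; exists B' => //; have [u [_ u1 ->]] := unit_repP h; rewrite act_scale.
Qed.

Lemma orbit_piece_mono : {homo orbit_piece : n m / (n <= m)%N >-> (n <= m)%O}.
Proof.
move=> n m nm; apply/subsetPset => B [h /repsP[i [ni gi e]] X].
by exists h => //; apply/repsP; exists i; split=> //; exact: leq_trans nm.
Qed.

Variables (E : nat) (v : 'I_E -> 'cV[C]_2) (rho : 'I_E -> R) (sigma : 'I_E -> C)
  (g : 'I_E -> 'M[C]_2).
Hypotheses (rho0 : forall e, 0 < rho e) (sig0 : forall e, 0 < complex.Im (sigma e))
  (vO : forall e, OF d (v e 0 0) /\ OF d (v e 1 0))
  (latE' : forall e tau, OF d (tau * v e 0 0 ^+ 2) -> OF d (tau * (v e 0 0 * v e 1 0)) ->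
    OF d (tau * v e 1 0 ^+ 2) -> exists a b : int, tau = rC a%:~R * rC (rho e) + rC b%:~R * sigma e)
  (v0 : forall e, v e != 0)
  (span_inj : forall e e', span2 d (v e) = span2 d (v e') -> e = e')
  (g1 : forall e, \det (g e) = 1) (gv : forall e, conjT (g e) *m vec2 0 1 = v e).

(** With s = r^2, the integral of the cell functions over P1 is at least the left side divided by
    r^4, by the strip bound, and at most N (A b + r M J) / r^4, by folding and the theta bound. Then
    r tends to 0. *)
Lemma unfolding_le : \sum_e rho e * complex.Im (sigma e) / 2 <= N%:R * (4 * pi ^+ 2 / absdisc d * b).
Proof.
have [M M0 hM] := @theta_small R d d0.
set A := 4 * pi ^+ 2 / absdisc d in hM *.
have A0 : 0 <= A by rewrite /A divr_ge0 ?(ltW (absdisc_gt0 d0)) // mulr_ge0 ?sqr_ge0.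
suff main r : 0 < r -> r <= 1 -> \sum_e rho e * complex.Im (sigma e) / 2 <= N%:R * (A * b) + r * (N%:R * (M * J)).
  apply/ler_addgt0Pr => e e0; set Z := N%:R * (M * J) in main.
  have Z0 : 0 <= Z by rewrite !mulr_ge0.
  have Ze : 0 < Z + e by rewrite ltr_wpDl.
  apply: (le_trans (main (e / (Z + e)) _ _)); first exact: divr_gt0.
    by rewrite ler_pdivrMr // mul1r lerDr.
  rewrite lerD2l mulrAC ler_pdivrMr // ler_pM2l // lerDl ltW //.
move=> r0 r1; pose s := r ^+ 2; have s0 : 0 < s by exact: exprn_gt0.
have s2 : s ^+ 2 = r ^+ 4 by rewrite /s -exprM.
have r4 : 0 < r ^+ 4 by exact: exprn_gt0.
pose f B := \sum_e cell_fun v rho sigma g e s B.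
have mf : measurable_fun [set: @form R] f by apply: measurable_sum => e; exact: measurable_cell_fun.
have f0 B : P1 B -> 0 <= f B by move=> PB; apply: sumr_ge0 => e _; exact: cell_fun_ge0.
have piece n : (\int[mu4]_(B in orbit_piece n) (f B)%:E <=
    (N%:R * (A / r ^+ 4 * b + r * M / r ^+ 4 * J))%:E)%E.
  pose k (j : 'I_(size (reps n))) := nth 0 (reps n) j.
  have kr j : k j \in reps n by exact: mem_nth.
  have kO j : glo d (k j) by exact: (glo_reps (kr j)).
  have kinj j j' u : OF d u -> normC2 u = 1 -> k j = u *: k j' -> j = j'.
    move=> hu u1; have /repsP[i [_ _ e]] := kr j; have /repsP[i' [_ _ e']] := kr j'.
    rewrite e e' => /(unit_rep_eq hu u1) h; apply: val_inj; apply/eqP.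
    by rewrite -(nth_uniq 0 (ltn_ord j) (ltn_ord j') (undup_uniq _)) -/(k j) -/(k j') e e' h.
  apply: (integral_pieces_le d0 sf mD DP Db DJ kO mf f0).
  - by rewrite divr_ge0 // ltW.
  - by rewrite divr_ge0 ?(ltW r4) // mulr_ge0 // ltW.
  - move=> B PB; have [l ul hl] := sum_cells_le d0 sf rho0 sig0 vO latE' v0 span_inj g1 gv kO kinj s PB.
    have := hM r B l r0 r1 PB ul; rewrite /f exchange_big /= -/s => h2.
    have -> : A / r ^+ 4 + r * M / r ^+ 4 * (2 + fa B + fc B) = (A + r * M * (2 + fa B + fc B)) / r ^+ 4.
      by rewrite mulrDl; congr (_ + _); rewrite mulrAC.
    rewrite ler_pdivlMr // mulrC; apply: le_trans h2; by rewrite ler_pM2l.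
  - exact: measurable_orbit_piece.
  - exact: orbit_piece_P1.
  - exact: orbit_pieceP.
have total : (\int[mu4]_(B in @P1 R) (f B)%:E <= (N%:R * (A / r ^+ 4 * b + r * M / r ^+ 4 * J))%:E)%E.
  rewrite -orbit_piece_cover; apply: ge0_integral_le_exhaust => //.
  - exact: orbit_piece_mono.
  - exact: measurable_orbit_piece.
  - by move=> n; apply/measurable_EFinP; exact: measurable_funTS.
  - by move=> n B /orbit_piece_P1/f0; rewrite lee_fin.
have low : ((\sum_e rho e * complex.Im (sigma e) / 2 / r ^+ 4)%:E <= \int[mu4]_(B in @P1 R) (f B)%:E)%E.
  have -> : (\int[mu4]_(B in @P1 R) (f B)%:E = \sum_e \int[mu4]_(B in @P1 R) (cell_fun v rho sigma g e s B)%:E)%E.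
    rewrite -ge0_integral_sum.
    - by apply: eq_integral => B _; rewrite sumEFin.
    - exact: measurable_P1.
    - by move=> e; apply/measurable_EFinP; apply: measurable_funTS; exact: measurable_cell_fun.
    - by move=> e B PB; rewrite lee_fin; exact: cell_fun_ge0.
  rewrite -sumEFin; apply: lee_sum => e _.
  have := frame_integral_ge (complex.Re (sigma e) / complex.Im (sigma e)) (g1 e) (gv e) (rho0 e) (sig0 e) s0.
  have -> : rho e * complex.Im (sigma e) / (2 * s ^+ 2) = rho e * complex.Im (sigma e) / 2 / r ^+ 4.
    by rewrite s2 invfM mulrA.
  move=> h; apply: (le_trans h); rewrite integral_mkcondr le_eqVlt; apply/orP; left; apply/eqP.
  apply: eq_integral => B _; rewrite patchE /cell_fun indicE /cell; case: ifPn => hB.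
    by rewrite mulr1.
  by rewrite mulr0.
have := le_trans low total; rewrite lee_fin -mulr_suml ler_pdivrMr // => h; apply: (le_trans h).
rewrite le_eqVlt; apply/orP; left; apply/eqP; field; by rewrite gt_eqF.
Qed.

End MainInequality.

(** * Classes of perfect forms and the bound for finite sums over ideals *)

Section PerfectClasses.
Context {R : realType}.
Variable d : int.
Hypotheses (d0 : d < 0) (sf : squarefree_int d).
Local Notation C := R[i].
Local Notation mu4 := (@mu4 R).
Local Notation lat := (@lat_nz R d).
Implicit Types (A : 'M[C]_2) (B : @form R) (g : 'M[C]_2).

Lemma glo_GL2 g : inGL2 d g -> glo d g.
Proof. by move=> [ug [hg hi]]; exists (invmx g); split=> //; exact: mulmxV. Qed.

Lemma glo_conjT g : glo d g -> glo d (conjT g).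
Proof.
move=> [g' [hg hg' e]]; exists (conjT g'); split; try exact: OF_conjT.
by rewrite -conjTM (mulmx1C e) mx2_1 mx2_conjT rmorph0 rmorph1.
Qed.

Lemma glo_lat g v : glo d g -> lat v -> lat (g *m v).
Proof.
move=> Gg /latE[h1 h2 v0]; have [hg0 [hg _ _]] := Gg.
have vO : forall i j, OF d (v i j) by move=> i j; rewrite [v]vec2E !mxE; case: ifP.
apply/latE; split; try exact: OF_mulmx.
have [g' _ [_ e]] := glo_inv Gg; apply: contra v0 => /eqP z; apply/eqP.
by rewrite -[v]mul1mx -e -mulmxA z mulmx0.
Qed.

Lemma hval_coord A v : posdef A -> hval (coord A) v = complex.Re (herm_eval A v).
Proof. by move=> /posdef_posform[_ e]; rewrite /hval e. Qed.

Lemma hval_coord_equiv A A' g (l : R) v : posdef A -> posdef A' -> A' = rC l *: (g *m A *m conjT g) ->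
  hval (coord A') v = l * hval (coord A) (conjT g *m v).
Proof.
move=> pA pA' e; rewrite !hval_coord // e /herm_eval conjTM conjTK -scalemxAr -scalemxAl !mulmxA mxE.
by rewrite Re_mul /= mul0r subr0.
Qed.

(** The equivalence multiplies values by l and permutes the nonzero lattice vectors. *)
Lemma Min_equiv A A' g (l : R) v : posdef A -> posdef A' -> glo d g -> 0 < l ->
  A' = rC l *: (g *m A *m conjT g) -> Min d A' v -> Min d A (conjT g *m v).
Proof.
move=> pA pA' Gg l0 e /(MinP d v pA')[lv mv]; have he := hval_coord_equiv _ pA pA' e.
apply/(MinP d _ pA); split; first by apply: glo_lat => //; exact: glo_conjT.
apply/eqP; rewrite eq_le; apply/andP; split; last first.
  by apply: minval_le => //; apply: glo_lat => //; exact: glo_conjT.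
have lw : lat (conjT g *m v) by apply: glo_lat => //; exact: glo_conjT.
apply: lb_le_inf; first by exists (complex.Re (herm_eval A (conjT g *m v))); exists (conjT g *m v).
move=> _ [w hw <-]; rewrite -hval_coord // -(ler_pM2l l0) -he mv.
have [g' Gg' [e1 e2]] := glo_inv (glo_conjT Gg).
have -> : w = conjT g *m (g' *m w) by rewrite mulmxA e1 mul1mx.
by rewrite -he; apply: minval_le => //; exact: glo_lat.
Qed.

Lemma min_cone_equiv A A' g (l : R) B : posdef A -> posdef A' -> glo d g -> 0 < l ->
  A' = rC l *: (g *m A *m conjT g) -> min_cone d A' B -> min_cone d A (act (conjT g) B).
Proof.
move=> pA pA' Gg l0 e [s [hs es]]; exists [seq (q.1, conjT g *m q.2) | q <- s]; split.
  move=> q hq; case: (mapP hq) => q' /hs[q0 mq] ->; split; [exact: q0|exact: (Min_equiv pA pA' Gg l0 e mq)].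
rewrite herm_act es big_map mulmx_sumr mulmx_suml; apply: eq_bigr => q _ /=.
by rewrite -scalemxAr -scalemxAl /outer conjTM !mulmxA.
Qed.

Lemma form_equiv_refl A : form_equiv d A A.
Proof.
have O1 (i j : 'I_2) : OF d ((1%:M : 'M[C]_2) i j).
  by rewrite mxE; case: (i == j); [exact: OF1 d0 sf|exact: OF0 d0 sf].
exists 1%:M; split; first by split; [exact: unitmx1|rewrite invmx1].
exists 1; split=> //; rewrite rC1 scale1r mul1mx.
by rewrite mx2_1 mx2_conjT rmorph0 rmorph1 -mx2_1 mulmx1.
Qed.

Lemma class_reps m : (@perf_classes R d #= `I_m)%card ->
  exists A : 'I_m -> 'M[C]_2, (forall i, perfect d (A i)) /\
    forall A', perfect d A' -> exists i, form_equiv d (A i) A'.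
Proof.
move=> /card_set_bijP[f [fI f_inj f_surj]].
have /choice[A hA] : forall i : 'I_m, exists A, perfect d A /\ f [set B | perfect d B /\ form_equiv d A B] = i.
  move=> i; have [X [A pA <-] e] := f_surj (i : nat) (ltn_ord i); by exists A.
exists A; split; first by move=> i; have [] := hA i.
move=> A' pA'; set X := [set B | perfect d B /\ form_equiv d A' B].
have PX : perf_classes d X by exists A'.
have fX := fI X PX; exists (Ordinal fX); have [pA e] := hA (Ordinal fX).
set Y := [set B | perfect d B /\ form_equiv d (A (Ordinal fX)) B] in e.
have PY : perf_classes d Y by exists (A (Ordinal fX)).
have : X = Y := f_inj X Y (mem_set PX) (mem_set PY) (esym e).
move/seteqP => [h _]; have [] : Y A'.
  by apply: h; split; [exact: pA'|exact: form_equiv_refl].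
by [].
Qed.

(** The perfect form found for B is equivalent to one of the representatives, and the equivalence
    carries its cone into the cone of that representative. *)
Lemma voronoi_cover m (A : 'I_m -> 'M[C]_2) B : (forall i, perfect d (A i)) ->
  (forall A', perfect d A' -> exists i, form_equiv d (A i) A') -> P1 B ->
  exists i h, glo d h /\ exists2 B', P1 B' /\ min_cone d (A i) B' & B = act h B'.
Proof.
move=> pA hA PB; have [A' [pA' cB]] := voronoi d0 sf (proj1 PB).
have [i [g [Gg [l [l0 e]]]]] := hA A' pA'; have gg := glo_conjT (glo_GL2 Gg).
have [h Gh [e1 e2]] := glo_inv gg.
exists i, h; split=> //; exists (act (conjT g) B); last by rewrite actK.
split; first by apply/P1_act => //; exact: glo_det gg.
apply: min_cone_equiv l0 e cB; [exact: (proj1 (pA i))|exact: (proj1 pA')|exact: glo_GL2].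
Qed.

(** An ideal contributes at least sqrt|Delta| / (4 N^2) to the left side of [unfolding_le]. With the
    theta constant 4 pi^2 / |Delta| and pieces of measure at most 45/2 Lambda(pi/3), the factor is 4
    * 4 * 45/2 = 360. *)
Lemma ideal_sum_le m (s : seq (set C * nat)) : (@perf_classes R d #= `I_m)%card -> uniq s ->
  (forall p, p \in s -> nz_ideal d p.1 /\ ideal_norm_is d p.1 p.2) ->
  \sum_(p <- s) ((p.2%:R : R) ^+ 2)^-1 <=
    m%:R * (360 * pi ^+ 2 * Lobachevsky (pi / 3)) / (absdisc d * Num.sqrt (absdisc d)).
Proof.
move=> /class_reps[A [pA hA]] us hs.
have /choice[D hD] : forall i, exists Di : set (@form R), [/\ measurable Di, Di `<=` @P1 R,
    forall B, P1 B -> min_cone d (A i) B -> Di B, (mu4 Di <= (15 * (3 / 2 * Lobachevsky (pi / 3)))%:E)%E &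
    (\int[mu4]_(B in Di) (2 + fa B + fc B)%:E < +oo)%E].
  by move=> i; exact: fundamental_piece.
have mD i : measurable (D i) by have [] := hD i.
have DP i : D i `<=` @P1 R by have [] := hD i.
have Db i : (mu4 (D i) <= (15 * (3 / 2 * Lobachevsky (pi / 3)))%:E)%E by have [] := hD i.
pose J i := fine (\int[mu4]_(B in D i) (2 + fa B + fc B)%:E).
have Jge i : (0 <= \int[mu4]_(B in D i) (2 + fa B + fc B)%:E)%E.
  apply: integral_ge0 => B /DP[[a0 db] _].
  by rewrite lee_fin !addr_ge0 // ltW // (posform_fc (conj a0 db)).
have J0 i : 0 <= J i by apply: fine_ge0.
have DJ i : (\int[mu4]_(B in D i) (2 + fa B + fc B)%:E <= (\sum_i J i)%:E)%E.
  have -> : (\int[mu4]_(B in D i) (2 + fa B + fc B)%:E = (J i)%:E)%E.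
    by rewrite /J fineK // ge0_fin_numE //; have [] := hD i.
  by rewrite lee_fin (bigD1 i) //= lerDl sumr_ge0.
have cover B : P1 B -> exists i h, glo d h /\ exists2 B', D i B' & B = act h B'.
  move=> /(voronoi_cover pA hA)[i [h [Gh [B' [PB' cB'] e]]]].
  by exists i, h; split=> //; exists B' => //; have [_ _ h3 _ _] := hD i; exact: h3.
pose E := size s; pose p (e : 'I_E) := nth (set0, 0%N) s e.
have ps e : p e \in s by exact: mem_nth.
have /choice[w hw] : forall e : 'I_E, exists w : (C * C) * (R * C),
    [/\ (p e).1 = span2 d (vec2 w.1.1 w.1.2), (p e).1 w.1.1 /\ (p e).1 w.1.2,
      0 < w.2.1 /\ 0 < complex.Im w.2.2,
      Num.sqrt (absdisc d) / 2 / (p e).2%:R ^+ 2 <= w.2.1 * complex.Im w.2.2 &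
      forall tau, OF d (tau * w.1.1 ^+ 2) -> OF d (tau * (w.1.1 * w.1.2)) -> OF d (tau * w.1.2 ^+ 2) ->
        exists k l : int, tau = rC k%:~R * rC w.2.1 + rC l%:~R * w.2.2].
  move=> e; have [nI hn] := hs _ (ps e).
  have [x [y [rho [sigma [h1 h2 h3 h4 h5]]]]] := ideal_data d0 sf nI hn.
  exists ((x, y), (rho, sigma)); split=> //=.
  rewrite h1; apply/seteqP; split=> z [a [b]]; rewrite ?vec2_0 ?vec2_1 => hab; exists a, b; by rewrite ?vec2_0 ?vec2_1.
pose v e := vec2 (w e).1.1 (w e).1.2.
have v0 e : v e != 0.
  have [nI _] := hs _ (ps e); have [h1 _ _ _ _] := hw e.
  move: nI => [_ [_ [_ [_ [z [Iz z0]]]]]]; apply: contra z0 => /eqP ev.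
  move: Iz; rewrite h1 -/(v e) ev => -[a [b [_ [_ ->]]]]; by rewrite !mxE !mulr0 addr0.
have /choice[g hg] : forall e, exists g : 'M[C]_2, \det g = 1 /\ conjT g *m vec2 0 1 = v e.
  by move=> e; have [g g1 gv] := exists_frame (v0 e); exists g.
have vO e : OF d (v e 0 0) /\ OF d (v e 1 0).
  have [nI _] := hs _ (ps e); have [_ [h1 h2] _ _ _] := hw e.
  by rewrite /v vec2_0 vec2_1; split; apply: (proj1 nI).
have vL e tau : OF d (tau * v e 0 0 ^+ 2) -> OF d (tau * (v e 0 0 * v e 1 0)) ->
    OF d (tau * v e 1 0 ^+ 2) -> exists k l : int, tau = rC k%:~R * rC (w e).2.1 + rC l%:~R * (w e).2.2.
  by rewrite /v vec2_0 vec2_1; have [_ _ _ _ h5] := hw e; exact: h5.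
have v_inj e e' : span2 d (v e) = span2 d (v e') -> e = e'.
  have [h1 _ _ _ _] := hw e; have [h1' _ _ _ _] := hw e'; rewrite /v -h1 -h1' => ee.
  have [_ n1] := hs _ (ps e); have [_ n2] := hs _ (ps e'); rewrite ee in n1.
  have en := ideal_norm_unique n1 n2; apply: val_inj; apply/eqP.
  rewrite -(nth_uniq (set0, 0%N) (ltn_ord e) (ltn_ord e') us) -/(p e) -/(p e').
  by apply/eqP; rewrite [p e]surjective_pairing ee en -surjective_pairing.
have rs e : 0 < (w e).2.1 /\ 0 < complex.Im (w e).2.2 by have [_ _ h3 _ _] := hw e.
have J00 : 0 <= \sum_i J i by apply: sumr_ge0.
have main := unfolding_le d0 sf mD DP Db DJ J00 cover (fun e => (rs e).1) (fun e => (rs e).2) vO vL v0 v_inj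
  (fun e => (hg e).1) (fun e => (hg e).2).
have D0 : 0 < absdisc d :> R := absdisc_gt0 d0.
set S := Num.sqrt (absdisc d); have S0 : 0 < S by rewrite sqrtr_gt0.
rewrite (big_nth (set0, 0%N)) big_mkord -/E.
have low : S / 4 * (\sum_(e < E) (((p e).2%:R : R) ^+ 2)^-1) <= \sum_e (w e).2.1 * complex.Im (w e).2.2 / 2.
  rewrite mulr_sumr; apply: ler_sum => e _; have [_ _ _ h4 _] := hw e.
  have -> : S / 4 * (((p e).2%:R : R) ^+ 2)^-1 = S / 2 / (p e).2%:R ^+ 2 / 2.
    by set y := (_ ^+ 2)^-1; field.
  by rewrite ler_pM2r // invr_gt0.
have := le_trans low main; set X := \sum_(e < E) _ => h.
rewrite ler_pdivlMr ?mulr_gt0 //.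
have -> : X * (absdisc d * S) = S / 4 * X * (4 * absdisc d) by field.
apply: (@le_trans _ _ (m%:R * (4 * pi ^+ 2 / absdisc d * (15 * (3 / 2 * Lobachevsky (pi / 3)))) * (4 * absdisc d))).
  by rewrite ler_pM2r // mulr_gt0.
rewrite le_eqVlt; apply/orP; left; apply/eqP; field; by rewrite gt_eqF.
Qed.

End PerfectClasses.

(** * The bound for the number of classes of perfect forms *)

Lemma powR_three_halves {R : realType} (x : R) : 0 < x -> x `^ (3 / 2) = x * Num.sqrt x.
Proof.
move=> x0; have -> : 3 / 2 = 1 + 2^-1 :> R by field.
rewrite powRD; last by rewrite gt_eqF ?implybT.
by rewrite powRr1 ?powR12_sqrt // ltW.
Qed.

(** The number of classes is measured by the initial segments that inject into the set of classes,
    which makes sense before that set is known to be finite. *)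
Theorem theorem4p7 (R : realType) (d : int) :
  d < 0 -> squarefree_int d ->
  exists z : R, @zetaF2 R d = z%:E /\
    forall n : nat,
      (n%:Z <= Num.ceil ((`|disc d|%:~R : R) `^ (3%:R / 2%:R)
                 / (360%:R * pi ^+ 2 * Lobachevsky (pi / 3%:R)) * z))%R ->
      (`I_n #<= @perf_classes R d)%card.
Proof.
move=> d0 sf.
have z0 : (0 <= zetaF2 (R := R) d)%E.
  by apply: esum_ge0 => p _; rewrite lee_fin invr_ge0 sqr_ge0.
exists (fine (zetaF2 (R := R) d)); split.
  by rewrite fineK // ge0_fin_numE //; exact: zetaF2_lt_pinfty.
move=> n hn.
(* An infinite set of classes admits every initial segment. *)
have [fin|inf] := pselect (finite_set (@perf_classes R d)); last first.
  by apply: card_le_trans ((infiniteP _).1 inf); exact: subset_card_le.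
have [m hm] := fin; rewrite (card_le_eqr hm) card_le_II -(ler_nat R) .
have zle : fine (zetaF2 (R := R) d) <=
    m%:R * (360 * pi ^+ 2 * Lobachevsky (pi / 3)) / (absdisc d * Num.sqrt (absdisc d)).
  have h : (zetaF2 (R := R) d <=
      (m%:R * (360 * pi ^+ 2 * Lobachevsky (pi / 3)) / (absdisc d * Num.sqrt (absdisc d)))%:E)%E.
    by apply: esum_le_lists => s us hs; exact: ideal_sum_le.
  by rewrite -lee_fin fineK // ge0_fin_numE // zetaF2_lt_pinfty.
have D0 : 0 < absdisc d :> R := absdisc_gt0 d0.
have L0 := @Lobachevsky_pi3_ge0 R.
suff Xm : (absdisc d) `^ (3 / 2) / (360 * pi ^+ 2 * Lobachevsky (pi / 3)) * fine (zetaF2 (R := R) d) <= m%:R.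
  have : Num.ceil ((absdisc d : R) `^ (3 / 2) / (360 * pi ^+ 2 * Lobachevsky (pi / 3)) * fine (zetaF2 (R := R) d)) <= m%:Z.
    by rewrite ceil_le_int.
  by move=> /(le_trans hn); rewrite ler_nat lez_nat.
rewrite powR_three_halves //; set DS := absdisc d * _ in zle *.
have DS0 : 0 < DS by rewrite mulr_gt0 // sqrtr_gt0.
set T := 360 * pi ^+ 2 * _ in zle *.
have T0 : 0 <= T := mulr_ge0 (mulr_ge0 (ler0n _ _) (sqr_ge0 _)) L0.
(* For T = 0 the quotient is 0 by the convention for inverses, and the bound is trivial. *)
move: T0; rewrite le_eqVlt => /orP[/eqP <-|T0]; first by rewrite invr0 mulr0 mul0r.
rewrite mulrAC ler_pdivrMr // [DS * _]mulrC -ler_pdivlMr //; exact: zle.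
Qed.
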